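(* Work in the setting described in the context (in particular Assumptions (A), (B), (C) hold, and $X_I$, $I\in\mathcal I$, are the solutions of the Cauchy problems (E)+(IC) constructed there). Let $\rho>0$ and let $\mathbb{H}_{\mathcal T,\rho}$ be the Banach space of bounded holomorphic functions on $\mathcal T\times D(0,\rho)$ with the supremum norm. For each $I\in\mathcal I$ let $K_I\subseteq U_I$ be a compact set with $\mathrm{Int}(K_I)\neq\emptyset$, chosen so that $\bigcup_{I\in\mathcal I}K_Iq^{-\mathbb N}=\mathcal U\setminus\{0\}$ for some neighborhood $\mathcal U$ of $0$ in $\mathbb C$. Then there exists a formal power series $$\hat X(\epsilon,t,z)=\sum_{k\ge0}\frac{X_k(t,z)}{k!}\epsilon^k\in\mathbb H_{\mathcal T,\rho}[[\epsilon]]$$ which is a formal solution of $$\epsilon t\,\partial_z^S\hat X(\epsilon,qt,z)+\partial_z^S\hat X(\epsilon,t,z)=\sum_{k=0}^{S-1}b_k(\epsilon,z)(t\sigma_q)^{m_{0,k}}(\partial_z^k\hat X)(\epsilon,t,zq^{-m_{1,k}}).$$ Moreover, for every $I\in\mathcal I$ and every compact subset $\tilde K_I$ of $\mathrm{Int}(K_I)$ there exists $B>0$ such that $X_I$ admits $\hat X$ as its $q$-Gevrey asymptotic expansion of type $B$ in $\tilde K_Iq^{-\mathbb N}$; that is, there exist $C_1,H>0$ such that for all $N\ge0$ and all $\epsilon\in\tilde K_Iq^{-\mathbb N}$ $$\Big\|X_I(\epsilon,\cdot,\cdot)-\sum_{n=0}^N\frac{X_n}{n!}\epsilon^n\Big\|_{\mathbb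 H_{\mathcal T,\rho}}\le C_1H^N|q|^{B\frac{N^2}{2}}\frac{|\epsilon|^{N+1}}{(N+1)!}.$$
   Context: **Notation.** $\mathbb N=\{0,1,2,\dots\}$, $\mathbb C^\star=\mathbb C\setminus\{0\}$, $D(0,r)$ is the open disc of radius $r$, $\dot D_{r}=D(0,r)\setminus\{0\}$. $q\in\mathbb C$ with $|q|>1$; a determination of $\log q$ is fixed and $q^s=e^{s\log q}$ for $s\in\mathbb R$. For a set $U\subseteq\mathbb C^\star$: $Uq^{-\mathbb N}=\{\epsilon q^{-n}:\epsilon\in U,n\in\mathbb N\}$, $Uq^{\mathbb R_+}=\{\tau q^l:\tau\in U,l\ge0\}$, $Uq^{\mathbb R}=\{\tau q^l:\tau\in U,l\in\mathbb R\}$. For an open set $\Omega$, $\mathcal O(\Omega)$ is the space of holomorphic functions on $\Omega$. $\sigma_q$ acts by $(\sigma_qX)(\epsilon,t,z)=X(\epsilon,qt,z)$ and $(t\sigma_q)^m$ is the $m$-fold composition of $X\mapsto tX(\epsilon,qt,z)$. **Good covering.** For a pair $I=(I_1,I_2)$ of open intervals of $\mathbb R$ of length smaller than $1/4$, $U_I=\{e^{2\pi ui}q^v:u\in I_1,v\in I_2\}$. For a finite family $\mathcal I$ of such pairs, $(U_Iq^{-\mathbb N})_{I\in\mathcal I}$ is a good covering if $\bigcup_{I}U_Iq^{-\mathbb N}=\nu\setminus\{0\}$ with $\nu$ a neighborhood of $0$ in $\mathbb C$, and the sets $U_Iq^{-\mathbb N}$ are four by four disjoint (any four with distinct indices have empty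 intersection). **Associated family.** Let $\delta>0$. A family $\{(V_I)_{I\in\mathcal I},\mathcal T\}$ of open bounded sets in $\mathbb C^\star$ is associated to the good covering if: (1) there is $\rho_0>1$ with $V_I\cap D(0,\rho_0)\ne\emptyset$ for all $I$; (2) $|\tau+1|>\delta$ for all $I$ and $\tau\in V_Iq^{\mathbb R}$; (3) $|1+\frac{\lambda_v}{\epsilon_utq^r}|>\delta$ for all $I$, $t\in\mathcal T$, $\epsilon_u\in U_I$, $\lambda_v\in V_I\cap D(0,\rho_0)$, $r\in\mathbb R$; (4) $|t|\le1$ for all $t\in\mathcal T$. **Data and assumptions.** $S\ge1$ is an integer; for $0\le k\le S-1$, $m_{0,k},m_{1,k}$ are positive integers and $b_k(\epsilon,z)=\sum_{s\in I_k}b_{ks}(\epsilon)z^s$ with $I_k\subset\mathbb N$ finite and $b_{ks}$ bounded holomorphic on $D(0,r_0)$, $0<r_0\le1$. $(U_Iq^{-\mathbb N})_{I\in\mathcal I}$ is a good covering with $U_Iq^{-\mathbb N}\subseteq D(0,r_0)$ for all $I$, and $\{(V_I)_I,\mathcal T\}$ is associated to it. $M,A_1,C>0$ are fixed. Assumption (A): for all $0\le k\le S-1$, $s\in I_k$: $m_{0,k}\le C(S-k+s)$ and $m_{1,k}\ge2(S-k+s)A_1$. Assumption (B): $M\le\frac1{2\log|q|}$. Assumption (C): there exist $a_1,a_2,b_1,b_2,d_1,d_2>0$ and $0<\xi,\overline\xi<1$ with (C.1) $\log|q|<\frac{b_1}{b_2}$; (C.2) $\log|q|+\frac{\xi b_1}{2b_2}+\frac{d_1}{d_2}\big(M-\frac{\xi}{2\log|q|}\big)>0$;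 (C.3) $M-\frac{\xi}{2\log|q|}+\frac{d_2}{d_1}\log|q|<0$; (C.4) $A_1\Big(1-\frac{d_2\log|q|}{d_1(\frac{\xi}{2\log|q|}-M)}\Big)>\frac{C^2}{4\overline\xi\log|q|(\frac{\xi}{2\log|q|}-M)}+\frac{Ca_2}{a_1}$. **$q$-Laplace transform.** $\Theta(x)=\sum_{n\in\mathbb Z}q^{-n(n-1)/2}x^n$ ($x\in\mathbb C^\star$), $\pi_q=\log(q)\prod_{n\ge0}(1-q^{-n-1})^{-1}$, and $$\mathcal L^\lambda_{q;1}F(z)=\frac1{\pi_q}\int_0^{\infty\lambda}\frac{F(\xi)}{\Theta(\xi/z)}\frac{d\xi}{\xi}=\frac{\log q}{\pi_q}\int_{-\infty}^{\infty}\frac{F(q^s\lambda)}{\Theta(q^s\lambda/z)}\,ds.$$ **Cauchy problems.** For each $0\le j\le S-1$, let $W_j$ be a bounded holomorphic function on $(D(0,r_0)\setminus\{0\})\times\dot D_{\rho_0}$ (the same for all $I$) which, for every $I\in\mathcal I$, extends to an analytic function $W_{U_I,V_I,j}$ on $U_Iq^{-\mathbb N}\times(V_Iq^{\mathbb R_+}\cup\dot D_{\rho_0})$, with $|W_j(\epsilon,\tau)|\le\Delta e^{\tilde M\log^2|\tau/\epsilon|}$ and $|W_{U_I,V_I,j}(\epsilon,\tau)|\le\Delta e^{\tilde M\log^2|\tau/\epsilon|}$ on the respective domains, for some $\Delta>0$ and $0<\tilde M<M$. Let $\lambda_I\in V_I\cap D(0,\rho_0)$ with $r_0<1<|\lambda_I|$.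 Put $\phi_{I,j}(\epsilon,t)=\mathcal L^{\lambda_I}_{q;1}(\tau\mapsto W_{U_I,V_I,j}(\epsilon,\tau))(\epsilon t)$. The Cauchy problem for $X_I$ is (E) $\ \epsilon t\,\partial_z^SX_I(\epsilon,qt,z)+\partial_z^SX_I(\epsilon,t,z)=\sum_{k=0}^{S-1}b_k(\epsilon,z)(t\sigma_q)^{m_{0,k}}(\partial_z^kX_I)(\epsilon,t,zq^{-m_{1,k}})$, (IC) $\ (\partial_z^jX_I)(\epsilon,t,0)=\phi_{I,j}(\epsilon,t)$, $0\le j\le S-1$. **The solutions $X_I$.** Let $W(\epsilon,\tau,z)=\sum_{\beta\ge0}W_\beta(\epsilon,\tau)\frac{z^\beta}{\beta!}\in\mathcal O((D(0,r_0)\setminus\{0\})\times\dot D_{\rho_0})[[z]]$ be the unique formal solution of $$\partial_z^SW(\epsilon,\tau,z)=\sum_{k=0}^{S-1}\frac{b_k(\epsilon,z)}{(\tau+1)\epsilon^{m_{0,k}}}\tau^{m_{0,k}}(\partial_z^kW)(\epsilon,\tau,zq^{-m_{1,k}}),\qquad(\partial_z^jW)(\epsilon,\tau,0)=W_j(\epsilon,\tau),\ 0\le j\le S-1.$$ For every $I\in\mathcal I$ the coefficients $W_\beta$ extend to holomorphic functions on $U_Iq^{-\mathbb N}\times V_Iq^{\mathbb R_+}$, namely the coefficients of the formal solution there of the same equation with initial data $W_{U_I,V_I,j}$; the extensions are still denoted $W_\beta$. Then $$X_I(\epsilon,t,z)=\sum_{\beta\ge0}\mathcal L^{\lambda_I}_{q;1}(\tau\mapsto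 W_\beta(\epsilon,\tau))(\epsilon t)\frac{z^\beta}{\beta!}.$$ **Formal solution.** $\hat X$ is a formal solution if the equation holds after identifying coefficients of the powers of $\epsilon$, where $b_k(\epsilon,z)$ is replaced by its Taylor series in $\epsilon$ at $0$. *)

(* Defs.v *)
From Stdlib Require Import Reals Factorial List.
From Coquelicot Require Import Coquelicot.
Import ListNotations.

Open Scope R_scope.
Open Scope C_scope.

(** ** Complex numbers *)

Definition Cexp (z : C) : C :=
  RtoC (exp (Re z)) * (cos (Im z), sin (Im z)).

(** [qpow lq s] is [q^s] for the determination [lq] of [log q]. *)
Definition qpow (lq : C) (s : R) : C := Cexp (RtoC s * lq).

Definition Cdisc (r : R) (z : C) : Prop := Cmod z < r.
Definition Cpdisc (r : R) (z : C) : Prop := z <> 0 /\ Cmod z < r.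

Definition Csum (l : list nat) (f : nat -> C) : C :=
  fold_right (fun n acc => f n + acc) 0 l.

Fixpoint Cprod (f : nat -> C) (n : nat) : C :=
  match n with
  | O => 1
  | S n' => Cprod f n' * f n'
  end.

(** Total limit and sum operators; the values are meaningful only in case of
    convergence, as for [Lim_seq] and [Series]. *)
Definition CLim_seq (u : nat -> C) : C :=
  (real (Lim_seq (fun n => Re (u n))), real (Lim_seq (fun n => Im (u n)))).
Definition CSeries (a : nat -> C) : C := CLim_seq (sum_n a).

Definition Cfact (n : nat) : C := RtoC (INR (fact n)).

Definition C_derive_n (f : C -> C) (k : nat) : C -> C :=
  Nat.iter k (fun g z => C_derive g z) f.

(** Intended for open [D]. *)
Definition holomorphic (D : C -> Prop) (f : C -> C) : Prop :=
  forall z, D z -> ex_derive (K := C_AbsRing) (V := C_NormedModule) f z.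

(** Holomorphy in two variables on an open set: existence of a C-linear Fréchet
    differential at every point. *)
Definition holomorphic2 (D : C -> C -> Prop) (f : C -> C -> C) : Prop :=
  forall x y, D x y ->
    ex_filterdiff (K := C_AbsRing)
      (U := prod_NormedModule C_AbsRing C_NormedModule C_NormedModule)
      (V := C_NormedModule)
      (fun p : C * C => f (fst p) (snd p)) (locally (x, y)).

Definition bounded_on2 (D : C -> C -> Prop) (f : C -> C -> C) : Prop :=
  exists c : R, forall x y, D x y -> Cmod (f x y) <= c.

Definition bounded_set (D : C -> Prop) : Prop :=
  exists c : R, forall z, D z -> Cmod z <= c.

Definition Ccompact (K : C -> Prop) : Prop :=
  forall F : (C -> Prop) -> Prop,
    (forall O, F O -> open O) ->
    (forall z, K z -> exists O, F O /\ O z) ->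
    exists l : list (C -> Prop),
      (forall O, In O l -> F O) /\ (forall z, K z -> exists O, In O l /\ O z).

Definition Cinterior (K : C -> Prop) (z : C) : Prop := locally z K.

(** ** The space of bounded holomorphic functions on [T x D(0,rho)] *)

Definition polyset (T : C -> Prop) (rho : R) (t z : C) : Prop :=
  T t /\ Cdisc rho z.

Definition in_H (T : C -> Prop) (rho : R) (f : C -> C -> C) : Prop :=
  holomorphic2 (polyset T rho) f /\ bounded_on2 (polyset T rho) f.

Definition H_norm (T : C -> Prop) (rho : R) (f : C -> C -> C) : Rbar :=
  Lub_Rbar (fun r => exists t z, polyset T rho t z /\ r = Cmod (f t z)).

Definition H_norm_le (T : C -> Prop) (rho : R) (f : C -> C -> C) (c : R) : Prop :=
  in_H T rho f /\ Rbar_le (H_norm T rho f) c.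

(** ** q-spirals and coverings *)

Definition mul_qN (q : C) (U : C -> Prop) (x : C) : Prop :=
  exists e n, U e /\ x = e / q ^ n.
Definition mul_qRp (lq : C) (U : C -> Prop) (x : C) : Prop :=
  exists e l, U e /\ 0 <= l /\ x = e * qpow lq l.
Definition mul_qR (lq : C) (U : C -> Prop) (x : C) : Prop :=
  exists e l, U e /\ x = e * qpow lq l.

(** [dilate q m T] is [q^m T]. *)
Definition dilate (q : C) (m : nat) (T : C -> Prop) (t : C) : Prop :=
  exists t0, T t0 /\ t = q ^ m * t0.

(** A pair of open intervals, given by their endpoints. *)
Definition ipair : Type := ((R * R) * (R * R))%type.

Definition short_interval (J : R * R) : Prop :=
  fst J < snd J /\ (snd J - fst J < 1 / 4)%R.

Definition Uset (lq : C) (J : ipair) (x : C) : Prop :=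
  exists u v : R,
    fst (fst J) < u < snd (fst J) /\ fst (snd J) < v < snd (snd J) /\
    x = Cexp (RtoC (2 * PI * u)%R * Ci) * qpow lq v.

Definition UqN (q lq : C) (J : ipair) : C -> Prop := mul_qN q (Uset lq J).

(** Families indexed by the finite set of pairs are indexed by the [i < p]. *)
Definition good_covering (q lq : C) (p : nat) (II : nat -> ipair) : Prop :=
  (forall i, (i < p)%nat ->
     short_interval (fst (II i)) /\ short_interval (snd (II i))) /\
  (exists nu : C -> Prop, locally (0 : C) nu /\
     forall x, (exists i, (i < p)%nat /\ UqN q lq (II i) x) <-> (nu x /\ x <> 0)) /\
  (forall i j k l, (i < p)%nat -> (j < p)%nat -> (k < p)%nat -> (l < p)%nat ->
     NoDup [i; j; k; l] ->
     forall x, ~ (UqN q lq (II i) x /\ UqN q lq (II j) x /\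
                  UqN q lq (II k) x /\ UqN q lq (II l) x)).

Definition open_bounded_Cstar (V : C -> Prop) : Prop :=
  open V /\ bounded_set V /\ ~ V 0.

Definition associated_family (lq : C) (p : nat) (II : nat -> ipair)
    (delta rho0 : R) (V : nat -> C -> Prop) (T : C -> Prop) : Prop :=
  (forall i, (i < p)%nat -> open_bounded_Cstar (V i)) /\
  open_bounded_Cstar T /\
  1 < rho0 /\
  (forall i, (i < p)%nat -> exists tau, V i tau /\ Cdisc rho0 tau) /\
  (forall i tau, (i < p)%nat -> mul_qR lq (V i) tau -> delta < Cmod (tau + 1)) /\
  (forall i t eps lam r, (i < p)%nat -> T t -> Uset lq (II i) eps ->
     V i lam -> Cdisc rho0 lam ->
     delta < Cmod (1 + lam / (eps * t * qpow lq r))) /\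
  (forall t, T t -> Cmod t <= 1).

(** ** Assumptions on the parameters *)

Section Assumptions.
Local Open Scope R_scope.

Definition assumption_A (Sz : nat) (m0 m1 : nat -> nat) (Ik : nat -> list nat)
    (A1 Cc : R) : Prop :=
  forall k s, (k < Sz)%nat -> In s (Ik k) ->
    INR (m0 k) <= Cc * (INR Sz - INR k + INR s) /\
    INR (m1 k) >= 2 * (INR Sz - INR k + INR s) * A1.

Definition assumption_B (q : C) (M : R) : Prop :=
  M <= 1 / (2 * ln (Cmod q)).

Definition assumption_C (q : C) (M A1 Cc : R) : Prop :=
  exists a1 a2 b1 b2 d1 d2 xi xib : R,
    (0 < a1 /\ 0 < a2 /\ 0 < b1 /\ 0 < b2 /\ 0 < d1 /\ 0 < d2) /\
    (0 < xi < 1) /\ (0 < xib < 1) /\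
    let L := ln (Cmod q) in
    L < b1 / b2 /\
    L + xi * b1 / (2 * b2) + d1 / d2 * (M - xi / (2 * L)) > 0 /\
    M - xi / (2 * L) + d2 / d1 * L < 0 /\
    A1 * (1 - d2 * L / (d1 * (xi / (2 * L) - M))) >
      Cc ^ 2 / (4 * xib * L * (xi / (2 * L) - M)) + Cc * a2 / a1.

End Assumptions.

(** ** q-Laplace transform *)

(** The terms of index [n >= 0] and [-(n+1) < 0] of the bilateral series. *)
Definition Theta (q x : C) : C :=
  CSeries (fun n => x ^ n / q ^ (n * (n - 1) / 2)%nat) +
  CSeries (fun n => / (x ^ (n + 1) * q ^ ((n + 1) * (n + 2) / 2)%nat)).

Definition pi_q (q lq : C) : C :=
  lq * CLim_seq (Cprod (fun n => / (1 - / q ^ (n + 1)))).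

Definition q_laplace (q lq lam : C) (F : C -> C) (z : C) : C :=
  lq / pi_q q lq *
  RInt_gen (V := C_R_CompleteNormedModule)
    (fun s : R => F (qpow lq s * lam) / Theta q (qpow lq s * lam / z))
    (Rbar_locally m_infty) (Rbar_locally p_infty).

(** ** Formal power series in [z] *)

(** A series is the sequence of the coefficients of the [z^n]. *)
Definition zs_deriv (c : nat -> C) (n : nat) : C :=
  RtoC (INR (n + 1)) * c (n + 1)%nat.
Definition zs_deriv_n (k : nat) (c : nat -> C) : nat -> C := Nat.iter k zs_deriv c.
Definition zs_dil (a : C) (c : nat -> C) (n : nat) : C := a ^ n * c n.
Definition zs_mul (a c : nat -> C) (n : nat) : C :=
  sum_n (fun j => a j * c (n - j)%nat) n.
Definition zs_scal (a : C) (c : nat -> C) (n : nat) : C := a * c n.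

(** [b_k(eps, z)] as a polynomial in [z]. *)
Definition zs_b (Ik : nat -> list nat) (b : nat -> nat -> C -> C)
    (k : nat) (eps : C) (s : nat) : C :=
  if in_dec Nat.eq_dec s (Ik k) then b k s eps else 0.

(** [w] lists the [W_beta], so that the series in [z] is
    [sum_beta w beta * z^beta / beta!]; [w0] lists the initial data.
    The coefficients of the equation have a pole at [tau = -1], which may lie
    in the punctured disc; the equation is used for [tau <> -1] only, which
    contains the integration paths of the q-Laplace transforms. *)
Definition W_formal_solution (q : C) (Sz : nat) (m0 m1 : nat -> nat)
    (Ik : nat -> list nat) (b : nat -> nat -> C -> C) (w0 : nat -> C)
    (eps tau : C) (w : nat -> C) : Prop :=
  let c := fun beta => w beta / Cfact beta in
  (forall n, zs_deriv_n Sz c n =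
     Csum (seq 0 Sz) (fun k =>
       zs_mul
         (zs_scal (tau ^ m0 k / ((tau + 1) * eps ^ m0 k)) (zs_b Ik b k eps))
         (zs_dil (/ q ^ m1 k) (zs_deriv_n k c)) n)) /\
  (forall j, (j < Sz)%nat -> zs_deriv_n j c 0%nat = w0 j).

(** ** Formal power series in [eps] *)

(** The coefficient of [eps^n] is a function of [(t, z)]. *)
Definition eseries : Type := nat -> C -> C -> C.

Definition es_eps_t (X : eseries) : eseries := fun n t z =>
  match n with O => 0 | S n' => t * X n' t z end.
Definition es_sigma (q : C) (X : eseries) : eseries := fun n t z => X n (q * t) z.
Definition es_tsigma_n (q : C) (m : nat) (X : eseries) : eseries :=
  Nat.iter m (fun Y n t z => t * es_sigma q Y n t z) X.
Definition es_dz (k : nat) (X : eseries) : eseries := fun n t z =>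
  C_derive_n (X n t) k z.
Definition es_zdil (a : C) (X : eseries) : eseries := fun n t z => X n t (z * a).
Definition es_mul (a : nat -> C -> C) (X : eseries) : eseries := fun n t z =>
  sum_n (fun l => a l z * X (n - l)%nat t z) n.

(** Taylor coefficients of [b_k(eps, z)] at [eps = 0]. *)
Definition b_taylor (Ik : nat -> list nat) (b : nat -> nat -> C -> C)
    (k l : nat) (z : C) : C :=
  Csum (Ik k) (fun s => C_derive_n (b k s) l 0 / Cfact l * z ^ s).

Definition formal_solution (q : C) (Sz : nat) (m0 m1 : nat -> nat)
    (Ik : nat -> list nat) (b : nat -> nat -> C -> C)
    (D : C -> C -> Prop) (X : eseries) : Prop :=
  forall n t z, D t z ->
    es_eps_t (es_sigma q (es_dz Sz X)) n t z + es_dz Sz X n t z =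
    Csum (seq 0 Sz) (fun k =>
      es_mul (b_taylor Ik b k)
        (es_zdil (/ q ^ m1 k) (es_tsigma_n q (m0 k) (es_dz k X))) n t z).

(** The remainder [X(eps,t,z) - sum_(n <= N) Xhat_n(t,z) eps^n / n!]. *)
Definition remainder (X : C -> C -> C -> C) (Xhat : nat -> C -> C -> C)
    (N : nat) (eps t z : C) : C :=
  X eps t z - sum_n (fun n => Xhat n t z / Cfact n * eps ^ n) N.

Definition q_gevrey_expansion (q : C) (T : C -> Prop) (rho B : R)
    (E : C -> Prop) (X : C -> C -> C -> C) (Xhat : nat -> C -> C -> C) : Prop :=
  exists C1 H : R, (0 < C1)%R /\ (0 < H)%R /\
    forall N eps, E eps ->
      H_norm_le T rho (remainder X Xhat N eps)
        (C1 * H ^ N * Rpower (Cmod q) (B * (INR N ^ 2 / 2)) *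
           (Cmod eps ^ (N + 1) / INR (fact (N + 1))))%R.

Definition asymptotic_expansion (T : C -> Prop) (rho : R)
    (E : C -> Prop) (X : C -> C -> C -> C) (Xhat : nat -> C -> C -> C) : Prop :=
  forall N, exists c : R, forall eps, E eps ->
    H_norm_le T rho (remainder X Xhat N eps) (c * Cmod eps ^ (N + 1))%R.

(** ** The initial data and the solutions *)

Definition initial_data (q lq : C) (p : nat) (II : nat -> ipair) (Sz : nat)
    (r0 rho0 M : R) (V : nat -> C -> Prop)
    (W0 : nat -> C -> C -> C) (WUV : nat -> nat -> C -> C -> C) : Prop :=
  let D0 := fun eps tau => Cpdisc r0 eps /\ Cpdisc rho0 tau in
  let DI := fun i eps tau =>
    UqN q lq (II i) eps /\ (mul_qRp lq (V i) tau \/ Cpdisc rho0 tau) in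
  (forall j, (j < Sz)%nat -> holomorphic2 D0 (W0 j) /\ bounded_on2 D0 (W0 j)) /\
  (forall i j, (i < p)%nat -> (j < Sz)%nat ->
     holomorphic2 (DI i) (WUV i j) /\
     forall eps tau, UqN q lq (II i) eps -> Cpdisc rho0 tau ->
       WUV i j eps tau = W0 j eps tau) /\
  exists Delta Mt : R, (0 < Delta)%R /\ (0 < Mt < M)%R /\
    (forall j eps tau, (j < Sz)%nat -> D0 eps tau ->
       Cmod (W0 j eps tau) <= Delta * exp (Mt * (ln (Cmod (tau / eps))) ^ 2))%R /\
    (forall i j eps tau, (i < p)%nat -> (j < Sz)%nat -> DI i eps tau ->
       Cmod (WUV i j eps tau) <= Delta * exp (Mt * (ln (Cmod (tau / eps))) ^ 2))%R.

(** [X_I], for [lam = lambda_I] and [W] the sequence of the [W_beta]. *)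
Definition X_solution (q lq lam : C) (W : nat -> C -> C -> C) (eps t z : C) : C :=
  CSeries (fun beta =>
    q_laplace q lq lam (W beta eps) (eps * t) * (z ^ beta / Cfact beta)).

(* Main.v *)
(** In the variable [w = tau / eps] the [W_beta] have, for every [eps] in the spiral
    sectors, an expansion [W_beta (eps, eps w) = sum_l p_(beta,l) (w) eps^l] whose
    coefficients do not depend on the sector: the initial data are bounded on a
    punctured polydisc, hence have a common double Taylor series, and the recursion
    for the [W_beta] becomes a recursion for the polynomials [p_(beta,l)]. The
    remainders are bounded by
    [exp (- al beta^2 + g beta + C beta ln (1 + |w|) + Mt ln^2 (1 + |w|)) (c (1 + |w|) |eps|)^N],
    where assumption (A) gives the Gaussian decay in [beta] and assumption (C)
    makes it win over the growth in [w] after the q-Laplace transform.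

    The relation [Theta (q x) = q x Theta x] makes the q-Laplace transform
    intertwine [w] with [t sigma_q], and a contour deformation makes the transform
    of [1] independent of the direction. So the transforms of the [p_(beta,l)] are
    polynomials in [t] independent of the sector, they satisfy the transformed
    recursion, which is the formal equation, and integrating the remainders against
    the lower bound [|Theta x| >= c exp (ln^2 |x| / (2 L) + ln |x| / 2)], with
    [L = ln |q|], gives the q-Gevrey estimates. *)

Require Import Defs.
From Stdlib Require Import Reals Factorial List.
From Stdlib Require Import Lra Lia Arith Psatz FunctionalExtensionality PropExtensionality ClassicalEpsilon.
From Coquelicot Require Import Coquelicot.
Open Scope R_scope.

(** All sectors share the coefficients, so each solution is expanded on its own and no difference of
    two solutions is estimated. The obstacle is that the initial data have a Taylor series only for
    |eps w| < rho0, whereas the path of the transform is unbounded. Remainders are therefore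
    measured by powers of [kap w * Cmod eps] with [kap w = 8 / r0 + 8 * Cmod w]. Once |eps w| >=
    rho0 > 1 this ratio exceeds 2 and its powers dominate both the function and the Taylor sum, so
    one estimate holds along the whole path. The price is a factor (1 + |w|)^N. Against the part
    (1/(2L) - M) ln^2 |w| of the kernel, completing the square leaves exp((Cc beta + N)^2 / (4 k0))
    with k0 = 1/(2L) - M. The part in beta is paid by a decay rate [al] strictly above Cc^2 / (4
    k0), the strict gap absorbs the cross term, and the remaining exp(a2 N^2) is the q-Gevrey
    growth. The type [B] comes from a2 and from the factorial in the required bound, which is itself
    below an exponential of a square. *)

(** * Limits along a filter, measured by the modulus *)

Definition tends {T : Type} (F : (T -> Prop) -> Prop) (f : T -> C) (l : C) : Prop :=
  forall eps, 0 < eps -> F (fun x => Cmod (f x - l)%C < eps).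

(** The uniform structure of [C] is that of a product, whose balls are squares; squares and discs
    are comparable up to the factor sqrt 2. *)
Lemma locally_Cmod (z : C) (P : C -> Prop) :
  locally z P <-> exists d, 0 < d /\ forall w, Cmod (w - z)%C < d -> P w.
Proof.
  split.
  - intros [e He]. exists e. split; [apply cond_pos|]. intros w Hw. apply He.
    apply C_NormedModule_mixin_compat1. exact Hw.
  - intros [d [Hd H]].
    assert (Hd' : 0 < d / sqrt 2) by (apply Rdiv_lt_0_compat; [|apply sqrt_lt_R0]; lra).
    exists (mkposreal _ Hd'). intros w Hw. apply H.
    apply C_NormedModule_mixin_compat2 in Hw. simpl in Hw.
    eapply Rlt_le_trans; [exact Hw|]. right. field.
    apply Rgt_not_eq, sqrt_lt_R0; lra.
Qed.

Lemma tends_filterlim {T : Type} (F : (T -> Prop) -> Prop) {FF : Filter F} (f : T -> C) (l : C) :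
  tends F f l <-> filterlim f F (locally l).
Proof.
  split.
  - intros H P HP. apply locally_Cmod in HP. destruct HP as [d [Hd HP]].
    unfold filtermap. generalize (H d Hd). apply filter_imp. intros x Hx. now apply HP.
  - intros H e He. apply (H (fun w => Cmod (w - l)%C < e)). apply locally_Cmod.
    exists e. split; auto.
Qed.

Lemma tends_eq {T : Type} (F : (T -> Prop) -> Prop) (f : T -> C) (l l' : C) :
  l = l' -> tends F f l -> tends F f l'.
Proof. now intros ->. Qed.

Section Tends.
Context {T : Type} (F : (T -> Prop) -> Prop) {FF : Filter F}.

Lemma tends_ext_loc (f g : T -> C) l : F (fun x => f x = g x) -> tends F f l -> tends F g l.
Proof.
  intros H Hf e He. generalize (filter_and _ _ H (Hf e He)). apply filter_imp.
  intros x [Hx Hx']. now rewrite <- Hx.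
Qed.

Lemma tends_ext (f g : T -> C) l : (forall x, f x = g x) -> tends F f l -> tends F g l.
Proof. intros H. apply tends_ext_loc. now apply filter_forall. Qed.

Lemma tends_const (c : C) : tends F (fun _ => c) c.
Proof.
  intros e He. apply filter_forall. intros _. replace (c - c)%C with (RtoC 0) by ring.
  now rewrite Cmod_0.
Qed.

Lemma tends_squeeze (f : T -> C) (g : T -> R) (l : C) :
  F (fun x => Cmod (f x - l)%C <= g x) -> (forall e, 0 < e -> F (fun x => g x < e)) -> tends F f l.
Proof.
  intros H Hg e He. generalize (filter_and _ _ H (Hg e He)). apply filter_imp. intros x [H1 H2]. lra.
Qed.

Lemma tends_plus (f g : T -> C) (lf lg : C) :
  tends F f lf -> tends F g lg -> tends F (fun x => f x + g x)%C (lf + lg)%C.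
Proof.
  intros Hf Hg e He. assert (He2 : 0 < e / 2) by lra.
  generalize (filter_and _ _ (Hf _ He2) (Hg _ He2)). apply filter_imp. intros x [H1 H2].
  replace (f x + g x - (lf + lg))%C with ((f x - lf) + (g x - lg))%C by ring.
  eapply Rle_lt_trans; [apply Cmod_triangle|]. lra.
Qed.

Lemma tends_mult (f g : T -> C) (lf lg : C) :
  tends F f lf -> tends F g lg -> tends F (fun x => f x * g x)%C (lf * lg)%C.
Proof.
  intros Hf Hg e He.
  set (K := Cmod lf + Cmod lg + 1).
  assert (Pf := Cmod_ge_0 lf). assert (Pg := Cmod_ge_0 lg).
  assert (HK : 0 < K) by (unfold K; lra).
  set (d := Rmin 1 (e / (K + 1))).
  assert (Hd : 0 < d) by (unfold d; apply Rmin_glb_lt; [lra|]; apply Rdiv_lt_0_compat; lra).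
  assert (Hd1 : d <= 1) by apply Rmin_l.
  assert (Hd2 : d * (K + 1) <= e).
  { apply Rle_trans with (e / (K + 1) * (K + 1)); [|right; field; lra].
    apply Rmult_le_compat_r; [lra|apply Rmin_r]. }
  generalize (filter_and _ _ (Hf _ Hd) (Hg _ Hd)). apply filter_imp. intros x [H1 H2].
  replace (f x * g x - lf * lg)%C with
    ((f x - lf) * (g x - lg) + (f x - lf) * lg + lf * (g x - lg))%C by ring.
  eapply Rle_lt_trans; [apply Cmod_triangle|].
  eapply Rle_lt_trans; [apply Rplus_le_compat_r, Cmod_triangle|].
  rewrite !Cmod_mult.
  assert (P1 := Cmod_ge_0 (f x - lf)%C). assert (P2 := Cmod_ge_0 (g x - lg)%C).
  apply Rlt_le_trans with (d * K + d); [|nra].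
  apply Rle_lt_trans with (d * 1 + d * Cmod lg + Cmod lf * d); [|unfold K; nra].
  repeat apply Rplus_le_compat; try (apply Rmult_le_compat; lra).
Qed.

Lemma tends_scal (c : C) (f : T -> C) (l : C) : tends F f l -> tends F (fun x => c * f x)%C (c * l)%C.
Proof. intros H. apply (tends_mult (fun _ => c)); [apply tends_const|exact H]. Qed.

Lemma tends_opp (f : T -> C) (l : C) : tends F f l -> tends F (fun x => - f x)%C (- l)%C.
Proof.
  intros H. apply tends_ext with (fun x => (-(1)) * f x)%C; [intros; ring|].
  replace (- l)%C with ((-(1)) * l)%C by ring. now apply tends_scal.
Qed.

Lemma tends_minus (f g : T -> C) (lf lg : C) :
  tends F f lf -> tends F g lg -> tends F (fun x => f x - g x)%C (lf - lg)%C.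
Proof. intros Hf Hg. apply tends_plus; [exact Hf|now apply tends_opp]. Qed.

Lemma tends_pow (f : T -> C) (l : C) n : tends F f l -> tends F (fun x => f x ^ n)%C (l ^ n)%C.
Proof.
  intros H. induction n; simpl; [apply tends_const|now apply tends_mult].
Qed.

Lemma tends_inv (f : T -> C) (l : C) : l <> 0 -> tends F f l -> tends F (fun x => / f x)%C (/ l)%C.
Proof.
  intros Hl Hf e He. assert (Pl := proj1 (Cmod_gt_0 l) Hl).
  set (d := Rmin (Cmod l / 2) (e * Cmod l * Cmod l / 2)).
  assert (Hd : 0 < d).
  { apply Rmin_glb_lt; [lra|]. apply Rdiv_lt_0_compat; [|lra].
    repeat apply Rmult_lt_0_compat; lra. }
  generalize (Hf d Hd). apply filter_imp. intros x Hx.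
  assert (H1 : Cmod l / 2 < Cmod (f x)).
  { assert (Cmod l <= Cmod (f x) + Cmod (f x - l)%C).
    { replace l with (f x + (- (f x - l)))%C at 1 by ring.
      eapply Rle_trans; [apply Cmod_triangle|]. rewrite Cmod_opp. lra. }
    assert (d <= Cmod l / 2) by apply Rmin_l. lra. }
  assert (Hfx : f x <> 0) by (apply Cmod_gt_0; lra).
  replace (/ f x - / l)%C with ((- (f x - l)) * (/ f x * / l))%C by (field; auto).
  rewrite Cmod_mult, Cmod_opp, Cmod_mult, !Cmod_inv by auto.
  assert (H2 : d <= e * Cmod l * Cmod l / 2) by apply Rmin_r.
  apply Rmult_lt_reg_r with (Cmod (f x) * Cmod l); [apply Rmult_lt_0_compat; lra|].
  replace (Cmod (f x - l)%C * (/ Cmod (f x) * / Cmod l) * (Cmod (f x) * Cmod l)) with (Cmod (f x - l)%C)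
    by (field; lra).
  apply Rlt_le_trans with d; [lra|]. apply Rle_trans with (1 := H2). nra.
Qed.

End Tends.

Lemma tends_le {T : Type} (F : (T -> Prop) -> Prop) {FF : ProperFilter F} (f : T -> C) l B :
  F (fun x => Cmod (f x) <= B) -> tends F f l -> Cmod l <= B.
Proof.
  intros HB Hf. apply le_epsilon. intros e He.
  destruct (filter_ex _ (filter_and _ _ HB (Hf e He))) as [x [H1 H2]].
  replace l with (f x + (- (f x - l)))%C by ring.
  eapply Rle_trans; [apply Cmod_triangle|]. rewrite Cmod_opp. lra.
Qed.

Lemma tends_unique {T : Type} (F : (T -> Prop) -> Prop) {FF : ProperFilter F} (f : T -> C) l l' :
  tends F f l -> tends F f l' -> l = l'.
Proof.
  intros H1 H2.
  assert (H : tends F (fun x => f x - f x)%C (l - l')%C) by (apply tends_minus; auto; apply FF).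
  apply (tends_le F _ _ 0) in H.
  - assert (E : (l - l')%C = 0) by (apply Cmod_eq_0; assert (P := Cmod_ge_0 (l - l')%C); lra).
    replace l with (l' + (l - l'))%C by ring. rewrite E. ring.
  - apply filter_forall. intros x. replace (f x - f x)%C with (RtoC 0) by ring. rewrite Cmod_0; lra.
Qed.

Lemma Cmod_sub_sym (a b : C) : Cmod (a - b)%C = Cmod (b - a)%C.
Proof. rewrite <- Cmod_opp. f_equal. ring. Qed.

Lemma Cmod_triangle_inv (a b : C) : Cmod a - Cmod b <= Cmod (a - b)%C.
Proof.
  replace a with ((a - b) + b)%C at 1 by ring.
  assert (H := Cmod_triangle (a - b)%C b). lra.
Qed.

Lemma Cmod_sub_le (a b : C) : Cmod (a - b)%C <= Cmod a + Cmod b.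
Proof. rewrite <- (Cmod_opp b). apply Cmod_triangle. Qed.

Lemma Cmod_RtoC_pos (x : R) : 0 <= x -> Cmod (RtoC x) = x.
Proof. intros H. rewrite Cmod_R. now apply Rabs_pos_eq. Qed.

Lemma im_le_Cmod (c : C) : Rabs (Im c) <= Cmod c.
Proof. eapply Rle_trans; [apply Rmax_r|]. apply (Rmax_Cmod c). Qed.

(** ** Sequences and series *)

Notation Clim := (tends eventually).

Lemma Clim_parts (u : nat -> C) (l : C) :
  Clim u l <-> is_lim_seq (fun n => Re (u n)) (Re l) /\ is_lim_seq (fun n => Im (u n)) (Im l).
Proof.
  split.
  - intros H. split; apply is_lim_seq_spec; intros e;
    generalize (H e (cond_pos e)); apply filter_imp; intros n Hn;
    (eapply Rle_lt_trans; [|exact Hn]).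
    + change (Re (u n) - Re l) with (Re (u n - l)%C). apply re_le_Cmod.
    + change (Im (u n) - Im l) with (Im (u n - l)%C). apply im_le_Cmod.
  - intros [H1 H2] e He. apply is_lim_seq_spec in H1. apply is_lim_seq_spec in H2.
    assert (He2 : 0 < e / 2) by lra.
    generalize (filter_and _ _ (H1 (mkposreal _ He2)) (H2 (mkposreal _ He2))). apply filter_imp.
    simpl. intros n [A B].
    replace (u n - l)%C with (RtoC (Re (u n) - Re l) + Ci * RtoC (Im (u n) - Im l))%C.
    + eapply Rle_lt_trans; [apply Cmod_triangle|]. rewrite Cmod_mult, Cmod_Ci, !Cmod_R. lra.
    + unfold Re, Im. destruct (u n), l. unfold Ci, RtoC, Cminus, Cplus, Cmult, Copp; simpl. f_equal; ring.
Qed.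

Lemma CLim_seq_eq (u : nat -> C) (l : C) : Clim u l -> CLim_seq u = l.
Proof.
  intros H. apply Clim_parts in H. destruct H as [H1 H2]. unfold CLim_seq.
  rewrite (is_lim_seq_unique _ _ H1), (is_lim_seq_unique _ _ H2). simpl. now destruct l.
Qed.

Lemma Clim_cauchy (u : nat -> C) :
  (forall eps, 0 < eps -> exists N, forall n m, (N <= n)%nat -> (N <= m)%nat -> Cmod (u n - u m)%C < eps) ->
  exists l, Clim u l.
Proof.
  intros H.
  assert (A : ex_finite_lim_seq (fun n => Re (u n))).
  { apply ex_lim_seq_cauchy_corr. intros e. destruct (H e (cond_pos e)) as [N HN]. exists N.
    intros n m Hn Hm. eapply Rle_lt_trans; [|exact (HN n m Hn Hm)].
    change (Re (u n) - Re (u m)) with (Re (u n - u m)%C). apply re_le_Cmod. }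
  assert (B : ex_finite_lim_seq (fun n => Im (u n))).
  { apply ex_lim_seq_cauchy_corr. intros e. destruct (H e (cond_pos e)) as [N HN]. exists N.
    intros n m Hn Hm. eapply Rle_lt_trans; [|exact (HN n m Hn Hm)].
    change (Im (u n) - Im (u m)) with (Im (u n - u m)%C). apply im_le_Cmod. }
  destruct A as [a Ha], B as [b Hb]. exists (a, b). apply Clim_parts. now split.
Qed.

Lemma Clim_le (u : nat -> C) l B : (forall n, Cmod (u n) <= B) -> Clim u l -> Cmod l <= B.
Proof. intros H. apply tends_le; [apply eventually_filter|]. now apply filter_forall. Qed.

Lemma Csum_n_S (a : nat -> C) n : sum_n a (S n) = (sum_n a n + a (S n))%C.
Proof. apply (sum_Sn (G := C_AbelianMonoid)). Qed.

Lemma Csum_n_0 (a : nat -> C) : sum_n a 0 = a 0%nat.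
Proof. apply (sum_O (G := C_AbelianMonoid)). Qed.

(** Unlike [sum_n], which always contains the term of index 0, this has an empty sum; the offset is
    [psum a (S n) = sum_n a n]. Remainders of order [N] subtract [psum _ N], so order 0 gives a
    bound on the function itself. *)
Fixpoint psum (a : nat -> C) (n : nat) : C :=
  match n with O => 0 | S n' => psum a n' + a n' end.

Lemma psum_sum_n (a : nat -> C) n : psum a (S n) = sum_n a n.
Proof.
  induction n; simpl in *; [rewrite Csum_n_0; ring|]. now rewrite Csum_n_S, <- IHn.
Qed.

Lemma psum_ext (a b : nat -> C) n : (forall k, (k < n)%nat -> a k = b k) -> psum a n = psum b n.
Proof. induction n; intros H; simpl; [easy|]. rewrite IHn, H; auto. Qed.

Lemma psum_plus (a b : nat -> C) n : psum (fun k => a k + b k)%C n = (psum a n + psum b n)%C.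
Proof. induction n; simpl; [ring|]. rewrite IHn. ring. Qed.

Lemma psum_scal (c : C) (a : nat -> C) n : psum (fun k => c * a k)%C n = (c * psum a n)%C.
Proof. induction n; simpl; [ring|]. rewrite IHn. ring. Qed.

Lemma psum_opp (a : nat -> C) n : psum (fun k => - a k)%C n = (- psum a n)%C.
Proof. induction n; simpl; [ring|]. rewrite IHn. ring. Qed.

Lemma psum_minus (a b : nat -> C) n : psum (fun k => a k - b k)%C n = (psum a n - psum b n)%C.
Proof. unfold Cminus. now rewrite psum_plus, psum_opp. Qed.

Lemma psum_shift (a : nat -> C) n : psum a (S n) = (a 0%nat + psum (fun k => a (S k)) n)%C.
Proof. induction n; [simpl; ring|]. change (psum a (S (S n))) with (psum a (S n) + a (S n))%C. rewrite IHn. simpl. ring. Qed.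

Lemma psum_add (a : nat -> C) n m : psum a (n + m) = (psum a n + psum (fun k => a (n + k)%nat) m)%C.
Proof. induction m; [rewrite Nat.add_0_r; simpl; ring|]. rewrite Nat.add_succ_r. simpl. rewrite IHm. ring. Qed.

Lemma psum_rev (a : nat -> C) n : psum a n = psum (fun k => a (n - 1 - k)%nat) n.
Proof.
  induction n; [easy|]. rewrite (psum_shift (fun k => a (S n - 1 - k)%nat)). simpl psum at 1.
  rewrite IHn, Cplus_comm. f_equal.
  - f_equal. lia.
  - apply psum_ext. intros. f_equal. lia.
Qed.

Fixpoint rsum (a : nat -> R) (n : nat) : R :=
  match n with O => 0 | S n' => rsum a n' + a n' end.

Lemma rsum_le (a b : nat -> R) n : (forall k, (k < n)%nat -> a k <= b k) -> rsum a n <= rsum b n.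
Proof. induction n; intros H; simpl; [lra|]. apply Rplus_le_compat; auto. Qed.

Lemma rsum_ge_0 (a : nat -> R) n : (forall k, (k < n)%nat -> 0 <= a k) -> 0 <= rsum a n.
Proof. induction n; intros H; simpl; [lra|]. assert (0 <= a n) by auto. assert (0 <= rsum a n) by auto. lra. Qed.

Lemma rsum_scal c (a : nat -> R) n : rsum (fun k => c * a k) n = c * rsum a n.
Proof. induction n; simpl; [ring|]. rewrite IHn. ring. Qed.

Lemma rsum_const c n : rsum (fun _ => c) n = INR n * c.
Proof. induction n; [simpl; ring|]. rewrite S_INR. simpl. rewrite IHn. ring. Qed.

Lemma psum_Cmod (a : nat -> C) n : Cmod (psum a n) <= rsum (fun k => Cmod (a k)) n.
Proof.
  induction n; simpl; [rewrite Cmod_0; lra|]. eapply Rle_trans; [apply Cmod_triangle|]. lra.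
Qed.

Lemma psum_Cmod_le (a : nat -> C) (b : nat -> R) n :
  (forall k, (k < n)%nat -> Cmod (a k) <= b k) -> Cmod (psum a n) <= rsum b n.
Proof. intros H. eapply Rle_trans; [apply psum_Cmod|]. now apply rsum_le. Qed.

Lemma rsum_geom x n : (1 - x) * rsum (fun k => x ^ k) n = 1 - x ^ n.
Proof. induction n; simpl; [ring|]. rewrite Rmult_plus_distr_l, IHn. ring. Qed.

Lemma rsum_half n : rsum (fun k => (/ 2) ^ k) n <= 2.
Proof.
  assert (H := rsum_geom (/ 2) n). assert (0 < (/2) ^ n) by (apply pow_lt; lra). lra.
Qed.

Lemma Clim_S (u : nat -> C) l : Clim (fun n => u (S n)) l <-> Clim u l.
Proof.
  split; intros H e He; destruct (H e He) as [N HN].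
  - exists (S N). intros [|n] Hn; [lia|]. apply HN. lia.
  - exists N. intros n Hn. apply HN. lia.
Qed.

Definition Cser (a : nat -> C) (l : C) : Prop := Clim (psum a) l.

Lemma Cser_eq (a : nat -> C) l : Cser a l -> CSeries a = l.
Proof.
  intros H. apply CLim_seq_eq. apply Clim_S in H.
  revert H. apply tends_ext; [apply eventually_filter|]. intros n. apply psum_sum_n.
Qed.

(** Normal convergence, with the bound put on the partial sums of the majorant: [S0] then bounds the
    sum of the series too, without naming the sum of the majorant. *)
Definition dominated (a : nat -> C) (S0 : R) : Prop :=
  exists b : nat -> R, (forall n, Cmod (a n) <= b n) /\ (forall n, rsum b n <= S0).

Lemma Cser_ex (a : nat -> C) S0 : dominated a S0 -> exists l, Cser a l /\ Cmod l <= S0.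
Proof.
  intros [b [Hab Hb]].
  assert (Hb0 : forall n, 0 <= b n) by (intros n; eapply Rle_trans; [apply Cmod_ge_0|apply Hab]).
  assert (Hcv : ex_finite_lim_seq (rsum b)).
  { apply ex_finite_lim_seq_incr with S0; [|exact Hb]. intros n; simpl. specialize (Hb0 n). lra. }
  assert (HC : forall eps, 0 < eps -> exists N, forall n m, (N <= n)%nat -> (N <= m)%nat ->
     Cmod (psum a n - psum a m)%C < eps).
  { intros e He. apply ex_lim_seq_cauchy_corr in Hcv. destruct (Hcv (mkposreal e He)) as [N HN].
    assert (G : forall n m, (N <= n)%nat -> (n <= m)%nat -> Cmod (psum a m - psum a n)%C < e).
    { intros n m Hn Hm. replace m with (n + (m - n))%nat by lia.
      rewrite psum_add.
      replace (psum a n + psum (fun k => a (n + k)%nat) (m - n) - psum a n)%C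
        with (psum (fun k => a (n + k)%nat) (m - n)) by ring.
      assert (E : forall k, Cmod (psum (fun k => a (n + k)%nat) k) <= rsum b (n + k) - rsum b n).
      { induction k; simpl; [rewrite Cmod_0, Nat.add_0_r; lra|]. rewrite Nat.add_succ_r. simpl.
        eapply Rle_trans; [apply Cmod_triangle|]. specialize (Hab (n + k)%nat). lra. }
      eapply Rle_lt_trans; [apply E|]. eapply Rle_lt_trans; [apply Rle_abs|].
      apply (HN (n + (m - n))%nat n); lia. }
    exists N. intros n m Hn Hm. destruct (le_ge_dec n m) as [h|h].
    - rewrite Cmod_sub_sym. now apply G.
    - now apply G. }
  destruct (Clim_cauchy _ HC) as [l Hl]. exists l. split; [exact Hl|].
  apply (Clim_le (psum a)); [|exact Hl]. intros n. eapply Rle_trans; [|apply (Hb n)].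
  apply psum_Cmod_le. auto.
Qed.

Lemma Cser_ext (a b : nat -> C) l : (forall n, a n = b n) -> Cser a l -> Cser b l.
Proof. intros H. apply tends_ext; [apply eventually_filter|]. intros n. apply psum_ext. auto. Qed.

Lemma Cser_plus (a b : nat -> C) la lb : Cser a la -> Cser b lb -> Cser (fun n => a n + b n)%C (la + lb)%C.
Proof.
  intros Ha Hb. apply tends_ext with (fun n => psum a n + psum b n)%C; [apply eventually_filter| |].
  - intros. symmetry. apply psum_plus.
  - apply tends_plus; auto. apply eventually_filter.
Qed.

Lemma Cser_scal (c : C) (a : nat -> C) l : Cser a l -> Cser (fun n => c * a n)%C (c * l)%C.
Proof.
  intros Ha. apply tends_ext with (fun n => c * psum a n)%C; [apply eventually_filter| |].
  - intros. symmetry. apply psum_scal.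
  - apply tends_scal; auto. apply eventually_filter.
Qed.

Lemma Cser_minus (a b : nat -> C) la lb : Cser a la -> Cser b lb -> Cser (fun n => a n - b n)%C (la - lb)%C.
Proof.
  intros Ha Hb. apply Cser_ext with (fun n => a n + (-(1)) * b n)%C; [intros; ring|].
  replace (la - lb)%C with (la + (-(1)) * lb)%C by ring. apply Cser_plus; [|apply Cser_scal]; auto.
Qed.

Lemma Cser_shift (a : nat -> C) l : Cser (fun n => a (S n)) l -> Cser a (a 0%nat + l)%C.
Proof.
  intros H. apply Clim_S. apply tends_ext with (fun n => a 0%nat + psum (fun k => a (S k)) n)%C;
  [apply eventually_filter| |].
  - intros. now rewrite psum_shift.
  - apply tends_plus; [apply eventually_filter|apply tends_const; apply eventually_filter|exact H].
Qed.

Lemma Cser_unique (a : nat -> C) l l' : Cser a l -> Cser a l' -> l = l'.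
Proof. apply tends_unique. apply eventually_filter. Qed.

Lemma Cser_0 : Cser (fun _ => RtoC 0) 0.
Proof.
  apply tends_ext with (fun _ => RtoC 0); [apply eventually_filter| |apply tends_const; apply eventually_filter].
  intros n. induction n; simpl; [easy|]. rewrite <- IHn. ring.
Qed.

(** ** Complex derivatives *)

(* Caratheodory's form of differentiability: closure under the algebraic
   operations reduces to the arithmetic of limits. *)
Definition cder (f : C -> C) (z l : C) : Prop :=
  exists phi : C -> C, (forall w, f w = f z + (w - z) * phi w)%C /\ tends (locally z) phi l.

Lemma cder_is_derive (f : C -> C) (z l : C) :
  cder f z l <-> is_derive (K := C_AbsRing) (V := C_NormedModule) f z l.
Proof.
  split.
  - intros [phi [Hf Hphi]]. split; [apply is_linear_scal_l|].
    intros x Hx. apply (is_filter_lim_locally_unique (V := AbsRing_NormedModule C_AbsRing)) in Hx. subst x.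
    (* Neighbourhoods in [is_derive] over [C_AbsRing] are discs of the modulus, those of [cder] come
       from the product structure; [locally_C] exchanges the two. *)
    intros e. apply (locally_C z).
    generalize (Hphi e (cond_pos e)). apply filter_imp. intros w Hw.
    change (Cmod (f w - f z - (w - z) * l)%C <= e * Cmod (w - z)%C).
    rewrite (Hf w). replace (f z + (w - z) * phi w - f z - (w - z) * l)%C with ((phi w - l) * (w - z))%C by ring.
    rewrite Cmod_mult. apply Rmult_le_compat_r; [apply Cmod_ge_0|]. now apply Rlt_le.
  - intros [_ H].
    specialize (H z (fun P HP => HP)).
    assert (H' : forall eps : posreal, locally (T := C_UniformSpace) z
      (fun y => norm (K := C_AbsRing) (V := C_NormedModule) (minus (minus (f y) (f z)) (scal (minus y z) l)) <= eps * norm (minus y z)))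
      by (intros e; apply locally_C; exact (H e)).
    clear H. rename H' into H.
    exists (fun w => if Ceq_dec w z then l else ((f w - f z) / (w - z))%C). split.
    + intros w. destruct (Ceq_dec w z) as [->|E]; [ring|]. field. intros E'. apply E.
      replace w with (z + (w - z))%C by ring. rewrite E'. ring.
    + intros e He. assert (He2 : 0 < e / 2) by lra. specialize (H (mkposreal _ He2)). revert H. apply filter_imp. intros w Hw.
      change (Cmod (f w - f z - (w - z) * l)%C <= e / 2 * Cmod (w - z)%C) in Hw.
      destruct (Ceq_dec w z) as [->|E]; [replace (l - l)%C with (RtoC 0) by ring; rewrite Cmod_0; lra|].
      assert (E' : (w - z)%C <> 0).
      { intros E'. apply E. replace w with (z + (w - z))%C by ring. rewrite E'. ring. }
      replace ((f w - f z) / (w - z) - l)%C with ((f w - f z - (w - z) * l) / (w - z))%C by (field; auto).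
      rewrite Cmod_div by auto. assert (P := proj1 (Cmod_gt_0 _) E').
      apply Rle_lt_trans with (e / 2); [|lra]. apply Rmult_le_reg_r with (Cmod (w - z)%C); [auto|].
      unfold Rdiv at 1. rewrite Rmult_assoc, Rinv_l by lra. lra.
Qed.

Lemma cder_C_derive (f : C -> C) z l : cder f z l -> C_derive f z = l.
Proof. intros H. apply is_C_derive_unique. apply cder_is_derive in H. exact H. Qed.

Lemma tends_id (z : C) : tends (locally z) (fun w => w) z.
Proof. intros e He. apply locally_Cmod. exists e. auto. Qed.

Lemma cder_cont (f : C -> C) z l : cder f z l -> tends (locally z) f (f z).
Proof.
  intros [phi [Hf Hphi]]. apply tends_ext with (fun w => f z + (w - z) * phi w)%C; [apply locally_filter|intros; now rewrite <- Hf|].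
  apply tends_eq with (f z + (z - z) * l)%C; [ring|].
  apply tends_plus; [apply locally_filter|apply tends_const, locally_filter|].
  apply tends_mult; [apply locally_filter| |exact Hphi].
  apply tends_minus; [apply locally_filter|apply tends_id|apply tends_const, locally_filter].
Qed.

Lemma cder_const (c z : C) : cder (fun _ => c) z 0.
Proof. exists (fun _ => RtoC 0). split; [intros; ring|apply tends_const, locally_filter]. Qed.

Lemma cder_id (z : C) : cder (fun w => w) z 1.
Proof. exists (fun _ => RtoC 1). split; [intros; ring|apply tends_const, locally_filter]. Qed.

Lemma cder_plus f g (z a b : C) : cder f z a -> cder g z b -> cder (fun w => f w + g w)%C z (a + b)%C.
Proof.
  intros [p [Hp Tp]] [r [Hr Tr]]. exists (fun w => p w + r w)%C. split.
  - intros w. rewrite (Hp w), (Hr w). ring.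
  - apply tends_plus; auto. apply locally_filter.
Qed.

Lemma cder_mult f g (z a b : C) : cder f z a -> cder g z b -> cder (fun w => f w * g w)%C z (a * g z + f z * b)%C.
Proof.
  intros Hf Hg. assert (Cg := cder_cont _ _ _ Hg).
  destruct Hf as [p [Hp Tp]], Hg as [r [Hr Tr]]. exists (fun w => p w * g w + f z * r w)%C. split.
  - intros w. rewrite (Hp w). rewrite (Hr w). ring.
  - apply tends_plus; [apply locally_filter| |].
    + apply tends_mult; auto. apply locally_filter.
    + apply tends_scal; auto. apply locally_filter.
Qed.

Lemma cder_comp f g (z a b : C) : cder g z b -> cder f (g z) a -> cder (fun w => f (g w)) z (a * b)%C.
Proof.
  intros Hg Hf. assert (Cg := cder_cont _ _ _ Hg).
  destruct Hf as [p [Hp Tp]], Hg as [r [Hr Tr]]. exists (fun w => p (g w) * r w)%C. split.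
  - intros w. rewrite (Hp (g w)), (Hr w). ring.
  - apply tends_mult; auto; [apply locally_filter|].
    intros e He. specialize (Tp e He).
    apply tends_filterlim in Cg; [|apply locally_filter]. exact (Cg _ Tp).
Qed.

Lemma cder_inv (z : C) : z <> 0 -> cder Cinv z (- / (z * z))%C.
Proof.
  (* Inversion returns 0 at 0, so the slope at [w = 0] must be 1 / z^2 for the identity to hold for
     every [w]; this value is far from [z] and does not affect the limit. *)
  intros Hz. exists (fun w => if Ceq_dec w 0 then (/ z / z)%C else (- / (w * z))%C). split.
  - intros w. destruct (Ceq_dec w 0) as [->|E].
    + replace (/ 0)%C with (RtoC 0). { field. auto. }
      unfold Cinv, RtoC; simpl. f_equal; unfold Rdiv; ring.
    + field. auto.
  - apply tends_ext_loc with (fun w => - / (w * z))%C; [apply locally_filter| |].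
    + apply locally_Cmod. exists (Cmod z). split; [now apply Cmod_gt_0|].
      intros w Hw. destruct (Ceq_dec w 0) as [->|E]; [|easy].
      replace (0 - z)%C with (- z)%C in Hw by ring. rewrite Cmod_opp in Hw. lra.
    + apply tends_opp; [apply locally_filter|]. apply tends_inv; [apply locally_filter| |].
      * now apply Cmult_neq_0.
      * apply tends_mult; [apply locally_filter|apply tends_id|apply tends_const, locally_filter].
Qed.

Lemma cder_loc f g (z a : C) : locally z (fun w => f w = g w) -> cder f z a -> cder g z a.
Proof.
  intros E H. apply cder_is_derive. apply cder_is_derive in H.
  eapply (is_derive_ext_loc (K := C_AbsRing) (V := C_NormedModule)); [|exact H].
  apply (locally_C z (fun w => f w = g w)). exact E.
Qed.

Lemma cder_ext f g (z a : C) : (forall w, f w = g w) -> cder f z a -> cder g z a.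
Proof. intros E. apply cder_loc. apply filter_forall. exact E. Qed.

Definition hol (D : C -> Prop) (f : C -> C) : Prop := forall z, D z -> exists l, cder f z l.

Lemma hol_holomorphic D f : hol D f <-> holomorphic D f.
Proof.
  split; intros H z Hz; destruct (H z Hz) as [l Hl]; exists l; now apply cder_is_derive.
Qed.

Lemma hol_const D c : hol D (fun _ => c).
Proof. intros z _. exists 0%C. apply cder_const. Qed.

Lemma hol_id D : hol D (fun z => z).
Proof. intros z _. exists 1%C. apply cder_id. Qed.

Lemma hol_plus D f g : hol D f -> hol D g -> hol D (fun z => f z + g z)%C.
Proof. intros Hf Hg z Hz. destruct (Hf z Hz), (Hg z Hz). eexists. apply cder_plus; eassumption. Qed.

Lemma hol_mult D f g : hol D f -> hol D g -> hol D (fun z => f z * g z)%C.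
Proof. intros Hf Hg z Hz. destruct (Hf z Hz), (Hg z Hz). eexists. apply cder_mult; eassumption. Qed.

Lemma hol_minus D f g : hol D f -> hol D g -> hol D (fun z => f z - g z)%C.
Proof.
  intros Hf Hg. intros z Hz.
  destruct (hol_plus D f (fun w => (-(1)) * g w)%C Hf (hol_mult D _ _ (hol_const D _) Hg) z Hz) as [l Hl].
  exists l. revert Hl. apply cder_ext. intros; ring.
Qed.

Lemma hol_pow D f n : hol D f -> hol D (fun z => f z ^ n)%C.
Proof. intros H. induction n; simpl; [apply hol_const|now apply hol_mult]. Qed.

Lemma hol_inv D f : hol D f -> (forall z, D z -> f z <> 0) -> hol D (fun z => / f z)%C.
Proof. intros Hf Hn z Hz. destruct (Hf z Hz) as [l Hl]. eexists. apply (cder_comp Cinv f); [exact Hl|]. apply cder_inv; auto. Qed.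

Lemma hol_comp D E f g : hol D g -> (forall z, D z -> E (g z)) -> hol E f -> hol D (fun z => f (g z)).
Proof. intros Hg HE Hf z Hz. destruct (Hg z Hz). destruct (Hf (g z) (HE z Hz)). eexists. eapply cder_comp; eassumption. Qed.

Lemma hol_subset (D E : C -> Prop) f : (forall z, D z -> E z) -> hol E f -> hol D f.
Proof. intros H Hf z Hz. auto. Qed.

Lemma hol_psum D (f : nat -> C -> C) n : (forall k, hol D (f k)) -> hol D (fun z => psum (fun k => f k z) n).
Proof. intros H. induction n; simpl; [apply hol_const|now apply hol_plus]. Qed.

(** ** Integrals of complex-valued functions of a real variable *)

Definition rcont (f : R -> C) (s : R) : Prop := tends (locally s) f (f s).

Lemma rcont_continuous (f : R -> C) s :
  rcont f s <-> continuous (U := C_R_CompleteNormedModule) f s.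
Proof.
  split; intros H.
  - apply tends_filterlim in H; [exact H|apply locally_filter].
  - apply tends_filterlim; [apply locally_filter|exact H].
Qed.

Lemma locally_R (s : R) (P : R -> Prop) :
  locally s P <-> exists d, 0 < d /\ forall r, Rabs (r - s) < d -> P r.
Proof.
  split.
  - intros [e He]. exists e. split; [apply cond_pos|exact He].
  - intros [d [Hd H]]. exists (mkposreal d Hd). exact H.
Qed.

Definition rder (F : R -> C) (s : R) (l : C) : Prop :=
  exists phi : R -> C, (forall r, F r = F s + RtoC (r - s) * phi r)%C /\ tends (locally s) phi l.

Lemma rder_is_derive (F : R -> C) s l :
  rder F s l -> is_derive (V := C_R_NormedModule) F s l.
Proof.
  intros [phi [Hf Hphi]]. split; [apply is_linear_scal_l|].
  intros x Hx. apply (is_filter_lim_locally_unique (V := R_NormedModule)) in Hx. subst x.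
  intros e. generalize (Hphi e (cond_pos e)). apply filter_imp. intros w Hw.
  assert (E : minus (minus (F w) (F s)) (scal (minus w s) l) = ((phi w - l) * RtoC (w - s))%C).
  { rewrite (Hf w).
    change (minus (F s + (w - s)%R * phi w)%C (F s)) with ((F s + (w - s)%R * phi w) - F s)%C.
    change (scal (minus w s) l) with ((w - s) * fst l, (w - s) * snd l).
    replace (((w - s) * fst l, (w - s) * snd l)) with (RtoC (w - s) * l)%C.
    + match goal with |- minus ?a ?b = ?r => change (@eq C (Cminus a b) r) end. ring.
    + destruct l. unfold RtoC, Cmult; simpl. f_equal; ring. }
  apply Rle_trans with (Cmod ((phi w - l) * RtoC (w - s))%C).
  { right. rewrite <- E. symmetry. apply Cmod_norm. }
  change (norm (minus w s)) with (Rabs (w - s)).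
  rewrite Cmod_mult, Cmod_R. apply Rmult_le_compat_r; [apply Rabs_pos|]. now apply Rlt_le.
Qed.

Lemma rder_cont F s l : rder F s l -> rcont F s.
Proof.
  intros [phi [Hf Hphi]]. unfold rcont.
  apply tends_ext with (fun r => F s + RtoC (r - s) * phi r)%C; [apply locally_filter|intros; now rewrite <- Hf|].
  apply tends_eq with (F s + RtoC 0 * l)%C; [ring|].
  apply tends_plus; [apply locally_filter|apply tends_const, locally_filter|].
  apply tends_mult; [apply locally_filter| |exact Hphi].
  intros e He. apply locally_R. exists e. split; [exact He|]. intros r Hr.
  replace (RtoC (r - s) - 0)%C with (RtoC (r - s)) by ring. now rewrite Cmod_R.
Qed.

Lemma rder_const c s : rder (fun _ => c) s 0.
Proof. exists (fun _ => RtoC 0). split; [intros; ring|apply tends_const, locally_filter]. Qed.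

Lemma rder_id s : rder RtoC s 1.
Proof.
  exists (fun _ => RtoC 1). split; [|apply tends_const, locally_filter]. intros r.
  rewrite RtoC_minus. ring.
Qed.

Lemma rder_plus f g s a b : rder f s a -> rder g s b -> rder (fun w => f w + g w)%C s (a + b)%C.
Proof.
  intros [p [Hp Tp]] [r [Hr Tr]]. exists (fun w => p w + r w)%C. split.
  - intros w. rewrite (Hp w), (Hr w). ring.
  - apply tends_plus; auto. apply locally_filter.
Qed.

Lemma rder_mult f g s a b : rder f s a -> rder g s b -> rder (fun w => f w * g w)%C s (a * g s + f s * b)%C.
Proof.
  intros Hf Hg. assert (Cg := rder_cont _ _ _ Hg).
  destruct Hf as [p [Hp Tp]], Hg as [r [Hr Tr]]. exists (fun w => p w * g w + f s * r w)%C. split.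
  - intros w. rewrite (Hp w). rewrite (Hr w). ring.
  - apply tends_plus; [apply locally_filter| |].
    + apply tends_mult; auto. apply locally_filter.
    + apply tends_scal; auto. apply locally_filter.
Qed.

Lemma rder_eq f s a b : a = b -> rder f s a -> rder f s b.
Proof. now intros ->. Qed.

Lemma rder_ext f g s a : (forall r, f r = g r) -> rder f s a -> rder g s a.
Proof.
  intros E [p [Hp Tp]]. exists p. split; [|exact Tp]. intros r. rewrite <- !E. apply Hp.
Qed.

Lemma tends_comp_at {T} (F : (T -> Prop) -> Prop) (f : C -> C) (g : T -> C) (z : C) l :
  Filter F -> tends F g z -> tends (locally z) f l -> tends F (fun x => f (g x)) l.
Proof.
  intros FF Hg Hf e He. apply tends_filterlim in Hg; [|exact FF]. exact (Hg _ (Hf e He)).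
Qed.

Notation isI := (is_RInt (V := C_R_NormedModule)).

Lemma isI_ex f a b : (forall s, Rmin a b <= s <= Rmax a b -> rcont f s) -> exists l, isI f a b l.
Proof.
  intros H. apply (ex_RInt_continuous (V := C_R_CompleteNormedModule)).
  intros s Hs. apply rcont_continuous. auto.
Qed.

Lemma isI_ex_le f a b : a <= b -> (forall s, a <= s <= b -> rcont f s) -> exists l, isI f a b l.
Proof. intros Hab H. apply isI_ex. now rewrite Rmin_left, Rmax_right. Qed.

Lemma isI_ext f g a b l : (forall s, Rmin a b < s < Rmax a b -> f s = g s) -> isI f a b l -> isI g a b l.
Proof. apply (is_RInt_ext (V := C_R_NormedModule)). Qed.

Lemma isI_eq f a b l l' : l = l' -> isI f a b l -> isI f a b l'.
Proof. now intros ->. Qed.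

Lemma isI_plus f g a b l l' : isI f a b l -> isI g a b l' -> isI (fun s => f s + g s)%C a b (l + l')%C.
Proof. apply (is_RInt_plus (V := C_R_NormedModule)). Qed.

Lemma isI_minus f g a b l l' : isI f a b l -> isI g a b l' -> isI (fun s => f s - g s)%C a b (l - l')%C.
Proof. apply (is_RInt_minus (V := C_R_NormedModule)). Qed.

Lemma isI_Re f a b l : isI f a b l -> is_RInt (fun s => Re (f s)) a b (Re l).
Proof. apply (is_RInt_fct_extend_fst (U := R_NormedModule) (V := R_NormedModule)). Qed.

Lemma isI_Im f a b l : isI f a b l -> is_RInt (fun s => Im (f s)) a b (Im l).
Proof. apply (is_RInt_fct_extend_snd (U := R_NormedModule) (V := R_NormedModule)). Qed.

Lemma isI_pair f a b l : is_RInt (fun s => Re (f s)) a b (Re l) -> is_RInt (fun s => Im (f s)) a b (Im l) -> isI f a b l.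
Proof.
  intros H1 H2. replace l with (Re l, Im l) by now destruct l.
  apply (is_RInt_fct_extend_pair (U := R_NormedModule) (V := R_NormedModule)); assumption.
Qed.

Lemma isI_scal c f a b l : isI f a b l -> isI (fun s => c * f s)%C a b (c * l)%C.
Proof.
  intros H. assert (H1 := isI_Re _ _ _ _ H). assert (H2 := isI_Im _ _ _ _ H).
  apply isI_pair; unfold Re, Im, Cmult in *; simpl.
  - apply (is_RInt_minus (V := R_NormedModule)); apply (is_RInt_scal (V := R_NormedModule)); assumption.
  - apply (is_RInt_plus (V := R_NormedModule)); apply (is_RInt_scal (V := R_NormedModule)); assumption.
Qed.

Lemma isI_Chasles f a b c l l' : isI f a b l -> isI f b c l' -> isI f a c (l + l')%C.
Proof. apply (is_RInt_Chasles (V := C_R_NormedModule)). Qed.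

Lemma isI_norm_le f g a b l lg : a <= b -> (forall s, a <= s <= b -> Cmod (f s) <= g s) ->
  isI f a b l -> is_RInt g a b lg -> Cmod l <= lg.
Proof.
  intros H1 H2 H3 H4. rewrite Cmod_norm.
  refine (norm_RInt_le (V := C_R_NormedModule) f g a b l lg H1 _ H3 H4).
  intros s Hs. rewrite <- Cmod_norm. auto.
Qed.

Lemma isI_norm_const f a b l B : a <= b -> (forall s, a <= s <= b -> Cmod (f s) <= B) ->
  isI f a b l -> Cmod l <= (b - a) * B.
Proof.
  intros H1 H2 H3. apply (isI_norm_le f (fun _ => B) a b l _ H1 H2 H3).
  apply (is_RInt_const (V := R_NormedModule)).
Qed.

Lemma isI_const a b c : isI (fun _ => c) a b (RtoC (b - a) * c)%C.
Proof.
  eapply isI_eq; [|apply (is_RInt_const (V := C_R_NormedModule))].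
  destruct c. unfold scal; simpl. unfold prod_scal, scal; simpl. unfold mult, RtoC, Cmult; simpl. f_equal; ring.
Qed.

Lemma isI_FTC F f a b : (forall s, Rmin a b <= s <= Rmax a b -> rder F s (f s)) ->
  (forall s, Rmin a b <= s <= Rmax a b -> rcont f s) -> isI f a b (F b - F a)%C.
Proof.
  intros H1 H2. apply (is_RInt_derive (V := C_R_CompleteNormedModule) F f).
  - intros s Hs. apply rder_is_derive. auto.
  - intros s Hs. apply rcont_continuous. auto.
Qed.

Definition CI (f : R -> C) (a b : R) : C := RInt (V := C_R_CompleteNormedModule) f a b.

Lemma CI_eq f a b l : isI f a b l -> CI f a b = l.
Proof. apply (is_RInt_unique (V := C_R_CompleteNormedModule)). Qed.

Lemma CI_correct f a b : (exists l, isI f a b l) -> isI f a b (CI f a b).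
Proof. intros [l Hl]. now rewrite (CI_eq _ _ _ _ Hl). Qed.

Lemma CI_cont f a b : a <= b -> (forall s, a <= s <= b -> rcont f s) -> isI f a b (CI f a b).
Proof. intros H1 H2. apply CI_correct. now apply isI_ex_le. Qed.

(** ** Goursat's lemma *)

Section Bisection.
Variable I : R -> R -> R -> R -> C.
Variables a0 c0 h k : R.
Hypothesis Hh : 0 <= h.
Hypothesis Hk : 0 <= k.
Hypothesis I_add1 : forall a m b c d, a0 <= a <= m -> m <= b <= a0 + h -> c0 <= c <= d -> d <= c0 + k ->
  I a b c d = (I a m c d + I m b c d)%C.
Hypothesis I_add2 : forall a b c m d, a0 <= a <= b -> b <= a0 + h -> c0 <= c <= m -> m <= d <= c0 + k ->
  I a b c d = (I a b c m + I a b m d)%C.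
Hypothesis I_loc : forall s t, a0 <= s <= a0 + h -> c0 <= t <= c0 + k -> forall eps, 0 < eps ->
  exists eta, 0 < eta /\ forall a b c d, a0 <= a <= s -> s <= b <= a0 + h -> c0 <= c <= t -> t <= d <= c0 + k ->
    b - a < eta -> d - c < eta -> Cmod (I a b c d) <= eps * ((b - a) + (d - c)) ^ 2.

Variable eps : R.
Hypothesis Heps : 0 < eps.

Let hn (n : nat) := h / 2 ^ n.
Let kn (n : nat) := k / 2 ^ n.
Let good n (p : R * R) : Prop :=
  Cmod (I (fst p) (fst p + hn n) (snd p) (snd p + kn n)) <= eps * (hn n + kn n) ^ 2.
Let inr n (p : R * R) : Prop :=
  (a0 <= fst p /\ fst p + hn n <= a0 + h) /\ (c0 <= snd p /\ snd p + kn n <= c0 + k).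
(** The corner of a quarter of the current rectangle on which the bound fails. Three quarters are
    tested and the upper right one is taken by default. *)
Let next n (p : R * R) : R * R :=
  if Rle_dec (Cmod (I (fst p) (fst p + hn (S n)) (snd p) (snd p + kn (S n)))) (eps * (hn (S n) + kn (S n)) ^ 2)
  then
    if Rle_dec (Cmod (I (fst p + hn (S n)) (fst p + hn n) (snd p) (snd p + kn (S n)))) (eps * (hn (S n) + kn (S n)) ^ 2)
    then
      if Rle_dec (Cmod (I (fst p) (fst p + hn (S n)) (snd p + kn (S n)) (snd p + kn n))) (eps * (hn (S n) + kn (S n)) ^ 2)
      then (fst p + hn (S n), snd p + kn (S n))
      else (fst p, snd p + kn (S n))
    else (fst p + hn (S n), snd p)
  else p.
Fixpoint corner n : R * R := match n with O => (a0, c0) | S n' => next n' (corner n') end.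

Let hnS n : hn n = 2 * hn (S n).
Proof. unfold hn. simpl. field. apply pow_nonzero; lra. Qed.
Let knS n : kn n = 2 * kn (S n).
Proof. unfold kn. simpl. field. apply pow_nonzero; lra. Qed.
Let hn0 n : 0 <= hn n.
Proof. unfold hn. apply Rmult_le_pos; [exact Hh|]. apply Rlt_le, Rinv_0_lt_compat, pow_lt; lra. Qed.
Let kn0 n : 0 <= kn n.
Proof. unfold kn. apply Rmult_le_pos; [exact Hk|]. apply Rlt_le, Rinv_0_lt_compat, pow_lt; lra. Qed.

(** Halving both sides divides the bound by four, so four good quarters would add up to a good
    rectangle. This justifies the default choice in [next]. *)
Lemma next_spec n p : inr n p -> ~ good n p ->
  inr (S n) (next n p) /\ ~ good (S n) (next n p) /\
  fst p <= fst (next n p) <= fst p + hn (S n) /\ snd p <= snd (next n p) <= snd p + kn (S n).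
Proof.
  intros [[A1 A2] [A3 A4]] Hng. destruct p as [a c]. cbn [fst snd] in *.
  assert (E1 := hnS n). assert (E2 := knS n). assert (P1 := hn0 (S n)). assert (P2 := kn0 (S n)).
  unfold good, inr, next in *. cbn [fst snd] in *.
  repeat match goal with |- context [Rle_dec ?x ?y] => destruct (Rle_dec x y) as [?H|?H] end; cbn [fst snd].
  - split; [lra|]. split; [|lra]. intros G. apply Hng.
    rewrite (I_add1 a (a + hn (S n)) (a + hn n)) by lra.
    rewrite (I_add2 a (a + hn (S n)) c (c + kn (S n)) (c + kn n)) by lra.
    rewrite (I_add2 (a + hn (S n)) (a + hn n) c (c + kn (S n)) (c + kn n)) by lra.
    replace (c + kn (S n) + kn (S n)) with (c + kn n) in G by lra.
    replace (a + hn (S n) + hn (S n)) with (a + hn n) in G by lra.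
    eapply Rle_trans; [apply Cmod_triangle|].
    eapply Rle_trans; [apply Rplus_le_compat; apply Cmod_triangle|].
    replace (eps * (hn n + kn n) ^ 2) with (4 * (eps * (hn (S n) + kn (S n)) ^ 2)) by (rewrite E1, E2; ring).
    lra.
  - split; [lra|]. split; [|lra]. intros G. apply H1. replace (c + kn n) with (c + kn (S n) + kn (S n)) by lra. exact G.
  - split; [lra|]. split; [|lra]. intros G. apply H0. replace (a + hn n) with (a + hn (S n) + hn (S n)) by lra. exact G.
  - split; [lra|]. split; [|lra]. exact H.
Qed.

Lemma corner_spec : ~ good 0 (a0, c0) -> forall n, inr n (corner n) /\ ~ good n (corner n).
Proof.
  intros H0. induction n.
  - simpl. split; [|exact H0]. unfold inr, hn, kn. simpl. lra.
  - simpl. destruct IHn as [A B]. destruct (next_spec n (corner n) A B) as [C [D _]]. now split.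
Qed.

(** Nested intervals in each coordinate: the lower corners increase, the upper ones decrease, and
    the suprema of the lower corners lie in every rectangle. *)
Lemma corner_lim : ~ good 0 (a0, c0) -> exists s t, forall n,
  fst (corner n) <= s <= fst (corner n) + hn n /\ snd (corner n) <= t <= snd (corner n) + kn n.
Proof.
  intros H0. assert (HS := corner_spec H0).
  assert (St : forall n, fst (corner n) <= fst (corner (S n)) <= fst (corner n) + hn (S n) /\
                         snd (corner n) <= snd (corner (S n)) <= snd (corner n) + kn (S n)).
  { intros n. destruct (HS n) as [A B]. apply (next_spec n (corner n) A B). }
  assert (Up : forall n m, fst (corner (n + m)) + hn (n + m) <= fst (corner n) + hn n /\
                        snd (corner (n + m)) + kn (n + m) <= snd (corner n) + kn n).
  { intros n m. induction m; [rewrite Nat.add_0_r; lra|]. rewrite Nat.add_succ_r.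
    specialize (St (n + m)%nat). assert (E1 := hnS (n + m)). assert (E2 := knS (n + m)). lra. }
  assert (Lo : forall n m, fst (corner n) <= fst (corner (n + m)) /\ snd (corner n) <= snd (corner (n + m))).
  { intros n m. induction m; [rewrite Nat.add_0_r; lra|]. rewrite Nat.add_succ_r.
    specialize (St (n + m)%nat). lra. }
  assert (X1 : forall n m, fst (corner n) <= fst (corner m) + hn m).
  { intros n m. destruct (le_ge_dec n m) as [l|l].
    - replace m with (n + (m - n))%nat by lia. destruct (Lo n (m - n)%nat). assert (P := hn0 (n + (m - n))). lra.
    - replace n with (m + (n - m))%nat by lia. destruct (Up m (n - m)%nat). assert (P := hn0 (m + (n - m))). lra. }
  assert (X2 : forall n m, snd (corner n) <= snd (corner m) + kn m).
  { intros n m. destruct (le_ge_dec n m) as [l|l].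
    - replace m with (n + (m - n))%nat by lia. destruct (Lo n (m - n)%nat). assert (P := kn0 (n + (m - n))). lra.
    - replace n with (m + (n - m))%nat by lia. destruct (Up m (n - m)%nat). assert (P := kn0 (m + (n - m))). lra. }
  destruct (completeness (fun x => exists n, x = fst (corner n))) as [s [S1 S2]].
  { exists (fst (corner 0) + hn 0). intros x [n ->]. apply X1. }
  { exists (fst (corner 0)). now exists 0%nat. }
  destruct (completeness (fun x => exists n, x = snd (corner n))) as [t [T1 T2]].
  { exists (snd (corner 0) + kn 0). intros x [n ->]. apply X2. }
  { exists (snd (corner 0)). now exists 0%nat. }
  exists s, t. intros n. repeat split.
  - apply S1. now exists n.
  - apply S2. intros x [m ->]. apply X1.
  - apply T1. now exists n.
  - apply T2. intros x [m ->]. apply X2.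
Qed.

Lemma small_size eta : 0 < eta -> exists n, hn n < eta /\ kn n < eta.
Proof.
  intros He. destruct (nfloor_ex ((h + k) / eta)) as [n [_ Hn]].
  { apply Rmult_le_pos; [lra|]. apply Rlt_le, Rinv_0_lt_compat; lra. }
  exists n.
  assert (P : 0 < 2 ^ n) by (apply pow_lt; lra).
  assert (Q : INR n + 1 <= 2 ^ n).
  { clear. induction n; [simpl; lra|]. rewrite S_INR. simpl. assert (0 <= INR n) by apply pos_INR. lra. }
  assert (X : h + k < 2 ^ n * eta).
  { apply Rmult_lt_reg_r with (/ eta); [now apply Rinv_0_lt_compat|].
    replace (2 ^ n * eta * / eta) with (2 ^ n) by (field; lra). unfold Rdiv in Hn. lra. }
  unfold hn, kn. split; apply Rmult_lt_reg_r with (2 ^ n); auto; unfold Rdiv; rewrite Rmult_assoc, Rinv_l, Rmult_1_r; nra.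
Qed.

(** A failure would propagate to rectangles shrinking to a point, where [I_loc] contradicts it.
    Integrals do not enter: [I] is any additive function of rectangles that is small to second order
    at each point. *)
Lemma bisection_le : Cmod (I a0 (a0 + h) c0 (c0 + k)) <= eps * (h + k) ^ 2.
Proof.
  destruct (Rle_dec (Cmod (I a0 (a0 + h) c0 (c0 + k))) (eps * (h + k) ^ 2)) as [H|H]; [exact H|exfalso].
  assert (G : ~ good 0 (a0, c0)).
  { unfold good, hn, kn. simpl fst; simpl snd. simpl (2 ^ 0). rewrite !Rdiv_1_r. exact H. }
  destruct (corner_lim G) as [s [t Hst]].
  assert (HS := corner_spec G).
  destruct (I_loc s t) with eps as [eta [He Hl]]; auto.
  { destruct (Hst 0%nat) as [X _]. simpl in X. unfold hn in X. simpl in X. lra. }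
  { destruct (Hst 0%nat) as [_ X]. simpl in X. unfold kn in X. simpl in X. lra. }
  destruct (small_size eta He) as [n [N1 N2]]. destruct (HS n) as [[A B] Cn].
  apply Cn. unfold good. destruct (Hst n).
  eapply Rle_trans; [apply Hl; lra|]. right. f_equal. f_equal. ring.
Qed.
End Bisection.

Lemma rcont_mult f g s : rcont f s -> rcont g s -> rcont (fun r => f r * g r)%C s.
Proof. intros; apply tends_mult; auto; apply locally_filter. Qed.
Lemma rcont_plus f g s : rcont f s -> rcont g s -> rcont (fun r => f r + g r)%C s.
Proof. intros; apply tends_plus; auto; apply locally_filter. Qed.
Lemma rcont_const c s : rcont (fun _ => c) s.
Proof. apply tends_const, locally_filter. Qed.
Lemma rcont_inv (f : R -> C) s : f s <> 0 -> rcont f s -> rcont (fun r => / f r)%C s.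
Proof. intros H Hf. exact (tends_inv (locally s) f (f s) H Hf). Qed.
Lemma cder_rcont g l gam s : cder g (gam s) l -> rcont gam s -> rcont (fun r => g (gam r)) s.
Proof. intros H1 H2. unfold rcont. eapply tends_comp_at; [apply locally_filter|exact H2|]. eapply cder_cont, H1. Qed.
Lemma rcont_ext f g s : (forall r, f r = g r) -> rcont f s -> rcont g s.
Proof. intros E H. unfold rcont. rewrite <- E. revert H. apply tends_ext; [apply locally_filter|exact E]. Qed.

Lemma rlip gam gam' a b K : a <= b -> (forall s, a <= s <= b -> rder gam s (gam' s)) ->
  (forall s, a <= s <= b -> rcont gam' s) -> (forall s, a <= s <= b -> Cmod (gam' s) <= K) ->
  Cmod (gam b - gam a)%C <= (b - a) * K.
Proof.
  intros Hab H1 H2 H3. eapply isI_norm_const; [exact Hab|exact H3|].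
  apply isI_FTC; now rewrite Rmin_left, Rmax_right.
Qed.

(* Near a point of differentiability of [g], the form [g dw] is exact up to an error of second order. *)
Lemma edge g w0 g1 phi del eps' rho K gam gam' a b l : a <= b ->
  (forall w, g w = g w0 + (w - w0) * phi w)%C ->
  (forall w, Cmod (w - w0)%C < del -> Cmod (phi w - g1)%C <= eps') ->
  (forall s, a <= s <= b -> rder gam s (gam' s)) ->
  (forall s, a <= s <= b -> rcont gam' s) ->
  (forall s, a <= s <= b -> Cmod (gam s - w0)%C <= rho) -> rho < del ->
  (forall s, a <= s <= b -> Cmod (gam' s) <= K) ->
  isI (fun s => g (gam s) * gam' s)%C a b l ->
  let G := fun w => (g w0 * w + g1 / 2 * ((w - w0) * (w - w0)))%C in
  Cmod (l - (G (gam b) - G (gam a)))%C <= (b - a) * (eps' * rho * K).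
Proof.
  intros Hab Hg Hphi Hd Hc Hr Hrd HK Hl G.
  assert (HG : isI (fun s => (g w0 + g1 * (gam s - w0)) * gam' s)%C a b (G (gam b) - G (gam a))%C).
  { apply (isI_FTC (fun s => G (gam s))); rewrite Rmin_left, Rmax_right by exact Hab; intros s Hs.
    - assert (D : rder (fun s => gam s - w0)%C s (gam' s)).
      { apply (rder_eq _ _ (gam' s + 0)%C); [ring|]. apply rder_plus; [auto|]. apply rder_const. }
      assert (D' := rder_plus _ _ s _ _ (rder_mult _ _ s _ _ (rder_const (g w0) s) (Hd s Hs))
        (rder_mult _ _ s _ _ (rder_const (g1 / 2)%C s) (rder_mult _ _ s _ _ D D))).
      revert D'. apply rder_eq. cbv beta. field.
    - apply rcont_mult; [|auto]. apply rcont_plus; [apply rcont_const|]. apply rcont_mult; [apply rcont_const|].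
      apply rcont_plus; [eapply rder_cont; eauto|apply rcont_const]. }
  eapply isI_norm_const; [exact Hab| |exact (isI_minus _ _ _ _ _ _ Hl HG)].
  intros s Hs. cbv beta. rewrite (Hg (gam s)).
  replace ((g w0 + (gam s - w0) * phi (gam s)) * gam' s - (g w0 + g1 * (gam s - w0)) * gam' s)%C
    with ((phi (gam s) - g1) * (gam s - w0) * gam' s)%C by ring.
  rewrite !Cmod_mult. specialize (Hr s Hs). specialize (HK s Hs).
  repeat apply Rmult_le_compat; try apply Cmod_ge_0; auto.
  - apply Rmult_le_pos; apply Cmod_ge_0.
  - apply Hphi. lra.
Qed.

Section Goursat.
Variables Phi Phi1 Phi2 : R -> R -> C.
Variable g : C -> C.
Variables a0 c0 h k K : R.
Hypothesis Hh : 0 <= h.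
Hypothesis Hk : 0 <= k.
Hypothesis HK0 : 0 <= K.
Hypothesis D1 : forall s t, rder (fun s => Phi s t) s (Phi1 s t).
Hypothesis D2 : forall s t, rder (fun t => Phi s t) t (Phi2 s t).
Hypothesis C1 : forall s t, rcont (fun s => Phi1 s t) s.
Hypothesis C2 : forall s t, rcont (fun t => Phi2 s t) t.
Hypothesis K1 : forall s t, a0 <= s <= a0 + h -> c0 <= t <= c0 + k -> Cmod (Phi1 s t) <= K.
Hypothesis K2 : forall s t, a0 <= s <= a0 + h -> c0 <= t <= c0 + k -> Cmod (Phi2 s t) <= K.
Hypothesis Hg : forall s t, a0 <= s <= a0 + h -> c0 <= t <= c0 + k -> exists l, cder g (Phi s t) l.

Let w1 t s := (g (Phi s t) * Phi1 s t)%C.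
Let w2 s t := (g (Phi s t) * Phi2 s t)%C.

Lemma goursat_I1 a b t : a0 <= a <= b -> b <= a0 + h -> c0 <= t <= c0 + k -> isI (w1 t) a b (CI (w1 t) a b).
Proof.
  intros. apply CI_cont; [lra|]. intros s Hs. apply rcont_mult; [|apply C1].
  destruct (Hg s t) as [l Hl]; [lra|lra|]. apply (cder_rcont g l (fun s => Phi s t)); [exact Hl|].
  eapply rder_cont, D1.
Qed.

Lemma goursat_I2 s c d : a0 <= s <= a0 + h -> c0 <= c <= d -> d <= c0 + k -> isI (w2 s) c d (CI (w2 s) c d).
Proof.
  intros. apply CI_cont; [lra|]. intros t Ht. apply rcont_mult; [|apply C2].
  destruct (Hg s t) as [l Hl]; [lra|lra|]. apply (cder_rcont g l (fun t => Phi s t)); [exact Hl|].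
  eapply rder_cont, D2.
Qed.

Lemma Phi_lip s t s' t' : a0 <= s <= a0 + h -> c0 <= t <= c0 + k -> a0 <= s' <= a0 + h -> c0 <= t' <= c0 + k ->
  Cmod (Phi s' t' - Phi s t)%C <= (Rabs (s' - s) + Rabs (t' - t)) * K.
Proof.
  intros H1 H2 H3 H4.
  replace (Phi s' t' - Phi s t)%C with ((Phi s' t' - Phi s t') + (Phi s t' - Phi s t))%C by ring.
  eapply Rle_trans; [apply Cmod_triangle|]. rewrite Rmult_plus_distr_r. apply Rplus_le_compat.
  - destruct (Rle_dec s s') as [l|l].
    + rewrite Rabs_pos_eq by lra. apply (rlip (fun s => Phi s t') (fun s => Phi1 s t')); auto.
      intros; apply K1; lra.
    + rewrite Rabs_left1 by lra. rewrite Cmod_sub_sym. replace (- (s' - s)) with (s - s') by ring.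
      apply (rlip (fun s => Phi s t') (fun s => Phi1 s t')); auto; [lra|]. intros; apply K1; lra.
  - destruct (Rle_dec t t') as [l|l].
    + rewrite Rabs_pos_eq by lra. apply (rlip (fun t => Phi s t) (fun t => Phi2 s t)); auto.
      intros; apply K2; lra.
    + rewrite Rabs_left1 by lra. rewrite Cmod_sub_sym. replace (- (t' - t)) with (t - t') by ring.
      apply (rlip (fun t => Phi s t) (fun t => Phi2 s t)); auto; [lra|]. intros; apply K2; lra.
Qed.

(** Stated for the image of a rectangle under [Phi], so that it serves both for Cauchy's formula and
    for turning the path of the q-Laplace transform. Only the partial derivatives of [Phi] enter:
    they are continuous each in its own variable and bounded by [K], which makes [Phi] Lipschitz and
    the local error of second order. *)
Theorem goursat :
  (CI (w1 c0) a0 (a0 + h) + CI (w2 (a0 + h)) c0 (c0 + k) =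
   CI (w1 (c0 + k)) a0 (a0 + h) + CI (w2 a0) c0 (c0 + k))%C.
Proof.
  set (I := fun a b c d => (CI (w1 c) a b + CI (w2 b) c d - CI (w1 d) a b - CI (w2 a) c d)%C).
  assert (E : I a0 (a0 + h) c0 (c0 + k) = 0).
  2: { unfold I in E. match goal with |- ?x = ?y => assert (E' : (x - y)%C = 0) end.
    { rewrite <- E. ring. }
    match goal with |- ?x = ?y => replace x with (y + (x - y))%C by ring end. rewrite E'. ring. }
  apply Cmod_eq_0, Rle_antisym; [|apply Cmod_ge_0].
  apply le_epsilon. intros e He. rewrite Rplus_0_l.
  set (eps := e / ((h + k) ^ 2 + 1)).
  assert (Q : 0 <= (h + k) ^ 2) by (apply pow2_ge_0).
  assert (Heps : 0 < eps) by (apply Rdiv_lt_0_compat; lra).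
  apply Rle_trans with (eps * (h + k) ^ 2).
  2: { unfold eps. apply Rmult_le_reg_r with ((h + k) ^ 2 + 1); [lra|]. unfold Rdiv.
       replace (e * / ((h + k) ^ 2 + 1) * (h + k) ^ 2 * ((h + k) ^ 2 + 1)) with (e * (h + k) ^ 2) by (field; lra). nra. }
  assert (Ch1 : forall a m b t, a0 <= a <= m -> m <= b <= a0 + h -> c0 <= t <= c0 + k ->
    CI (w1 t) a b = (CI (w1 t) a m + CI (w1 t) m b)%C).
  { intros. apply CI_eq. apply (isI_Chasles _ a m b); apply goursat_I1; lra. }
  assert (Ch2 : forall s c m d, a0 <= s <= a0 + h -> c0 <= c <= m -> m <= d <= c0 + k ->
    CI (w2 s) c d = (CI (w2 s) c m + CI (w2 s) m d)%C).
  { intros. apply CI_eq. apply (isI_Chasles _ c m d); apply goursat_I2; lra. }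
  apply (bisection_le I a0 c0 h k Hh Hk); [| | |exact Heps].
  - intros a m b c d H1 H2 H3 H4. unfold I. rewrite (Ch1 a m b c), (Ch1 a m b d) by lra. ring.
  - intros a b c m d H1 H2 H3 H4. unfold I. rewrite (Ch2 a c m d), (Ch2 b c m d) by lra. ring.
  - intros s t Hs Ht e0 He0. destruct (Hg s t Hs Ht) as [g1 [phi [Hphi Tphi]]].
    (* The four edges together contribute at most [2 * sz * (eps' * rho * K)] with [rho = sz * K],
       that is [2 * K * K * eps'] times [sz ^ 2]. *)
    set (eps' := e0 / (2 * K * K + 1)).
    assert (HKK : 0 <= K * K) by nra.
    assert (He' : 0 < eps') by (apply Rdiv_lt_0_compat; lra).
    destruct (proj1 (locally_Cmod _ _) (Tphi eps' He')) as [del [Hdel Hphi']].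
    exists (del / (2 * K + 1)). split; [apply Rdiv_lt_0_compat; lra|].
    intros a b c d H1 H2 H3 H4 H5 H6.
    set (sz := (b - a) + (d - c)).
    set (rho := sz * K).
    assert (Hsz : 0 <= sz) by (unfold sz; lra).
    assert (Hrho : rho < del).
    { unfold rho. apply Rle_lt_trans with (2 * (del / (2 * K + 1)) * K).
      - apply Rmult_le_compat_r; [exact HK0|]. unfold sz. lra.
      - apply Rmult_lt_reg_r with (2 * K + 1); [lra|]. unfold Rdiv.
        replace (2 * (del * / (2 * K + 1)) * K * (2 * K + 1)) with (2 * K * del) by (field; lra). nra. }
    assert (Rr : forall s' t', a <= s' <= b -> c <= t' <= d -> Cmod (Phi s' t' - Phi s t)%C <= rho).
    { intros s' t' Hs' Ht'. eapply Rle_trans; [apply Phi_lip; lra|]. apply Rmult_le_compat_r; [exact HK0|].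
      unfold sz. apply Rplus_le_compat; apply Rabs_le; lra. }
    assert (Hp : forall w, Cmod (w - Phi s t)%C < del -> Cmod (phi w - g1)%C <= eps') by (intros w Hw; apply Rlt_le; auto).
    (* A primitive of the affine approximation of [g] at [Phi s t]. Its increments cancel around the
       rectangle, which leaves the four errors given by [edge]. *)
    set (G := fun w => (g (Phi s t) * w + g1 / 2 * ((w - Phi s t) * (w - Phi s t)))%C).
    assert (E1 : forall t', c <= t' <= d -> Cmod (CI (w1 t') a b - (G (Phi b t') - G (Phi a t')))%C <= (b - a) * (eps' * rho * K)).
    { intros t' Ht'. apply (edge g (Phi s t) g1 phi del eps' rho K (fun s => Phi s t') (fun s => Phi1 s t')); auto; [lra| |].
      - intros; apply K1; lra.
      - apply goursat_I1; lra. }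
    assert (E2 : forall s', a <= s' <= b -> Cmod (CI (w2 s') c d - (G (Phi s' d) - G (Phi s' c)))%C <= (d - c) * (eps' * rho * K)).
    { intros s' Hs'. apply (edge g (Phi s t) g1 phi del eps' rho K (fun t => Phi s' t) (fun t => Phi2 s' t)); auto; [lra| |].
      - intros; apply K2; lra.
      - apply goursat_I2; lra. }
    replace (I a b c d) with
      ((CI (w1 c) a b - (G (Phi b c) - G (Phi a c))) + (CI (w2 b) c d - (G (Phi b d) - G (Phi b c)))
       - (CI (w1 d) a b - (G (Phi b d) - G (Phi a d))) - (CI (w2 a) c d - (G (Phi a d) - G (Phi a c))))%C
      by (unfold I; ring).
    assert (A1 := E1 c ltac:(lra)). assert (A2 := E1 d ltac:(lra)).
    assert (A3 := E2 a ltac:(lra)). assert (A4 := E2 b ltac:(lra)).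
    eapply Rle_trans; [apply Cmod_sub_le|].
    eapply Rle_trans; [apply Rplus_le_compat_r, Cmod_sub_le|].
    eapply Rle_trans; [apply Rplus_le_compat_r, Rplus_le_compat_r, Cmod_triangle|].
    apply Rle_trans with (2 * sz * (eps' * rho * K)); [unfold sz at 1; lra|].
    replace (2 * sz * (eps' * rho * K)) with (2 * K * K * eps' * sz ^ 2) by (unfold rho; ring).
    apply Rmult_le_compat_r; [apply pow2_ge_0|].
    unfold eps'. apply Rmult_le_reg_r with (2 * K * K + 1); [lra|]. unfold Rdiv.
    replace (2 * K * K * (e0 * / (2 * K * K + 1)) * (2 * K * K + 1)) with (2 * K * K * e0) by (field; lra). nra.
Qed.
End Goursat.

(** ** Exponentials *)

Lemma Cexp_plus u v : Cexp (u + v)%C = (Cexp u * Cexp v)%C.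
Proof.
  unfold Cexp, Re, Im, Cplus, Cmult, RtoC. cbn [fst snd].
  rewrite exp_plus, cos_plus, sin_plus. apply injective_projections; cbn [fst snd]; ring.
Qed.

Lemma Cexp_0 : Cexp 0 = 1%C.
Proof. unfold Cexp, Re, Im. simpl. rewrite exp_0, cos_0, sin_0. unfold Cmult, RtoC; simpl. f_equal; ring. Qed.

Lemma Cmod_Cexp u : Cmod (Cexp u) = exp (Re u).
Proof.
  unfold Cexp. rewrite Cmod_mult, Cmod_R, Rabs_pos_eq by apply Rlt_le, exp_pos.
  replace (Cmod (cos (Im u), sin (Im u))) with 1; [ring|].
  unfold Cmod; cbn [fst snd]. symmetry. rewrite <- sqrt_1. f_equal.
  generalize (sin2_cos2 (Im u)). unfold Rsqr. lra.
Qed.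

Lemma Cexp_neq_0 u : Cexp u <> 0.
Proof. apply Cmod_gt_0. rewrite Cmod_Cexp. apply exp_pos. Qed.

Lemma rder_pair (F : R -> C) s a b : is_derive (fun r => Re (F r)) s a -> is_derive (fun r => Im (F r)) s b ->
  rder F s (a, b).
Proof.
  intros H1 H2.
  exists (fun r => if Req_EM_T r s then (a, b) else ((F r - F s) / RtoC (r - s))%C).
  assert (N : forall r, r <> s -> RtoC (r - s) <> 0).
  { intros r Hr E. apply (f_equal Re) in E. simpl in E. lra. }
  split.
  - intros r. destruct (Req_EM_T r s) as [->|Hr]; [replace (s - s) with 0 by ring; ring|].
    field. auto.
  - intros e He. destruct H1 as [_ H1], H2 as [_ H2].
    specialize (H1 s (fun P HP => HP)). specialize (H2 s (fun P HP => HP)).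
    assert (He3 : 0 < e / 3) by lra.
    generalize (filter_and _ _ (H1 (mkposreal _ He3)) (H2 (mkposreal _ He3))). apply filter_imp.
    intros r [A B].
    change (Rabs (Re (F r) - Re (F s) - (r - s) * a) <= e / 3 * Rabs (r - s)) in A.
    change (Rabs (Im (F r) - Im (F s) - (r - s) * b) <= e / 3 * Rabs (r - s)) in B.
    destruct (Req_EM_T r s) as [->|Hr].
    + replace ((a, b) - (a, b))%C with (RtoC 0) by ring. rewrite Cmod_0. lra.
    + replace ((F r - F s) / RtoC (r - s) - (a, b))%C with ((F r - F s - RtoC (r - s) * (a, b)) / RtoC (r - s))%C by (field; auto).
      rewrite Cmod_div by auto. rewrite Cmod_R.
      assert (P : 0 < Rabs (r - s)) by (apply Rabs_pos_lt; lra).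
      apply Rmult_lt_reg_r with (Rabs (r - s)); [exact P|]. unfold Rdiv. rewrite Rmult_assoc, Rinv_l, Rmult_1_r by lra.
      set (Z := (F r - F s - RtoC (r - s) * (a, b))%C).
      replace Z with (RtoC (Re Z) + Ci * RtoC (Im Z))%C
        by (destruct Z; unfold Re, Im, Ci, RtoC, Cplus, Cmult; simpl; f_equal; ring).
      eapply Rle_lt_trans; [apply Cmod_triangle|]. rewrite Cmod_mult, Cmod_Ci, !Cmod_R.
      replace (Re Z) with (Re (F r) - Re (F s) - (r - s) * a) by (unfold Z, Re; simpl; ring).
      replace (Im Z) with (Im (F r) - Im (F s) - (r - s) * b) by (unfold Z, Im; simpl; ring).
      nra.
Qed.

Lemma rder_Cexp (c : C) s : rder (fun r => Cexp (RtoC r * c)) s (c * Cexp (RtoC s * c))%C.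
Proof.
  replace (c * Cexp (RtoC s * c))%C with (Re (c * Cexp (RtoC s * c))%C, Im (c * Cexp (RtoC s * c))%C)
    by (now destruct (c * Cexp (RtoC s * c))%C).
  apply rder_pair.
  - apply (is_derive_ext (fun r => exp (r * Re c) * cos (r * Im c))).
    + intros r. unfold Cexp, Re, Im. simpl. unfold Re, Im. 
      replace (r * fst c - 0 * snd c) with (r * fst c) by ring.
      replace (r * snd c + 0 * fst c) with (r * snd c) by ring. ring.
    + auto_derive; [easy|]. unfold Cexp, Re, Im. simpl. unfold Re, Im. simpl.
      replace (s * fst c - 0 * snd c) with (s * fst c) by ring.
      replace (s * snd c + 0 * fst c) with (s * snd c) by ring. ring.
  - apply (is_derive_ext (fun r => exp (r * Re c) * sin (r * Im c))).
    + intros r. unfold Cexp, Re, Im. simpl. unfold Re, Im. 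
      replace (r * fst c - 0 * snd c) with (r * fst c) by ring.
      replace (r * snd c + 0 * fst c) with (r * snd c) by ring. ring.
    + auto_derive; [easy|]. unfold Cexp, Re, Im. simpl. unfold Re, Im. simpl.
      replace (s * fst c - 0 * snd c) with (s * fst c) by ring.
      replace (s * snd c + 0 * fst c) with (s * snd c) by ring. ring.
Qed.

Definition cis (t : R) : C := Cexp (RtoC t * Ci).

Lemma cis_mod t : Cmod (cis t) = 1.
Proof. unfold cis. rewrite Cmod_Cexp. unfold Re. simpl. replace (t * 0 - 0 * 1) with 0 by ring. apply exp_0. Qed.

Lemma cis_neq_0 t : cis t <> 0.
Proof. apply Cexp_neq_0. Qed.

Lemma cis_2PI : cis (2 * PI) = cis 0.
Proof.
  unfold cis, Cexp, Re, Im. simpl.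
  replace (2 * PI * 0 - 0 * 1) with 0 by ring. replace (2 * PI * 1 + 0 * 0) with (2 * PI) by ring.
  replace (0 * 0 - 0 * 1) with 0 by ring. replace (0 * 1 + 0 * 0) with 0 by ring.
  now rewrite cos_2PI, sin_2PI, cos_0, sin_0.
Qed.

Lemma rder_cis t : rder cis t (Ci * cis t)%C.
Proof. apply rder_Cexp. Qed.

Lemma rcont_cis t : rcont cis t.
Proof. eapply rder_cont, rder_cis. Qed.

(** ** Cauchy's formula and Taylor expansions *)

Lemma isI_CI_ext f g a b l : (forall s, f s = g s) -> isI f a b l -> CI g a b = l.
Proof. intros E H. apply CI_eq. revert H. apply isI_ext. auto. Qed.

Lemma CI_ext f g a b : (forall s, f s = g s) -> (exists l, isI f a b l) -> CI f a b = CI g a b.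
Proof. intros E [l H]. rewrite (CI_eq _ _ _ _ H). symmetry. now apply (isI_CI_ext f). Qed.

(** On a circle w = r cis t around 0 one has dw / w = i dt, so the Cauchy integral of f(w) / (w - z)
    is the mean over the angle of f(w) w / (w - z). *)
Definition avg (F : R -> C) : C := (/ RtoC (2 * PI) * CI F 0 (2 * PI))%C.

Lemma twoPI_pos : 0 < 2 * PI.
Proof. generalize PI_RGT_0. lra. Qed.

Lemma twoPI_neq : RtoC (2 * PI) <> 0.
Proof. intros E. apply (f_equal Re) in E. simpl in E. generalize twoPI_pos. lra. Qed.

Lemma avg_norm F B : (forall t, rcont F t) -> (forall t, Cmod (F t) <= B) -> Cmod (avg F) <= B.
Proof.
  intros HF HB. unfold avg. assert (P := twoPI_pos).
  rewrite Cmod_mult, Cmod_inv, Cmod_RtoC_pos by (try apply twoPI_neq; lra).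
  assert (Cmod (CI F 0 (2 * PI)) <= (2 * PI - 0) * B).
  { eapply isI_norm_const; [lra|intros; apply HB|]. apply CI_cont; [lra|auto]. }
  apply Rmult_le_reg_l with (2 * PI); [lra|]. rewrite <- Rmult_assoc, Rinv_r by lra. lra.
Qed.

Lemma avg_plus F G : (forall t, rcont F t) -> (forall t, rcont G t) -> avg (fun t => F t + G t)%C = (avg F + avg G)%C.
Proof.
  intros HF HG. unfold avg. assert (P := twoPI_pos).
  rewrite (CI_eq _ _ _ _ (isI_plus _ _ _ _ _ _ (CI_cont F 0 (2 * PI) ltac:(lra) ltac:(auto)) (CI_cont G 0 (2 * PI) ltac:(lra) ltac:(auto)))). ring.
Qed.

Lemma avg_scal c F : (forall t, rcont F t) -> avg (fun t => c * F t)%C = (c * avg F)%C.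
Proof.
  intros HF. unfold avg. assert (P := twoPI_pos).
  rewrite (CI_eq _ _ _ _ (isI_scal c _ _ _ _ (CI_cont F 0 (2 * PI) ltac:(lra) ltac:(auto)))). ring.
Qed.

Lemma avg_ext F G : (forall t, rcont F t) -> (forall t, F t = G t) -> avg F = avg G.
Proof.
  intros HF E. unfold avg. f_equal. apply CI_ext; [exact E|]. eexists. apply CI_cont; [apply Rlt_le, twoPI_pos|auto].
Qed.

Lemma avg_const c : avg (fun _ => c) = c.
Proof.
  unfold avg. rewrite (CI_eq _ _ _ _ (isI_const 0 (2 * PI) c)). rewrite Rminus_0_r. field. apply twoPI_neq.
Qed.

Lemma RtoC_neq_0 x : x <> 0 -> RtoC x <> 0.
Proof. intros H E. apply H. apply (f_equal Re) in E. exact E. Qed.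

(** The circle of radius [r] around 0 is moved linearly to the circle of radius [e] around [z]. The
    point [z] is avoided because (1 - s) r + s e > (1 - s) |z|. The sides at the angles 0 and 2 pi
    coincide, so their contributions to [goursat] are equal. *)
Lemma cauchy_homotopy f r e (z : C) : 0 < r -> 0 < e -> Cmod z + e <= r ->
  (forall w, Cmod w <= r -> exists l, cder f w l) ->
  CI (fun t => f (RtoC e * cis t + z)%C * Ci)%C 0 (2 * PI) =
  CI (fun t => f (RtoC r * cis t)%C * (RtoC r * cis t / (RtoC r * cis t - z)) * Ci)%C 0 (2 * PI).
Proof.
  intros Hr He Hz Hf. assert (Pz := Cmod_ge_0 z). assert (P := twoPI_pos).
  set (Phi := fun s t => (RtoC ((1 - s) * r + s * e) * cis t + RtoC s * z)%C).
  set (Phi1 := fun (s : R) t => (RtoC (e - r) * cis t + z)%C).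
  set (Phi2 := fun s t => (RtoC ((1 - s) * r + s * e) * (Ci * cis t))%C).
  set (g := fun w => (f w / (w - z))%C).
  assert (Q : forall s t, 0 <= s <= 1 -> 0 < Cmod (Phi s t - z)%C).
  { intros s t Hs. eapply Rlt_le_trans; [|apply (Cmod_triangle_inv (RtoC ((1 - s) * r + s * e) * cis t)%C (RtoC (1 - s) * z)%C)] || idtac.
    apply Rlt_le_trans with (Cmod (RtoC ((1 - s) * r + s * e) * cis t)%C - Cmod (RtoC (1 - s) * z)%C).
    - rewrite !Cmod_mult, cis_mod, !Cmod_RtoC_pos by nra. nra.
    - eapply Rle_trans; [apply Cmod_triangle_inv|]. right. f_equal. unfold Phi. rewrite RtoC_minus. ring. }
  assert (G := goursat Phi Phi1 Phi2 g 0 0 1 (2 * PI) (2 * r)).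
  cbv beta in G. rewrite !Rplus_0_l in G.
  assert (R1 : forall s, rder (fun s => RtoC ((1 - s) * r + s * e)) s (RtoC (e - r))).
  { intros s. apply (rder_ext (fun s => RtoC r + RtoC s * RtoC (e - r))%C).
    - intros u. rewrite <- RtoC_mult, <- RtoC_plus. f_equal. ring.
    - apply (rder_eq _ _ (0 + (1 * RtoC (e - r) + RtoC s * 0))%C); [ring|].
      apply rder_plus; [apply rder_const|]. apply (rder_mult RtoC (fun _ => RtoC (e - r))); [apply rder_id|apply rder_const]. }
  assert (X : (CI (fun s => g (Phi s 0%R) * Phi1 s 0%R)%C 0 1 + CI (fun t => g (Phi 1%R t) * Phi2 1%R t)%C 0 (2 * PI) =
       CI (fun s => g (Phi s (2 * PI)%R) * Phi1 s (2 * PI)%R)%C 0 1 + CI (fun t => g (Phi 0%R t) * Phi2 0%R t)%C 0 (2 * PI))%C).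
  { apply G; clear G; try lra.
    - intros s t. unfold Phi, Phi1.
      apply (rder_eq _ _ ((RtoC (e - r) * cis t + RtoC ((1 - s) * r + s * e) * 0) + (1 * z + RtoC s * 0))%C); [ring|].
      apply rder_plus.
      + apply (rder_mult (fun s => RtoC ((1 - s) * r + s * e)) (fun _ => cis t)); [apply R1|apply rder_const].
      + apply (rder_mult RtoC (fun _ => z)); [apply rder_id|apply rder_const].
    - intros s t. unfold Phi, Phi2.
      apply (rder_eq _ _ ((0 * cis t + RtoC ((1 - s) * r + s * e) * (Ci * cis t)) + 0)%C); [ring|].
      apply rder_plus; [|apply rder_const].
      apply (rder_mult (fun _ => _)); [apply rder_const|apply rder_cis].
    - intros s t. unfold Phi1. apply rcont_const.
    - intros s t. apply rcont_mult; [apply rcont_const|]. apply rcont_mult; [apply rcont_const|apply rcont_cis].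
    - intros s t _ _. unfold Phi1. eapply Rle_trans; [apply Cmod_triangle|].
      rewrite Cmod_mult, cis_mod, Cmod_R, Rabs_left1 by lra. lra.
    - intros s t Hs _. unfold Phi2. rewrite !Cmod_mult, cis_mod, Cmod_Ci, Cmod_RtoC_pos by nra. nra.
    - intros s t Hs _. destruct (Hf (Phi s t)) as [l Hl].
      + unfold Phi. eapply Rle_trans; [apply Cmod_triangle|]. rewrite !Cmod_mult, cis_mod, !Cmod_RtoC_pos by nra. nra.
      + eexists. unfold g. apply cder_mult; [exact Hl|].
        apply (cder_comp Cinv (fun w => w - z)%C); [apply cder_plus; [apply cder_id|apply cder_const]|].
        apply cder_inv. apply Cmod_gt_0. apply Q. lra. }
  assert (Y : CI (fun s => g (Phi s 0%R) * Phi1 s 0%R)%C 0 1 = CI (fun s => g (Phi s (2 * PI)%R) * Phi1 s (2 * PI)%R)%C 0 1).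
  { unfold CI. apply (RInt_ext (V := C_R_CompleteNormedModule)). intros s _. unfold Phi, Phi1. now rewrite cis_2PI. }
  rewrite Y in X.
  assert (X' : CI (fun t => g (Phi 1%R t) * Phi2 1%R t)%C 0 (2 * PI) = CI (fun t => g (Phi 0%R t) * Phi2 0%R t)%C 0 (2 * PI)).
  { match type of X with (?A + ?B = ?A + ?D)%C => replace B with (A + B - A)%C by ring; rewrite X; ring end. }
  transitivity (CI (fun t => g (Phi 1%R t) * Phi2 1%R t)%C 0 (2 * PI)); [|rewrite X'];
    unfold CI; apply (RInt_ext (V := C_R_CompleteNormedModule)); intros t _; unfold g, Phi, Phi2.
  - replace ((1 - 1) * r + 1 * e) with e by ring. replace (RtoC 1 * z)%C with z by ring.
    match goal with |- ?x = ?y => change (@eq C x y) end. 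
    replace (RtoC e * cis t + z - z)%C with (RtoC e * cis t)%C by ring.
    assert (E1 := cis_neq_0 t). assert (E2 := RtoC_neq_0 e ltac:(lra)). field. auto.
  - assert (Q0 := Q 0 t ltac:(lra)). unfold Phi in Q0.
    replace ((1 - 0) * r + 0 * e) with r in * by ring. 
    replace (RtoC r * cis t + RtoC 0 * z)%C with (RtoC r * cis t)%C in * by ring.
    match goal with |- ?x = ?y => change (@eq C x y) end. field. now apply Cmod_gt_0.
Qed.

(** By [cauchy_homotopy] the mean on the large circle equals the mean of [f] over arbitrarily small
    circles around [z], which tends to [f z] by continuity. *)
Lemma cauchy_formula f r (z : C) : 0 < r -> Cmod z < r ->
  (forall w, Cmod w <= r -> exists l, cder f w l) ->
  f z = avg (fun t => f (RtoC r * cis t)%C * (RtoC r * cis t / (RtoC r * cis t - z)))%C.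
Proof.
  intros Hr Hz Hf. assert (P := twoPI_pos).
  destruct (Hf z) as [l Hl]; [lra|]. apply cder_cont in Hl.
  set (A := avg _).
  assert (E : (f z - A)%C = 0).
  2: { replace (f z) with (f z - A + A)%C by ring. rewrite E. ring. }
  apply Cmod_eq_0, Rle_antisym; [|apply Cmod_ge_0]. apply le_epsilon. intros eta Heta. rewrite Rplus_0_l.
  destruct (proj1 (locally_Cmod _ _) (Hl eta Heta)) as [d [Hd Hc]].
  set (e := Rmin (d / 2) (r - Cmod z)).
  assert (He : 0 < e) by (apply Rmin_glb_lt; lra).
  assert (He1 : e <= d / 2) by apply Rmin_l. assert (He2 : e <= r - Cmod z) by apply Rmin_r.
  assert (Ce : forall t, Cmod (RtoC e * cis t)%C = e) by (intros t; rewrite Cmod_mult, cis_mod, Cmod_RtoC_pos by lra; ring).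
  assert (Cr : forall t, Cmod (RtoC r * cis t)%C = r) by (intros t; rewrite Cmod_mult, cis_mod, Cmod_RtoC_pos by lra; ring).
  assert (N : forall t, (RtoC r * cis t - z)%C <> 0).
  { intros t. apply Cmod_gt_0. eapply Rlt_le_trans; [|apply Cmod_triangle_inv]. rewrite Cr. lra. }
  assert (Ccis : forall c t, rcont (fun t => RtoC c * cis t)%C t).
  { intros c t. apply rcont_mult; [apply rcont_const|apply rcont_cis]. }
  assert (F1 : forall t, rcont (fun t => f (RtoC e * cis t + z)%C) t).
  { intros t. destruct (Hf (RtoC e * cis t + z)%C) as [l' Hl'].
    - eapply Rle_trans; [apply Cmod_triangle|]. rewrite Ce. lra.
    - apply (cder_rcont f l' (fun t => RtoC e * cis t + z)%C); [exact Hl'|]. apply rcont_plus; [apply Ccis|apply rcont_const]. }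
  assert (F2 : forall t, rcont (fun t => f (RtoC r * cis t)%C * (RtoC r * cis t / (RtoC r * cis t - z)))%C t).
  { intros t. destruct (Hf (RtoC r * cis t)%C) as [l' Hl']; [rewrite Cr; lra|]. apply rcont_mult.
    - apply (cder_rcont f l' (fun t => RtoC r * cis t)%C); [exact Hl'|]. apply Ccis.
    - apply rcont_mult; [apply Ccis|]. apply rcont_inv; [apply N|]. apply rcont_plus; [apply Ccis|apply rcont_const]. }
  assert (H := cauchy_homotopy f r e z Hr He ltac:(lra) Hf).
  assert (X : avg (fun t => f (RtoC e * cis t + z)%C) = A).
  { assert (Y : avg (fun t => Ci * f (RtoC e * cis t + z)%C)%C = avg (fun t => Ci * (f (RtoC r * cis t)%C * (RtoC r * cis t / (RtoC r * cis t - z))))%C).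
    { unfold avg. f_equal. etransitivity; [|etransitivity; [exact H|]]; unfold CI; apply (RInt_ext (V := C_R_CompleteNormedModule)); intros t _;
      match goal with |- ?x = ?y => change (@eq C x y) end; ring. }
    rewrite !avg_scal in Y by auto. fold A in Y.
    apply (f_equal (fun x => - Ci * x)%C) in Y.
    assert (CC : (Ci * Ci = - (1))%C) by (unfold Ci, Cmult, Copp, RtoC; simpl; f_equal; ring).
    match type of Y with (- Ci * (Ci * ?a) = - Ci * (Ci * ?b))%C =>
      replace (- Ci * (Ci * a))%C with (- (Ci * Ci) * a)%C in Y by ring;
      replace (- Ci * (Ci * b))%C with (- (Ci * Ci) * b)%C in Y by ring end.
    rewrite CC in Y. match type of Y with (_ * ?a = _ * ?b)%C => replace a with (- - (1) * a)%C by ring; rewrite Y; ring end. }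
  rewrite <- X. rewrite Cmod_sub_sym.
  assert (Z : (avg (fun t => f (RtoC e * cis t + z)%C) - f z)%C = avg (fun t => f (RtoC e * cis t + z)%C + - f z)%C).
  { rewrite avg_plus by (auto; intros; apply rcont_const). now rewrite avg_const. }
  rewrite Z. apply avg_norm.
  - intros t. apply rcont_plus; [apply F1|apply rcont_const].
  - intros t. apply Rlt_le. apply Hc. replace (RtoC e * cis t + z - z)%C with (RtoC e * cis t)%C by ring. rewrite Ce. lra.
Qed.

Lemma Cpow_neq_0 (z : C) n : z <> 0 -> (z ^ n)%C <> 0.
Proof. intros H. induction n; simpl; [apply C1_nz|now apply Cmult_neq_0]. Qed.

Lemma rcont_pow f t n : rcont f t -> rcont (fun t => f t ^ n)%C t.
Proof. intros; unfold rcont; apply (tends_pow (locally t) f (f t) n H). Qed.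

(** Riemann's removable singularity theorem and Taylor's formula at once. The function z^2 f(z) is
    differentiable at 0 as well, so Cauchy's formula applies to it on the circle of radius [R0 / 2];
    its first two coefficients vanish, and a shift by two gives those of [f]. No value at 0 is
    needed, and the remainder estimate holds on the whole punctured disc. *)
Lemma taylor_punctured f R0 B : 0 < R0 -> hol (Cpdisc R0) f -> (forall z, Cpdisc R0 z -> Cmod (f z) <= B) ->
  exists a : nat -> C, (forall n, Cmod (a n) <= B * (2 / R0) ^ n) /\
    forall N z, Cpdisc R0 z -> Cmod (f z - psum (fun n => a n * z ^ n) N)%C <= 3 * B * (4 * Cmod z / R0) ^ N.
Proof.
  intros HR Hf HB. set (r := R0 / 2). assert (Hr : 0 < r) by (unfold r; lra).
  assert (HB0 : 0 <= B).
  { eapply Rle_trans; [apply Cmod_ge_0|apply (HB (RtoC r))]. split; [apply RtoC_neq_0; lra|].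
    rewrite Cmod_RtoC_pos; unfold r; lra. }
  set (w := fun t => (RtoC r * cis t)%C).
  assert (Cw : forall t, Cmod (w t) = r) by (intros t; unfold w; rewrite Cmod_mult, cis_mod, Cmod_RtoC_pos by lra; ring).
  assert (Nw : forall t, w t <> 0) by (intros t; apply Cmod_gt_0; rewrite Cw; lra).
  assert (Dw : forall t, Cpdisc R0 (w t)) by (intros t; split; [auto|rewrite Cw; unfold r; lra]).
  assert (Kw : forall t, rcont w t) by (intros t; apply rcont_mult; [apply rcont_const|apply rcont_cis]).
  assert (Kf : forall t, rcont (fun t => f (w t)) t).
  { intros t. destruct (Hf (w t) (Dw t)) as [l Hl]. apply (cder_rcont f l w); auto. }
  (* [c M] is the Taylor coefficient of order [M] of z^2 f(z), and [TT M z] is the remainder divided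
     by z^M: [RT] below peels off one coefficient at a time. *)
  set (c := fun M => avg (fun t => w t ^ 2 * f (w t) / w t ^ M)%C).
  set (Tt := fun M z t => (w t ^ 2 * f (w t) / w t ^ M * (w t / (w t - z)))%C).
  set (TT := fun M z => avg (Tt M z)).
  assert (Kc : forall M t, rcont (fun t => w t ^ 2 * f (w t) / w t ^ M)%C t).
  { intros M t. apply rcont_mult.
    - apply rcont_mult; [now apply rcont_pow|apply Kf].
    - apply rcont_inv; [apply Cpow_neq_0, Nw|now apply rcont_pow]. }
  assert (Mc : forall M t, Cmod (w t ^ 2 * f (w t) / w t ^ M)%C <= r ^ 2 * B * / r ^ M).
  { intros M t. unfold Cdiv. rewrite !Cmod_mult, Cmod_inv, !Cmod_pow, !Cw by apply Cpow_neq_0, Nw.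
    apply Rmult_le_compat_r; [apply Rlt_le, Rinv_0_lt_compat, pow_lt; lra|].
    apply Rmult_le_compat_l; [apply pow_le; lra|]. apply HB, Dw. }
  assert (Nz : forall z t, Cmod z < r -> (w t - z)%C <> 0).
  { intros z t Hz. apply Cmod_gt_0. eapply Rlt_le_trans; [|apply Cmod_triangle_inv]. rewrite Cw. lra. }
  assert (KT : forall M z t, Cmod z < r -> rcont (Tt M z) t).
  { intros M z t Hz. apply rcont_mult; [apply Kc|]. apply rcont_mult; [apply Kw|].
    apply rcont_inv; [now apply Nz|]. apply rcont_plus; [apply Kw|apply rcont_const]. }
  assert (BT : forall M z, Cmod z <= r / 2 -> Cmod (TT M z) <= 2 * (r ^ 2 * B * / r ^ M)).
  { intros M z Hz. apply avg_norm; [intros; apply KT; lra|]. intros t. unfold Tt. rewrite Cmod_mult, Rmult_comm.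
    apply Rmult_le_compat; try apply Cmod_ge_0; [|apply Mc].
    rewrite Cmod_div, Cw by (apply Nz; lra).
    assert (r / 2 <= Cmod (w t - z)%C).
    { eapply Rle_trans; [|apply Cmod_triangle_inv]. rewrite Cw. lra. }
    apply Rmult_le_reg_r with (Cmod (w t - z)%C); [lra|]. unfold Rdiv. rewrite Rmult_assoc, Rinv_l by lra. lra. }
  assert (RT : forall M z, Cmod z < r -> TT M z = (c M + z * TT (S M) z)%C).
  { intros M z Hz. unfold TT, c. rewrite <- avg_scal by (intros; now apply KT).
    rewrite <- avg_plus; [|apply Kc|intros; apply rcont_mult; [apply rcont_const|now apply KT]].
    apply avg_ext; [intros; now apply KT|]. intros t. unfold Tt. simpl. field. repeat split; auto using Cpow_neq_0. }
  assert (T0 : forall z, Cmod z < r -> (z ^ 2 * f z)%C = TT 0%nat z).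
  { intros z Hz. assert (H := cauchy_formula (fun z => z ^ 2 * f z)%C r z Hr Hz).
    cbv beta in H. rewrite H.
    - apply avg_ext.
      + intros t. apply rcont_ext with (Tt 0%nat z); [|now apply KT]. intros u. unfold Tt. simpl. fold (w u). field. split; [now apply Nz|apply C1_nz] || (now apply Nz).
      + intros u. unfold Tt. simpl. fold (w u). field. now apply Nz.
    (* At 0 the difference quotient of z^2 f(z) is z f(z), which is at most B |z|: the derivative is
       0. *)
    - intros u Hu. destruct (Ceq_dec u 0) as [->|Nu].
      + exists 0. exists (fun v => v * f v)%C. split; [intros; simpl; ring|].
        apply (tends_squeeze (locally (RtoC 0))) with (g := fun v => B * Cmod v).
        * apply locally_Cmod. exists R0. split; [exact HR|]. intros v Hv.
          replace (v - 0)%C with v in Hv by ring. replace (v * f v - 0)%C with (v * f v)%C by ring.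
          rewrite Cmod_mult, Rmult_comm. destruct (Ceq_dec v 0) as [->|Nv]; [rewrite Cmod_0; lra|].
          apply Rmult_le_compat_r; [apply Cmod_ge_0|]. apply HB. now split.
        * intros e He. apply locally_Cmod. exists (e / (B + 1)). split; [apply Rdiv_lt_0_compat; lra|].
          intros v Hv. replace (v - 0)%C with v in Hv by ring.
          apply Rmult_lt_compat_r with (r := B + 1) in Hv; [|lra]. unfold Rdiv in Hv. rewrite Rmult_assoc, Rinv_l in Hv by lra.
          assert (Pv := Cmod_ge_0 v). nra.
      + destruct (Hf u) as [l Hl]; [split; [exact Nu|unfold r in Hu; lra]|].
        destruct (hol_pow (fun _ => True) _ 2 (hol_id _) u I) as [l2 Hl2].
        eexists. apply cder_mult; [exact Hl2|exact Hl]. }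
  assert (Small : forall (x : C) (K : R), 0 <= K -> (forall e, 0 < e <= r / 2 -> e < 1 -> Cmod x <= K * e) -> x = 0).
  { intros x K HK H. apply Cmod_eq_0, Rle_antisym; [|apply Cmod_ge_0]. apply le_epsilon. intros eta Heta. rewrite Rplus_0_l.
    set (e := Rmin (Rmin (r / 2) (1 / 2)) (eta / (K + 1))).
    assert (He : 0 < e) by (repeat apply Rmin_glb_lt; try lra; apply Rdiv_lt_0_compat; lra).
    assert (e <= Rmin (r / 2) (1 / 2)) by apply Rmin_l. assert (Rmin (r / 2) (1 / 2) <= r / 2) by apply Rmin_l.
    assert (Rmin (r / 2) (1 / 2) <= 1 / 2) by apply Rmin_r.
    assert (Q : e <= eta / (K + 1)) by apply Rmin_r.
    apply Rmult_le_compat_r with (r := K + 1) in Q; [|lra]. unfold Rdiv in Q. rewrite Rmult_assoc, Rinv_l in Q by lra.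
    eapply Rle_trans; [apply (H e); lra|]. nra. }
  assert (Pr : forall M, 0 <= r ^ 2 * B * / r ^ M).
  { intros M. apply Rmult_le_pos; [apply Rmult_le_pos; [apply pow_le; lra|lra]|]. apply Rlt_le, Rinv_0_lt_compat, pow_lt; lra. }
  (* Let z tend to 0 in z^2 f(z) = c_0 + z TT_1(z), with f and TT_1 bounded. After division by z the
     same argument gives c_1 = 0. *)
  assert (c0 : c 0%nat = 0).
  { apply Small with (B + 2 * (r ^ 2 * B * / r ^ 1)); [specialize (Pr 1%nat); lra|]. intros e He1 He2.
    assert (Me : Cmod (RtoC e) = e) by (apply Cmod_RtoC_pos; lra).
    replace (c 0%nat) with (RtoC e ^ 2 * f (RtoC e) - RtoC e * TT 1%nat (RtoC e))%C
      by (rewrite T0, (RT 0%nat) by (rewrite Me; lra); ring).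
    eapply Rle_trans; [apply Cmod_sub_le|]. rewrite !Cmod_mult, Cmod_pow, Me.
    assert (X1 : Cmod (f (RtoC e)) <= B) by (apply HB; split; [apply RtoC_neq_0; lra|rewrite Me; unfold r in He1; lra]).
    assert (X2 := BT 1%nat (RtoC e) ltac:(rewrite Me; lra)).
    assert (X3 := Cmod_ge_0 (f (RtoC e))).
    rewrite Rmult_plus_distr_r. apply Rplus_le_compat; [|rewrite Rmult_comm; apply Rmult_le_compat_r; lra].
    replace (e ^ 2 * Cmod (f (RtoC e))) with (e * Cmod (f (RtoC e)) * e) by ring.
    apply Rmult_le_compat_r; [lra|]. apply Rle_trans with (1 * Cmod (f (RtoC e))); [apply Rmult_le_compat_r; lra|lra]. }
  assert (c1 : c 1%nat = 0).
  { apply Small with (B + 2 * (r ^ 2 * B * / r ^ 2)); [specialize (Pr 2%nat); lra|]. intros e He1 He2.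
    assert (Me : Cmod (RtoC e) = e) by (apply Cmod_RtoC_pos; lra).
    assert (Ne : RtoC e <> 0) by (apply RtoC_neq_0; lra).
    assert (Y : (RtoC e * f (RtoC e))%C = TT 1%nat (RtoC e)).
    { assert (Z := T0 (RtoC e) ltac:(rewrite Me; lra)). rewrite (RT 0%nat), c0 in Z by (rewrite Me; lra).
      replace (TT 1%nat (RtoC e)) with ((0 + RtoC e * TT 1%nat (RtoC e)) / RtoC e)%C by (field; auto).
      rewrite <- Z. simpl. field. auto. }
    replace (c 1%nat) with (RtoC e * f (RtoC e) - RtoC e * TT 2%nat (RtoC e))%C
      by (rewrite Y, (RT 1%nat) by (rewrite Me; lra); ring).
    eapply Rle_trans; [apply Cmod_sub_le|]. rewrite !Cmod_mult, Me.
    assert (X1 : Cmod (f (RtoC e)) <= B) by (apply HB; split; [apply RtoC_neq_0; lra|rewrite Me; unfold r in He1; lra]).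
    assert (X2 := BT 2%nat (RtoC e) ltac:(rewrite Me; lra)).
    rewrite <- Rmult_plus_distr_l, Rmult_comm. apply Rmult_le_compat_r; lra. }
  exists (fun n => c (n + 2)%nat).
  assert (Ba : forall n, Cmod (c (n + 2)%nat) <= B * (/ r) ^ n).
  { intros n. apply avg_norm; [apply Kc|]. intros t. eapply Rle_trans; [apply Mc|]. right.
    rewrite pow_add, pow_inv. field. split; [apply pow_nonzero; lra|lra]. }
  split.
  - intros n. replace (2 / R0) with (/ r) by (unfold r; field; lra). apply Ba.
  - intros N z [Nz0 Hz]. assert (Pz := proj1 (Cmod_gt_0 z) Nz0).
    destruct (Rle_dec (Cmod z) (r / 2)) as [l|l].
    + assert (Hzr : Cmod z < r) by lra.
      assert (X : forall M, TT 2%nat z = (psum (fun n => c (n + 2)%nat * z ^ n) M + z ^ M * TT (M + 2)%nat z)%C).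
      { induction M; simpl; [ring|]. rewrite IHM, (RT (M + 2)%nat) by exact Hzr. simpl. ring. }
      assert (Y : f z = TT 2%nat z).
      { assert (Z := T0 z Hzr). rewrite (RT 0%nat), (RT 1%nat), c0, c1 in Z by exact Hzr.
        replace (TT 2%nat z) with ((0 + z * (0 + z * TT 2%nat z)) / (z * z))%C by (field; auto).
        rewrite <- Z. simpl. field. auto. }
      rewrite Y, (X N).
      match goal with |- Cmod (?p + ?q - ?p)%C <= _ => replace (p + q - p)%C with q by ring end.
      rewrite Cmod_mult, Cmod_pow.
      eapply Rle_trans; [apply Rmult_le_compat_l; [apply pow_le, Cmod_ge_0|apply BT; exact l]|].
      replace (r ^ 2 * B * / r ^ (N + 2)) with (B * (/ r) ^ N) by (rewrite pow_add, pow_inv; field; split; try apply pow_nonzero; lra).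
      replace (Cmod z ^ N * (2 * (B * (/ r) ^ N))) with (2 * B * (Cmod z * / r) ^ N) by (rewrite Rpow_mult_distr; ring).
      apply Rmult_le_compat; [lra| |lra|].
      * apply pow_le. apply Rmult_le_pos; [lra|]. apply Rlt_le, Rinv_0_lt_compat; lra.
      * apply pow_incr. split; [apply Rmult_le_pos; [lra|]; apply Rlt_le, Rinv_0_lt_compat; lra|].
        unfold r. replace (Cmod z * / (R0 / 2)) with (2 * (Cmod z * / R0)) by (field; lra).
        assert (0 <= Cmod z * / R0) by (apply Rmult_le_pos; [lra|]; apply Rlt_le, Rinv_0_lt_compat; lra). unfold Rdiv. lra.
    (* For |z| > R0 / 4 the ratio [x] is at least 1, and the crude bounds [B] for [f] and
       [2 * B * x ^ N] for the partial sum suffice. *)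
    + set (x := 4 * Cmod z / R0).
      assert (Hx : 1 <= x).
      { unfold x. apply Rmult_le_reg_r with R0; [lra|]. unfold Rdiv. rewrite Rmult_assoc, Rinv_l by lra. unfold r in l. lra. }
      assert (Hx1 : forall n, (n <= N)%nat -> x ^ n <= x ^ N) by (intros; apply Rle_pow; auto).
      eapply Rle_trans; [apply Cmod_sub_le|].
      assert (X : Cmod (psum (fun n => c (n + 2)%nat * z ^ n)%C N) <= 2 * B * x ^ N).
      { eapply Rle_trans; [apply psum_Cmod_le with (b := fun n => (B * x ^ N) * (/ 2) ^ n)|].
        - intros n Hn. rewrite Cmod_mult, Cmod_pow.
          eapply Rle_trans; [apply Rmult_le_compat_r; [apply pow_le, Cmod_ge_0|apply Ba]|].
          replace (B * (/ r) ^ n * Cmod z ^ n) with (B * x ^ n * (/ 2) ^ n).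
          + apply Rmult_le_compat_r; [apply pow_le; lra|]. apply Rmult_le_compat_l; [lra|]. apply Hx1; lia.
          + rewrite !Rmult_assoc, <- !Rpow_mult_distr. f_equal. f_equal. unfold x, r. field. lra.
        - rewrite rsum_scal. assert (H := rsum_half N). assert (0 <= x ^ N) by (apply pow_le; lra).
          apply Rle_trans with (B * x ^ N * 2); [apply Rmult_le_compat_l; [apply Rmult_le_pos; lra|exact H]|lra]. }
      assert (Y : Cmod (f z) <= B) by (apply HB; now split).
      assert (1 <= x ^ N) by (specialize (Hx1 0%nat); simpl in Hx1; apply Hx1; lia). nra.
Qed.

(** * Cauchy estimates and limits of holomorphic functions *)

Lemma cder_unique f z a b : cder f z a -> cder f z b -> a = b.
Proof. intros Ha Hb. apply cder_C_derive in Ha. apply cder_C_derive in Hb. congruence. Qed.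

Lemma Csub_neq_0 (a b : C) : a <> b -> (a - b)%C <> 0.
Proof. intros H E. apply H. replace a with (b + (a - b))%C by ring. rewrite E. ring. Qed.

Lemma cder_eps (f : C -> C) (z l : C) :
  (forall e, 0 < e -> locally z (fun w => Cmod (f w - f z - (w - z) * l)%C <= e * Cmod (w - z)%C)) -> cder f z l.
Proof.
  intros H. exists (fun w => if Ceq_dec w z then l else ((f w - f z) / (w - z))%C). split.
  - intros w. destruct (Ceq_dec w z) as [->|E]; [ring|]. field. now apply Csub_neq_0.
  - intros e He. assert (He2 : 0 < e / 2) by lra. generalize (H _ He2). apply filter_imp. intros w Hw.
    destruct (Ceq_dec w z) as [->|E]; [replace (l - l)%C with (RtoC 0) by ring; rewrite Cmod_0; lra|].
    apply Csub_neq_0 in E.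
    replace ((f w - f z) / (w - z) - l)%C with ((f w - f z - (w - z) * l) / (w - z))%C by (field; auto).
    rewrite Cmod_div by auto. assert (P := proj1 (Cmod_gt_0 _) E).
    apply Rle_lt_trans with (e / 2); [|lra]. apply Rmult_le_reg_r with (Cmod (w - z)%C); [auto|].
    unfold Rdiv at 1. rewrite Rmult_assoc, Rinv_l by lra. lra.
Qed.

Lemma cder_quad (f : C -> C) (z l : C) R0 K : 0 < R0 ->
  (forall h, 0 < Cmod h < R0 -> Cmod (f (z + h) - f z - h * l)%C <= K * Cmod h ^ 2) -> cder f z l.
Proof.
  intros HR H. apply cder_eps. intros e He. apply locally_Cmod.
  set (K' := Rabs K + 1). assert (HK' : 0 < K') by (unfold K'; generalize (Rabs_pos K); lra).
  exists (Rmin R0 (e / K')). split; [apply Rmin_glb_lt; [exact HR|now apply Rdiv_lt_0_compat]|].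
  intros w Hw. assert (Hw1 := Rlt_le_trans _ _ _ Hw (Rmin_l _ _)). assert (Hw2 := Rlt_le_trans _ _ _ Hw (Rmin_r _ _)).
  destruct (Ceq_dec w z) as [->|E].
  - replace (f z - f z - (z - z) * l)%C with (RtoC 0) by ring. replace (z - z)%C with (RtoC 0) by ring. rewrite Cmod_0. lra.
  - apply Csub_neq_0 in E. apply Cmod_gt_0 in E. specialize (H (w - z)%C (conj E Hw1)).
    replace (z + (w - z))%C with w in H by ring. eapply Rle_trans; [exact H|].
    apply Rmult_lt_compat_r with (r := K') in Hw2; [|lra]. unfold Rdiv in Hw2. rewrite Rmult_assoc, Rinv_l in Hw2 by lra.
    assert (K <= K') by (unfold K'; generalize (Rle_abs K); lra).
    simpl. nra.
Qed.

Definition ball_at (z : C) (r : R) (w : C) : Prop := Cmod (w - z)%C < r.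

Lemma ball_at_add z r h : Cmod h < r -> ball_at z r (z + h)%C.
Proof. intros H. unfold ball_at. now replace (z + h - z)%C with h by ring. Qed.

(** The removable case recentred at a point of the domain; continuity there identifies the constant
    coefficient with [f z]. *)
Lemma taylor_ball f z R0 B : 0 < R0 -> hol (ball_at z R0) f -> (forall w, ball_at z R0 w -> Cmod (f w) <= B) ->
  exists a : nat -> C, a 0%nat = f z /\ (forall n, Cmod (a n) <= B * (2 / R0) ^ n) /\
    forall N h, Cmod h < R0 -> h <> 0 -> Cmod (f (z + h)%C - psum (fun n => a n * h ^ n) N)%C <= 3 * B * (4 * Cmod h / R0) ^ N.
Proof.
  intros HR Hf HB.
  destruct (taylor_punctured (fun h => f (z + h)%C) R0 B HR) as [a [Ha1 Ha2]].
  - intros h [Nh Hh]. destruct (Hf (z + h)%C (ball_at_add _ _ _ Hh)) as [l Hl]. eexists.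
    apply (cder_comp f (fun h => z + h)%C); [apply cder_plus; [apply cder_const|apply cder_id]|exact Hl].
  - intros h [Nh Hh]. apply HB. now apply ball_at_add.
  - exists a. split; [|split; [exact Ha1|]].
    2: { intros N h H1 H2. apply Ha2. now split. }
    assert (C0 : tends (locally z) f (f z)).
    { destruct (Hf z) as [l Hl]; [unfold ball_at; replace (z - z)%C with (RtoC 0) by ring; now rewrite Cmod_0|]. eapply cder_cont, Hl. }
    assert (HB0 : 0 <= B) by (eapply Rle_trans; [apply Cmod_ge_0|]; apply (HB z); unfold ball_at; replace (z - z)%C with (RtoC 0) by ring; now rewrite Cmod_0).
    assert (E : (a 0%nat - f z)%C = 0).
    2: { replace (a 0%nat) with (f z + (a 0%nat - f z))%C by ring. rewrite E. ring. }
    apply Cmod_eq_0, Rle_antisym; [|apply Cmod_ge_0]. apply le_epsilon. intros e He. rewrite Rplus_0_l.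
    assert (He2 : 0 < e / 2) by lra.
    destruct (proj1 (locally_Cmod _ _) (C0 _ He2)) as [d [Hd Hd']].
    set (x := Rmin (Rmin (d / 2) (R0 / 2)) (e * R0 / (24 * (B + 1)))).
    assert (Hx : 0 < x).
    { repeat apply Rmin_glb_lt; try lra. apply Rdiv_lt_0_compat; [nra|lra]. }
    assert (x <= Rmin (d / 2) (R0 / 2)) by apply Rmin_l. assert (Rmin (d / 2) (R0 / 2) <= d / 2) by apply Rmin_l.
    assert (Rmin (d / 2) (R0 / 2) <= R0 / 2) by apply Rmin_r. assert (X : x <= e * R0 / (24 * (B + 1))) by apply Rmin_r.
    assert (Mx : Cmod (RtoC x) = x) by (apply Cmod_RtoC_pos; lra).
    specialize (Hd' (z + RtoC x)%C). replace (z + RtoC x - z)%C with (RtoC x) in Hd' by ring. rewrite Mx in Hd'.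
    specialize (Hd' ltac:(lra)).
    assert (T := Ha2 1%nat (RtoC x)). simpl in T. rewrite Mx in T. specialize (T ltac:(split; [apply RtoC_neq_0; lra|rewrite Mx; lra])).
    replace (a 0%nat - f z)%C with ((f (z + RtoC x) - f z) - (f (z + RtoC x) - (0 + a 0%nat * 1)))%C by ring.
    eapply Rle_trans; [apply Cmod_sub_le|].
    apply Rle_trans with (e / 2 + 3 * B * (4 * x / R0 * 1)); [apply Rplus_le_compat; [lra|exact T]|].
    apply Rmult_le_compat_r with (r := 24 * (B + 1)) in X; [|lra]. unfold Rdiv in X. rewrite Rmult_assoc, Rinv_l in X by lra.
    assert (12 * B * x / R0 <= e / 2); [|lra].
    apply Rmult_le_reg_r with R0; [lra|]. unfold Rdiv. rewrite (Rmult_assoc _ (/ R0)), Rinv_l by lra. nra.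
Qed.

Lemma cauchy_lip f z R0 B h : 0 < R0 -> hol (ball_at z R0) f -> (forall w, ball_at z R0 w -> Cmod (f w) <= B) ->
  Cmod h < R0 -> Cmod (f (z + h)%C - f z)%C <= 12 * B / R0 * Cmod h.
Proof.
  intros HR Hf HB Hh. destruct (taylor_ball f z R0 B HR Hf HB) as [a [A0 [A1 A2]]].
  destruct (Ceq_dec h 0) as [->|N].
  - replace (z + 0)%C with z by ring. replace (f z - f z)%C with (RtoC 0) by ring. rewrite Cmod_0. lra.
  - specialize (A2 1%nat h Hh N). simpl in A2. rewrite A0 in A2.
    replace (f (z + h) - f z)%C with (f (z + h) - (0 + f z * 1))%C by ring.
    eapply Rle_trans; [exact A2|]. right. field. lra.
Qed.

(** The Taylor remainder of order 2, whence the constant 3 * 4^2; the same bound shows that the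
    linear coefficient is a derivative, so it equals [l] by uniqueness. *)
Lemma cauchy_quad f z R0 B l h : 0 < R0 -> hol (ball_at z R0) f -> (forall w, ball_at z R0 w -> Cmod (f w) <= B) ->
  cder f z l -> Cmod h < R0 -> Cmod (f (z + h)%C - f z - h * l)%C <= 48 * B / R0 ^ 2 * Cmod h ^ 2.
Proof.
  intros HR Hf HB Hl Hh. destruct (taylor_ball f z R0 B HR Hf HB) as [a [A0 [A1 A2]]].
  assert (Q : forall h, 0 < Cmod h < R0 -> Cmod (f (z + h)%C - f z - h * a 1%nat)%C <= 48 * B / R0 ^ 2 * Cmod h ^ 2).
  { intros k [P Hk]. apply Cmod_gt_0 in P. specialize (A2 2%nat k Hk P). simpl in A2. rewrite A0 in A2.
    replace (f (z + k) - f z - k * a 1%nat)%C with (f (z + k) - (0 + f z * 1 + a 1%nat * (k * 1)))%C by ring.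
    eapply Rle_trans; [exact A2|]. right. field. lra. }
  assert (E : a 1%nat = l) by (eapply cder_unique; [|exact Hl]; exact (cder_quad f z (a 1%nat) R0 (48 * B / R0 ^ 2) HR Q)).
  rewrite <- E.
  destruct (Ceq_dec h 0) as [->|N].
  - replace (z + 0)%C with z by ring. replace (f z - f z - 0 * a 1%nat)%C with (RtoC 0) by ring. rewrite Cmod_0. lra.
  - apply Q. split; [now apply Cmod_gt_0|exact Hh].
Qed.

(* The three-point inequality controls difference quotients without mentioning
   derivatives, so it passes to pointwise limits and integrals. *)
Definition three_point (f : C -> C) (z : C) (R0 K : R) : Prop :=
  forall h k, Cmod h < R0 -> Cmod k < R0 ->
    Cmod (k * (f (z + h) - f z) - h * (f (z + k) - f z))%C <= K * (Cmod h * Cmod k * (Cmod h + Cmod k)).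

Lemma three_point_hol f z R0 B : 0 < R0 -> hol (ball_at z R0) f -> (forall w, ball_at z R0 w -> Cmod (f w) <= B) ->
  three_point f z R0 (48 * B / R0 ^ 2).
Proof.
  intros HR Hf HB h k Hh Hk.
  destruct (Hf z) as [l Hl]; [unfold ball_at; replace (z - z)%C with (RtoC 0) by ring; now rewrite Cmod_0|].
  assert (Q1 := cauchy_quad f z R0 B l h HR Hf HB Hl Hh). assert (Q2 := cauchy_quad f z R0 B l k HR Hf HB Hl Hk).
  replace (k * (f (z + h) - f z) - h * (f (z + k) - f z))%C with
    (k * (f (z + h) - f z - h * l) - h * (f (z + k) - f z - k * l))%C by ring.
  eapply Rle_trans; [apply Cmod_sub_le|]. rewrite !Cmod_mult.
  assert (Ph := Cmod_ge_0 h). assert (Pk := Cmod_ge_0 k).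
  apply Rle_trans with (Cmod k * (48 * B / R0 ^ 2 * Cmod h ^ 2) + Cmod h * (48 * B / R0 ^ 2 * Cmod k ^ 2)).
  - apply Rplus_le_compat; apply Rmult_le_compat_l; auto.
  - right. ring.
Qed.

(** Divided by h k, the inequality says that two difference quotients differ by at most K (|h| +
    |k|). They are therefore Cauchy along any sequence tending to 0, and their limit is approached
    with a linear error, hence is the derivative. *)
Lemma three_point_cder f z R0 K : 0 < R0 -> three_point f z R0 K -> exists l, cder f z l.
Proof.
  intros HR H.
  set (q := fun h => ((f (z + h) - f z) / h)%C).
  assert (Q : forall h k, 0 < Cmod h < R0 -> 0 < Cmod k < R0 -> Cmod (q h - q k)%C <= K * (Cmod h + Cmod k)).
  { intros h k [Ph Hh] [Pk Hk]. specialize (H h k Hh Hk). assert (Nh := proj2 (Cmod_gt_0 h) Ph). assert (Nk := proj2 (Cmod_gt_0 k) Pk).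
    replace (q h - q k)%C with ((k * (f (z + h) - f z) - h * (f (z + k) - f z)) / (h * k))%C by (unfold q; field; auto).
    rewrite Cmod_div, Cmod_mult by now apply Cmult_neq_0.
    apply Rmult_le_reg_r with (Cmod h * Cmod k); [nra|]. unfold Rdiv. rewrite Rmult_assoc, Rinv_l by nra. nra. }
  set (x := fun n => RtoC (R0 / (INR n + 2))).
  assert (Px : forall n, 0 < R0 / (INR n + 2)).
  { intros n. apply Rdiv_lt_0_compat; [exact HR|]. generalize (pos_INR n). lra. }
  assert (Mx : forall n, Cmod (x n) = R0 / (INR n + 2)) by (intros n; apply Cmod_RtoC_pos, Rlt_le, Px).
  assert (Bx : forall n, 0 < Cmod (x n) < R0).
  { intros n. rewrite Mx. split; [apply Px|]. generalize (pos_INR n). intros. apply Rmult_lt_reg_r with (INR n + 2); [lra|].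
    unfold Rdiv. rewrite Rmult_assoc, Rinv_l by lra. nra. }
  set (K' := Rabs K + 1). assert (HK' : 0 < K') by (unfold K'; generalize (Rabs_pos K); lra).
  assert (KK : K <= K') by (unfold K'; generalize (Rle_abs K); lra).
  assert (Sx : forall e, 0 < e -> exists N, forall n, (N <= n)%nat -> Cmod (x n) < e).
  { intros e He. destruct (nfloor_ex (R0 / e)) as [N [_ HN]]; [apply Rlt_le, Rdiv_lt_0_compat; lra|].
    exists N. intros n Hn. rewrite Mx. apply le_INR in Hn. generalize (pos_INR n). intros P.
    apply Rmult_lt_reg_r with (INR n + 2); [lra|]. unfold Rdiv at 1. rewrite Rmult_assoc, Rinv_l by lra.
    apply Rmult_lt_compat_r with (r := e) in HN; [|exact He]. unfold Rdiv in HN. rewrite Rmult_assoc, Rinv_l in HN by lra. nra. }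
  destruct (Clim_cauchy (fun n => q (x n))) as [l Hl].
  { intros e He. assert (He' : 0 < e / (2 * K')) by (apply Rdiv_lt_0_compat; lra).
    destruct (Sx _ He') as [N HN]. exists N. intros n m Hn Hm.
    eapply Rle_lt_trans; [apply Q; auto|]. generalize (HN n Hn) (HN m Hm) (Bx n) (Bx m). intros.
    apply Rle_lt_trans with (K' * (Cmod (x n) + Cmod (x m))); [nra|].
    apply Rlt_le_trans with (K' * (e / (2 * K') + e / (2 * K'))); [|right; field; lra]. nra. }
  exists l. apply (cder_quad f z l R0 K' HR). intros h [Ph Hh].
  assert (Nh := proj2 (Cmod_gt_0 h) Ph).
  assert (X : Cmod (q h - l)%C <= K' * Cmod h).
  { apply le_epsilon. intros e He.
    assert (He' : 0 < e / K') by (apply Rdiv_lt_0_compat; lra).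
    destruct (Sx _ He') as [N HN].
    apply (tends_le eventually (fun n => q h - q (x n))%C).
    - exists N. intros n Hn. eapply Rle_trans; [apply Q; auto|].
      specialize (HN n Hn). specialize (Bx n).
      apply Rle_trans with (K' * (Cmod h + Cmod (x n))); [nra|].
      apply Rle_trans with (K' * (Cmod h + e / K')); [nra|]. right. field. lra.
    - apply tends_minus; [apply eventually_filter|apply tends_const, eventually_filter|exact Hl]. }
  replace (f (z + h) - f z - h * l)%C with (h * (q h - l))%C by (unfold q; field; auto).
  rewrite Cmod_mult. simpl. nra.
Qed.

Lemma open_ball_at (D : C -> Prop) z : open D -> D z -> exists R0, 0 < R0 /\ forall w, ball_at z R0 w -> D w.
Proof. intros HD Hz. apply HD in Hz. apply locally_Cmod in Hz. exact Hz. Qed.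

(** Pointwise convergence is enough: the uniform bound gives all functions of the sequence the same
    constant in the three-point inequality. *)
Lemma hol_lim (D : C -> Prop) (f : nat -> C -> C) (g : C -> C) B : open D ->
  (forall n, hol D (f n)) -> (forall n z, D z -> Cmod (f n z) <= B) ->
  (forall z, D z -> Clim (fun n => f n z) (g z)) -> hol D g.
Proof.
  intros HD Hf HB Hl z Hz. destruct (open_ball_at D z HD Hz) as [R0 [HR HRD]].
  apply (three_point_cder g z R0 (48 * B / R0 ^ 2) HR). intros h k Hh Hk.
  apply (Clim_le (fun n => k * (f n (z + h) - f n z) - h * (f n (z + k) - f n z))%C).
  - intros n. apply (three_point_hol (f n) z R0 B HR); auto. intros w Hw. apply Hf. auto.
  - apply tends_minus; [apply eventually_filter| |]; (apply tends_scal; [apply eventually_filter|]);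
    (apply tends_minus; [apply eventually_filter| |]); apply Hl; auto; apply HRD; now apply ball_at_add.
Qed.

Lemma cder_lim (f : nat -> C -> C) (g : C -> C) (l : nat -> C) l' z R0 B : 0 < R0 ->
  (forall n, hol (ball_at z R0) (f n)) -> (forall n w, ball_at z R0 w -> Cmod (f n w) <= B) ->
  (forall w, ball_at z R0 w -> Clim (fun n => f n w) (g w)) ->
  (forall n, cder (f n) z (l n)) -> Clim l l' -> cder g z l'.
Proof.
  intros HR Hf HB Hg Hd Hl. apply (cder_quad g z l' R0 (48 * B / R0 ^ 2) HR). intros h [_ Hh].
  apply (Clim_le (fun n => f n (z + h) - f n z - h * l n)%C).
  - intros n. apply (cauchy_quad (f n) z R0 B); auto.
  - apply tends_minus; [apply eventually_filter| |apply tends_scal; [apply eventually_filter|exact Hl]].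
    apply tends_minus; [apply eventually_filter| |]; apply Hg; [now apply ball_at_add|].
    unfold ball_at. replace (z - z)%C with (RtoC 0) by ring. now rewrite Cmod_0.
Qed.

Lemma hol_integral (D : C -> Prop) (F : R -> C -> C) (G : C -> C) a b B : a <= b -> open D ->
  (forall s, a <= s <= b -> hol D (F s)) -> (forall s z, a <= s <= b -> D z -> Cmod (F s z) <= B) ->
  (forall z, D z -> isI (fun s => F s z) a b (G z)) -> hol D G.
Proof.
  intros Hab HD Hf HB Hl z Hz. destruct (open_ball_at D z HD Hz) as [R0 [HR HRD]].
  apply (three_point_cder G z R0 ((b - a) * (48 * B / R0 ^ 2)) HR). intros h k Hh Hk.
  rewrite Rmult_assoc.
  apply (isI_norm_const (fun s => k * (F s (z + h) - F s z) - h * (F s (z + k) - F s z))%C); [exact Hab| |].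
  - intros s Hs. apply (three_point_hol (F s) z R0 B HR); auto. intros w Hw. apply Hf; auto.
  - apply isI_minus; apply isI_scal; apply isI_minus; apply Hl; auto; apply HRD; now apply ball_at_add.
Qed.

(** ** Functions of two variables *)

Definition C2 := prod_NormedModule C_AbsRing C_NormedModule C_NormedModule.

Lemma C2_norm_l (p : C * C) : Cmod (fst p) <= norm (V := C2) p.
Proof.
  unfold norm; simpl. unfold prod_norm. change (norm (K := C_AbsRing) (fst p)) with (Cmod (fst p)).
  change (norm (K := C_AbsRing) (snd p)) with (Cmod (snd p)).
  rewrite <- (sqrt_pow2 (Cmod (fst p))) at 1 by apply Cmod_ge_0. apply sqrt_le_1_alt.
  generalize (pow2_ge_0 (Cmod (snd p))). lra.
Qed.

Lemma C2_norm_r (p : C * C) : Cmod (snd p) <= norm (V := C2) p.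
Proof.
  unfold norm; simpl. unfold prod_norm. change (norm (K := C_AbsRing) (fst p)) with (Cmod (fst p)).
  change (norm (K := C_AbsRing) (snd p)) with (Cmod (snd p)).
  rewrite <- (sqrt_pow2 (Cmod (snd p))) at 1 by apply Cmod_ge_0. apply sqrt_le_1_alt.
  generalize (pow2_ge_0 (Cmod (fst p))). lra.
Qed.

Lemma C2_norm_0_l (h : C) : norm (V := C2) (h, RtoC 0) = Cmod h.
Proof.
  unfold norm; simpl. unfold prod_norm. cbn [fst snd]. change (norm (K := C_AbsRing) h) with (Cmod h).
  change (norm (K := C_AbsRing) (RtoC 0)) with (Cmod 0). rewrite Cmod_0.
  replace (Cmod h ^ 2 + 0 ^ 2) with (Cmod h ^ 2) by ring. apply sqrt_pow2, Cmod_ge_0.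
Qed.

Lemma C2_norm_0_r (h : C) : norm (V := C2) (RtoC 0, h) = Cmod h.
Proof.
  unfold norm; simpl. unfold prod_norm. cbn [fst snd]. change (norm (K := C_AbsRing) h) with (Cmod h).
  change (norm (K := C_AbsRing) (RtoC 0)) with (Cmod 0). rewrite Cmod_0.
  replace (0 ^ 2 + Cmod h ^ 2) with (Cmod h ^ 2) by ring. apply sqrt_pow2, Cmod_ge_0.
Qed.

Lemma C2_linear (a b : C) : is_linear (U := C2) (V := C_NormedModule) (fun p : C2 => (a * fst p + b * snd p)%C).
Proof.
  split.
  - intros x y. change (a * (fst x + fst y) + b * (snd x + snd y) = (a * fst x + b * snd x) + (a * fst y + b * snd y))%C. ring.
  - intros k x. change (a * (k * fst x) + b * (k * snd x) = k * (a * fst x + b * snd x))%C. ring.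
  - exists (Cmod a + Cmod b + 1). assert (Pa := Cmod_ge_0 a). assert (Pb := Cmod_ge_0 b). split; [lra|].
    intros x. change (Cmod (a * fst x + b * snd x)%C <= (Cmod a + Cmod b + 1) * norm (V := C2) x).
    eapply Rle_trans; [apply Cmod_triangle|]. rewrite !Cmod_mult.
    assert (H1 := C2_norm_l x). assert (H2 := C2_norm_r x).
    assert (P1 := Cmod_ge_0 (fst x)). set (n := norm (V := C2) x) in *. change (norm (V := C2) x) with n.
    apply Rle_trans with (Cmod a * n + Cmod b * n); [apply Rplus_le_compat; apply Rmult_le_compat_l; assumption|].
    assert (0 <= n) by exact (Rle_trans _ _ _ P1 H1).
    replace ((Cmod a + Cmod b + 1) * n) with (Cmod a * n + Cmod b * n + n) by ring. lra.
Qed.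

Lemma locally_C2 (x y : C) (P : C * C -> Prop) :
  (exists d, 0 < d /\ forall u v, Cmod (u - x)%C < d -> Cmod (v - y)%C < d -> P (u, v)) <-> locally (T := C2) (x, y) P.
Proof.
  split.
  - intros [d [Hd H]].
    destruct (proj2 (locally_Cmod x (fun u => Cmod (u - x)%C < d))) as [e1 He1]; [exists d; auto|].
    destruct (proj2 (locally_Cmod y (fun u => Cmod (u - y)%C < d))) as [e2 He2]; [exists d; auto|].
    assert (Hm : 0 < Rmin e1 e2) by (apply Rmin_glb_lt; apply cond_pos).
    exists (mkposreal _ Hm). intros [u v] [B1 B2]. simpl in B1, B2. apply H.
    + apply He1. eapply ball_le; [|exact B1]. apply Rmin_l.
    + apply He2. eapply ball_le; [|exact B2]. apply Rmin_r.
  - intros [e He].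
    destruct (proj1 (locally_Cmod x (fun u => ball x e u))) as [d1 [Hd1 H1]]; [exists e; auto|].
    destruct (proj1 (locally_Cmod y (fun u => ball y e u))) as [d2 [Hd2 H2]]; [exists e; auto|].
    exists (Rmin d1 d2). split; [now apply Rmin_glb_lt|]. intros u v Hu Hv. apply He. split.
    + apply H1. eapply Rlt_le_trans; [exact Hu|apply Rmin_l].
    + apply H2. eapply Rlt_le_trans; [exact Hv|apply Rmin_r].
Qed.

(** For bounded functions, separate holomorphy gives the Fréchet differential: the pure increments
    are quadratic by Cauchy's estimate, and the mixed increment is at most K3 |h| |k|. *)
Lemma osgood (D1 D2 : C -> Prop) (F : C -> C -> C) B : open D1 -> open D2 ->
  (forall y, D2 y -> hol D1 (fun x => F x y)) -> (forall x, D1 x -> hol D2 (F x)) ->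
  (forall x y, D1 x -> D2 y -> Cmod (F x y) <= B) ->
  holomorphic2 (fun x y => D1 x /\ D2 y) F.
Proof.
  intros O1 O2 H1 H2 HB x y [Dx Dy].
  destruct (open_ball_at D1 x O1 Dx) as [R1 [P1 I1]]. destruct (open_ball_at D2 y O2 Dy) as [R2 [P2 I2]].
  destruct (H1 y Dy x Dx) as [a Ha]. destruct (H2 x Dx y Dy) as [b Hb].
  assert (HB0 : 0 <= B) by (eapply Rle_trans; [apply Cmod_ge_0|apply (HB x y Dx Dy)]).
  set (K1 := 48 * B / R1 ^ 2). set (K2 := 48 * B / R2 ^ 2). set (K3 := 12 * (12 * B / R1) / R2).
  assert (PK1 : 0 <= K1) by (apply Rmult_le_pos; [lra|]; apply Rlt_le, Rinv_0_lt_compat, pow_lt; lra).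
  assert (PK2 : 0 <= K2) by (apply Rmult_le_pos; [lra|]; apply Rlt_le, Rinv_0_lt_compat, pow_lt; lra).
  assert (PB : 0 <= 12 * B / R1) by (apply Rmult_le_pos; [lra|]; apply Rlt_le, Rinv_0_lt_compat; lra).
  assert (PK3 : 0 <= K3) by (apply Rmult_le_pos; [lra|]; apply Rlt_le, Rinv_0_lt_compat; lra).
  assert (Main : forall h k, Cmod h < R1 -> Cmod k < R2 ->
    Cmod (F (x + h)%C (y + k)%C - F x y - (a * h + b * k))%C <= K1 * Cmod h ^ 2 + K2 * Cmod k ^ 2 + K3 * (Cmod h * Cmod k)).
  { intros h k Hh Hk.
    assert (Q1 : Cmod (F (x + h)%C y - F x y - h * a)%C <= K1 * Cmod h ^ 2).
    { apply (cauchy_quad (fun x => F x y) x R1 B); auto. intros w Hw. apply H1; auto. }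
    assert (Q2 : Cmod (F x (y + k)%C - F x y - k * b)%C <= K2 * Cmod k ^ 2).
    { apply (cauchy_quad (F x) y R2 B); auto. intros w Hw. apply H2; auto. }
    (* The Lipschitz estimate is used twice: in y, for the function F(x + h, y) - F(x, y), which is
       itself bounded by 12 B |h| / R1 through the estimate in x. *)
    assert (Q3 : Cmod ((F (x + h)%C (y + k)%C - F x (y + k)%C) - (F (x + h)%C y - F x y))%C <= K3 * (Cmod h * Cmod k)).
    { replace (K3 * (Cmod h * Cmod k)) with (12 * (12 * B / R1 * Cmod h) / R2 * Cmod k) by (unfold K3; field; lra).
      apply (cauchy_lip (fun y => F (x + h)%C y - F x y)%C y R2); auto.
      - intros w Hw. apply hol_minus with (D := D2); auto. apply H2. apply I1. now apply ball_at_add.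
      - intros w Hw. apply (cauchy_lip (fun x => F x w) x R1 B); auto. intros v Hv. apply H1; auto. }
    replace (F (x + h)%C (y + k)%C - F x y - (a * h + b * k))%C with
      ((F (x + h)%C y - F x y - h * a) + (F x (y + k)%C - F x y - k * b) +
       ((F (x + h)%C (y + k)%C - F x (y + k)%C) - (F (x + h)%C y - F x y)))%C by ring.
    eapply Rle_trans; [apply Cmod_triangle|]. apply Rplus_le_compat; [|exact Q3].
    eapply Rle_trans; [apply Cmod_triangle|]. now apply Rplus_le_compat. }
  exists (fun p => (a * fst p + b * snd p)%C). split; [apply C2_linear|].
  intros p Hp. apply (is_filter_lim_locally_unique (V := C2)) in Hp. subst p.
  intros e. apply locally_C2.
  set (K := K1 + K2 + K3 + 1).
  exists (Rmin (Rmin R1 R2) (e / K)).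
  assert (HK : 0 < K) by (unfold K; lra). assert (He := cond_pos e).
  split; [repeat apply Rmin_glb_lt; auto; now apply Rdiv_lt_0_compat|].
  intros u v Hu Hv.
  assert (M1 : Rmin (Rmin R1 R2) (e / K) <= R1) by (eapply Rle_trans; [apply Rmin_l|apply Rmin_l]).
  assert (M2 : Rmin (Rmin R1 R2) (e / K) <= R2) by (eapply Rle_trans; [apply Rmin_l|apply Rmin_r]).
  assert (M3 : Rmin (Rmin R1 R2) (e / K) <= e / K) by apply Rmin_r.
  assert (MK : e / K * K = e) by (field; lra).
  change (Cmod (F u v - F x y - (a * (u - x) + b * (v - y)))%C <= e * norm (V := C2) ((u - x)%C, (v - y)%C)).
  assert (M := Main (u - x)%C (v - y)%C ltac:(lra) ltac:(lra)).
  replace (x + (u - x))%C with u in M by ring. replace (y + (v - y))%C with v in M by ring.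
  eapply Rle_trans; [exact M|].
  assert (N1 := C2_norm_l ((u - x)%C, (v - y)%C)). assert (N2 := C2_norm_r ((u - x)%C, (v - y)%C)). cbn [fst snd] in N1, N2.
  set (n := norm (V := C2) ((u - x)%C, (v - y)%C)) in *.
  assert (Pu := Cmod_ge_0 (u - x)%C). assert (Pv := Cmod_ge_0 (v - y)%C).
  set (U := Cmod (u - x)%C) in *. set (W := Cmod (v - y)%C) in *.
  set (d := e / K) in *.
  assert (0 < d) by (apply Rdiv_lt_0_compat; auto).
  apply Rle_trans with (K1 * (d * n) + K2 * (d * n) + K3 * (d * n)).
  - simpl. repeat apply Rplus_le_compat; apply Rmult_le_compat_l; auto; nra.
  - replace (e * n) with (K * (d * n)) by (rewrite <- MK; ring). unfold K. assert (0 <= d * n) by nra. nra.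
Qed.

Lemma holomorphic2_fst (D : C -> C -> Prop) F x y : holomorphic2 D F -> D x y -> exists l, cder (fun u => F u y) x l.
Proof.
  intros H Hxy. destruct (H x y Hxy) as [l [Hl Hd]]. specialize (Hd (x, y) (fun P HP => HP)).
  exists (l (RtoC 1, RtoC 0)). apply cder_eps. intros e He.
  destruct (proj2 (locally_C2 x y _) (Hd (mkposreal e He))) as [d [Hd1 Hd2]].
  apply locally_Cmod. exists d. split; [exact Hd1|]. intros u Hu.
  assert (Z : (y - y)%C = 0) by ring.
  specialize (Hd2 u y Hu). rewrite Z, Cmod_0 in Hd2. specialize (Hd2 Hd1).
  change (Cmod (F u y - F x y - l (((u - x)%C, (y - y)%C)))%C <= e * norm (V := C2) ((u - x)%C, (y - y)%C)) in Hd2.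
  rewrite Z, C2_norm_0_l in Hd2.
  assert (E : l ((u - x)%C, RtoC 0) = ((u - x) * l (RtoC 1, RtoC 0))%C).
  { assert (L := linear_scal l Hl (u - x)%C (RtoC 1, RtoC 0)).
    change (scal (u - x)%C ((RtoC 1, RtoC 0) : C2)) with ((((u - x) * 1)%C, ((u - x) * 0)%C)) in L.
    replace ((u - x) * 1)%C with (u - x)%C in L by ring. replace ((u - x) * 0)%C with (RtoC 0) in L by ring. exact L. }
  rewrite <- E. exact Hd2.
Qed.

Lemma holomorphic2_snd (D : C -> C -> Prop) F x y : holomorphic2 D F -> D x y -> exists l, cder (fun u => F x u) y l.
Proof.
  intros H Hxy. destruct (H x y Hxy) as [l [Hl Hd]]. specialize (Hd (x, y) (fun P HP => HP)).
  exists (l (RtoC 0, RtoC 1)). apply cder_eps. intros e He.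
  destruct (proj2 (locally_C2 x y _) (Hd (mkposreal e He))) as [d [Hd1 Hd2]].
  apply locally_Cmod. exists d. split; [exact Hd1|]. intros u Hu.
  assert (Z : (x - x)%C = 0) by ring.
  specialize (Hd2 x u). rewrite Z, Cmod_0 in Hd2. specialize (Hd2 Hd1 Hu).
  change (Cmod (F x u - F x y - l (((x - x)%C, (u - y)%C)))%C <= e * norm (V := C2) ((x - x)%C, (u - y)%C)) in Hd2.
  rewrite Z, C2_norm_0_r in Hd2.
  assert (E : l (RtoC 0, (u - y)%C) = ((u - y) * l (RtoC 0, RtoC 1))%C).
  { assert (L := linear_scal l Hl (u - y)%C (RtoC 0, RtoC 1)).
    change (scal (u - y)%C ((RtoC 0, RtoC 1) : C2)) with ((((u - y) * 0)%C, ((u - y) * 1)%C)) in L.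
    replace ((u - y) * 1)%C with (u - y)%C in L by ring. replace ((u - y) * 0)%C with (RtoC 0) in L by ring. exact L. }
  rewrite <- E. exact Hd2.
Qed.

(** ** Power series *)

Definition psf (a : nat -> C) (z : C) : C := CSeries (fun n => a n * z ^ n)%C.
Definition psder (a : nat -> C) (n : nat) : C := (RtoC (INR (S n)) * a (S n))%C.

Lemma ps_term (a : nat -> C) K x z : (forall n, Cmod (a n) <= K * x ^ n) -> 0 <= K -> Cmod z * x <= / 2 -> 0 <= x ->
  forall n, Cmod (a n * z ^ n)%C <= K * (/ 2) ^ n.
Proof.
  intros Ha HK Hz Hx n. rewrite Cmod_mult, Cmod_pow.
  apply Rle_trans with (K * x ^ n * Cmod z ^ n).
  - apply Rmult_le_compat_r; [apply pow_le, Cmod_ge_0|apply Ha].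
  - rewrite Rmult_assoc, <- Rpow_mult_distr. apply Rmult_le_compat_l; [exact HK|].
    apply pow_incr. split; [apply Rmult_le_pos; [exact Hx|apply Cmod_ge_0]|lra].
Qed.

Lemma ps_dominated (a : nat -> C) K x z : (forall n, Cmod (a n) <= K * x ^ n) -> 0 <= K -> Cmod z * x <= / 2 -> 0 <= x ->
  dominated (fun n => a n * z ^ n)%C (2 * K).
Proof.
  intros Ha HK Hz Hx. exists (fun n => K * (/ 2) ^ n). split; [now apply (ps_term a K x)|].
  intros n. rewrite rsum_scal, (Rmult_comm 2 K). apply Rmult_le_compat_l; [exact HK|apply rsum_half].
Qed.

Lemma ps_ser (a : nat -> C) K x z : (forall n, Cmod (a n) <= K * x ^ n) -> 0 <= K -> Cmod z * x <= / 2 -> 0 <= x ->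
  Cser (fun n => a n * z ^ n)%C (psf a z) /\ Cmod (psf a z) <= 2 * K.
Proof.
  intros Ha HK Hz Hx. destruct (Cser_ex _ _ (ps_dominated a K x z Ha HK Hz Hx)) as [l [Hl Bl]].
  unfold psf. rewrite (Cser_eq _ _ Hl). now split.
Qed.

Lemma cder_pow z n : cder (fun w => w ^ S n)%C z (RtoC (INR (S n)) * z ^ n)%C.
Proof.
  induction n.
  - simpl. apply (cder_ext (fun w => w)); [intros; ring|]. replace (1 * 1)%C with (RtoC 1) by ring. apply cder_id.
  - change (fun w => w ^ S (S n))%C with (fun w => w * w ^ S n)%C.
    assert (H := cder_mult _ _ z _ _ (cder_id z) IHn). cbv beta in H.
    rewrite S_INR, RtoC_plus. simpl Cpow. simpl Cpow in H.
    match type of H with cder _ _ ?A => match goal with |- cder _ _ ?B => replace B with A by ring end end. exact H.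
Qed.

Lemma cder_psum (f : nat -> C -> C) (l : nat -> C) z n : (forall k, (k < n)%nat -> cder (f k) z (l k)) ->
  cder (fun w => psum (fun k => f k w) n) z (psum l n).
Proof. induction n; intros H; simpl; [apply cder_const|]. apply cder_plus; auto. Qed.

Lemma psder_bound a K x : (forall n, Cmod (a n) <= K * x ^ n) -> 0 <= x -> 0 <= K ->
  forall n, Cmod (psder a n) <= (K * x) * (2 * x) ^ n.
Proof.
  intros Ha Hx HK n. unfold psder. rewrite Cmod_mult, Cmod_RtoC_pos by apply pos_INR.
  assert (Q : INR (S n) <= 2 ^ n).
  { induction n; [simpl; lra|]. rewrite S_INR. simpl (2 ^ S n). assert (1 <= 2 ^ n) by (apply pow_R1_Rle; lra). lra. }
  apply Rle_trans with (2 ^ n * (K * x ^ S n)).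
  - apply Rmult_le_compat; auto; [apply pos_INR|apply Cmod_ge_0].
  - right. rewrite Rpow_mult_distr. simpl. ring.
Qed.

(** The condition on [z] leaves room for a ball of radius 1 / (4 x) on which |w| x <= 1/2; there the
    series is dominated by a geometric one of ratio 1/2 and the partial sums may be differentiated
    in the limit. *)
Lemma ps_cder (a : nat -> C) K x z : (forall n, Cmod (a n) <= K * x ^ n) -> 0 <= K -> 0 < x -> Cmod z * (4 * x) <= 1 ->
  cder (psf a) z (psf (psder a) z).
Proof.
  intros Ha HK Hx Hz.
  set (R0 := / (4 * x)). assert (HR : 0 < R0) by (apply Rinv_0_lt_compat; lra).
  assert (Hb : forall w, ball_at z R0 w -> Cmod w * x <= / 2).
  { intros w Hw. unfold ball_at in Hw. assert (T := Cmod_triangle_inv w z).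
    assert (Cmod w * (4 * x) <= Cmod z * (4 * x) + R0 * (4 * x)) by nra.
    assert (R0 * (4 * x) = 1) by (unfold R0; field; lra). lra. }
  apply (cder_lim (fun N w => psum (fun n => a n * w ^ n)%C (S N)) (psf a) (fun N => psum (fun n => psder a n * z ^ n)%C N) _ z R0 (2 * K) HR).
  - intros N. apply (hol_psum (ball_at z R0) (fun k w => a k * w ^ k)%C (S N)). intros k. apply hol_mult; [apply hol_const|apply hol_pow, hol_id].
  - intros N w Hw. destruct (ps_dominated a K x w Ha HK (Hb w Hw) ltac:(lra)) as [b [H1 H2]].
    eapply Rle_trans; [|apply (H2 (S N))]. apply psum_Cmod_le. auto.
  - intros w Hw. apply Clim_S. exact (proj1 (ps_ser a K x w Ha HK (Hb w Hw) ltac:(lra))).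
  - intros N. apply (cder_ext (fun w => a 0%nat + psum (fun n => a (S n) * w ^ S n) N)%C).
    + intros w. rewrite psum_shift. simpl. ring.
    + replace (psum (fun n => psder a n * z ^ n)%C N) with (0 + psum (fun n => psder a n * z ^ n)%C N)%C by ring.
      apply cder_plus; [apply cder_const|]. apply (cder_psum (fun n w => a (S n) * w ^ S n)%C). intros k _.
      unfold psder. replace (RtoC (INR (S k)) * a (S k) * z ^ k)%C with (0 * z ^ S k + a (S k) * (RtoC (INR (S k)) * z ^ k))%C by ring.
      apply (cder_mult (fun _ => a (S k))); [apply cder_const|apply cder_pow].
  - refine (proj1 (ps_ser (psder a) (K * x) (2 * x) z (psder_bound a K x Ha _ HK) _ _ _)); nra.
Qed.

Lemma psf_0 a : psf a 0 = a 0%nat.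
Proof.
  apply Cser_eq. apply Clim_S. apply tends_ext with (fun _ => a 0%nat); [apply eventually_filter| |apply tends_const, eventually_filter].
  intros n. rewrite psum_shift. simpl.
  replace (psum _ n) with (RtoC 0); [ring|]. induction n; simpl; [easy|]. rewrite <- IHn. ring.
Qed.

Lemma C_derive_n_S f k z : C_derive_n f (S k) z = C_derive (C_derive_n f k) z.
Proof. reflexivity. Qed.

Lemma psder_iter_0 a l : Nat.iter l psder a 0%nat = (Cfact l * a l)%C.
Proof.
  assert (G : forall n, Nat.iter l psder a n = (RtoC (INR (fact (n + l)) / INR (fact n)) * a (n + l)%nat)%C).
  { induction l; intros n; simpl Nat.iter.
    - rewrite Nat.add_0_r. replace (INR (fact n) / INR (fact n)) with 1 by (field; apply INR_fact_neq_0). ring.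
    - unfold psder at 1. rewrite IHl. replace (S n + l)%nat with (n + S l)%nat by lia.
      rewrite Cmult_assoc. f_equal. rewrite <- RtoC_mult. f_equal.
      replace (n + S l)%nat with (S (n + l)) by lia. change (fact (S n)) with (S n * fact n)%nat. rewrite mult_INR. field.
      split; [apply INR_fact_neq_0|]. apply not_0_INR. lia. }
  rewrite G. unfold Cfact. simpl. f_equal. f_equal. field.
Qed.

(** [C_derive_n] iterates a total operator, so each derivative must be known on a neighbourhood and
    not only at 0. The induction keeps such a neighbourhood, shrinking the radius and doubling the
    growth rate [x'] each time. *)
Lemma taylor_coef (f : C -> C) (a : nat -> C) K x R0 : 0 < x -> 0 <= K -> 0 < R0 ->
  (forall n, Cmod (a n) <= K * x ^ n) -> (forall z, Cmod z < R0 -> f z = psf a z) ->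
  forall l, C_derive_n f l 0 = (Cfact l * a l)%C.
Proof.
  intros Hx HK HR Ha Hf l.
  assert (G : exists K' x' R', 0 < x' /\ 0 <= K' /\ 0 < R' /\ (forall n, Cmod (Nat.iter l psder a n) <= K' * x' ^ n) /\
     forall z, Cmod z < R' -> C_derive_n f l z = psf (Nat.iter l psder a) z).
  { induction l.
    - exists K, x, R0. repeat split; auto.
    - destruct IHl as [K' [x' [R' [H1 [H2 [H3 [H4 H5]]]]]]].
      exists (K' * x'), (2 * x'), (Rmin R' (/ (4 * x'))).
      split; [lra|]. split; [nra|]. split; [apply Rmin_glb_lt; [exact H3|apply Rinv_0_lt_compat; lra]|].
      split; [apply psder_bound; auto; lra|].
      intros z Hz. rewrite C_derive_n_S. apply cder_C_derive.
      apply (cder_loc (psf (Nat.iter l psder a))).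
      + apply locally_Cmod. exists (R' - Cmod z).
        split; [generalize (Rmin_l R' (/ (4 * x'))); lra|].
        intros w Hw. symmetry. apply H5. generalize (Cmod_triangle_inv w z). lra.
      + simpl Nat.iter. apply (ps_cder _ K' x'); auto.
        assert (Y : Cmod z < / (4 * x')) by (eapply Rlt_le_trans; [exact Hz|apply Rmin_r]).
        apply Rmult_lt_compat_r with (r := 4 * x') in Y; [|lra]. rewrite Rinv_l in Y by lra. lra. }
  destruct G as [K' [x' [R' [H1 [H2 [H3 [H4 H5]]]]]]].
  rewrite H5 by (now rewrite Cmod_0). rewrite psf_0. apply psder_iter_0.
Qed.

(** ** Exponential generating series with bounded coefficients *)

Definition egf (u : nat -> C) (z : C) : C := CSeries (fun n => u n * (z ^ n / Cfact n))%C.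

Lemma Cfact_neq_0 n : Cfact n <> 0.
Proof. apply RtoC_neq_0, INR_fact_neq_0. Qed.

Lemma Cmod_Cfact n : Cmod (Cfact n) = INR (fact n).
Proof. apply Cmod_RtoC_pos, pos_INR. Qed.

Lemma rsum_sum_n (a : nat -> R) n : rsum a (S n) = sum_n a n.
Proof.
  induction n; [simpl; rewrite sum_O; ring|]. change (rsum a (S (S n))) with (rsum a (S n) + a (S n)). rewrite IHn.
  symmetry. apply (sum_Sn (G := R_AbelianMonoid)).
Qed.

Lemma rsum_exp x n : 0 <= x -> rsum (fun k => x ^ k / INR (fact k)) n <= exp x.
Proof.
  intros Hx.
  assert (P : forall k, 0 <= x ^ k / INR (fact k)).
  { intros k. apply Rmult_le_pos; [now apply pow_le|]. apply Rlt_le, Rinv_0_lt_compat, INR_fact_lt_0. }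
  assert (H := is_exp_Reals x).
  assert (L : is_lim_seq (rsum (fun k => x ^ k / INR (fact k))) (exp x)).
  { apply is_lim_seq_incr_1. apply (is_lim_seq_ext (sum_n (fun k => scal (pow_n x k) (/ INR (fact k))))).
    - intros m. rewrite rsum_sum_n. apply sum_n_ext. intros k. rewrite pow_n_pow. reflexivity.
    - exact H. }
  apply (is_lim_seq_incr_compare _ _ L). intros k. simpl. specialize (P k). lra.
Qed.

Lemma egf_dominated (u : nat -> C) K z : (forall n, Cmod (u n) <= K) ->
  dominated (fun n => u n * (z ^ n / Cfact n))%C (K * exp (Cmod z)).
Proof.
  intros Hu. assert (HK : 0 <= K) by (eapply Rle_trans; [apply Cmod_ge_0|apply (Hu 0%nat)]).
  exists (fun n => K * (Cmod z ^ n / INR (fact n))). split.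
  - intros n. rewrite Cmod_mult, Cmod_div, Cmod_pow, Cmod_Cfact by apply Cfact_neq_0.
    apply Rmult_le_compat_r; [|apply Hu]. apply Rmult_le_pos; [apply pow_le, Cmod_ge_0|]. apply Rlt_le, Rinv_0_lt_compat, INR_fact_lt_0.
  - intros n. rewrite rsum_scal. apply Rmult_le_compat_l; [exact HK|]. apply rsum_exp, Cmod_ge_0.
Qed.

Lemma egf_ser (u : nat -> C) K z : (forall n, Cmod (u n) <= K) ->
  Cser (fun n => u n * (z ^ n / Cfact n))%C (egf u z) /\ Cmod (egf u z) <= K * exp (Cmod z).
Proof.
  intros Hu. destruct (Cser_ex _ _ (egf_dominated u K z Hu)) as [l [Hl Bl]].
  unfold egf. rewrite (Cser_eq _ _ Hl). now split.
Qed.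

Lemma egf_cder (u : nat -> C) K z : (forall n, Cmod (u n) <= K) -> cder (egf u) z (egf (fun n => u (S n)) z).
Proof.
  intros Hu. assert (HK : 0 <= K) by (eapply Rle_trans; [apply Cmod_ge_0|apply (Hu 0%nat)]).
  set (a := fun n => (u n / Cfact n)%C).
  assert (E : forall w, psf a w = egf u w).
  { intros w. unfold egf. destruct (egf_ser u K w Hu) as [S1 _]. apply Cser_eq. revert S1. unfold egf.
    apply Cser_ext. intros n. unfold a, Cdiv. ring. }
  apply (cder_ext (psf a)); [exact E|].
  replace (egf (fun n => u (S n)) z) with (psf (psder a) z).
  (* The coefficients u_n / n! are below K exp(1/x) x^n for every x > 0, because (1/x)^n / n! is a
     term of exp(1/x); [x] is taken small enough to cover [z]. *)
  - set (x := / (4 * (Cmod z + 1))). assert (Pz := Cmod_ge_0 z).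
    assert (Hx : 0 < x) by (apply Rinv_0_lt_compat; lra).
    apply (ps_cder a (K * exp (/ x)) x); auto.
    + intros n. unfold a. rewrite Cmod_div, Cmod_Cfact by apply Cfact_neq_0.
      apply Rle_trans with (K * ((/ x) ^ n / INR (fact n)) * x ^ n).
      * rewrite pow_inv. replace (K * (/ x ^ n / INR (fact n)) * x ^ n) with (K / INR (fact n)) by (field; split; [apply pow_nonzero; lra|apply INR_fact_neq_0]).
        apply Rmult_le_compat_r; [apply Rlt_le, Rinv_0_lt_compat, INR_fact_lt_0|apply Hu].
      * apply Rmult_le_compat_r; [apply pow_le; lra|]. apply Rmult_le_compat_l; [exact HK|].
        eapply Rle_trans; [|apply (rsum_exp (/ x) (S n)); apply Rlt_le, Rinv_0_lt_compat; lra]. simpl.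
        assert (0 <= rsum (fun k => (/ x) ^ k / INR (fact k)) n); [|lra].
        apply rsum_ge_0. intros k _. apply Rmult_le_pos; [apply pow_le, Rlt_le, Rinv_0_lt_compat; lra|apply Rlt_le, Rinv_0_lt_compat, INR_fact_lt_0].
    + apply Rmult_le_pos; [exact HK|apply Rlt_le, exp_pos].
    + replace (Cmod z * (4 * x)) with (Cmod z / (Cmod z + 1)) by (unfold x; field; lra).
      apply Rmult_le_reg_r with (Cmod z + 1); [lra|]. unfold Rdiv. rewrite Rmult_assoc, Rinv_l by lra. lra.
  - destruct (egf_ser (fun n => u (S n)) K z (fun n => Hu (S n))) as [S1 _]. apply Cser_eq. revert S1. unfold egf.
    apply Cser_ext. intros n. unfold psder, a.
    assert (X : Cfact (S n) = (RtoC (INR (S n)) * Cfact n)%C).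
    { unfold Cfact. rewrite <- RtoC_mult, <- mult_INR. reflexivity. }
    rewrite X. field. split; [apply Cfact_neq_0|]. apply RtoC_neq_0. apply not_0_INR. lia.
Qed.

Lemma egf_derive_n (f : C -> C) (u : nat -> C) K k : (forall n, Cmod (u n) <= K) -> (forall z, f z = egf u z) ->
  forall z, C_derive_n f k z = egf (fun n => u (n + k)%nat) z.
Proof.
  intros Hu Hf. induction k; intros z.
  - simpl. rewrite Hf. symmetry. apply Cser_eq. destruct (egf_ser u K z Hu) as [S1 _]. revert S1.
    apply Cser_ext. intros n. now rewrite Nat.add_0_r.
  - rewrite C_derive_n_S. apply cder_C_derive.
    apply (cder_ext (egf (fun n => u (n + k)%nat))); [intros; symmetry; apply IHk|].
    replace (egf (fun n => u (n + S k)%nat) z) with (egf (fun n => (fun m => u (m + k)%nat) (S n)) z).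
    + apply egf_cder with K. auto.
    + unfold egf. symmetry. apply Cser_eq.
      destruct (egf_ser (fun n => u (S n + k)%nat) K z (fun n => Hu _)) as [S1 _]. revert S1. unfold egf. apply Cser_ext.
      intros n. now replace (n + S k)%nat with (S n + k)%nat by lia.
Qed.

Lemma open_Cdisc rho : open (Cdisc rho).
Proof.
  intros z Hz. apply locally_Cmod. exists (rho - Cmod z). unfold Cdisc in *. split; [lra|].
  intros w Hw. generalize (Cmod_triangle_inv w z). lra.
Qed.

(** A bound uniform in the index makes the partial sums uniformly bounded by [K * exp rho], so
    holomorphy in each variable passes to the limit and [osgood] joins the two. *)
Lemma egf_in_H (D : C -> Prop) rho K (u : nat -> C -> C) (F : C -> C -> C) : open D ->
  (forall n, hol D (u n)) -> (forall n t, D t -> Cmod (u n t) <= K) ->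
  (forall t z, polyset D rho t z -> F t z = egf (fun n => u n t) z) ->
  in_H D rho F /\ forall t z, polyset D rho t z -> Cmod (F t z) <= K * exp rho.
Proof.
  intros HD Hu HK HF.
  assert (PS : forall t z N, polyset D rho t z -> Cmod (psum (fun n => u n t * (z ^ n / Cfact n))%C N) <= K * exp rho).
  { intros t z N [Ht Hz]. destruct (egf_dominated (fun n => u n t) K z (fun n => HK n t Ht)) as [b [B1 B2]].
    assert (HK0 : 0 <= K) by (eapply Rle_trans; [apply Cmod_ge_0|apply (HK 0%nat t Ht)]).
    eapply Rle_trans; [apply psum_Cmod_le with (b := b); auto|]. eapply Rle_trans; [apply B2|].
    apply Rmult_le_compat_l; [exact HK0|]. apply Rlt_le, exp_increasing. exact Hz. }
  assert (CV : forall t z, polyset D rho t z -> Clim (fun N => psum (fun n => u n t * (z ^ n / Cfact n))%C N) (F t z)).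
  { intros t z [Ht Hz]. rewrite HF by (now split). apply (egf_ser (fun n => u n t) K z (fun n => HK n t Ht)). }
  assert (BD : forall t z, polyset D rho t z -> Cmod (F t z) <= K * exp rho).
  { intros t z H. eapply Clim_le; [|apply CV; exact H]. intros N. now apply PS. }
  split; [|exact BD]. split; [|exists (K * exp rho); exact BD].
  apply (osgood D (Cdisc rho) F (K * exp rho)); auto.
  - apply open_Cdisc.
  - intros z Hz. apply (hol_lim D (fun N t => psum (fun n => u n t * (z ^ n / Cfact n))%C N) _ (K * exp rho)); auto.
    + intros N. apply (hol_psum D (fun n t => u n t * (z ^ n / Cfact n))%C). intros k. apply hol_mult; [apply Hu|apply hol_const].
    + intros N t Ht. apply PS. now split.
    + intros t Ht. apply CV. now split.
  - intros t Ht. apply (hol_lim (Cdisc rho) (fun N z => psum (fun n => u n t * (z ^ n / Cfact n))%C N) _ (K * exp rho)).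
    + apply open_Cdisc.
    + intros N. apply (hol_psum _ (fun n z => u n t * (z ^ n / Cfact n))%C). intros k.
      apply hol_mult; [apply hol_const|]. apply hol_mult; [apply hol_pow, hol_id|apply hol_const].
    + intros N z Hz. apply PS. now split.
    + intros z Hz. apply CV. now split.
  - intros x y Hx Hy. apply BD. now split.
Qed.

Lemma H_norm_le_intro D rho F c : in_H D rho F -> (forall t z, polyset D rho t z -> Cmod (F t z) <= c) -> H_norm_le D rho F c.
Proof.
  intros H1 H2. split; [exact H1|]. unfold H_norm.
  destruct (Lub_Rbar_correct (fun r => exists t z, polyset D rho t z /\ r = Cmod (F t z))) as [_ L].
  apply L. intros x [t [z [Hp ->]]]. simpl. auto.
Qed.

(** ** The function Theta *)

Definition tri (n : nat) : nat := (n * (n - 1) / 2)%nat.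

Lemma tri_double n : (2 * tri n = n * (n - 1))%nat.
Proof.
  unfold tri. assert (E : Nat.even (n * (n - 1)) = true).
  { rewrite Nat.even_mul. destruct n; [easy|]. replace (S n - 1)%nat with n by lia. rewrite Nat.even_succ, <- Nat.negb_even.
    now destruct (Nat.even n). }
  apply Nat.even_spec in E. destruct E as [k E]. rewrite E. rewrite (Nat.mul_comm 2 k), Nat.div_mul by lia. lia.
Qed.

Lemma tri_S n : tri (S n) = (tri n + n)%nat.
Proof. assert (H1 := tri_double n). assert (H2 := tri_double (S n)). destruct n; nia. Qed.

Lemma tri_square n : (n * n = 2 * tri n + n)%nat.
Proof. rewrite tri_double. destruct n; lia. Qed.

Lemma tri_plus a b : (tri (a + b) = tri a + tri b + a * b)%nat.
Proof. assert (H := tri_square (a + b)). assert (H1 := tri_square a). assert (H2 := tri_square b). lia. Qed.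

Section Theta.
Variables q lq : C.
Hypothesis hq : 1 < Cmod q.
Hypothesis hlq : Cexp lq = q.
Let L := ln (Cmod q).
Let t := / Cmod q.
Let p := (/ q)%C.

Lemma q_neq_0 : q <> 0.
Proof. apply Cmod_gt_0. lra. Qed.
Let qn0 := q_neq_0.

Lemma L_pos : 0 < L.
Proof. unfold L. rewrite <- ln_1. apply ln_increasing; lra. Qed.

Lemma Cmod_q_exp : Cmod q = exp L.
Proof. unfold L. rewrite exp_ln; lra. Qed.

Lemma Re_lq : Re lq = L.
Proof. unfold L. rewrite <- hlq, Cmod_Cexp. now rewrite ln_exp. Qed.

Lemma t_bounds : 0 < t < 1.
Proof. unfold t. split; [apply Rinv_0_lt_compat; lra|]. rewrite <- Rinv_1. apply Rinv_lt_contravar; lra. Qed.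

Lemma p_mod : Cmod p = t.
Proof. unfold p, t. now rewrite Cmod_inv. Qed.

Lemma exp_nat x n : exp x ^ n = exp (INR n * x).
Proof. induction n; [simpl; rewrite Rmult_0_l, exp_0; easy|]. rewrite S_INR. simpl. rewrite IHn, <- exp_plus. f_equal. ring. Qed.

Lemma tri_INR n : INR (tri n) = INR n * (INR n - 1) / 2.
Proof.
  assert (H := f_equal INR (tri_double n)). rewrite !mult_INR in H. simpl (INR 2) in H.
  destruct n; [simpl in *; lra|]. rewrite minus_INR in H by lia. simpl (INR 1) in H. lra.
Qed.

Lemma tri_decay r : 0 < r -> exists K, 0 <= K /\ forall n, / Cmod q ^ tri n <= K * r ^ n.
Proof.
  intros Hr. assert (HL := L_pos). set (b := L / 2 - ln r). exists (exp (b ^ 2 / (2 * L))).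
  split; [apply Rlt_le, exp_pos|]. intros n. rewrite Cmod_q_exp, exp_nat, <- exp_Ropp.
  rewrite <- (exp_ln r) at 1 by exact Hr. rewrite exp_nat, <- exp_plus.
  assert (H : - (INR (tri n) * L) <= b ^ 2 / (2 * L) + INR n * ln r).
  { rewrite tri_INR. set (x := INR n).
    assert (E : b ^ 2 / (2 * L) + x * ln r - - (x * (x - 1) / 2 * L) = (b - L * x) ^ 2 / (2 * L)) by (unfold b; field; lra).
    assert (0 <= (b - L * x) ^ 2 / (2 * L)) by (apply Rmult_le_pos; [apply pow2_ge_0|apply Rlt_le, Rinv_0_lt_compat; lra]).
    lra. }
  destruct H as [H|H]; [apply Rlt_le, exp_increasing, H|rewrite H; lra].
Qed.

(** [thA] and [thB] are the coefficients of [Theta] in powers of x and of 1/x. The constant term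
    belongs to [thA], whence the zero in [thB]; for the index -(m + 1) the exponent n (n - 1) / 2 is
    [tri (m + 2)]. *)
Definition thA (n : nat) : C := (/ q ^ tri n)%C.
Definition thB (n : nat) : C := match n with O => 0 | S m => (/ q ^ tri (m + 2))%C end.

Lemma Cmod_thA n : Cmod (thA n) = / Cmod q ^ tri n.
Proof. unfold thA. rewrite Cmod_inv, Cmod_pow by now apply Cpow_neq_0. easy. Qed.

Lemma thA_bound r : 0 < r -> exists K, 0 <= K /\ forall n, Cmod (thA n) <= K * r ^ n.
Proof. intros Hr. destruct (tri_decay r Hr) as [K [HK H]]. exists K. split; [exact HK|]. intros n. rewrite Cmod_thA. auto. Qed.

Lemma thB_bound r : 0 < r -> exists K, 0 <= K /\ forall n, Cmod (thB n) <= K * r ^ n.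
Proof.
  intros Hr. destruct (tri_decay r Hr) as [K [HK H]]. exists (K * r). split; [nra|]. intros [|m]; simpl.
  - rewrite Cmod_0. nra.
  - rewrite Cmod_inv, Cmod_pow by now apply Cpow_neq_0. eapply Rle_trans; [apply H|]. right.
    replace (m + 2)%nat with (S (S m)) by lia. simpl. ring.
Qed.

Lemma entire_ser (a : nat -> C) z : (forall r, 0 < r -> exists K, 0 <= K /\ forall n, Cmod (a n) <= K * r ^ n) ->
  Cser (fun n => a n * z ^ n)%C (psf a z) /\ exists S0, dominated (fun n => a n * z ^ n)%C S0.
Proof.
  intros H. assert (P := Cmod_ge_0 z). destruct (H (/ (2 * (Cmod z + 1)))) as [K [HK Ha]]; [apply Rinv_0_lt_compat; lra|].
  assert (X : Cmod z * / (2 * (Cmod z + 1)) <= / 2).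
  { rewrite Rinv_mult. apply Rmult_le_reg_r with (Cmod z + 1); [lra|].
    replace (Cmod z * (/ 2 * / (Cmod z + 1)) * (Cmod z + 1)) with (Cmod z / 2) by (field; lra). lra. }
  assert (Y : 0 <= / (2 * (Cmod z + 1))) by (apply Rlt_le, Rinv_0_lt_compat; lra).
  split; [apply (ps_ser a K (/ (2 * (Cmod z + 1)))); auto|].
  exists (2 * K). apply (ps_dominated a K (/ (2 * (Cmod z + 1)))); auto.
Qed.

Lemma entire_hol (a : nat -> C) : (forall r, 0 < r -> exists K, 0 <= K /\ forall n, Cmod (a n) <= K * r ^ n) ->
  hol (fun _ => True) (psf a).
Proof.
  intros H z _. assert (P := Cmod_ge_0 z). destruct (H (/ (4 * (Cmod z + 1)))) as [K [HK Ha]]; [apply Rinv_0_lt_compat; lra|].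
  eexists. apply (ps_cder a K _ z Ha HK); [apply Rinv_0_lt_compat; lra|].
  replace (Cmod z * (4 * / (4 * (Cmod z + 1)))) with (Cmod z / (Cmod z + 1)) by (field; lra).
  apply Rmult_le_reg_r with (Cmod z + 1); [lra|]. unfold Rdiv. rewrite Rmult_assoc, Rinv_l by lra. lra.
Qed.

Lemma Theta_psf (x : C) : x <> 0 -> Theta q x = (psf thA x + psf thB (/ x))%C.
Proof.
  intros Hx. unfold Theta. f_equal.
  - apply Cser_eq. destruct (entire_ser thA x thA_bound) as [H _]. revert H. apply Cser_ext. intros n. unfold thA, tri, Cdiv. ring.
  - apply Cser_eq. destruct (entire_ser thB (/ x)%C thB_bound) as [H _].
    apply Clim_S in H. revert H. apply tends_ext; [apply eventually_filter|]. intros n. rewrite psum_shift.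
    simpl thB at 1. replace (0 * (/ x) ^ 0)%C with (RtoC 0) by ring. rewrite Cplus_0_l.
    apply psum_ext. intros k _. replace ((k + 1) * (k + 2) / 2)%nat with (tri (k + 2)).
    + simpl thB. replace (k + 1)%nat with (S k) by lia. rewrite Cpow_inv by exact Hx.
      field. split; apply Cpow_neq_0; auto.
    + unfold tri. f_equal. replace (k + 2 - 1)%nat with (k + 1)%nat by lia. lia.
Qed.

Lemma Theta_hol : hol (fun x : C => x <> 0) (Theta q).
Proof.
  intros x Hx. destruct (entire_hol thA thA_bound x I) as [a Ha].
  destruct (entire_hol thB thB_bound (/ x)%C I) as [b Hb].
  assert (H := cder_plus _ _ x _ _ Ha (cder_comp _ _ x _ _ (cder_inv x Hx) Hb)).
  eexists. refine (cder_loc _ _ _ _ _ H). apply locally_Cmod. exists (Cmod x). split; [now apply Cmod_gt_0|].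
  intros w Hw. symmetry. apply Theta_psf. intros ->. replace (0 - x)%C with (- x)%C in Hw by ring. rewrite Cmod_opp in Hw. lra.
Qed.

(** Shifting the summation index of the bilateral series by one; the term 1 crosses from one half to
    the other, which is why it appears in both [A] and [B]. *)
Lemma Theta_q (x : C) : x <> 0 -> Theta q (q * x)%C = (q * x * Theta q x)%C.
Proof.
  intros Hx. assert (Hqx : (q * x)%C <> 0) by now apply Cmult_neq_0.
  rewrite !Theta_psf by auto.
  assert (A : psf thA (q * x)%C = (1 + q * x * psf thA x)%C).
  { destruct (entire_ser thA (q * x)%C thA_bound) as [H _]. apply (Cser_unique _ _ _ H).
    replace (RtoC 1) with (thA 0 * (q * x) ^ 0)%C by (unfold thA; simpl; field; apply C1_nz).
    apply Cser_shift. destruct (entire_ser thA x thA_bound) as [H' _]. apply (Cser_scal (q * x)%C) in H'. revert H'.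
    apply Cser_ext. intros n. unfold thA. rewrite tri_S, Cpow_add_r, !Cpow_mult_l. simpl. field. split; now apply Cpow_neq_0. }
  assert (B : (q * x * psf thB (/ x))%C = (1 + psf thB (/ (q * x)))%C).
  { set (b := fun n => (/ (x ^ S n * q ^ tri (n + 2)))%C). set (b' := fun n => (/ ((q * x) ^ S n * q ^ tri (n + 2)))%C).
    assert (E1 : forall y : C, y <> 0 -> Cser (fun n => / (y ^ S n * q ^ tri (n + 2)))%C (psf thB (/ y))).
    { intros y Hy. destruct (entire_ser thB (/ y)%C thB_bound) as [H _]. apply Clim_S in H. revert H.
      apply tends_ext; [apply eventually_filter|]. intros n. rewrite psum_shift. simpl thB at 1.
      replace (0 * (/ y) ^ 0)%C with (RtoC 0) by ring. rewrite Cplus_0_l. apply psum_ext. intros k _.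
      simpl thB. rewrite Cpow_inv by exact Hy. field. split; apply Cpow_neq_0; auto. }
    assert (H1 := E1 x Hx). assert (H2 := E1 (q * x)%C Hqx).
    apply (Cser_scal (q * x)%C) in H1. apply (Cser_unique _ _ _ H1).
    match goal with |- Cser ?f _ => replace (RtoC 1) with (f 0%nat) end.
    2: { cbv beta. simpl. replace (tri 2) with 1%nat by reflexivity. simpl. field. split; auto. }
    apply Cser_shift. revert H2. apply Cser_ext. intros n.
    replace (S n + 2)%nat with (S (n + 2)) by lia. rewrite tri_S, Cpow_add_r.
    replace (n + 2)%nat with (S (S n)) at 3 by lia. rewrite !Cpow_mult_l. simpl. field. repeat split; auto using Cpow_neq_0. }
  rewrite A. replace (q * x * (psf thA x + psf thB (/ x)))%C with (q * x * psf thA x + q * x * psf thB (/ x))%C by ring.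
  rewrite B. ring.
Qed.

(** *** A lower bound through the triple product *)

Fixpoint prod (f : nat -> C) n : C := match n with O => 1 | S m => (prod f m * f m)%C end.
Fixpoint rprod (f : nat -> R) n : R := match n with O => 1 | S m => rprod f m * f m end.

Lemma rprod_S f n : rprod f (S n) = rprod f n * f n.
Proof. reflexivity. Qed.

Lemma prod_S f n : prod f (S n) = (prod f n * f n)%C.
Proof. reflexivity. Qed.

Lemma rsum_S f n : rsum f (S n) = rsum f n + f n.
Proof. reflexivity. Qed.

Lemma prod_ext f g n : (forall k, (k < n)%nat -> f k = g k) -> prod f n = prod g n.
Proof. induction n; intros H; simpl; [easy|]. rewrite IHn, H; auto. Qed.

Lemma prod_shift f n : prod f (S n) = (f 0%nat * prod (fun k => f (S k)) n)%C.
Proof. induction n; [simpl; ring|]. change (prod f (S (S n))) with (prod f (S n) * f (S n))%C. rewrite IHn. simpl. ring. Qed.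

Lemma prod_add f n m : prod f (n + m) = (prod f n * prod (fun k => f (n + k)%nat) m)%C.
Proof. induction m; [rewrite Nat.add_0_r; simpl; ring|]. rewrite Nat.add_succ_r. simpl. rewrite IHm. ring. Qed.

Lemma prod_rev f n : prod f n = prod (fun k => f (n - 1 - k)%nat) n.
Proof.
  induction n; [easy|]. rewrite (prod_shift (fun k => f (S n - 1 - k)%nat)). simpl prod at 1.
  rewrite IHn, Cmult_comm. f_equal; [f_equal; lia|]. apply prod_ext. intros. f_equal. lia.
Qed.

Lemma prod_Cmod f n : Cmod (prod f n) = rprod (fun k => Cmod (f k)) n.
Proof. induction n; simpl; [apply Cmod_1|]. now rewrite Cmod_mult, IHn. Qed.

Lemma rprod_le f g n : (forall k, (k < n)%nat -> 0 <= f k <= g k) -> 0 <= rprod f n <= rprod g n.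
Proof.
  induction n; intros H; simpl; [lra|]. destruct IHn as [A B]; [auto|]. destruct (H n) as [C D]; [lia|].
  split; [now apply Rmult_le_pos|]. now apply Rmult_le_compat.
Qed.

(** From the rank [n0] on, a product of factors 1 - x_i is at least 1 minus the sum of the x_i; [n0]
    is chosen so that this tail sum is at most 1/2. *)
Lemma rprod_low : exists m0, 0 < m0 /\ forall n, m0 <= rprod (fun i => 1 - t ^ S i) n.
Proof.
  assert (Ht := t_bounds).
  assert (P : forall i, 0 < 1 - t ^ S i).
  { intros i. assert (t ^ S i < 1) by (apply pow_lt_1_compat; [lra|lia]). lra. }
  destruct (pow_lt_1_zero t ltac:(rewrite Rabs_pos_eq; lra) ((1 - t) / 2) ltac:(lra)) as [n0 Hn0].
  specialize (Hn0 n0 ltac:(lia)). rewrite Rabs_pos_eq in Hn0 by (apply pow_le; lra).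
  set (P0 := rprod (fun i => 1 - t ^ S i) n0).
  assert (Pp : forall n, 0 < rprod (fun i => 1 - t ^ S i) n).
  { induction n; simpl; [lra|]. apply Rmult_lt_0_compat; [exact IHn|apply P]. }
  assert (Dec : forall n m, rprod (fun i => 1 - t ^ S i) (n + m) <= rprod (fun i => 1 - t ^ S i) n).
  { intros n m. induction m; [rewrite Nat.add_0_r; lra|]. rewrite Nat.add_succ_r, rprod_S.
    assert (0 < t ^ S (n + m)) by (apply pow_lt; lra). specialize (Pp (n + m)%nat).
    apply Rle_trans with (rprod (fun i => 1 - t ^ S i) (n + m)); [|exact IHm].
    nra. }
  assert (Q : forall m, P0 * (1 - t ^ n0 * rsum (fun i => t ^ i) m) <= rprod (fun i => 1 - t ^ S i) (n0 + m)).
  { induction m.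
    - rewrite Nat.add_0_r. simpl rsum. unfold P0. lra.
    - rewrite Nat.add_succ_r. rewrite rprod_S, rsum_S.
      assert (E : rprod (fun i => 1 - t ^ S i) (n0 + m) * (1 - t ^ S (n0 + m)) =
        rprod (fun i => 1 - t ^ S i) (n0 + m) - rprod (fun i => 1 - t ^ S i) (n0 + m) * (t ^ S (n0 + m))) by ring.
      rewrite E. assert (D := Dec n0 m). fold P0 in D. specialize (Pp (n0 + m)%nat).
      assert (A : rprod (fun i => 1 - t ^ S i) (n0 + m) * (t ^ S (n0 + m)) <= P0 * (t ^ n0 * t ^ m)).
      { change (t ^ S (n0 + m)) with (t * t ^ (n0 + m)). rewrite pow_add. assert (Y : 0 <= t ^ n0 * t ^ m) by (apply Rmult_le_pos; apply pow_le; lra).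
        apply Rmult_le_compat; [lra|apply Rmult_le_pos; lra|exact D|].
        apply Rle_trans with (1 * (t ^ n0 * t ^ m)); [apply Rmult_le_compat_r; lra|lra]. }
      lra. }
  exists (P0 / 2). assert (HP0 : 0 < P0) by apply Pp. split; [lra|]. intros n.
  destruct (le_ge_dec n0 n) as [l|l].
  - replace n with (n0 + (n - n0))%nat by lia. eapply Rle_trans; [|apply Q].
    assert (G := rsum_geom t (n - n0)). assert (0 < t ^ (n - n0)) by (apply pow_lt; lra).
    set (s := rsum (fun i => t ^ i) (n - n0)) in *.
    assert (0 < t ^ n0) by (apply pow_lt; lra).
    assert (Hs : (1 - t) * s <= 1) by lra.
    assert (t ^ n0 * s <= / 2); [|nra].
    assert (0 <= s) by (apply rsum_ge_0; intros; apply pow_le; lra).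
    apply Rle_trans with ((1 - t) / 2 * s); [apply Rmult_le_compat_r; lra|lra].
  - replace n0 with (n + (n0 - n))%nat in P0 by lia. assert (D := Dec n (n0 - n)%nat).
    unfold P0. replace (n + (n0 - n))%nat with n0 in * by lia. unfold P0 in HP0. lra.
Qed.

Lemma rprod_ge_0 f n : (forall k, 0 <= f k) -> 0 <= rprod f n.
Proof. intros H. induction n; simpl; [lra|]. now apply Rmult_le_pos. Qed.

Lemma rprod_up : exists M0, 0 < M0 /\ forall n, rprod (fun i => 1 + t ^ S i) n <= M0.
Proof.
  assert (Ht := t_bounds). exists (exp (/ (1 - t))). split; [apply exp_pos|]. intros n.
  assert (Pt : forall k, 0 <= t ^ k) by (intros; apply pow_le; lra).
  assert (A : rprod (fun i => 1 + t ^ S i) n <= exp (rsum (fun i => t ^ S i) n)).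
  { induction n; [simpl; rewrite exp_0; lra|]. rewrite rprod_S, rsum_S. rewrite exp_plus. apply Rmult_le_compat; auto.
    - apply rprod_ge_0. intros k. specialize (Pt (S k)). lra.
    - specialize (Pt (S n)). lra.
    - apply exp_ineq1_le. }
  eapply Rle_trans; [exact A|].
  assert (B : rsum (fun i => t ^ S i) n <= / (1 - t)).
  { assert (X : rsum (fun i => t ^ S i) n = t * rsum (fun i => t ^ i) n) by (rewrite <- rsum_scal; reflexivity).
    rewrite X.
    assert (G := rsum_geom t n). assert (0 < t ^ n) by (apply pow_lt; lra).
    assert (0 <= rsum (fun i => t ^ i) n) by (apply rsum_ge_0; auto).
    apply Rmult_le_reg_l with (1 - t); [lra|]. rewrite Rinv_r by lra.
    replace ((1 - t) * (t * rsum (fun i => t ^ i) n)) with (t * ((1 - t) * rsum (fun i => t ^ i) n)) by ring.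
    apply Rle_trans with (t * 1); [apply Rmult_le_compat_l|]; lra. }
  destruct B as [B|B]; [apply Rlt_le, exp_increasing, B|rewrite B; lra].
Qed.

(** The q-Pochhammer symbol (p; p)_n for p = 1/q. *)
Definition poch (n : nat) : C := prod (fun i => 1 - p ^ S i)%C n.

Lemma poch_low : exists m0, 0 < m0 /\ forall n, m0 <= Cmod (poch n).
Proof.
  destruct rprod_low as [m0 [H0 H]]. exists m0. split; [exact H0|]. intros n. unfold poch. rewrite prod_Cmod.
  eapply Rle_trans; [apply H|]. apply rprod_le. intros k _. assert (Ht := t_bounds). split.
  - assert (t ^ S k < 1) by (apply pow_lt_1_compat; [lra|lia]). lra.
  - eapply Rle_trans; [|apply Cmod_triangle_inv]. rewrite Cmod_1, Cmod_pow, p_mod. lra.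
Qed.

Lemma poch_up : exists M0, 0 < M0 /\ forall n, Cmod (poch n) <= M0.
Proof.
  destruct rprod_up as [m0 [H0 H]]. exists m0. split; [exact H0|]. intros n. unfold poch. rewrite prod_Cmod.
  eapply Rle_trans; [|apply (H n)]. apply rprod_le. intros k _. split; [apply Cmod_ge_0|].
  eapply Rle_trans; [apply Cmod_sub_le|]. rewrite Cmod_1, Cmod_pow, p_mod. lra.
Qed.

Lemma poch_neq_0 n : poch n <> 0.
Proof. destruct poch_low as [m0 [H0 H]]. apply Cmod_gt_0. specialize (H n). lra. Qed.

(** The q-binomial theorem. The induction uses Pascal's rule for the Gaussian binomials, here with
    the power p^(k(k-1)/2) included: e(m+1, k+1) = e(m, k+1) + p^m e(m, k). *)
Lemma qbinom y m : prod (fun n => 1 + y * p ^ n)%C m =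
  psum (fun k => p ^ tri k * poch m / (poch k * poch (m - k)) * y ^ k)%C (S m).
Proof.
  induction m.
  - simpl. unfold poch; simpl. change (tri 0) with 0%nat. simpl. field.
  - simpl prod. rewrite IHm. clear IHm.
    set (e := fun m k => (p ^ tri k * poch m / (poch k * poch (m - k)))%C).
    change (psum (fun k => e m k * y ^ k) (S m) * (1 + y * p ^ m) = psum (fun k => e (S m) k * y ^ k) (S (S m)))%C.
    rewrite (psum_shift (fun k => e (S m) k * y ^ k)%C (S m)). simpl (psum _ (S m)) at 2.
    assert (E0 : forall n, e n 0%nat = 1%C).
    { intros n. unfold e. rewrite Nat.sub_0_r. change (tri 0) with 0%nat. unfold poch at 2. simpl. field. apply poch_neq_0. }
    assert (E1 : forall k, (k < m)%nat -> e (S m) (S k) = (e m (S k) + p ^ m * e m k)%C).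
    { intros k Hk. unfold e. replace (S m - S k)%nat with (m - k)%nat by lia.
      replace (m - k)%nat with (S (m - S k)) by lia.
      assert (P1 : forall n, poch (S n) = (poch n * (1 - p ^ S n))%C) by (intros; reflexivity).
      assert (N1 : forall n, (1 - p ^ S n)%C <> 0).
      { intros n Hn. apply (poch_neq_0 (S n)). rewrite P1, Hn. ring. }
      rewrite (P1 (m - S k)%nat), (P1 k), (P1 m), tri_S.
      set (j := (m - S k)%nat).
      assert (Em : (p ^ m = p * p ^ j * p ^ k)%C).
      { replace m with (S j + k)%nat by (unfold j; lia). rewrite Cpow_add_r. reflexivity. }
      assert (Nk := poch_neq_0 k). assert (Nj := poch_neq_0 j). assert (Nk' := N1 k). assert (Nj' := N1 j).
      simpl Cpow in *. rewrite Em, !Cpow_add_r. field. auto. }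
    assert (E2 : e (S m) (S m) = (p ^ m * e m m)%C).
    { unfold e. rewrite !Nat.sub_diag, tri_S, Cpow_add_r. unfold poch at 3 6. simpl prod.
      field. split; apply poch_neq_0. }
    rewrite E2, E0.
    rewrite (psum_ext _ (fun k => e m (S k) * y ^ S k + (y * p ^ m) * (e m k * y ^ k))%C m).
    2: { intros k Hk. rewrite E1 by exact Hk. simpl. ring. }
    rewrite psum_plus, psum_scal.
    rewrite Cmult_plus_distr_l, Cmult_1_r. rewrite (psum_shift (fun k => e m k * y ^ k)%C m) at 1.
    rewrite E0. simpl. ring.
Qed.

(** The partial product in Jacobi's triple product, without its factor free of x, which [poch]
    supplies. *)
Definition tprod (N : nat) (x : C) : C :=
  (prod (fun n => 1 + x * p ^ n) N * prod (fun n => 1 + p ^ S n / x) N)%C.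

(** A quotient of Gaussian binomials, normalised to 1 at k = 0. It deforms the terms of the theta
    series into those of its finite form and tends to 1 for fixed k. *)
Definition tratio (N k : nat) : C := (poch N * poch N / (poch (N + k) * poch (N - k)))%C.

Lemma qp_pow n : (q ^ n * p ^ n)%C = 1%C.
Proof. rewrite <- Cpow_mult_l. unfold p. rewrite Cinv_r by exact qn0. apply Cpow_1_l. Qed.

(** Each factor 1 + p^(n+1) / x becomes 1 + x q^(n+1) after multiplication by x q^(n+1). The
    two-sided product thus turns into a single q-binomial product of length 2N at x q^N. *)
Lemma tprod_shift N (x : C) : x <> 0 ->
  (tprod N x * (x ^ N * q ^ tri (S N)))%C = prod (fun n => 1 + (x * q ^ N) * p ^ n)%C (N + N).
Proof.
  intros Hx. rewrite prod_add. unfold tprod.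
  assert (A : prod (fun k => 1 + x * q ^ N * p ^ (N + k))%C N = prod (fun n => 1 + x * p ^ n)%C N).
  { apply prod_ext. intros k _. rewrite Cpow_add_r. replace (x * q ^ N * (p ^ N * p ^ k))%C with (x * (q ^ N * p ^ N) * p ^ k)%C by ring.
    rewrite qp_pow. ring. }
  rewrite A.
  assert (B : forall M, (prod (fun n => 1 + p ^ S n / x) M * (x ^ M * q ^ tri (S M)))%C = prod (fun n => 1 + x * q ^ S n)%C M).
  { induction M; [simpl; change (tri 1) with 0%nat; simpl; ring|].
    rewrite !prod_S, <- IHM. rewrite (tri_S (S M)), Cpow_add_r.
    assert (Q := qp_pow (S M)). simpl Cpow in *.
    set (P0 := prod _ M). set (a := (q * q ^ M)%C) in *. set (b := (p * p ^ M)%C) in *.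
    transitivity (P0 * (x ^ M * q ^ tri (S M)) * (x * a + a * b))%C; [field; exact Hx|]. rewrite Q. ring. }
  assert (B' : prod (fun n => 1 + x * q ^ N * p ^ n)%C N = prod (fun n => 1 + x * q ^ S n)%C N).
  { rewrite prod_rev. apply prod_ext. intros k Hk.
    assert (Q := qp_pow (N - 1 - k)). replace N with (S k + (N - 1 - k))%nat at 1 by lia. rewrite Cpow_add_r.
    replace (x * (q ^ S k * q ^ (N - 1 - k)) * p ^ (N - 1 - k))%C with (x * q ^ S k * (q ^ (N - 1 - k) * p ^ (N - 1 - k)))%C by ring.
    rewrite Q. ring. }
  rewrite B', <- (B N). ring.
Qed.

Lemma p_pow n : (p ^ n)%C = (/ q ^ n)%C.
Proof. unfold p. apply Cpow_inv. exact qn0. Qed.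

(** The finite form of Jacobi's identity: the q-binomial sum of [2 * N + 1] terms is recentred at
    its middle index, the upper half giving the powers of x and the reversed lower half those of
    1/x. *)
Lemma tprod_expand N (x : C) : x <> 0 ->
  tprod N x = (poch (N + N) / (poch N * poch N) *
    (psum (fun k => tratio N k * (x ^ k / q ^ tri k)) (S N) +
     psum (fun k => tratio N (S k) * / (x ^ S k * q ^ tri (k + 2))) N))%C.
Proof.
  intros Hx. assert (X := tprod_shift N x Hx). rewrite qbinom in X.
  assert (NX : (x ^ N * q ^ tri (S N))%C <> 0) by (apply Cmult_neq_0; now apply Cpow_neq_0).
  apply (f_equal (fun z => z / (x ^ N * q ^ tri (S N)))%C) in X.
  replace (tprod N x * (x ^ N * q ^ tri (S N)) / (x ^ N * q ^ tri (S N)))%C with (tprod N x) in X by (field; auto using Cpow_neq_0).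
  rewrite X. replace (S (N + N)) with (N + S N)%nat by lia. rewrite psum_add, psum_rev.
  unfold Cdiv at 1. rewrite Cmult_plus_distr_r, Cmult_plus_distr_l, Cplus_comm. f_equal.
  - rewrite Cmult_comm, <- !psum_scal. apply psum_ext. intros k Hk.
    unfold tratio. replace (N + N - (N + k))%nat with (N - k)%nat by lia.
    assert (T : (N * (N + k) + tri k = tri (N + k) + tri (S N))%nat).
    { rewrite tri_plus, tri_S. assert (H := tri_square N). lia. }
    apply (f_equal (fun n => q ^ n)%C) in T. rewrite !Cpow_add_r in T.
    rewrite p_pow, Cpow_mult_l, <- Cpow_mult_r, Cpow_add_r.
    assert (N1 := poch_neq_0 N). assert (N2 := poch_neq_0 (N + k)). assert (N3 := poch_neq_0 (N - k)).
    assert (N4 := Cpow_neq_0 q (tri k) qn0). assert (N5 := Cpow_neq_0 q (tri (N + k)) qn0). assert (N6 := Cpow_neq_0 q (tri (S N)) qn0).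
    assert (N7 := Cpow_neq_0 x N Hx).
    replace (q ^ (N * (N + k)))%C with (q ^ tri (N + k) * q ^ tri (S N) / q ^ tri k)%C by (rewrite <- T; field; auto).
    field. repeat split; auto.
  - rewrite Cmult_comm, <- !psum_scal. apply psum_ext. intros k Hk.
    unfold tratio. replace (N - S k)%nat with (N - 1 - k)%nat by lia. replace (N + N - (N - 1 - k))%nat with (N + S k)%nat by lia.
    set (j := (N - 1 - k)%nat).
    assert (T : (N * j + tri (k + 2) = tri j + tri (S N))%nat).
    { assert (HN : (S N = j + (k + 2))%nat) by (unfold j; lia). clearbody j. rewrite HN, (tri_plus j).
      assert (H := tri_square j). assert (HN' : (N = j + k + 1)%nat) by lia. rewrite HN' at 1. lia. }
    apply (f_equal (fun n => q ^ n)%C) in T. rewrite !Cpow_add_r in T.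
    rewrite p_pow, Cpow_mult_l, <- Cpow_mult_r.
    assert (N1 := poch_neq_0 N). assert (N2 := poch_neq_0 (N + S k)). assert (N3 := poch_neq_0 j).
    assert (N4 := Cpow_neq_0 q (tri (k + 2)) qn0). assert (N5 := Cpow_neq_0 q (tri j) qn0). assert (N6 := Cpow_neq_0 q (tri (S N)) qn0).
    assert (N7 := Cpow_neq_0 x j Hx). assert (N8 := Cpow_neq_0 x (S k) Hx).
    assert (XN : (x ^ N = x ^ j * x ^ S k)%C) by (rewrite <- Cpow_add_r; f_equal; unfold j; lia).
    rewrite XN.
    replace (q ^ (N * j))%C with (q ^ tri j * q ^ tri (S N) / q ^ tri (k + 2))%C by (rewrite <- T; field; auto).
    field. repeat split; auto.
Qed.
End Theta.

(** Dominated convergence for series whose number of terms grows with [N]: beyond a fixed rank the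
    tail is small uniformly in [N], and the head converges term by term. *)
Lemma tannery (a : nat -> C) l S0 (c : nat -> nat -> C) (s : nat -> nat) rho : Cser a l -> dominated a S0 ->
  0 <= rho -> (forall N, (N <= s N)%nat) -> (forall N k, (k < s N)%nat -> Cmod (c N k) <= rho) ->
  (forall k, Clim (fun N => c N k) 1) ->
  Clim (fun N => psum (fun k => c N k * a k)%C (s N)) l.
Proof.
  intros Hl [b [Hab Hb]] Hrho Hs Hc Hk e He.
  assert (Hb0 : forall n, 0 <= b n) by (intros n; eapply Rle_trans; [apply Cmod_ge_0|apply Hab]).
  assert (Hcv : ex_finite_lim_seq (rsum b)).
  { apply ex_finite_lim_seq_incr with S0; [|exact Hb]. intros n; simpl. specialize (Hb0 n). lra. }
  assert (He4 : 0 < e / (4 * (rho + 1))) by (apply Rdiv_lt_0_compat; lra).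
  apply ex_lim_seq_cauchy_corr in Hcv. destruct (Hcv (mkposreal _ He4)) as [N1 HN1]. simpl in HN1.
  assert (He2 : 0 < e / 4) by lra.
  destruct (Hl _ He2) as [N2 HN2].
  set (K0 := max N1 N2).
  assert (F : Clim (fun N => psum (fun k => c N k * a k)%C K0) (psum a K0)).
  { generalize K0. clear -Hk. intros K0. induction K0; simpl; [apply tends_const, eventually_filter|].
    apply tends_plus; [apply eventually_filter|exact IHK0|].
    apply tends_eq with (1 * a K0)%C; [ring|]. apply tends_mult; [apply eventually_filter|apply Hk|apply tends_const, eventually_filter]. }
  destruct (F _ He2) as [N3 HN3].
  exists (max K0 N3). intros N HN.
  assert (HsN := Hs N). assert (HK : (K0 <= s N)%nat) by lia.
  replace (s N) with (K0 + (s N - K0))%nat by lia. rewrite psum_add.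
  set (m := (s N - K0)%nat).
  assert (T : Cmod (psum (fun k => c N (K0 + k)%nat * a (K0 + k)%nat)%C m) <= rho * (e / (4 * (rho + 1)))).
  { eapply Rle_trans; [apply psum_Cmod_le with (b := fun k => rho * b (K0 + k)%nat)|].
    - intros k Hkm. rewrite Cmod_mult. apply Rmult_le_compat; try apply Cmod_ge_0; [|apply Hab].
      apply Hc. unfold m in Hkm. lia.
    - rewrite rsum_scal. apply Rmult_le_compat_l; [exact Hrho|].
      assert (E : forall m, rsum (fun k => b (K0 + k)%nat) m = rsum b (K0 + m) - rsum b K0).
      { clear. induction m; simpl; [rewrite Nat.add_0_r; ring|]. rewrite Nat.add_succ_r. simpl. rewrite IHm. ring. }
      rewrite E. eapply Rle_trans; [apply Rle_abs|]. apply Rlt_le, HN1; unfold K0; lia. }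
  assert (T' : rho * (e / (4 * (rho + 1))) <= e / 4).
  { apply Rmult_le_reg_r with (4 * (rho + 1)); [lra|]. unfold Rdiv. field_simplify; [|lra]. nra. }
  specialize (HN2 K0 ltac:(unfold K0; lia)). specialize (HN3 N ltac:(lia)).
  match goal with |- Cmod (?A + ?B - l)%C < e =>
    replace (A + B - l)%C with ((A - psum a K0) + (psum a K0 - l) + B)%C by ring end.
  eapply Rle_lt_trans; [apply Cmod_triangle|].
  eapply Rle_lt_trans; [apply Rplus_le_compat_r, Cmod_triangle|]. lra.
Qed.

Lemma tends_ge {T : Type} (F : (T -> Prop) -> Prop) {FF : ProperFilter F} (f : T -> C) l B :
  F (fun x => B <= Cmod (f x)) -> tends F f l -> B <= Cmod l.
Proof.
  intros HB Hf. apply le_epsilon. intros e He.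
  destruct (filter_ex _ (filter_and _ _ HB (Hf e He))) as [x [H1 H2]].
  generalize (Cmod_triangle_inv (f x) l). lra.
Qed.

Section Theta2.
Variables q lq : C.
Hypothesis hq : 1 < Cmod q.
Hypothesis hlq : Cexp lq = q.
Let L := ln (Cmod q).
Let t := / Cmod q.
Let p := (/ q)%C.
Let qn0 := q_neq_0 q hq.

Lemma tratio_lim k : Clim (fun N => tratio q N k) 1.
Proof.
  assert (EF := eventually_filter).
  assert (Ht := t_bounds q hq). fold t in Ht.
  assert (P0 : forall m, Clim (fun N => (p ^ (N + m))%C) 0).
  { intros m. apply (tends_squeeze _ _ (fun N => t ^ N)).
    - apply filter_forall. intros N. replace (p ^ (N + m) - 0)%C with (p ^ (N + m))%C by ring.
      rewrite Cmod_pow, pow_add. unfold p. rewrite (p_mod q hq). fold t.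
      assert (0 <= t ^ N) by (apply pow_le; lra). assert (t ^ m <= 1) by (rewrite <- (pow1 m); apply pow_incr; lra).
      assert (0 <= t ^ m) by (apply pow_le; lra). nra.
    - intros e He. destruct (pow_lt_1_zero t ltac:(rewrite Rabs_pos_eq; lra) e He) as [N0 HN0]. exists N0. intros n Hn.
      specialize (HN0 n ltac:(lia)). generalize (Rle_abs (t ^ n)). lra. }
  assert (A : forall k, Clim (fun N => poch q (N + k) / poch q N)%C 1).
  { induction k0.
    - apply tends_ext with (fun _ => RtoC 1); [apply EF| |apply tends_const, EF]. intros N. rewrite Nat.add_0_r. field. apply poch_neq_0, hq.
    - apply tends_ext with (fun N => poch q (N + k0) / poch q N * (1 - p ^ (N + S k0)))%C; [apply EF| |].
      + intros N. rewrite Nat.add_succ_r. change (poch q (S (N + k0))) with (poch q (N + k0) * (1 - (/ q) ^ S (N + k0)))%C. fold p. field. apply poch_neq_0, hq.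
      + apply tends_eq with (1 * (1 - 0))%C; [ring|]. apply tends_mult; [apply EF|exact IHk0|].
        apply tends_minus; [apply EF|apply tends_const, EF|apply P0]. }
  assert (B : Clim (fun N => poch q (N - k) / poch q N)%C 1).
  { assert (B' : Clim (fun N => / (poch q (N + k) / poch q N))%C 1).
    { apply tends_eq with (/ 1)%C; [field|]. apply tends_inv; [apply EF| |apply A]. apply C1_nz. }
    intros e He. destruct (B' e He) as [N0 HN0]. exists (N0 + k)%nat. intros n Hn.
    specialize (HN0 (n - k)%nat ltac:(lia)). replace (n - k + k)%nat with n in HN0 by lia.
    replace (poch q (n - k) / poch q n)%C with (/ (poch q n / poch q (n - k)))%C; [exact HN0|]. field. split; apply poch_neq_0, hq. }
  apply tends_ext with (fun N => / ((poch q (N + k) / poch q N) * (poch q (N - k) / poch q N)))%C; [apply EF| |].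
  - intros N. unfold tratio. field. repeat split; apply poch_neq_0, hq.
  - apply tends_eq with (/ (1 * 1))%C; [field|]. apply tends_inv; [apply EF| |apply tends_mult; [apply EF|apply A|exact B]].
    rewrite Cmult_1_l. apply C1_nz.
Qed.

Lemma tratio_bound : exists rho, 0 <= rho /\ forall N k, Cmod (tratio q N k) <= rho.
Proof.
  destruct (poch_low q hq) as [m0 [H0 H]]. destruct (poch_up q hq) as [M0 [G0 G]].
  exists (M0 * M0 * / (m0 * m0)). split; [apply Rmult_le_pos; [nra|]; apply Rlt_le, Rinv_0_lt_compat; nra|].
  intros N k. unfold tratio. assert (N0 := poch_neq_0 q hq).
  rewrite Cmod_div, !Cmod_mult by (apply Cmult_neq_0; apply N0).
  assert (Q := fun n => Cmod_ge_0 (poch q n)).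
  apply Rmult_le_compat.
  - apply Rmult_le_pos; apply Q.
  - apply Rlt_le, Rinv_0_lt_compat. generalize (H (N + k)%nat) (H (N - k)%nat). intros. nra.
  - apply Rmult_le_compat; auto.
  - apply Rinv_le_contravar; [nra|]. apply Rmult_le_compat; auto; lra.
Qed.

(** Jacobi's triple product as a limit. The prefactor cancels the one of [tprod_expand], so that
    what remains is the theta series weighted by [tratio]. *)
Lemma Theta_tprod (x : C) : x <> 0 ->
  Clim (fun N => poch q N * poch q N / poch q (N + N) * tprod q N x)%C (Theta q x).
Proof.
  intros Hx. assert (EF := eventually_filter). assert (N0 := poch_neq_0 q hq).
  apply tends_ext with (fun N => psum (fun k => tratio q N k * (x ^ k / q ^ tri k)) (S N) +
     psum (fun k => tratio q N (S k) * / (x ^ S k * q ^ tri (k + 2))) N)%C; [apply EF| |].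
  { intros N. rewrite (tprod_expand q hq N x Hx). field. auto. }
  rewrite (Theta_psf q hq x Hx). destruct tratio_bound as [rho [Hrho Hr]].
  apply tends_plus; [apply EF| |].
  - destruct (entire_ser (thA q) x (thA_bound q hq)) as [S1 [S0 D]].
    apply (tannery (fun k => x ^ k / q ^ tri k)%C _ S0 (tratio q) S rho); auto.
    + revert S1. apply Cser_ext. intros n. unfold thA, Cdiv. ring.
    + destruct D as [b [D1 D2]]. exists b. split; [|exact D2]. intros n. specialize (D1 n).
      replace (x ^ n / q ^ tri n)%C with (thA q n * x ^ n)%C by (unfold thA, Cdiv; ring). exact D1.
    + apply tratio_lim.
  - destruct (entire_ser (thB q) (/ x)%C (thB_bound q hq)) as [S1 [S0 D]].
    assert (E : forall k, (/ (x ^ S k * q ^ tri (k + 2)))%C = (thB q (S k) * (/ x) ^ S k)%C).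
    { intros k. simpl thB. rewrite Cpow_inv by exact Hx. field. split; apply Cpow_neq_0; auto. }
    apply (tannery (fun k => / (x ^ S k * q ^ tri (k + 2)))%C _ S0 (fun N k => tratio q N (S k)) (fun N => N) rho); auto.
    + apply Clim_S in S1. revert S1. apply tends_ext; [apply EF|]. intros n. rewrite psum_shift.
      simpl (thB q 0). replace (0 * (/ x) ^ 0)%C with (RtoC 0) by ring. rewrite Cplus_0_l.
      apply psum_ext. intros k _. now rewrite E.
    + destruct D as [b [D1 D2]]. exists (fun n => b (S n)). split; [intros n; rewrite E; apply D1|].
      intros n. apply Rle_trans with (rsum b (S n)); [|apply D2].
      assert (X : rsum b (S n) = b 0%nat + rsum (fun n => b (S n)) n).
      { clear. induction n; [simpl; ring|]. rewrite rsum_S, IHn. simpl. ring. }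
      rewrite X. assert (0 <= b 0%nat) by (eapply Rle_trans; [apply Cmod_ge_0|apply D1]). lra.
    + intros k. apply tratio_lim.
Qed.

(** For 1 <= |x| <= |q| only the factors 1 + x and 1 + x/q can be small; all the others are at least
    1 - t^(k+1) in modulus, and their products are bounded below. *)
Lemma Theta_annulus : exists c, 0 < c /\ forall x, 1 <= Cmod x <= Cmod q ->
  c * (Cmod (1 + x)%C * Cmod (1 + x / q)%C) <= Cmod (Theta q x).
Proof.
  destruct (poch_low q hq) as [m0 [H0 H]]. destruct (poch_up q hq) as [M0 [G0 G]].
  destruct (rprod_low q hq) as [m1 [H1 Hm1]]. fold t in Hm1.
  assert (Ht := t_bounds q hq). fold t in Ht.
  exists (m0 * m0 * / M0 * (m1 * m1)).
  assert (Pc : 0 < m0 * m0 * / M0) by (apply Rmult_lt_0_compat; [nra|now apply Rinv_0_lt_compat]).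
  split; [apply Rmult_lt_0_compat; nra|]. intros x [Hx1 Hx2].
  assert (Hx : x <> 0) by (apply Cmod_gt_0; lra).
  apply (tends_ge eventually (fun N => poch q N * poch q N / poch q (N + N) * tprod q N x)%C); [|now apply Theta_tprod].
  exists 2%nat. intros N HN.
  assert (N0 := poch_neq_0 q hq).
  rewrite Cmod_mult, Rmult_assoc. apply Rmult_le_compat; [lra| | |].
  - apply Rmult_le_pos; [nra|]. apply Rmult_le_pos; apply Cmod_ge_0.
  - rewrite Cmod_div, Cmod_mult by apply N0. apply Rmult_le_compat; [nra| | |].
    + apply Rlt_le, Rinv_0_lt_compat; lra.
    + apply Rmult_le_compat; auto; lra.
    + apply Rinv_le_contravar; [apply Cmod_gt_0, N0|auto].
  - unfold tprod. rewrite Cmod_mult.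
    replace (m1 * m1 * (Cmod (1 + x)%C * Cmod (1 + x / q)%C)) with ((Cmod (1 + x)%C * Cmod (1 + x / q)%C * m1) * m1) by ring.
    apply Rmult_le_compat; [|lra| |].
    + apply Rmult_le_pos; [|lra]. apply Rmult_le_pos; apply Cmod_ge_0.
    + replace N with (2 + (N - 2))%nat by lia. rewrite prod_add. simpl (prod _ 2).
      rewrite !Cmod_mult, Cmod_1, Rmult_1_l.
      replace (1 + x * 1)%C with (1 + x)%C by ring. replace (1 + x * (/ q * 1))%C with (1 + x / q)%C by (unfold Cdiv; ring).
      apply Rmult_le_compat_l; [apply Rmult_le_pos; apply Cmod_ge_0|].
      rewrite prod_Cmod. eapply Rle_trans; [apply (Hm1 (N - 2)%nat)|]. apply rprod_le. intros k _. split.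
      * assert (t ^ S k < 1) by (apply pow_lt_1_compat; [lra|lia]). lra.
      * replace (1 + x * (/ q) ^ (2 + k))%C with (1 - (- x * (/ q) ^ (2 + k)))%C by ring.
        eapply Rle_trans; [|apply Cmod_triangle_inv]. rewrite Cmod_1, Cmod_mult, Cmod_opp, Cmod_pow, (p_mod q hq). fold t.
        assert (E : t ^ (2 + k) * Cmod q = t ^ S k) by (simpl; unfold t; field; lra).
        assert (0 <= t ^ (2 + k)) by (apply pow_le; lra). nra.
    + rewrite prod_Cmod. eapply Rle_trans; [apply (Hm1 N)|]. apply rprod_le. intros k _. split.
      * assert (t ^ S k < 1) by (apply pow_lt_1_compat; [lra|lia]). lra.
      * replace (1 + (/ q) ^ S k / x)%C with (1 - (- ((/ q) ^ S k / x)))%C by ring.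
        eapply Rle_trans; [|apply Cmod_triangle_inv]. rewrite Cmod_1, Cmod_opp, Cmod_div, Cmod_pow, (p_mod q hq) by exact Hx. fold t.
        assert (0 <= t ^ S k) by (apply pow_le; lra).
        assert (/ Cmod x <= 1) by (rewrite <- Rinv_1; apply Rinv_le_contravar; lra).
        assert (0 < / Cmod x) by (apply Rinv_0_lt_compat; lra). unfold Rdiv. nra.
Qed.

(** The exponent is chosen so that [gauss] transforms under x -> q x exactly as the modulus of
    [Theta]; their quotient is then invariant. *)
Definition gauss (x : C) : R := exp (ln (Cmod x) ^ 2 / (2 * L) + ln (Cmod x) / 2).

Lemma gauss_q (x : C) : x <> 0 -> gauss (q * x)%C = Cmod q * Cmod x * gauss x.
Proof.
  intros Hx. assert (P := proj1 (Cmod_gt_0 x) Hx). assert (HL := L_pos q hq). fold L in HL. unfold gauss.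
  rewrite Cmod_mult, ln_mult by lra. fold L. set (X := ln (Cmod x)).
  rewrite (Cmod_q_exp q hq). fold L. rewrite <- (exp_ln (Cmod x)) by exact P. fold X.
  rewrite <- !exp_plus. f_equal. field. lra.
Qed.

Lemma qpow_0 : qpow lq 0 = 1%C.
Proof. unfold qpow. rewrite <- Cexp_0. f_equal. ring. Qed.

Lemma qpow_plus a b : qpow lq (a + b) = (qpow lq a * qpow lq b)%C.
Proof. unfold qpow. rewrite <- Cexp_plus. f_equal. rewrite RtoC_plus. ring. Qed.

Lemma qpow_1 : qpow lq 1 = q.
Proof. unfold qpow. rewrite <- hlq. f_equal. ring. Qed.

Lemma qpow_neq_0 a : qpow lq a <> RtoC 0.
Proof. apply Cexp_neq_0. Qed.

Lemma qpow_nat n : qpow lq (INR n) = (q ^ n)%C.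
Proof. induction n; [apply qpow_0|]. rewrite S_INR, qpow_plus, IHn, qpow_1. simpl. ring. Qed.

Lemma qpow_opp a : qpow lq (- a) = (/ qpow lq a)%C.
Proof.
  assert (H := qpow_plus (- a) a). rewrite Rplus_opp_l, qpow_0 in H.
  replace (qpow lq (- a)) with (qpow lq (- a) * qpow lq a / qpow lq a)%C by (field; apply qpow_neq_0).
  rewrite <- H. field. apply qpow_neq_0.
Qed.

Lemma Cmod_qpow a : Cmod (qpow lq a) = exp (a * L).
Proof. unfold qpow. rewrite Cmod_Cexp. unfold L. rewrite <- (Re_lq q lq hlq). f_equal. unfold Re. simpl. ring. Qed.

(** The bound on the fundamental annulus is carried to every nonzero x by powers of q, the quotient
    of |Theta| by [gauss] being invariant. The exponent [r] records the power that brings x back to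
    the annulus, where the two factors that may vanish are read. *)
Lemma Theta_lower_ex : exists c, 0 < c /\ forall x : C, x <> 0 -> exists r,
  c * (Cmod (1 + x * qpow lq r)%C * Cmod (1 + x * qpow lq (r - 1))%C) * gauss x <= Cmod (Theta q x).
Proof.
  assert (HL := L_pos q hq). fold L in HL.
  (* The factor exp (- L) compensates [gauss], which is at most exp L on the annulus. *)
  destruct Theta_annulus as [c [Hc H]]. exists (c * exp (- L)). split; [apply Rmult_lt_0_compat; [exact Hc|apply exp_pos]|].
  set (P := fun x => exists r, c * exp (- L) * (Cmod (1 + x * qpow lq r)%C * Cmod (1 + x * qpow lq (r - 1))%C) * gauss x <= Cmod (Theta q x)).
  assert (Base : forall x, 1 <= Cmod x <= Cmod q -> P x).
  { intros x Hx. exists 0. rewrite qpow_0. replace (0 - 1) with (- (1)) by ring. rewrite qpow_opp, qpow_1.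
    replace (x * 1)%C with x by ring. replace (x * / q)%C with (x / q)%C by reflexivity.
    eapply Rle_trans; [|apply (H x Hx)].
    assert (G : exp (- L) * gauss x <= 1).
    { unfold gauss. rewrite <- exp_plus, <- exp_0. set (X := ln (Cmod x)).
      assert (X1 : 0 <= X) by (unfold X; rewrite <- ln_1; destruct (proj1 Hx) as [h|h]; [apply Rlt_le, ln_increasing; lra|rewrite <- h; lra]).
      assert (X2 : X <= L) by (unfold X, L; destruct (proj2 Hx) as [h|h]; [apply Rlt_le, ln_increasing; lra|rewrite <- h; lra]).
      assert (E : - L + (X ^ 2 / (2 * L) + X / 2) <= 0).
      { assert (X ^ 2 / (2 * L) <= X / 2); [|lra]. apply Rmult_le_reg_r with (2 * L); [lra|].
        unfold Rdiv. rewrite Rmult_assoc, Rinv_l by lra. nra. }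
      destruct E as [E|E]; [apply Rlt_le, exp_increasing, E|rewrite E; lra]. }
    assert (0 <= c * (Cmod (1 + x)%C * Cmod (1 + x / q)%C)).
    { apply Rmult_le_pos; [lra|]. apply Rmult_le_pos; apply Cmod_ge_0. }
    replace (c * exp (- L) * (Cmod (1 + x)%C * Cmod (1 + x / q)%C) * gauss x) with
      (c * (Cmod (1 + x)%C * Cmod (1 + x / q)%C) * (exp (- L) * gauss x)) by ring. nra. }
  assert (Up : forall x : C, x <> 0 -> P x -> P (q * x)%C).
  { intros x Hx [r Hr]. exists (r - 1). rewrite (Theta_q q hq x Hx), (gauss_q x Hx), !Cmod_mult.
    replace (q * x * qpow lq (r - 1))%C with (x * qpow lq r)%C
      by (replace r with ((r - 1) + 1) at 1 by ring; rewrite qpow_plus, qpow_1; ring).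
    replace (q * x * qpow lq (r - 1 - 1))%C with (x * qpow lq (r - 1))%C
      by (replace (r - 1) with ((r - 1 - 1) + 1) at 1 by ring; rewrite qpow_plus, qpow_1; ring).
    assert (0 <= Cmod q * Cmod x) by (apply Rmult_le_pos; apply Cmod_ge_0).
    match goal with |- ?A * (?B * ?D) <= ?B * ?E => replace (A * (B * D)) with (B * (A * D)) by ring end.
    now apply Rmult_le_compat_l. }
  assert (Down : forall x : C, x <> 0 -> P (q * x)%C -> P x).
  { intros x Hx [r Hr]. exists (r + 1). rewrite (Theta_q q hq x Hx), (gauss_q x Hx), !Cmod_mult in Hr.
    replace (q * x * qpow lq r)%C with (x * qpow lq (r + 1))%C in Hr by (rewrite qpow_plus, qpow_1; ring).
    replace (q * x * qpow lq (r - 1))%C with (x * qpow lq (r + 1 - 1))%C in Hr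
      by (replace (r + 1 - 1) with ((r - 1) + 1) by ring; rewrite qpow_plus, qpow_1; ring).
    assert (0 < Cmod q * Cmod x) by (apply Rmult_lt_0_compat; [lra|now apply Cmod_gt_0]).
    match goal with |- ?A * ?D <= ?E => apply Rmult_le_reg_l with (Cmod q * Cmod x); [lra|];
      replace (Cmod q * Cmod x * (A * D)) with (A * (Cmod q * Cmod x * D)) by ring end. exact Hr. }
  assert (Up' : forall n (x : C), x <> 0 -> P x -> P (q ^ n * x)%C).
  { induction n; intros x Hx Px; simpl; [now rewrite Cmult_1_l|].
    replace (q * q ^ n * x)%C with (q * (q ^ n * x))%C by ring. apply Up; auto. apply Cmult_neq_0; auto. now apply Cpow_neq_0. }
  assert (Down' : forall n (x : C), x <> 0 -> P (q ^ n * x)%C -> P x).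
  { induction n; intros x Hx Px; simpl in Px; [now rewrite Cmult_1_l in Px|].
    apply IHn; auto. apply Down; [apply Cmult_neq_0; auto; now apply Cpow_neq_0|].
    replace (q * (q ^ n * x))%C with (q * q ^ n * x)%C by ring. exact Px. }
  assert (Big : forall y, 1 <= Cmod y -> exists n x, 1 <= Cmod x <= Cmod q /\ y = (q ^ n * x)%C).
  { intros y Hy. destruct (nfloor_ex (ln (Cmod y) / L)) as [n [Hn1 Hn2]].
    { apply Rmult_le_pos; [|apply Rlt_le, Rinv_0_lt_compat; lra]. rewrite <- ln_1. destruct Hy as [h|h]; [apply Rlt_le, ln_increasing; lra|rewrite <- h; lra]. }
    exists n, (y / q ^ n)%C. assert (Nq := Cpow_neq_0 q n qn0). split; [|field; exact Nq].
    rewrite Cmod_div, Cmod_pow, (Cmod_q_exp q hq) by exact Nq. fold L.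
    rewrite (exp_nat L n), <- (exp_ln (Cmod y)) by lra. unfold Rdiv. rewrite <- exp_Ropp, <- exp_plus.
    assert (A1 : INR n * L <= ln (Cmod y)).
    { apply Rmult_le_compat_r with (r := L) in Hn1; [|lra]. unfold Rdiv in Hn1. rewrite Rmult_assoc, Rinv_l in Hn1 by lra. lra. }
    assert (A2 : ln (Cmod y) < (INR n + 1) * L).
    { apply Rmult_lt_compat_r with (r := L) in Hn2; [|lra]. unfold Rdiv in Hn2. rewrite Rmult_assoc, Rinv_l in Hn2 by lra. lra. }
    split.
    - rewrite <- exp_0. assert (E : 0 <= ln (Cmod y) + - (INR n * L)) by lra.
      destruct E as [E|E]; [apply Rlt_le, exp_increasing, E|rewrite <- E; lra].
    - apply Rlt_le, exp_increasing. lra. }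
  intros x Hx. change (P x). destruct (Rle_dec 1 (Cmod x)) as [l|l].
  - destruct (Big x l) as [n [y [Hy ->]]]. apply Up'; [apply Cmod_gt_0; lra|]. now apply Base.
  - assert (Px := proj1 (Cmod_gt_0 x) Hx).
    (* Chosen so that (n + 1) L |x| > 1; since exp y >= y, the point q^(n+1) x then lies outside the
       unit disc. *)
    destruct (nfloor_ex (/ (Cmod x * L))) as [n [_ Hn]]; [apply Rlt_le, Rinv_0_lt_compat; nra|].
    apply (Down' (S n)); [exact Hx|].
    assert (Hbig : 1 <= Cmod (q ^ S n * x)%C).
    { rewrite Cmod_mult, Cmod_pow, (Cmod_q_exp q hq). fold L. rewrite (exp_nat L (S n)), S_INR.
      apply Rle_trans with ((INR n + 1) * L * Cmod x).
      - apply Rmult_lt_compat_r with (r := Cmod x * L) in Hn; [|nra]. rewrite Rinv_l in Hn by nra. lra.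
      - apply Rmult_le_compat_r; [lra|]. generalize (exp_ineq1_le ((INR n + 1) * L)). lra. }
    destruct (Big _ Hbig) as [m [y [Hy Ey]]]. rewrite Ey. apply Up'; [apply Cmod_gt_0; lra|]. now apply Base.
Qed.

Lemma Theta_lower : exists c, 0 < c /\ forall (d : R) (x : C), 0 < d -> x <> 0 -> (forall r, d <= Cmod (1 + x * qpow lq r)%C) ->
  c * (d * d) * gauss x <= Cmod (Theta q x).
Proof.
  destruct Theta_lower_ex as [c [Hc H]]. exists c. split; [exact Hc|]. intros d x Hd Hx Hr.
  destruct (H x Hx) as [r Hr']. eapply Rle_trans; [|exact Hr']. apply Rmult_le_compat_r; [apply Rlt_le, exp_pos|].
  apply Rmult_le_compat_l; [lra|]. apply Rmult_le_compat; auto; lra.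
Qed.

Lemma Theta_neq_0 (x : C) : x <> 0 -> (forall r, (1 + x * qpow lq r)%C <> 0) -> Theta q x <> 0.
Proof.
  intros Hx Hr. destruct Theta_lower_ex as [c [Hc H]]. destruct (H x Hx) as [r H']. apply Cmod_gt_0.
  eapply Rlt_le_trans; [|exact H']. apply Rmult_lt_0_compat; [|apply exp_pos]. apply Rmult_lt_0_compat; [exact Hc|].
  apply Rmult_lt_0_compat; apply Cmod_gt_0; auto.
Qed.
End Theta2.

(** ** Improper integrals *)

Section Improper.
Variable L : R.
Hypothesis HL : 0 < L.

(** All integrands are compared with 1 / (1 + (L s + v)^2), whose primitive is this arctangent. For
    x = q^s u / t and v = ln |u / t|, the quantity L s + v is ln |x|, so the comparison constant
    does not depend on u and t. *)
Let hh (v s : R) := atan (L * s + v) / L.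
Let dd (v s : R) := / (1 + (L * s + v) ^ 2).

Lemma dd_pos v s : 0 < dd v s.
Proof. unfold dd. apply Rinv_0_lt_compat. generalize (pow2_ge_0 (L * s + v)). lra. Qed.

Lemma hh_RInt v a b : is_RInt (dd v) a b (hh v b - hh v a).
Proof.
  apply (is_RInt_derive (V := R_CompleteNormedModule) (hh v) (dd v)).
  - intros s _. unfold hh, dd. auto_derive; [easy|]. field. split; [|lra].
    apply Rgt_not_eq. generalize (pow2_ge_0 (L * s + v)). simpl. lra.
  - intros s _. apply (ex_derive_continuous (K := R_AbsRing) (V := R_NormedModule)). unfold dd. auto_derive.
    generalize (pow2_ge_0 (L * s + v)). simpl. lra.
Qed.

Lemma hh_bound v s : Rabs (hh v s) <= PI / (2 * L).
Proof.
  unfold hh. generalize (atan_bound (L * s + v)). intros [A B]. apply Rabs_le.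
  replace (PI / (2 * L)) with (PI / 2 / L) by (field; lra).
  assert (0 < / L) by now apply Rinv_0_lt_compat. unfold Rdiv in *. split; nra.
Qed.

Lemma hh_incr v a b : a <= b -> hh v a <= hh v b.
Proof.
  intros H. assert (G : 0 <= hh v b - hh v a); [|lra].
  apply (is_RInt_ge_0 (dd v) a b); [exact H|apply hh_RInt|]. intros s _. apply Rlt_le, dd_pos.
Qed.

(** The primitive is monotone and bounded, hence within [e] of its supremum and infimum outside a
    bounded interval. *)
Lemma hh_tail v e : 0 < e -> exists N : nat, forall x, INR N <= x ->
  hh v x - hh v (INR N) <= e /\ hh v (- INR N) - hh v (- x) <= e.
Proof.
  intros He.
  assert (B := hh_bound v).
  destruct (completeness (fun y => exists s, y = hh v s)) as [u [U1 U2]].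
  { exists (PI / (2 * L)). intros y [s ->]. generalize (B s) (Rle_abs (hh v s)). lra. }
  { exists (hh v 0). now exists 0. }
  destruct (completeness (fun y => exists s, y = - hh v s)) as [w [W1 W2]].
  { exists (PI / (2 * L)). intros y [s ->]. generalize (B s) (Rle_abs (- hh v s)). rewrite Rabs_Ropp. lra. }
  { exists (- hh v 0). now exists 0. }
  assert (E1 : exists s, u - e <= hh v s).
  { destruct (Classical_Prop.classic (exists s, u - e <= hh v s)) as [h|h]; [exact h|exfalso].
    assert (u <= u - e); [|lra]. apply U2. intros y [s ->]. apply Rnot_lt_le. intros G. apply h. exists s. lra. }
  assert (E2 : exists s, w - e <= - hh v s).
  { destruct (Classical_Prop.classic (exists s, w - e <= - hh v s)) as [h|h]; [exact h|exfalso].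
    assert (w <= w - e); [|lra]. apply W2. intros y [s ->]. apply Rnot_lt_le. intros G. apply h. exists s. lra. }
  destruct E1 as [s1 E1], E2 as [s2 E2].
  destruct (nfloor_ex (Rabs s1 + Rabs s2)) as [n [_ Hn]]; [generalize (Rabs_pos s1) (Rabs_pos s2); lra|].
  exists (S n). intros x Hx. rewrite S_INR in *.
  assert (A1 := Rle_abs s1). assert (A2 := Rle_abs (- s2)). rewrite Rabs_Ropp in A2.
  assert (P1 := Rabs_pos s1). assert (P2 := Rabs_pos s2).
  split.
  - assert (hh v x <= u) by (apply U1; now exists x). assert (hh v s1 <= hh v (INR n + 1)) by (apply hh_incr; lra). lra.
  - assert (- hh v (- x) <= w) by (apply W1; now exists (- x)). assert (hh v (- (INR n + 1)) <= hh v s2) by (apply hh_incr; lra). lra.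
Qed.

Definition Gdom (v : R) (A : R) (f : R -> C) : Prop :=
  (forall s, rcont f s) /\ forall s, Cmod (f s) <= A / (1 + (L * s + v) ^ 2).

(** Integrals over the line as limits over the intervals [-n, n], together with a domination. The
    domination makes the symmetric limit a genuine improper integral ([Gint_RInt_gen]), while limits
    of sequences are easier to combine. *)
Definition Gint (v : R) (f : R -> C) (l : C) : Prop :=
  (exists A, Gdom v A f) /\ Clim (fun n => CI f (- INR n) (INR n)) l.

Lemma CI_all f a b : (forall s, rcont f s) -> isI f a b (CI f a b).
Proof. intros H. apply CI_correct. apply isI_ex. auto. Qed.

Lemma Gdom_CI v A f a b : Gdom v A f -> a <= b -> Cmod (CI f a b) <= A * (hh v b - hh v a).
Proof.
  intros [H1 H2] Hab.
  apply (isI_norm_le f (fun s => A * dd v s) a b); [exact Hab| |now apply CI_all|].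
  - intros s _. apply H2.
  - apply (is_RInt_scal (V := R_NormedModule)). apply hh_RInt.
Qed.

Lemma CI_Chasles f a b c : (forall s, rcont f s) -> CI f a c = (CI f a b + CI f b c)%C.
Proof. intros H. apply CI_eq. apply (isI_Chasles _ a b c); now apply CI_all. Qed.

Lemma Gdom_A v A f : Gdom v A f -> 0 <= A.
Proof.
  intros [_ H]. specialize (H 0). assert (P := Cmod_ge_0 (f 0)).
  assert (D := dd_pos v 0). unfold dd in D. unfold Rdiv in H.
  apply Rmult_le_reg_r with (/ (1 + (L * 0 + v) ^ 2)); [exact D|]. lra.
Qed.

Lemma Gint_ex v A f : Gdom v A f -> exists l, Gint v f l.
Proof.
  intros H. assert (HA := Gdom_A v A f H).
  destruct (Clim_cauchy (fun n => CI f (- INR n) (INR n))) as [l Hl].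
  2: { exists l. split; [now exists A|exact Hl]. }
  intros e He. assert (He' : 0 < e / (8 * (A + 1))) by (apply Rdiv_lt_0_compat; lra).
  destruct (hh_tail v _ He') as [N HN].
  assert (G : forall n, (N <= n)%nat -> Cmod (CI f (- INR n) (INR n) - CI f (- INR N) (INR N))%C <= e / 4).
  { intros n Hn. apply le_INR in Hn. destruct (HN _ Hn) as [T1 T2]. destruct H as [H1 H2].
    rewrite (CI_Chasles f (- INR n) (- INR N) (INR n) H1), (CI_Chasles f (- INR N) (INR N) (INR n) H1).
    match goal with |- Cmod (?a + (?b + ?c) - ?b)%C <= _ => replace (a + (b + c) - b)%C with (a + c)%C by ring end.
    eapply Rle_trans; [apply Cmod_triangle|].
    assert (B1 := Gdom_CI v A f (- INR n) (- INR N) (conj H1 H2) ltac:(lra)).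
    assert (B2 := Gdom_CI v A f (INR N) (INR n) (conj H1 H2) ltac:(lra)).
    apply Rle_trans with (A * (e / (8 * (A + 1))) + A * (e / (8 * (A + 1)))).
    - apply Rplus_le_compat; (eapply Rle_trans; [eassumption|]); apply Rmult_le_compat_l; auto.
    - apply Rmult_le_reg_r with (8 * (A + 1)); [lra|].
      replace ((A * (e / (8 * (A + 1))) + A * (e / (8 * (A + 1)))) * (8 * (A + 1))) with (2 * A * e) by (field; lra). nra. }
  exists N. intros n m Hn Hm.
  replace (CI f (- INR n) (INR n) - CI f (- INR m) (INR m))%C with
    ((CI f (- INR n) (INR n) - CI f (- INR N) (INR N)) - (CI f (- INR m) (INR m) - CI f (- INR N) (INR N)))%C by ring.
  eapply Rle_lt_trans; [apply Cmod_sub_le|]. generalize (G n Hn) (G m Hm). lra.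
Qed.

Lemma Gint_bound v A f l : Gint v f l -> (forall s, Cmod (f s) <= A / (1 + (L * s + v) ^ 2)) -> Cmod l <= A * (PI / L).
Proof.
  intros [[A' [H1 _]] Hl] H2. assert (HA := Gdom_A v A f (conj H1 H2)).
  apply (Clim_le (fun n => CI f (- INR n) (INR n))); [|exact Hl]. intros n.
  eapply Rle_trans; [apply (Gdom_CI v A f); [now split|generalize (pos_INR n); lra]|].
  apply Rmult_le_compat_l; [exact HA|].
  assert (B1 := hh_bound v (INR n)). assert (B2 := hh_bound v (- INR n)).
  assert (C1 := Rle_abs (hh v (INR n))). assert (C2' := Rle_abs (- hh v (- INR n))). rewrite Rabs_Ropp in C2'.
  replace (PI / L) with (PI / (2 * L) + PI / (2 * L)) by (field; lra). lra.
Qed.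

Lemma Gint_RInt_gen v f l : Gint v f l ->
  RInt_gen (V := C_R_CompleteNormedModule) f (Rbar_locally m_infty) (Rbar_locally p_infty) = l.
Proof.
  intros [[A HG] Hl]. assert (HA := Gdom_A v A f HG).
  apply (is_RInt_gen_unique (V := C_R_CompleteNormedModule)); try apply Proper_StrongProper; try apply Rbar_locally_filter.
  intros P HP. apply locally_Cmod in HP. destruct HP as [e [He HP]].
  assert (He' : 0 < e / (8 * (A + 1))) by (apply Rdiv_lt_0_compat; lra).
  destruct (hh_tail v _ He') as [N1 HN1].
  assert (He2 : 0 < e / 2) by lra. destruct (Hl _ He2) as [N2 HN2].
  set (N := max N1 N2).
  assert (LN : INR N1 <= INR N) by (apply le_INR; unfold N; lia).
  apply (Filter_prod _ _ _ (fun a => a < - INR N) (fun b => INR N < b)).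
  - exists (- INR N). auto.
  - exists (INR N). auto.
  - intros a b Ha Hb. simpl fst. simpl snd. exists (CI f a b). split; [apply CI_all, HG|].
    apply HP. destruct HG as [H1 H2].
    rewrite (CI_Chasles f a (- INR N) b H1), (CI_Chasles f (- INR N) (INR N) b H1).
    match goal with |- Cmod (?a + (?b + ?c) - l)%C < _ => replace (a + (b + c) - l)%C with ((b - l) + (a + c))%C by ring end.
    eapply Rle_lt_trans; [apply Cmod_triangle|].
    specialize (HN2 N ltac:(unfold N; lia)).
    assert (B1 := Gdom_CI v A f a (- INR N) (conj H1 H2) ltac:(lra)).
    assert (B2 := Gdom_CI v A f (INR N) b (conj H1 H2) ltac:(lra)).
    destruct (HN1 b ltac:(lra)) as [T1 _]. destruct (HN1 (- a) ltac:(lra)) as [_ T2]. rewrite Ropp_involutive in T2.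
    assert (M1 := hh_incr v (INR N1) (INR N) LN). assert (M2 := hh_incr v (- INR N) (- INR N1) ltac:(lra)).
    assert (X : Cmod (CI f a (- INR N) + CI f (INR N) b)%C <= e / 4); [|lra].
    eapply Rle_trans; [apply Cmod_triangle|].
    apply Rle_trans with (A * (e / (8 * (A + 1))) + A * (e / (8 * (A + 1)))).
    + apply Rplus_le_compat; (eapply Rle_trans; [eassumption|]); apply Rmult_le_compat_l; auto; lra.
    + apply Rmult_le_reg_r with (8 * (A + 1)); [lra|].
      replace ((A * (e / (8 * (A + 1))) + A * (e / (8 * (A + 1)))) * (8 * (A + 1))) with (2 * A * e) by (field; lra). nra.
Qed.

Lemma Gint_plus v f g l l' : Gint v f l -> Gint v g l' -> Gint v (fun s => f s + g s)%C (l + l')%C.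
Proof.
  intros [[A [A1 A2]] Hl] [[B [B1 B2]] Hl']. split.
  - exists (A + B). split; [intros; now apply rcont_plus|]. intros s. eapply Rle_trans; [apply Cmod_triangle|].
    unfold Rdiv in *. rewrite Rmult_plus_distr_r. now apply Rplus_le_compat.
  - apply tends_ext with (fun n => CI f (- INR n) (INR n) + CI g (- INR n) (INR n))%C; [apply eventually_filter| |].
    + intros n. symmetry. apply CI_eq. apply isI_plus; now apply CI_all.
    + apply tends_plus; auto. apply eventually_filter.
Qed.

Lemma Gint_scal v c f l : Gint v f l -> Gint v (fun s => c * f s)%C (c * l)%C.
Proof.
  intros [[A [A1 A2]] Hl]. split.
  - exists (Cmod c * A). split; [intros; apply rcont_mult; [apply rcont_const|auto]|]. intros s. rewrite Cmod_mult.
    unfold Rdiv in *. rewrite Rmult_assoc. apply Rmult_le_compat_l; [apply Cmod_ge_0|auto].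
  - apply tends_ext with (fun n => c * CI f (- INR n) (INR n))%C; [apply eventually_filter| |].
    + intros n. symmetry. apply CI_eq. apply isI_scal; now apply CI_all.
    + apply tends_scal; auto. apply eventually_filter.
Qed.

Lemma Gint_ext v f g l : (forall s, f s = g s) -> Gint v f l -> Gint v g l.
Proof.
  intros E [[A [A1 A2]] Hl]. split.
  - exists A. split; [intros s; apply rcont_ext with f; auto|]. intros s. rewrite <- E. auto.
  - revert Hl. apply tends_ext; [apply eventually_filter|]. intros n. apply CI_ext; [exact E|].
    eexists. now apply CI_all.
Qed.

Lemma Gint_0 v : Gint v (fun _ => RtoC 0) 0.
Proof.
  split.
  - exists 0. split; [intros; apply rcont_const|]. intros s. rewrite Cmod_0. unfold Rdiv. rewrite Rmult_0_l. lra.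
  - apply tends_ext with (fun _ => RtoC 0); [apply eventually_filter| |apply tends_const, eventually_filter].
    intros n. symmetry. apply CI_eq. apply (isI_eq _ _ _ (RtoC (INR n - - INR n) * 0)%C); [match goal with |- ?x = ?y => change (@eq C x y) end; ring|apply isI_const].
Qed.

Lemma Gint_minus v f g l l' : Gint v f l -> Gint v g l' -> Gint v (fun s => f s - g s)%C (l - l')%C.
Proof.
  intros Hf Hg. apply Gint_ext with (fun s => f s + (-(1)) * g s)%C; [intros; ring|].
  replace (l - l')%C with (l + (-(1)) * l')%C by ring. apply Gint_plus; [|apply Gint_scal]; auto.
Qed.

Lemma Gint_psum v (f : nat -> R -> C) (l : nat -> C) n : (forall k, Gint v (f k) (l k)) ->
  Gint v (fun s => psum (fun k => f k s) n) (psum l n).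
Proof. intros H. induction n; simpl; [apply Gint_0|now apply Gint_plus]. Qed.

(* Pointwise integrability with a common bound gives holomorphy in the parameter,
   although the dominating functions may move with the parameter. *)
Lemma Gint_hol (D : C -> Prop) (F : R -> C -> C) (G : C -> C) (v : C -> R) A : open D -> 
  (forall s, hol D (F s)) -> (forall K, 0 < K -> exists B, forall s z, - K <= s <= K -> D z -> Cmod (F s z) <= B) ->
  (forall z, D z -> Gint (v z) (fun s => F s z) (G z)) ->
  (forall z s, D z -> Cmod (F s z) <= A / (1 + (L * s + v z) ^ 2)) -> hol D G.
Proof.
  intros HD Hh HB HG HA.
  apply (hol_lim D (fun n z => CI (fun s => F s z) (- INR n) (INR n)) G (A * (PI / L))); [exact HD| | |].
  - intros n. destruct (HB (INR n + 1)) as [B HB']; [generalize (pos_INR n); lra|].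
    apply (hol_integral D F _ (- INR n) (INR n) B); [generalize (pos_INR n); lra|exact HD|auto| |].
    + intros s z Hs. apply HB'. lra.
    + intros z Hz. destruct (HG z Hz) as [[A' [H1 _]] _]. now apply CI_all.
  - intros n z Hz. destruct (HG z Hz) as [[A' [H1 _]] _].
    assert (GD : Gdom (v z) A (fun s => F s z)) by (split; auto).
    eapply Rle_trans; [apply (Gdom_CI (v z) A _ _ _ GD); generalize (pos_INR n); lra|].
    apply Rmult_le_compat_l; [eapply Gdom_A, GD|].
    assert (B1 := hh_bound (v z) (INR n)). assert (B2 := hh_bound (v z) (- INR n)).
    assert (C1 := Rle_abs (hh (v z) (INR n))). assert (C2' := Rle_abs (- hh (v z) (- INR n))). rewrite Rabs_Ropp in C2'.
    replace (PI / L) with (PI / (2 * L) + PI / (2 * L)) by (field; lra). lra.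
  - intros z Hz. apply HG. exact Hz.
Qed.
End Improper.

(** ** The kernel [1 / Theta] *)

Section Kernel.
Variables q lq : C.
Hypothesis hq : 1 < Cmod q.
Hypothesis hlq : Cexp lq = q.
Let L := ln (Cmod q).
Let HL : 0 < L := L_pos q hq.

(** The curve of all q^s x keeps a margin from -1, hence x stays off the spiral of the points -q^r
    with r real. That spiral contains the zeros -q^n of [Theta]. *)
Definition off_spiral (d : R) (x : C) : Prop := 0 < d /\ x <> 0 /\ forall r, d <= Cmod (1 + x * qpow lq r)%C.

Lemma off_spiral_mul d x s : off_spiral d x -> off_spiral d (qpow lq s * x)%C.
Proof.
  intros [H1 [H2 H3]]. split; [exact H1|]. split; [apply Cmult_neq_0; auto; apply qpow_neq_0|].
  intros r. replace (qpow lq s * x * qpow lq r)%C with (x * qpow lq (s + r))%C by (rewrite qpow_plus; ring). apply H3.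
Qed.

Lemma off_spiral_Theta d x : off_spiral d x -> Theta q x <> 0.
Proof.
  intros [H1 [H2 H3]]. apply (Theta_neq_0 q lq hq hlq x H2). intros r. apply Cmod_gt_0. specialize (H3 r). lra.
Qed.

Lemma rcont_Theta (gam : R -> C) s : gam s <> RtoC 0 -> rcont gam s -> rcont (fun s => Theta q (gam s)) s.
Proof. intros H1 H2. destruct (Theta_hol q hq (gam s) H1) as [l Hl]. exact (cder_rcont _ l gam s Hl H2). Qed.

Lemma ln_qpow (x : C) s : x <> 0 -> ln (Cmod (qpow lq s * x)%C) = L * s + ln (Cmod x).
Proof.
  intros Hx. rewrite Cmod_mult, (Cmod_qpow q lq hlq), ln_mult, ln_exp; [unfold L; ring|apply exp_pos|now apply Cmod_gt_0].
Qed.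

(** The Gaussian rate of the kernel splits as 1/(2L) = k0 + (M - Mt) + Mt, with k0 = 1/(2L) - M. The
    share Mt cancels the growth of the integrand, M - Mt pays for the fixed linear terms and for
    integrability, and k0 pays for the linear growth D, at the cost exp(D^2 / (4 k0)). The constant
    [K] does not depend on [D], which later grows with beta and N. *)
Lemma laplace_bound d tau M Mt : 0 < d -> 0 <= tau -> 0 <= Mt < M -> 0 < 1 / (2 * L) - M ->
  exists K, 0 <= K /\ forall (D Q : R) (u t w x : C), 0 <= D -> off_spiral d (u / t)%C -> t <> 0 -> Cmod t <= exp tau ->
    forall s, w = (qpow lq s * u)%C ->
      Cmod x <= Q * exp (D * ln (1 + Cmod w) + Mt * ln (1 + Cmod w) ^ 2) ->
      Cmod (x / Theta q (w / t))%C <=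
        Q * K * exp (D * (ln 2 + tau) + D ^ 2 / (4 * (1 / (2 * L) - M))) / (1 + (L * s + ln (Cmod (u / t)%C)) ^ 2).
Proof.
  intros Hd Htau HMt Hk. set (k0 := 1 / (2 * L) - M) in *. set (eta := M - Mt).
  destruct (Theta_lower q lq hq hlq) as [c [Hc HT]].
  set (ct := ln 2 + tau). assert (Hct : 0 < ct) by (unfold ct; generalize ln_lt_2; lra).
  (* The total linear coefficient in a = |y|: 2 Mt ct from the square of ct + a, 2 from 1 + y^2 <=
     exp(2a), and 1/2 from the linear term of [gauss]. *)
  set (bb := 2 * Mt * ct + 5 / 2).
  exists (/ (c * (d * d)) * exp (Mt * ct ^ 2 + bb ^ 2 / (4 * eta))).
  assert (Pc : 0 < c * (d * d)) by (apply Rmult_lt_0_compat; nra).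
  split; [apply Rmult_le_pos; [apply Rlt_le, Rinv_0_lt_compat, Pc|apply Rlt_le, exp_pos]|].
  intros D Q u t w x HD Hoff Ht Htt s Hw Hx.
  assert (Hoff' := off_spiral_mul d _ s Hoff). replace (qpow lq s * (u / t))%C with (w / t)%C in Hoff' by (rewrite Hw; unfold Cdiv; ring).
  assert (HTh := HT d (w / t)%C Hd (proj1 (proj2 Hoff')) (proj2 (proj2 Hoff'))).
  assert (Hln : ln (Cmod (w / t)%C) = L * s + ln (Cmod (u / t)%C)).
  { rewrite <- ln_qpow by apply Hoff. f_equal. f_equal. rewrite Hw. unfold Cdiv. ring. }
  unfold gauss in HTh. fold L in HTh. rewrite Hln in HTh. set (y := L * s + ln (Cmod (u / t)%C)) in *.
  set (a := Rabs y). assert (Pa : 0 <= a) by apply Rabs_pos. assert (Pt := proj1 (Cmod_gt_0 t) Ht).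
  assert (Hw0 : (w / t)%C <> 0) by apply Hoff'.
  assert (Mw : Cmod w <= exp (tau + a)).
  { replace w with (w / t * t)%C by (field; exact Ht). rewrite Cmod_mult, exp_plus, Rmult_comm.
    apply Rmult_le_compat; try apply Cmod_ge_0; [exact Htt|].
    rewrite <- (exp_ln (Cmod (w / t)%C)) by (now apply Cmod_gt_0). rewrite Hln.
    assert (Z : y <= a) by apply Rle_abs. destruct Z as [Z|Z]; [apply Rlt_le, exp_increasing, Z|rewrite <- Z; lra]. }
  set (psi := ln (1 + Cmod w)) in *. assert (Pw := Cmod_ge_0 w).
  assert (P0 : 0 <= psi).
  { unfold psi. rewrite <- ln_1. destruct Pw as [h|h]; [apply Rlt_le, ln_increasing; lra|rewrite <- h, Rplus_0_r; lra]. }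
  assert (P1 : psi <= ct + a).
  { unfold psi, ct. rewrite <- (ln_exp (tau + a)) in *. replace (ln 2 + tau + a) with (ln 2 + (tau + a)) by ring.
    rewrite <- (ln_exp (tau + a)), <- ln_mult by (try apply exp_pos; lra).
    assert (E1 : 1 <= exp (tau + a)) by (generalize (exp_ineq1_le (tau + a)); lra).
    assert (E2 : 1 + Cmod w <= 2 * exp (tau + a)) by (rewrite ln_exp in Mw; lra).
    destruct E2 as [h|h]; [apply Rlt_le, ln_increasing; lra|rewrite h; lra]. }
  assert (NT : Theta q (w / t)%C <> 0) by (eapply off_spiral_Theta, Hoff').
  rewrite Cmod_div by exact NT.
  assert (PT := proj1 (Cmod_gt_0 _) NT).
  assert (HQ : 0 <= Q).
  { assert (P := Cmod_ge_0 x). assert (E := exp_pos (D * psi + Mt * psi ^ 2)). apply Rmult_le_reg_r with (exp (D * psi + Mt * psi ^ 2)); [exact E|]. lra. }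
  assert (Y2 : 0 < 1 + y ^ 2) by (generalize (pow2_ge_0 y); lra).
  apply Rmult_le_reg_r with (Cmod (Theta q (w / t)%C)); [exact PT|].
  unfold Rdiv at 1. rewrite Rmult_assoc, Rinv_l, Rmult_1_r by lra.
  apply Rmult_le_reg_r with (1 + y ^ 2); [exact Y2|].
  set (E1 := exp (D * ct + D ^ 2 / (4 * k0))). set (E2 := exp (Mt * ct ^ 2 + bb ^ 2 / (4 * eta))).
  replace (Q * (/ (c * (d * d)) * E2) * E1 / (1 + y ^ 2) * Cmod (Theta q (w / t)%C) * (1 + y ^ 2)) with
    (Q * / (c * (d * d)) * E2 * E1 * Cmod (Theta q (w / t)%C)) by (field; lra).
  apply Rle_trans with (Q * / (c * (d * d)) * E2 * E1 * (c * (d * d) * exp (y ^ 2 / (2 * L) + y / 2))).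
  2: { apply Rmult_le_compat_l; [|exact HTh]. repeat apply Rmult_le_pos; try apply Rlt_le, exp_pos; [exact HQ|]. apply Rlt_le, Rinv_0_lt_compat, Pc. }
  replace (Q * / (c * (d * d)) * E2 * E1 * (c * (d * d) * exp (y ^ 2 / (2 * L) + y / 2))) with
    (Q * (E2 * E1 * exp (y ^ 2 / (2 * L) + y / 2))) by (field; lra).
  apply Rle_trans with (Q * exp (D * psi + Mt * psi ^ 2) * exp (2 * a)).
  { apply Rmult_le_compat; [apply Cmod_ge_0|lra|exact Hx|].
    assert (Ea := exp_ineq1_le a). replace (2 * a) with (a + a) by ring. rewrite exp_plus.
    rewrite <- (pow2_abs y). fold a. apply Rle_trans with ((1 + a) * (1 + a)); [nra|]. apply Rmult_le_compat; lra. }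
  rewrite Rmult_assoc. apply Rmult_le_compat_l; [exact HQ|]. unfold E1, E2. rewrite <- !exp_plus.
  assert (G : D * psi + Mt * psi ^ 2 + 2 * a <= Mt * ct ^ 2 + bb ^ 2 / (4 * eta) + (D * ct + D ^ 2 / (4 * k0)) + (y ^ 2 / (2 * L) + y / 2)).
  { assert (Heta : 0 < eta) by (unfold eta; lra).
    assert (A1 : D * psi <= D * (ct + a)) by (apply Rmult_le_compat_l; lra).
    assert (A2 : Mt * psi ^ 2 <= Mt * (ct + a) ^ 2) by (apply Rmult_le_compat_l; [lra|]; apply pow_incr; lra).
    assert (A3 : D * a - k0 * a ^ 2 <= D ^ 2 / (4 * k0)).
    { assert (Z : 0 <= (D - 2 * k0 * a) ^ 2 / (4 * k0)) by (apply Rmult_le_pos; [apply pow2_ge_0|apply Rlt_le, Rinv_0_lt_compat; lra]).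
      replace ((D - 2 * k0 * a) ^ 2 / (4 * k0)) with (D ^ 2 / (4 * k0) - D * a + k0 * a ^ 2) in Z by (field; lra). lra. }
    assert (A4 : bb * a - eta * a ^ 2 <= bb ^ 2 / (4 * eta)).
    { assert (Z : 0 <= (bb - 2 * eta * a) ^ 2 / (4 * eta)) by (apply Rmult_le_pos; [apply pow2_ge_0|apply Rlt_le, Rinv_0_lt_compat; lra]).
      replace ((bb - 2 * eta * a) ^ 2 / (4 * eta)) with (bb ^ 2 / (4 * eta) - bb * a + eta * a ^ 2) in Z by (field; lra). lra. }
    (* The splitting of the Gaussian rate into the three shares used in [A2], [A3] and [A4]. *)
    assert (A5 : y ^ 2 / (2 * L) = (k0 + eta + Mt) * a ^ 2).
    { rewrite <- (pow2_abs y). fold a. unfold k0, eta. field. apply Rgt_not_eq, HL. }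
    assert (A6 : - a <= y) by (generalize (Rle_abs (- y)); rewrite Rabs_Ropp; fold a; lra).
    rewrite A5. unfold bb in *. simpl in *. nra. }
  destruct G as [G|G]; [apply Rlt_le, exp_increasing, G|rewrite G; lra].
Qed.
End Kernel.

(** * Independence of the direction of integration *)

Lemma cis_eq th : cis th = (cos th, sin th).
Proof.
  unfold cis, Cexp, Re, Im. simpl. replace (th * 0 - 0 * 1) with 0 by ring. replace (th * 1 + 0 * 0) with th by ring.
  rewrite exp_0. unfold Cmult, RtoC; simpl. f_equal; ring.
Qed.

Lemma unit_cis (u : C) : Cmod u = 1 -> exists th, 0 <= th < 2 * PI /\ u = cis th.
Proof.
  intros Hu. destruct u as [x y]. assert (H : x ^ 2 + y ^ 2 = 1).
  { assert (H := Cmod2_alt (x, y)). rewrite Hu in H. unfold Re, Im in H. simpl in *. lra. }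
  assert (Hx : -1 <= x <= 1) by (assert (0 <= y ^ 2) by apply pow2_ge_0; nra).
  assert (Hs : sqrt (1 - x * x) = Rabs y).
  { replace (1 - x * x) with (y * y) by (simpl in H; lra). apply sqrt_Rsqr_abs. }
  assert (B := acos_bound x). assert (P := PI_RGT_0).
  destruct (Rle_dec 0 y) as [l|l].
  - exists (acos x). split; [lra|]. rewrite cis_eq, cos_acos, sin_acos by exact Hx. unfold Rsqr. rewrite Hs, Rabs_pos_eq by exact l. easy.
  - assert (N0 : 0 < acos x).
    { destruct (proj1 B) as [h|h]; [exact h|exfalso]. assert (E := cos_acos x Hx). rewrite <- h, cos_0 in E. subst x.
      assert (y ^ 2 = 0) by lra. simpl in *. nra. }
    exists (2 * PI - acos x). split; [lra|]. rewrite cis_eq.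
    replace (2 * PI - acos x) with (- acos x + 2 * INR 1 * PI) by (simpl; ring).
    rewrite cos_period, sin_period, cos_neg, sin_neg, cos_acos, sin_acos by exact Hx.
    unfold Rsqr. rewrite Hs, Rabs_left by lra. f_equal. ring.
Qed.

Lemma convex_between lo hi x y s : lo < x < hi -> lo < y < hi -> 0 <= s <= 1 -> lo < x + s * (y - x) < hi.
Proof.
  intros Hx Hy Hs. destruct (Rle_dec x y) as [l|l].
  - assert (0 <= s * (y - x)) by (apply Rmult_le_pos; lra).
    assert (s * (y - x) <= 1 * (y - x)) by (apply Rmult_le_compat_r; lra). lra.
  - assert (0 <= s * (x - y)) by (apply Rmult_le_pos; lra).
    assert (s * (x - y) <= 1 * (x - y)) by (apply Rmult_le_compat_r; lra). lra.
Qed.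

Lemma cis_PI : cis PI = (- (1))%C.
Proof. rewrite cis_eq, cos_PI, sin_PI. unfold Copp, RtoC; simpl. f_equal; ring. Qed.

Lemma rcont_continuity_pt (f : R -> C) s : rcont f s -> continuity_pt (fun s => Cmod (f s)) s.
Proof.
  intros H e He. destruct (proj1 (locally_R _ _) (H e He)) as [d [Hd H']]. exists d. split; [exact Hd|].
  intros y [_ Hy]. apply Rle_lt_trans with (Cmod (f y - f s)%C); [|now apply H'].
  simpl. unfold Rdist. apply Rabs_le.
  assert (H1 := Cmod_triangle_inv (f y) (f s)). assert (H2 := Cmod_triangle_inv (f s) (f y)). rewrite Cmod_sub_sym in H2. lra.
Qed.

Section Constancy.
Variables q lq : C.
Hypothesis hq : 1 < Cmod q.
Hypothesis hlq : Cexp lq = q.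
Let L := ln (Cmod q).
Let HL : 0 < L := L_pos q hq.
Let qn0 := q_neq_0 q hq.

Notation off_spiral := (off_spiral lq).

(** Logarithmic coordinates u = - e^(i th) q^r. The excluded spiral is th = 0, so the admissible
    points fill the strip 0 < th < 2 pi, which is convex: two directions can be joined by a
    segment. *)
Lemma off_spiral_log d (u : C) : off_spiral d u -> exists th r, 0 < th < 2 * PI /\
  u = Cexp (RtoC PI * Ci + RtoC th * Ci + RtoC r * lq)%C.
Proof.
  intros [Hd [Hu H]]. set (r := ln (Cmod u) / L).
  assert (Mr : Cmod (qpow lq r) = Cmod u).
  { rewrite (Cmod_qpow q lq hlq). fold L. unfold r. replace (ln (Cmod u) / L * L) with (ln (Cmod u)) by (field; lra).
    apply exp_ln. now apply Cmod_gt_0. }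
  assert (Nq := qpow_neq_0 lq r). assert (Pu := proj1 (Cmod_gt_0 u) Hu).
  destruct (unit_cis (- u / qpow lq r)%C) as [th [Hth E]].
  { rewrite Cmod_div, Cmod_opp, Mr by exact Nq. field. lra. }
  assert (Eu : u = (- cis th * qpow lq r)%C) by (rewrite <- E; field; exact Nq).
  exists th, r. split.
  - split; [|lra]. destruct (proj1 Hth) as [h|h]; [exact h|exfalso].
    specialize (H (- r)). rewrite <- h in Eu. rewrite cis_eq, cos_0, sin_0 in Eu.
    rewrite Eu, qpow_opp in H. replace (1 + - (1, 0) * qpow lq r * / qpow lq r)%C with (RtoC 0) in H.
    + rewrite Cmod_0 in H. lra.
    + change (1, 0) with (RtoC 1). field. exact Nq.
  - rewrite !Cexp_plus. fold (cis PI) (cis th) (qpow lq r). rewrite cis_PI, Eu. ring.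
Qed.

Lemma Theta_spiral_neq_0 th r : 0 < th < 2 * PI -> Theta q (Cexp (RtoC PI * Ci + RtoC th * Ci + RtoC r * lq)%C) <> 0.
Proof.
  intros Hth. apply (Theta_neq_0 q lq hq hlq); [apply Cexp_neq_0|]. intros r' E.
  rewrite !Cexp_plus in E. fold (cis PI) (cis th) (qpow lq r) in E. rewrite cis_PI in E.
  assert (E' : (cis th * qpow lq (r + r'))%C = 1%C).
  { rewrite qpow_plus. replace (cis th * (qpow lq r * qpow lq r'))%C with (1 - (1 + - (1) * cis th * qpow lq r * qpow lq r'))%C by ring.
    rewrite E. ring. }
  assert (M := f_equal Cmod E'). rewrite Cmod_mult, cis_mod, Cmod_1, (Cmod_qpow q lq hlq), Rmult_1_l in M. fold L in M.
  assert (Z : r + r' = 0).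
  { rewrite <- exp_0 in M. apply exp_inv in M. apply Rmult_integral in M. destruct M; [easy|lra]. }
  rewrite Z, qpow_0, Cmult_1_r, cis_eq in E'.
  assert (C1' := f_equal fst E'). assert (C2' := f_equal snd E'). simpl in C1', C2'.
  destruct (Rtotal_order th PI) as [h|[h|h]].
  - assert (0 < sin th) by (apply sin_gt_0; lra). lra.
  - rewrite h, cos_PI in C1'. lra.
  - assert (sin th < 0) by (apply sin_lt_0; lra). lra.
Qed.

Lemma Theta_gauss_shift n (x : C) : x <> 0 -> Cmod (Theta q (q ^ n * x)%C) * gauss q x = Cmod (Theta q x) * gauss q (q ^ n * x)%C.
Proof.
  intros Hx. induction n; [simpl; now rewrite Cmult_1_l|].
  assert (Ny : (q ^ n * x)%C <> 0) by (apply Cmult_neq_0; auto; now apply Cpow_neq_0).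
  replace (q ^ S n * x)%C with (q * (q ^ n * x))%C by (simpl; ring).
  rewrite (Theta_q q hq _ Ny), (gauss_q q hq _ Ny), !Cmod_mult.
  match type of IHn with ?A * ?G = ?B * ?D =>
    transitivity (Cmod q * (Cmod (q ^ n)%C * Cmod x) * (A * G)); [ring|rewrite IHn; ring] end.
Qed.

Lemma exp_ge_1 x : 0 <= x -> 1 <= exp x.
Proof. intros. generalize (exp_ineq1_le x). lra. Qed.

Lemma exp_le x y : x <= y -> exp x <= exp y.
Proof. intros [H|H]; [apply Rlt_le, exp_increasing, H|rewrite H; lra]. Qed.

Lemma gauss_up (x : C) R1 : x <> 0 -> Rabs (ln (Cmod x)) <= R1 -> gauss q x <= exp (R1 ^ 2 / (2 * L) + R1 / 2).
Proof.
  intros Hx H. unfold gauss. fold L. apply exp_le. set (X := ln (Cmod x)) in *.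
  assert (X ^ 2 <= R1 ^ 2) by (rewrite <- (pow2_abs X); apply pow_incr; split; [apply Rabs_pos|exact H]).
  assert (X <= R1) by (generalize (Rle_abs X); lra).
  assert (X ^ 2 / (2 * L) <= R1 ^ 2 / (2 * L)); [|lra].
  apply Rmult_le_compat_r; [apply Rlt_le, Rinv_0_lt_compat; lra|assumption].
Qed.

Lemma gauss_low (x : C) : x <> 0 -> 3 * L <= Rabs (ln (Cmod x)) -> Rabs (ln (Cmod x)) <= gauss q x.
Proof.
  intros Hx H. unfold gauss. fold L. set (X := ln (Cmod x)) in *. set (a := Rabs X) in *.
  apply Rle_trans with (exp a); [generalize (exp_ineq1_le a); lra|]. apply exp_le.
  rewrite <- (pow2_abs X). fold a. assert (- a <= X) by (generalize (Rle_abs (- X)); rewrite Rabs_Ropp; fold a; lra).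
  assert (3 * a / 2 <= a ^ 2 / (2 * L)); [|lra].
  apply Rmult_le_reg_r with (2 * L); [lra|]. unfold Rdiv. rewrite (Rmult_assoc (a ^ 2)), Rinv_l by lra. simpl. nra.
Qed.

(** Goursat's theorem for the form dw / (w Theta(w)) on the image of (s, sg) -> q^s y(sg), where [y]
    runs through a segment in logarithmic coordinates. The long sides give [lq] times the two
    integrals, and the short sides at s = n and s = -n tend to 0. *)
Lemma kernel_const d1 d2 u1 u2 v1 v2 l1 l2 : off_spiral d1 u1 -> off_spiral d2 u2 ->
  Gint L v1 (fun s => / Theta q (qpow lq s * u1))%C l1 -> Gint L v2 (fun s => / Theta q (qpow lq s * u2))%C l2 -> l1 = l2.
Proof.
  intros H1 H2 [_ G1] [_ G2].
  destruct (off_spiral_log d1 u1 H1) as [th1 [r1 [T1 E1]]]. destruct (off_spiral_log d2 u2 H2) as [th2 [r2 [T2 E2]]].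
  set (a1 := (RtoC PI * Ci + RtoC th1 * Ci + RtoC r1 * lq)%C) in *.
  set (a2 := (RtoC PI * Ci + RtoC th2 * Ci + RtoC r2 * lq)%C) in *.
  set (y := fun sg => Cexp (a1 + RtoC sg * (a2 - a1))%C).
  assert (Ny : forall sg, y sg <> 0) by (intros; apply Cexp_neq_0).
  set (Phi := fun s sg => (qpow lq s * y sg)%C).
  assert (NPhi : forall s sg, Phi s sg <> 0) by (intros; apply Cmult_neq_0; [apply qpow_neq_0|apply Ny]).
  assert (NT : forall s sg, 0 <= sg <= 1 -> Theta q (Phi s sg) <> 0).
  { intros s sg Hsg.
    replace (Phi s sg) with (Cexp (RtoC PI * Ci + RtoC (th1 + sg * (th2 - th1)) * Ci + RtoC (s + (r1 + sg * (r2 - r1))) * lq)%C).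
    - apply Theta_spiral_neq_0. now apply convex_between.
    - unfold Phi, y, qpow. rewrite <- Cexp_plus. f_equal. unfold a1, a2. rewrite !RtoC_plus, !RtoC_mult, !RtoC_minus. ring. }
  assert (Dy : forall sg, rder y sg ((a2 - a1) * y sg)%C).
  { intros sg. unfold y. apply (rder_ext (fun sg => Cexp a1 * Cexp (RtoC sg * (a2 - a1)))%C); [intros; now rewrite Cexp_plus|].
    apply (rder_eq _ _ (0 * Cexp (RtoC sg * (a2 - a1)) + Cexp a1 * ((a2 - a1) * Cexp (RtoC sg * (a2 - a1))))%C).
    - rewrite Cexp_plus. ring.
    - apply (rder_mult (fun _ => Cexp a1)); [apply rder_const|apply rder_Cexp]. }
  assert (Cy : forall sg, rcont y sg) by (intros; eapply rder_cont, Dy).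
  assert (Dq : forall s, rder (qpow lq) s (lq * qpow lq s)%C) by (intros; apply rder_Cexp).
  set (R1 := Cmod a1 + Cmod (a2 - a1)%C).
  assert (Ry : forall sg, 0 <= sg <= 1 -> Rabs (ln (Cmod (y sg))) <= R1).
  { intros sg Hsg. unfold y. rewrite Cmod_Cexp, ln_exp. eapply Rle_trans; [apply re_le_Cmod|].
    eapply Rle_trans; [apply Cmod_triangle|]. unfold R1. rewrite Cmod_mult, Cmod_RtoC_pos by lra.
    assert (P := Cmod_ge_0 (a2 - a1)%C). nra. }
  assert (PR1 : 0 <= R1) by (apply Rplus_le_le_0_compat; apply Cmod_ge_0).
  set (G := exp (R1 ^ 2 / (2 * L) + R1 / 2)).
  (* Compactness gives a lower bound of |Theta| on the segment at s = 0. Since the truncations are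
     at integers, invariance of |Theta| / gauss under powers of q carries it to both short sides. *)
  assert (Min : exists m, 0 < m /\ forall sg, 0 <= sg <= 1 -> m <= Cmod (Theta q (y sg))).
  { destruct (continuity_ab_min (fun sg => Cmod (Theta q (y sg))) 0 1 ltac:(lra)) as [mx [M1 M2]].
    - intros c Hc. apply (rcont_continuity_pt (fun sg => Theta q (y sg))). apply rcont_Theta; auto.
    - exists (Cmod (Theta q (y mx))). split; [|exact M1]. apply Cmod_gt_0.
      assert (Z := NT 0 mx M2). unfold Phi in Z. rewrite qpow_0, Cmult_1_l in Z. exact Z. }
  destruct Min as [m [Hm Hmin]].
  assert (PG : 0 < G) by apply exp_pos.
  (* A decay of order 1/n is enough here, so [gauss] is only bounded below by |ln |x||. *)
  assert (Edge : forall n sg (sgn : bool), 0 <= sg <= 1 -> 3 * L + R1 <= INR n * L ->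
    Cmod (/ Theta q (Phi (if sgn then INR n else (- INR n)%R) sg))%C <= G / (m * (INR n * L - R1))).
  { intros n sg sgn Hsg Hn. rewrite Cmod_inv by now apply NT.
    set (x := Phi (if sgn then INR n else (- INR n)%R) sg).
    assert (Nx : x <> 0) by apply NPhi.
    assert (EQ : Cmod (Theta q x) * gauss q (y sg) = Cmod (Theta q (y sg)) * gauss q x).
    { unfold x, Phi. destruct sgn.
      - rewrite (qpow_nat q lq hlq). now apply Theta_gauss_shift.
      - rewrite qpow_opp, (qpow_nat q lq hlq).
        assert (Nn := Cpow_neq_0 q n qn0).
        assert (S := Theta_gauss_shift n (/ q ^ n * y sg)%C). 
        replace (q ^ n * (/ q ^ n * y sg))%C with (y sg) in S by (field; exact Nn).
        rewrite S; [ring|]. apply Cmult_neq_0; [|apply Ny]. intros Z. apply (f_equal (fun w => q ^ n * w)%C) in Z.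
        rewrite Cinv_r in Z by exact Nn. apply C1_nz. rewrite Z. ring. }
    assert (Lx : INR n * L - R1 <= Rabs (ln (Cmod x))).
    { unfold x, Phi. rewrite (ln_qpow q lq hlq) by apply Ny. fold L. specialize (Ry sg Hsg). apply Rabs_le_between in Ry.
      destruct sgn.
      - eapply Rle_trans; [|apply Rle_abs]. lra.
      - rewrite <- Rabs_Ropp. eapply Rle_trans; [|apply Rle_abs]. lra. }
    assert (GL := gauss_low x Nx ltac:(lra)). assert (GU := gauss_up (y sg) R1 (Ny sg) (Ry sg Hsg)). fold G in GU.
    specialize (Hmin sg Hsg). assert (PT := proj1 (Cmod_gt_0 _) (NT (if sgn then INR n else (- INR n)%R) sg Hsg)). fold x in PT.
    assert (K : m * (INR n * L - R1) <= Cmod (Theta q x) * G).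
    { apply Rle_trans with (Cmod (Theta q x) * gauss q (y sg)); [|apply Rmult_le_compat_l; lra].
      rewrite EQ. apply Rmult_le_compat; lra. }
    assert (P3 : 0 < m * (INR n * L - R1)) by (apply Rmult_lt_0_compat; lra).
    apply Rmult_le_reg_r with (Cmod (Theta q x)); [exact PT|]. rewrite Rinv_l by lra.
    apply Rmult_le_reg_r with (m * (INR n * L - R1)); [exact P3|].
    replace (G / (m * (INR n * L - R1)) * Cmod (Theta q x) * (m * (INR n * L - R1))) with (Cmod (Theta q x) * G) by (field; lra). lra. }
  assert (Nlq : lq <> 0).
  { intros Z. assert (RL := Re_lq q lq hlq). fold L in RL. rewrite Z in RL. simpl in RL. lra. }
  assert (Go : forall n, 
    (CI (fun s => lq * / Theta q (Phi s 0%R)) (- INR n) (INR n) + CI (fun sg => (a2 - a1) * / Theta q (Phi (INR n) sg)) 0 1 =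
     CI (fun s => lq * / Theta q (Phi s 1%R)) (- INR n) (INR n) + CI (fun sg => (a2 - a1) * / Theta q (Phi (- INR n)%R sg)) 0 1)%C).
  { intros n. assert (Pn := pos_INR n).
    set (K := (Cmod lq + Cmod (a2 - a1)%C) * exp (INR n * L + R1)).
    assert (Bq : forall s sg, - INR n <= s <= - INR n + 2 * INR n -> 0 <= sg <= 0 + 1 -> Cmod (Phi s sg) <= exp (INR n * L + R1)).
    { intros s sg Hs Hsg. rewrite <- (exp_ln (Cmod (Phi s sg))) by (apply Cmod_gt_0, NPhi). apply exp_le. unfold Phi. rewrite (ln_qpow q lq hlq) by apply Ny.
      fold L. assert (R := Ry sg ltac:(lra)). apply Rabs_le_between in R. assert (L * s <= INR n * L) by nra. lra. }
    assert (Gs := goursat Phi (fun s sg => lq * Phi s sg)%C (fun s sg => (a2 - a1) * Phi s sg)%C (fun w => / Theta q w / w)%C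
      (- INR n) 0 (2 * INR n) 1 K ltac:(lra) ltac:(lra)).
    cbv beta in Gs. rewrite !Rplus_0_l in Gs. replace (- INR n + 2 * INR n) with (INR n) in Gs by ring.
    assert (P1 := Cmod_ge_0 lq). assert (P2 := Cmod_ge_0 (a2 - a1)%C). assert (P3 := exp_pos (INR n * L + R1)).
    replace (- INR n + 2 * INR n) with (INR n) in Bq by ring. rewrite Rplus_0_l in Bq.
    etransitivity; [|etransitivity; [apply Gs|]]; clear Gs.
    - f_equal; unfold CI; apply (RInt_ext (V := C_R_CompleteNormedModule)); intros s Hs; rewrite Rmin_left, Rmax_right in Hs by lra;
      match goal with |- ?x = ?y => change (@eq C x y) end; field; split; (apply NPhi || (apply NT; lra)).
    - unfold K. nra.
    - intros s sg. unfold Phi. apply (rder_eq _ _ (lq * qpow lq s * y sg + qpow lq s * 0)%C); [ring|].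
      apply (rder_mult (qpow lq) (fun _ => y sg)); [apply Dq|apply rder_const].
    - intros s sg. unfold Phi. apply (rder_eq _ _ (0 * y sg + qpow lq s * ((a2 - a1) * y sg))%C); [ring|].
      apply (rder_mult (fun _ => qpow lq s) y); [apply rder_const|apply Dy].
    - intros s sg. apply rcont_mult; [apply rcont_const|]. apply rcont_mult; [eapply rder_cont, Dq|apply rcont_const].
    - intros s sg. apply rcont_mult; [apply rcont_const|]. apply rcont_mult; [apply rcont_const|apply Cy].
    - intros s sg Hs Hsg. rewrite Cmod_mult. unfold K. apply Rmult_le_compat; try apply Cmod_ge_0; [lra|now apply Bq].
    - intros s sg Hs Hsg. rewrite Cmod_mult. unfold K. apply Rmult_le_compat; try apply Cmod_ge_0; [lra|now apply Bq].
    - intros s sg Hs Hsg. destruct (Theta_hol q hq (Phi s sg) (NPhi s sg)) as [l Hl].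
      eexists. apply (cder_mult (fun w => / Theta q w)%C Cinv).
      + apply (cder_comp Cinv (Theta q)); [exact Hl|]. apply cder_inv. now apply NT.
      + apply cder_inv, NPhi.
    - f_equal; unfold CI; apply (RInt_ext (V := C_R_CompleteNormedModule)); intros s Hs; rewrite Rmin_left, Rmax_right in Hs by lra;
      match goal with |- ?x = ?y => change (@eq C x y) end; field; split; (apply NPhi || (apply NT; lra)). }
  assert (CT : forall s0 sg, 0 <= sg <= 1 -> rcont (fun s => / Theta q (Phi s sg))%C s0).
  { intros s0 sg Hsg. apply rcont_inv; [now apply NT|]. apply rcont_Theta; [exact hq|apply NPhi|].
    unfold Phi. apply rcont_mult; [eapply rder_cont, Dq|apply rcont_const]. }
  assert (CT2 : forall s0 sg, 0 <= sg <= 1 -> rcont (fun sg => (a2 - a1) * / Theta q (Phi s0 sg))%C sg).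
  { intros s0 sg Hsg. apply rcont_mult; [apply rcont_const|]. apply rcont_inv; [now apply NT|]. apply rcont_Theta; [exact hq|apply NPhi|].
    unfold Phi. apply rcont_mult; [apply rcont_const|apply Cy]. }
  assert (F1 : forall n, CI (fun s => lq * / Theta q (Phi s 0%R))%C (- INR n) (INR n) = (lq * CI (fun s => / Theta q (qpow lq s * u1))%C (- INR n) (INR n))%C).
  { intros n. apply CI_eq. apply isI_ext with (fun s => lq * / Theta q (qpow lq s * u1))%C.
    - intros s _. unfold Phi, y. rewrite E1. do 4 f_equal. f_equal. ring.
    - apply isI_scal. apply CI_correct. apply isI_ex. intros s _. eapply rcont_ext; [|apply (CT s 0 ltac:(lra))].
      intros s'. cbv beta. unfold Phi, y. rewrite E1. do 3 f_equal. f_equal. ring. }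
  assert (F2 : forall n, CI (fun s => lq * / Theta q (Phi s 1%R))%C (- INR n) (INR n) = (lq * CI (fun s => / Theta q (qpow lq s * u2))%C (- INR n) (INR n))%C).
  { intros n. apply CI_eq. apply isI_ext with (fun s => lq * / Theta q (qpow lq s * u2))%C.
    - intros s _. unfold Phi, y. rewrite E2. do 4 f_equal. f_equal. ring.
    - apply isI_scal. apply CI_correct. apply isI_ex. intros s _. eapply rcont_ext; [|apply (CT s 1 ltac:(lra))].
      intros s'. cbv beta. unfold Phi, y. rewrite E2. do 3 f_equal. f_equal. ring. }
  assert (B : forall n (sgn : bool), 3 * L + R1 <= INR n * L ->
     Cmod (CI (fun sg => (a2 - a1) * / Theta q (Phi (if sgn then INR n else (- INR n)%R) sg))%C 0 1) <= (1 - 0) * (Cmod (a2 - a1)%C * (G / (m * (INR n * L - R1))))).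
  { intros n sgn Hn. eapply isI_norm_const; [lra| |apply CI_cont; [lra|intros; apply CT2; lra]].
    intros sg Hsg. cbv beta. rewrite Cmod_mult. apply Rmult_le_compat_l; [apply Cmod_ge_0|]. now apply Edge. }
  assert (X : Clim (fun n => lq * CI (fun s => / Theta q (qpow lq s * u1))%C (- INR n) (INR n) - lq * CI (fun s => / Theta q (qpow lq s * u2))%C (- INR n) (INR n))%C 0).
  { set (A := 2 * Cmod (a2 - a1)%C * (G / m) + 1).
    assert (PA : 0 < A).
    { assert (0 <= Cmod (a2 - a1)%C * (G / m)) by (apply Rmult_le_pos; [apply Cmod_ge_0|]; apply Rlt_le, Rdiv_lt_0_compat; lra). unfold A. lra. }
    intros e He. 
    destruct (nfloor_ex ((3 * L + R1 + A / e + 1) / L)) as [N [_ HN]].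
    { apply Rmult_le_pos; [|apply Rlt_le, Rinv_0_lt_compat; lra]. assert (0 < A / e) by (apply Rdiv_lt_0_compat; lra). lra. }
    exists (S N). intros n Hn. apply le_INR in Hn. rewrite S_INR in Hn.
    apply Rmult_lt_compat_r with (r := L) in HN; [|lra]. unfold Rdiv at 1 in HN. rewrite Rmult_assoc, Rinv_l, Rmult_1_r in HN by lra.
    assert (PAe : 0 < A / e) by (apply Rdiv_lt_0_compat; lra).
    assert (HnL : 3 * L + R1 + A / e + 1 < INR n * L) by nra.
    rewrite <- F1, <- F2. specialize (Go n).
    set (I1 := CI (fun s => lq * / Theta q (Phi s 0%R))%C (- INR n) (INR n)) in *. set (I2 := CI (fun s => lq * / Theta q (Phi s 1%R))%C (- INR n) (INR n)) in *.
    assert (B1 := B n true ltac:(lra)). assert (B2 := B n false ltac:(lra)). cbv iota in B1, B2.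
    set (J1 := CI (fun sg => (a2 - a1) * / Theta q (Phi (INR n) sg))%C 0 1) in *. set (J2 := CI (fun sg => (a2 - a1) * / Theta q (Phi (- INR n)%R sg))%C 0 1) in *.
    replace (I1 - I2 - 0)%C with ((I1 + J1) - I2 - J1)%C by ring. rewrite Go.
    replace (I2 + J2 - I2 - J1)%C with (J2 - J1)%C by ring.
    eapply Rle_lt_trans; [apply Cmod_sub_le|]. eapply Rle_lt_trans; [exact (Rplus_le_compat _ _ _ _ B2 B1)|].
    assert (PX : A / e < INR n * L - R1) by lra. set (XX := INR n * L - R1) in *.
    replace ((1 - 0) * (Cmod (a2 - a1)%C * (G / (m * XX))) + (1 - 0) * (Cmod (a2 - a1)%C * (G / (m * XX)))) with ((A - 1) / XX) by (unfold A; field; lra).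
    apply Rmult_lt_reg_r with XX; [lra|]. unfold Rdiv. rewrite Rmult_assoc, Rinv_l by lra.
    apply Rmult_lt_compat_r with (r := e) in PX; [|lra]. unfold Rdiv in PX. rewrite Rmult_assoc, Rinv_l in PX by lra. lra. }
  assert (Y : (lq * l1 - lq * l2)%C = 0).
  { eapply tends_unique; [apply eventually_filter| |exact X]. apply tends_minus; [apply eventually_filter| |]; (apply tends_scal; [apply eventually_filter|assumption]). }
  replace l1 with (l2 + (lq * l1 - lq * l2) / lq)%C by (field; exact Nlq). rewrite Y. field. exact Nlq.
Qed.
End Constancy.

(** ** The coefficients of the formal expansion *)

Section Coefs.
Variables (Sz jm : nat) (m0 : nat -> nat) (cf bt ini : nat -> nat -> nat -> C).

(* The sum over the monomials [z^j] of the [b_k] in the coefficient of [z^n / n!]. *)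
Definition SS (n : nat) (G : nat -> nat -> C) : C :=
  psum (fun k => psum (fun j => if (j <=? n)%nat then G k j else 0) jm) Sz.

Lemma SS_ext n G H : (forall k j, (k < Sz)%nat -> (j < jm)%nat -> (j <= n)%nat -> G k j = H k j) -> SS n G = SS n H.
Proof.
  intros E. apply psum_ext. intros k Hk. apply psum_ext. intros j Hj. destruct (Nat.leb_spec j n); auto.
Qed.

(* [X] stands for the multiplication by [w], and for [t sigma_q] after the q-Laplace
   transform; [one] stands for [1], or its transform. *)
Variable X : (C -> C) -> C -> C.
Variable one : C -> C.

(** With tau = eps w, a monomial tau^m eps^n of the initial data becomes w^m eps^(m+n): the
    coefficient of eps^l collects the pairs (m, l - m). *)
Definition initl (b l : nat) (t : C) : C := psum (fun m => ini b m (l - m)%nat * Nat.iter m X one t)%C (S l).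

Definition src (P : nat -> nat -> C -> C) (n l : nat) (t : C) : C :=
  SS n (fun k j => cf n k j * psum (fun i => bt k j i * Nat.iter (m0 k) X (P (n - j + k)%nat (l - i)%nat) t) (S l))%C.

(* Division by [1 + eps X]. *)
Fixpoint divx (s : nat -> C -> C) (l : nat) : C -> C :=
  match l with O => s O | S l' => fun t => (s (S l') t - X (divx s l') t)%C end.

(** The coefficient of index b calls the indices b - Sz - j + k, which are smaller than b because k
    < Sz; this is not structural, hence the fuel. Any amount above b gives the same value
    ([PP_fuel]). *)
Fixpoint PP (fuel : nat) (b l : nat) : C -> C :=
  match fuel with
  | O => fun _ => 0
  | S f => if (b <? Sz)%nat then initl b l else divx (src (PP f) (b - Sz)) l
  end.

Definition PB (b : nat) : nat -> C -> C := PP (S b) b.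

Lemma divx_ext s s' : (forall l, s l = s' l) -> forall l, divx s l = divx s' l.
Proof. intros E. induction l; simpl; [apply E|]. now rewrite IHl, E. Qed.

Lemma PP_fuel : forall f f' b l, (b < f)%nat -> (b < f')%nat -> PP f b l = PP f' b l.
Proof.
  induction f; intros f' b l H H'; [lia|]. destruct f' as [|f']; [lia|]. simpl.
  destruct (Nat.ltb_spec b Sz) as [h|h]; [easy|]. apply divx_ext. intros l'. apply functional_extensionality. intros t.
  apply SS_ext. intros k j Hk Hj Hn. f_equal. apply psum_ext. intros i Hi. f_equal. f_equal. apply IHf; lia.
Qed.

Lemma PB_init b l t : (b < Sz)%nat -> PB b l t = initl b l t.
Proof. intros H. unfold PB. simpl. now rewrite (proj2 (Nat.ltb_lt b Sz) H). Qed.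

Lemma PB_rec n l t : PB (n + Sz) l t =
  (src PB n l t - match l with O => 0 | S l' => X (PB (n + Sz) l') t end)%C.
Proof.
  assert (E : forall l, PB (n + Sz) l = divx (src PB n) l).
  { intros l'. unfold PB at 1. simpl. rewrite (proj2 (Nat.ltb_ge (n + Sz) Sz)) by lia. apply divx_ext.
    intros l2. apply functional_extensionality. intros t'. replace (n + Sz - Sz)%nat with n by lia.
    apply SS_ext. intros k j Hk Hj Hn. f_equal. apply psum_ext. intros i Hi. unfold PB.
    rewrite (PP_fuel (n + Sz) (S (n - j + k)) (n - j + k)) by lia. reflexivity. }
  rewrite E. destruct l; [simpl; ring|]. rewrite <- E. rewrite E. simpl. now rewrite E.
Qed.

End Coefs.

Section Induct.
Variables (Sz jm : nat) (m0 : nat -> nat) (cf bt ini : nat -> nat -> nat -> C).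

(* Two operators and their bases give coefficients related by any relation that is
   linear and compatible with the operators. *)
Lemma PB_rel (X Y : (C -> C) -> C -> C) (one one' : C -> C) (Rel : (C -> C) -> (C -> C) -> Prop) :
  Rel one one' -> (forall f g, Rel f g -> Rel (X f) (Y g)) ->
  Rel (fun _ => RtoC 0) (fun _ => RtoC 0) ->
  (forall f g f' g', Rel f g -> Rel f' g' -> Rel (fun x => f x + f' x)%C (fun x => g x + g' x)%C) ->
  (forall c f g, Rel f g -> Rel (fun x => c * f x)%C (fun x => c * g x)%C) ->
  forall b l, Rel (PB Sz jm m0 cf bt ini X one b l) (PB Sz jm m0 cf bt ini Y one' b l).
Proof.
  intros H1 HX H0 Hp Hs.
  assert (It : forall m f g, Rel f g -> Rel (Nat.iter m X f) (Nat.iter m Y g)) by (induction m; simpl; auto).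
  assert (Ps : forall (F G : nat -> C -> C) n, (forall k, (k < n)%nat -> Rel (F k) (G k)) ->
    Rel (fun x => psum (fun k => F k x) n) (fun x => psum (fun k => G k x) n)).
  { induction n; intros H; simpl; [exact H0|]. apply Hp; [apply IHn; intros; apply H; lia|apply H; lia]. }
  assert (Hm : forall f g f' g', Rel f g -> Rel f' g' -> Rel (fun x => f x - f' x)%C (fun x => g x - g' x)%C).
  { intros f g f' g' Hf Hf'.
    replace (fun x => f x - f' x)%C with (fun x => f x + (-(1)) * f' x)%C by (apply functional_extensionality; intros; ring).
    replace (fun x => g x - g' x)%C with (fun x => g x + (-(1)) * g' x)%C by (apply functional_extensionality; intros; ring).
    auto. }
  assert (Main : forall fuel b l, Rel (PP Sz jm m0 cf bt ini X one fuel b l) (PP Sz jm m0 cf bt ini Y one' fuel b l)).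
  { induction fuel; intros b l; simpl; [exact H0|]. destruct (b <? Sz)%nat.
    - unfold initl. apply (Ps (fun m x => ini b m (l - m)%nat * Nat.iter m X one x)%C (fun m x => ini b m (l - m)%nat * Nat.iter m Y one' x)%C).
      intros k _. apply Hs. auto.
    - set (PX := PP Sz jm m0 cf bt ini X one fuel) in *. set (PY := PP Sz jm m0 cf bt ini Y one' fuel) in *.
      assert (Src : forall l, Rel (src Sz jm m0 cf bt X PX (b - Sz) l) (src Sz jm m0 cf bt Y PY (b - Sz) l)).
      { intros l'. unfold src, SS. 
        apply (Ps (fun k x => psum (fun j => if (j <=? b - Sz)%nat then _ else 0) jm) (fun k x => psum (fun j => if (j <=? b - Sz)%nat then _ else 0) jm)).
        intros k _.
        apply (Ps (fun j x => if (j <=? b - Sz)%nat then _ else 0) (fun j x => if (j <=? b - Sz)%nat then _ else 0)).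
        intros j _. destruct (j <=? b - Sz)%nat; [|exact H0]. apply Hs.
        apply (Ps (fun i x => bt k j i * _)%C (fun i x => bt k j i * _)%C). intros i _. apply Hs. apply It. apply IHfuel. }
      induction l; simpl; [apply Src|]. apply Hm; [apply Src|]. apply HX. exact IHl. }
  intros b l. apply Main.
Qed.
End Induct.

(** ** Expansions with uniform remainders *)

(* [kap] is the inverse of an admissible radius. *)
Definition expands (kap : R) (e : C) (F : C) (f : nat -> C) (Q : R) : Prop :=
  (forall l, Cmod (f l) <= Q * kap ^ l) /\
  (forall N, Cmod (F - psum (fun l => f l * e ^ l) N)%C <= Q * (kap * Cmod e) ^ N).

Section Expands.
Variables (kap : R) (e : C).
Hypothesis Hkap : 0 <= kap.

Lemma ke_pos : 0 <= kap * Cmod e.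
Proof. apply Rmult_le_pos; [exact Hkap|apply Cmod_ge_0]. Qed.

Lemma expands_mono F f Q Q' : Q <= Q' -> expands kap e F f Q -> expands kap e F f Q'.
Proof.
  intros HQ [H1 H2]. split.
  - intros l. eapply Rle_trans; [apply H1|]. apply Rmult_le_compat_r; [now apply pow_le|exact HQ].
  - intros N. eapply Rle_trans; [apply H2|]. apply Rmult_le_compat_r; [apply pow_le, ke_pos|exact HQ].
Qed.

Lemma expands_Q F f Q : expands kap e F f Q -> 0 <= Q.
Proof. intros [H _]. specialize (H 0%nat). simpl in H. generalize (Cmod_ge_0 (f 0%nat)). lra. Qed.

Lemma expands_eq F f F' f' Q : F = F' -> (forall l, f l = f' l) -> expands kap e F f Q -> expands kap e F' f' Q.
Proof.
  intros -> E [H1 H2]. split; [intros l; rewrite <- E; auto|]. intros N.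
  rewrite (psum_ext _ (fun l => f l * e ^ l)%C); auto. intros; now rewrite E.
Qed.

Lemma expands_0 : expands kap e 0 (fun _ => RtoC 0) 0.
Proof.
  split; [intros; rewrite Cmod_0; lra|]. intros N. replace (psum (fun _ => (0 * e ^ _)%C) N) with (RtoC 0).
  - replace (0 - 0)%C with (RtoC 0) by ring. rewrite Cmod_0. lra.
  - induction N; simpl; [easy|]. rewrite <- IHN. ring.
Qed.

Lemma expands_plus F f Q G g Q' : expands kap e F f Q -> expands kap e G g Q' ->
  expands kap e (F + G)%C (fun l => f l + g l)%C (Q + Q').
Proof.
  intros [A1 A2] [B1 B2]. split.
  - intros l. eapply Rle_trans; [apply Cmod_triangle|]. rewrite Rmult_plus_distr_r. now apply Rplus_le_compat.
  - intros N. rewrite (psum_ext _ (fun l => f l * e ^ l + g l * e ^ l)%C) by (intros; ring). rewrite psum_plus.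
    match goal with |- Cmod (F + G - (?a + ?b))%C <= _ => replace (F + G - (a + b))%C with ((F - a) + (G - b))%C by ring end.
    eapply Rle_trans; [apply Cmod_triangle|]. rewrite Rmult_plus_distr_r. now apply Rplus_le_compat.
Qed.

Lemma expands_scal c F f Q : expands kap e F f Q -> expands kap e (c * F)%C (fun l => c * f l)%C (Cmod c * Q).
Proof.
  intros [A1 A2]. split.
  - intros l. rewrite Cmod_mult, Rmult_assoc. apply Rmult_le_compat_l; [apply Cmod_ge_0|auto].
  - intros N. rewrite (psum_ext _ (fun l => c * (f l * e ^ l))%C) by (intros; ring). rewrite psum_scal.
    match goal with |- Cmod (c * F - c * ?a)%C <= _ => replace (c * F - c * a)%C with (c * (F - a))%C by ring end.
    rewrite Cmod_mult, Rmult_assoc. apply Rmult_le_compat_l; [apply Cmod_ge_0|auto].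
Qed.

Lemma expands_psum (F : nat -> C) (f : nat -> nat -> C) Q n : (forall k, (k < n)%nat -> expands kap e (F k) (f k) Q) ->
  expands kap e (psum F n) (fun l => psum (fun k => f k l) n) (INR n * Q).
Proof.
  induction n; intros H.
  - simpl. rewrite Rmult_0_l. apply expands_0.
  - rewrite S_INR, Rmult_plus_distr_r, Rmult_1_l. simpl. apply expands_plus; auto.
Qed.

Lemma half_pow_sum N : rsum (fun k => (/ 2) ^ k) N + (/ 2) ^ N <= 2.
Proof.
  assert (H := rsum_geom (/ 2) N). assert (0 < (/ 2) ^ N) by (apply pow_lt; lra). lra.
Qed.

Lemma tri_exchange (A : nat -> nat -> C) N :
  psum (fun l => psum (fun i => A i (l - i)%nat) (S l)) N = psum (fun i => psum (A i) (N - i)) N.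
Proof.
  induction N; [easy|]. 
  change (psum (fun l => psum (fun i => A i (l - i)%nat) (S l)) (S N)) with
    (psum (fun l => psum (fun i => A i (l - i)%nat) (S l)) N + psum (fun i => A i (N - i)%nat) (S N))%C.
  rewrite IHN.
  change (psum (fun i => psum (A i) (S N - i)) (S N)) with (psum (fun i => psum (A i) (S N - i)) N + psum (A N) (S N - N))%C.
  change (psum (fun i => A i (N - i)%nat) (S N)) with (psum (fun i => A i (N - i)%nat) N + A N (N - N)%nat)%C.
  rewrite (psum_ext (fun i => psum (A i) (S N - i)) (fun i => psum (A i) (N - i) + A i (N - i)%nat)%C).
  - rewrite psum_plus. replace (S N - N)%nat with 1%nat by lia. replace (N - N)%nat with 0%nat by lia. simpl. ring.
  - intros i Hi. replace (S N - i)%nat with (S (N - i)) by lia. reflexivity.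
Qed.

(** The multiplier expands with the rate [kap / 2]. The Cauchy product is then weighted by powers of
    1/2 and costs only a factor 2, with no loss in [kap]; a loss at each step would ruin the
    induction on beta. *)
Lemma expands_mult F f Q G g B : expands kap e F f Q -> expands (kap / 2) e G g B ->
  expands kap e (G * F)%C (fun l => psum (fun i => g i * f (l - i)%nat) (S l))%C (2 * B * Q).
Proof.
  intros HF HG. assert (HQ := expands_Q _ _ _ HF).
  assert (HB : 0 <= B) by (destruct HG as [HG _]; specialize (HG 0%nat); simpl in HG; generalize (Cmod_ge_0 (g 0%nat)); lra).
  destruct HF as [F1 F2], HG as [G1 G2]. split.
  - intros l. eapply Rle_trans; [apply psum_Cmod_le with (b := fun i => (B * Q * kap ^ l) * (/ 2) ^ i)|].
    + intros i Hi. rewrite Cmod_mult. eapply Rle_trans; [apply Rmult_le_compat; try apply Cmod_ge_0; [apply G1|apply F1]|].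
      right. replace (kap ^ l) with (kap ^ i * kap ^ (l - i)) by (rewrite <- pow_add; f_equal; lia).
      unfold Rdiv. rewrite Rpow_mult_distr. ring.
    + rewrite rsum_scal. assert (H := rsum_half (S l)). assert (0 <= B * Q * kap ^ l) by (repeat apply Rmult_le_pos; auto; now apply pow_le).
      apply Rle_trans with (B * Q * kap ^ l * 2); [now apply Rmult_le_compat_l|right; ring].
  - intros N. set (x := kap * Cmod e). assert (Hx : 0 <= x) by apply ke_pos.
    rewrite (psum_ext _ (fun l => psum (fun i => (fun i n => (g i * e ^ i) * (f n * e ^ n)) i (l - i)%nat) (S l))%C).
    2: { intros l _. rewrite Cmult_comm, <- psum_scal. apply psum_ext. intros i Hi.
         replace (e ^ l)%C with (e ^ i * e ^ (l - i))%C by (rewrite <- Cpow_add_r; f_equal; lia). ring. }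
    rewrite (tri_exchange (fun i n => (g i * e ^ i) * (f n * e ^ n))%C).
    rewrite (psum_ext _ (fun i => (g i * e ^ i) * F - (g i * e ^ i) * (F - psum (fun n => f n * e ^ n) (N - i)))%C).
    2: { intros i _. rewrite psum_scal. ring. }
    rewrite psum_minus.
    rewrite (psum_ext (fun i => g i * e ^ i * F)%C (fun i => F * (g i * e ^ i))%C) by (intros; ring). rewrite psum_scal.
    match goal with |- Cmod (G * F - (F * ?a - ?b))%C <= _ => replace (G * F - (F * a - b))%C with ((G - a) * F + b)%C by ring end.
    eapply Rle_trans; [apply Cmod_triangle|].
    assert (T1 : Cmod ((G - psum (fun i => g i * e ^ i) N) * F)%C <= B * Q * x ^ N * (/ 2) ^ N).
    { rewrite Cmod_mult. specialize (F2 0%nat). simpl in F2. replace (F - 0)%C with F in F2 by ring.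
      eapply Rle_trans; [apply Rmult_le_compat; try apply Cmod_ge_0; [apply G2|exact F2]|]. right.
      replace (kap / 2 * Cmod e) with (x * / 2) by (unfold x; field). rewrite Rpow_mult_distr. ring. }
    assert (T2 : Cmod (psum (fun i => g i * e ^ i * (F - psum (fun n => f n * e ^ n) (N - i))) N)%C <= B * Q * x ^ N * rsum (fun k => (/ 2) ^ k) N).
    { rewrite <- rsum_scal. apply psum_Cmod_le. intros i Hi. rewrite !Cmod_mult, Cmod_pow.
      eapply Rle_trans; [apply Rmult_le_compat; [|apply Cmod_ge_0| |apply F2]|].
      - apply Rmult_le_pos; [apply Cmod_ge_0|apply pow_le, Cmod_ge_0].
      - apply Rmult_le_compat_r; [apply pow_le, Cmod_ge_0|apply G1].
      - fold x. right. replace (x ^ N) with (x ^ i * x ^ (N - i)) by (rewrite <- pow_add; f_equal; lia).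
        unfold x at 2. unfold Rdiv. rewrite !Rpow_mult_distr. ring. }
    assert (H := half_pow_sum N). assert (0 <= B * Q * x ^ N) by (repeat apply Rmult_le_pos; auto; now apply pow_le).
    apply Rle_trans with (B * Q * x ^ N * 2); [|right; ring].
    eapply Rle_trans; [apply Rplus_le_compat; eassumption|]. rewrite <- Rmult_plus_distr_l. apply Rmult_le_compat_l; [assumption|lra].
Qed.

(** As 2 |w| <= kap, the recursion g_l = f_l - w g_(l-1) keeps the bound 2 Q kap^l. Multiplied by 1
    + e w, the remainder of the quotient collapses to the remainder of F minus the single term w
    g_(N-1) e^N, so a lower bound of |1 + e w| suffices, even where the geometric series of 1 / (1 +
    e w) diverges. *)
Lemma expands_div w F f Q G g d : expands kap e F f Q -> 2 * Cmod w <= kap -> 0 < d -> d <= Cmod (1 + e * w)%C ->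
  (G * (1 + e * w))%C = F -> (forall l, g l = (f l - match l with O => 0 | S l' => w * g l' end)%C) ->
  expands kap e G g (2 * (1 + / d) * Q).
Proof.
  intros HF Hw Hd Hdw HG Hg. assert (HQ := expands_Q _ _ _ HF). destruct HF as [F1 F2].
  assert (Pd : 0 < / d) by now apply Rinv_0_lt_compat. assert (Pw := Cmod_ge_0 w).
  assert (B : forall l, Cmod (g l) <= 2 * Q * kap ^ l).
  { induction l.
    - rewrite Hg. replace (f 0%nat - 0)%C with (f 0%nat) by ring. specialize (F1 0%nat). simpl in *. lra.
    - rewrite Hg. eapply Rle_trans; [apply Cmod_sub_le|]. rewrite Cmod_mult. specialize (F1 (S l)).
      assert (Cmod w * Cmod (g l) <= kap / 2 * (2 * Q * kap ^ l)).
      { apply Rmult_le_compat; try apply Cmod_ge_0; [lra|exact IHl]. }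
      simpl in *. lra. }
  split.
  - intros l. eapply Rle_trans; [apply B|]. apply Rmult_le_compat_r; [now apply pow_le|].
    apply Rle_trans with (2 * (1 + 0) * Q); [lra|]. apply Rmult_le_compat_r; lra.
  - intros N. set (x := kap * Cmod e). assert (Hx : 0 <= x) by apply ke_pos.
    assert (E : ((G - psum (fun l => g l * e ^ l) N) * (1 + e * w) =
      (F - psum (fun l => f l * e ^ l) N) - match N with O => 0 | S N' => w * g N' * e ^ N end)%C).
    { rewrite <- HG. induction N; [simpl; ring|].
      simpl psum. 
      transitivity ((G - psum (fun l => g l * e ^ l) N) * (1 + e * w) - g N * e ^ N * (1 + e * w))%C; [ring|].
      rewrite IHN. rewrite (Hg N). destruct N; simpl; ring. }
    assert (N1 : (1 + e * w)%C <> 0) by (apply Cmod_gt_0; lra).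
    set (R := (G - psum (fun l => g l * e ^ l) N)%C) in *.
    assert (K : Cmod R * d <= 2 * Q * x ^ N).
    { apply Rle_trans with (Cmod R * Cmod (1 + e * w)%C); [apply Rmult_le_compat_l; [apply Cmod_ge_0|exact Hdw]|].
      rewrite <- Cmod_mult, E. eapply Rle_trans; [apply Cmod_sub_le|]. specialize (F2 N). fold x in F2.
      assert (Y : Cmod (match N with O => 0 | S N' => w * g N' * e ^ N end)%C <= Q * x ^ N).
      { destruct N; [rewrite Cmod_0; simpl; lra|]. rewrite !Cmod_mult, Cmod_pow.
        apply Rle_trans with (kap / 2 * (2 * Q * kap ^ N) * Cmod e ^ S N).
        - apply Rmult_le_compat_r; [apply pow_le, Cmod_ge_0|]. apply Rmult_le_compat; try apply Cmod_ge_0; [lra|apply B].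
        - right. unfold x. rewrite Rpow_mult_distr. simpl. field. }
      lra. }
    apply Rmult_le_reg_r with d; [exact Hd|]. eapply Rle_trans; [exact K|].
    replace (2 * (1 + / d) * Q * x ^ N * d) with (2 * Q * x ^ N * (d + 1)) by (field; lra).
    assert (0 <= 2 * Q * x ^ N) by (apply Rmult_le_pos; [lra|now apply pow_le]). nra.
Qed.
End Expands.

Lemma open_Cpdisc r : open (Cpdisc r).
Proof.
  intros z [Hz1 Hz2]. apply locally_Cmod. assert (P := proj1 (Cmod_gt_0 z) Hz1).
  exists (Rmin (Cmod z) (r - Cmod z)). split; [apply Rmin_glb_lt; lra|]. intros w Hw.
  assert (H1 := Rlt_le_trans _ _ _ Hw (Rmin_l _ _)). assert (H2 := Rlt_le_trans _ _ _ Hw (Rmin_r _ _)).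
  split; [|generalize (Cmod_triangle_inv w z); lra].
  intros ->. replace (0 - z)%C with (- z)%C in H1 by ring. rewrite Cmod_opp in H1. lra.
Qed.

(** Taylor expansion in tau for fixed e, then in e for each coefficient [v m]. The estimates are
    kept in two stages because the regrouping by powers of eps is done after the substitution tau =
    eps w. *)
Lemma two_var (f : C -> C -> C) r0 rho0 B : 0 < r0 -> 0 < rho0 ->
  (forall e, Cpdisc r0 e -> hol (Cpdisc rho0) (f e)) -> (forall tau, Cpdisc rho0 tau -> hol (Cpdisc r0) (fun e => f e tau)) ->
  (forall e tau, Cpdisc r0 e -> Cpdisc rho0 tau -> Cmod (f e tau) <= B) ->
  exists (a : nat -> nat -> C) (v : nat -> C -> C),
    (forall m n, Cmod (a m n) <= B * (2 / rho0) ^ m * (2 / r0) ^ n) /\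
    (forall m N e, Cpdisc r0 e -> Cmod (v m e - psum (fun n => a m n * e ^ n) N)%C <= 3 * (B * (2 / rho0) ^ m) * (4 * Cmod e / r0) ^ N) /\
    (forall N e tau, Cpdisc r0 e -> Cpdisc rho0 tau -> Cmod (f e tau - psum (fun m => v m e * tau ^ m) N)%C <= 3 * B * (4 * Cmod tau / rho0) ^ N).
Proof.
  intros Hr Hrho H1 H2 HB.
  set (spec := fun e (a : nat -> C) => (forall n, Cmod (a n) <= B * (2 / rho0) ^ n) /\
    forall N z, Cpdisc rho0 z -> Cmod (f e z - psum (fun n => a n * z ^ n) N)%C <= 3 * B * (4 * Cmod z / rho0) ^ N).
  set (v := fun m e => epsilon (inhabits (fun _ : nat => RtoC 0)) (spec e) m).
  assert (Hv : forall e, Cpdisc r0 e -> spec e (fun m => v m e)).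
  { intros e He. unfold v. apply (epsilon_spec (inhabits (fun _ : nat => RtoC 0)) (spec e)).
    apply taylor_punctured; auto. }
  assert (HB0 : 0 <= B).
  { eapply Rle_trans; [apply Cmod_ge_0|apply (HB (RtoC (r0 / 2)) (RtoC (rho0 / 2)))]; split;
    try (apply RtoC_neq_0; lra); rewrite Cmod_RtoC_pos; lra. }
  assert (Hhol : forall m, hol (Cpdisc r0) (v m)).
  { intros m. induction m as [m IH] using (well_founded_induction lt_wf).
    set (x := fun k => RtoC (rho0 / (INR k + 2))).
    assert (Mx : forall k, Cmod (x k) = rho0 / (INR k + 2)).
    { intros k. apply Cmod_RtoC_pos. apply Rlt_le, Rdiv_lt_0_compat; [exact Hrho|]. generalize (pos_INR k). lra. }
    assert (Dx : forall k, Cpdisc rho0 (x k)).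
    { intros k. assert (P := pos_INR k). assert (0 < rho0 / (INR k + 2)) by (apply Rdiv_lt_0_compat; lra). split.
      - apply RtoC_neq_0. lra.
      - rewrite Mx. apply Rmult_lt_reg_r with (INR k + 2); [lra|]. unfold Rdiv. rewrite Rmult_assoc, Rinv_l by lra. nra. }
    (* [v m] was chosen pointwise in e; its holomorphy is obtained by exhibiting it as the bounded
       limit, as x_k tends to 0, of these quotients, which involve only [f] and the coefficients of
       smaller index. *)
    set (fk := fun k e => ((f e (x k) - psum (fun i => v i e * x k ^ i) m) / x k ^ m)%C).
    set (A := 3 * B * (4 / rho0) ^ S m).
    assert (PA : 0 <= A) by (apply Rmult_le_pos; [lra|]; apply pow_le, Rlt_le, Rdiv_lt_0_compat; lra).
    assert (Er : forall k e, Cpdisc r0 e -> Cmod (fk k e - v m e)%C <= A * Cmod (x k)).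
    { intros k e He. destruct (Hv e He) as [_ S2]. specialize (S2 (S m) (x k) (Dx k)). simpl psum in S2.
      assert (Nx : (x k ^ m)%C <> 0) by apply Cpow_neq_0, Dx. assert (Px := proj1 (Cmod_gt_0 _) (proj1 (Dx k))).
      unfold fk.
      replace ((f e (x k) - psum (fun i => v i e * x k ^ i) m) / x k ^ m - v m e)%C with
        ((f e (x k) - (psum (fun i => v i e * x k ^ i) m + v m e * x k ^ m)) / x k ^ m)%C by (field; exact Nx).
      rewrite Cmod_div, Cmod_pow by exact Nx.
      apply Rmult_le_reg_r with (Cmod (x k) ^ m); [now apply pow_lt|].
      unfold Rdiv at 1. rewrite Rmult_assoc, Rinv_l, Rmult_1_r by (apply Rgt_not_eq; now apply pow_lt).
      eapply Rle_trans; [exact S2|]. right. unfold A. replace (4 * Cmod (x k) / rho0) with (4 / rho0 * Cmod (x k)) by (field; lra).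
      rewrite Rpow_mult_distr. simpl. ring. }
    apply (hol_lim (Cpdisc r0) fk (v m) (B * (2 / rho0) ^ m + A * rho0)).
    - apply open_Cpdisc.
    - intros k. apply hol_mult; [|apply hol_const]. apply hol_minus; [now apply H2|].
      assert (G : forall M, (M <= m)%nat -> hol (Cpdisc r0) (fun e => psum (fun i => v i e * x k ^ i)%C M)).
      { induction M; intros HM; simpl; [apply hol_const|]. apply hol_plus; [apply IHM; lia|].
        apply hol_mult; [apply IH; lia|apply hol_const]. }
      apply G. lia.
    - intros k e He. replace (fk k e) with (v m e + (fk k e - v m e))%C by ring.
      eapply Rle_trans; [apply Cmod_triangle|]. apply Rplus_le_compat; [apply Hv, He|].
      eapply Rle_trans; [apply Er, He|]. apply Rmult_le_compat_l; [exact PA|]. apply Rlt_le, Dx.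
    - intros e He. apply (tends_squeeze _ _ (fun k => A * Cmod (x k))).
      + apply filter_forall. intros k. now apply Er.
      + intros eta Heta. destruct (nfloor_ex (A * rho0 / eta)) as [N [_ HN]].
        { apply Rmult_le_pos; [apply Rmult_le_pos; lra|apply Rlt_le, Rinv_0_lt_compat; lra]. }
        exists N. intros k Hk. rewrite Mx. apply le_INR in Hk. assert (P := pos_INR N).
        apply Rmult_lt_compat_r with (r := eta) in HN; [|lra]. unfold Rdiv in HN. rewrite (Rmult_assoc _ (/ eta)), Rinv_l in HN by lra.
        apply Rmult_lt_reg_r with (INR k + 2); [lra|].
        replace (A * (rho0 / (INR k + 2)) * (INR k + 2)) with (A * rho0) by (field; lra). nra. }
  assert (Hva : forall m, exists a : nat -> C, (forall n, Cmod (a n) <= (B * (2 / rho0) ^ m) * (2 / r0) ^ n) /\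
    forall N z, Cpdisc r0 z -> Cmod (v m z - psum (fun n => a n * z ^ n) N)%C <= 3 * (B * (2 / rho0) ^ m) * (4 * Cmod z / r0) ^ N).
  { intros m. apply taylor_punctured; auto. intros z Hz. apply Hv, Hz. }
  set (a := fun m => epsilon (inhabits (fun _ : nat => RtoC 0)) (fun a : nat -> C => (forall n, Cmod (a n) <= (B * (2 / rho0) ^ m) * (2 / r0) ^ n) /\
    forall N z, Cpdisc r0 z -> Cmod (v m z - psum (fun n => a n * z ^ n) N)%C <= 3 * (B * (2 / rho0) ^ m) * (4 * Cmod z / r0) ^ N)).
  assert (Ha := fun m => epsilon_spec (inhabits (fun _ : nat => RtoC 0)) _ (Hva m)).
  exists a, v. split; [|split].
  - intros m n. apply Ha.
  - intros m N e He. now apply Ha.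
  - intros N e tau He Htau. apply (Hv e He). exact Htau.
Qed.

Lemma pow_ge_succ N : INR N + 1 <= 2 ^ N.
Proof. induction N; [simpl; lra|]. rewrite S_INR. simpl. generalize (pos_INR N). lra. Qed.

Lemma rsum_pow_le x N : 2 <= x -> rsum (fun l => x ^ l) N <= x ^ N.
Proof.
  intros Hx. induction N; simpl; [lra|]. assert (0 <= x ^ N) by (apply pow_le; lra). nra.
Qed.

(** Where |e w| < rho0, the double Taylor series is regrouped by total degree; the number of terms
    is absorbed by the margin between [kap] and the two inverse radii. Where |e w| >= rho0, nothing
    is expanded: the bound [E] on [F] and the growth of (kap |e|)^N do the work. *)
Lemma init_expands (a : nat -> nat -> C) (v : nat -> C -> C) f r0 rho0 B (e w F : C) E : 0 < r0 -> 1 < rho0 -> 0 <= B -> 0 <= E ->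
  (forall m n, Cmod (a m n) <= B * (2 / rho0) ^ m * (2 / r0) ^ n) ->
  (forall m N, Cmod (v m e - psum (fun n => a m n * e ^ n) N)%C <= 3 * (B * (2 / rho0) ^ m) * (4 * Cmod e / r0) ^ N) ->
  (Cmod (e * w)%C < rho0 -> F = f /\ forall N, Cmod (f - psum (fun m => v m e * (e * w) ^ m) N)%C <= 3 * B * (4 * Cmod (e * w)%C / rho0) ^ N) ->
  (rho0 <= Cmod (e * w)%C -> Cmod F <= E) ->
  expands (8 / r0 + 8 * Cmod w) e F (fun l => psum (fun m => a m (l - m)%nat * w ^ m) (S l))%C (3 * B + E).
Proof.
  intros Hr Hrho HB HE Ha Hv Hf HF. set (kap := 8 / r0 + 8 * Cmod w).
  assert (Pw := Cmod_ge_0 w). assert (Pe := Cmod_ge_0 e).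
  assert (Pr : 0 < / r0) by now apply Rinv_0_lt_compat.
  assert (Pk : 0 <= kap) by (unfold kap, Rdiv; lra).
  assert (K1 : 2 / r0 <= kap / 4) by (unfold kap, Rdiv; lra).
  assert (Irho : / rho0 <= 1) by (rewrite <- Rinv_1; apply Rinv_le_contravar; lra).
  assert (Irho' : 0 < / rho0) by (apply Rinv_0_lt_compat; lra).
  assert (K2 : 2 / rho0 * Cmod w <= kap / 4).
  { unfold kap, Rdiv. assert (2 * / rho0 * Cmod w <= 2 * 1 * Cmod w); [|lra]. apply Rmult_le_compat_r; [exact Pw|lra]. }
  assert (Coef : forall l, Cmod (psum (fun m => a m (l - m)%nat * w ^ m) (S l))%C <= B * kap ^ l).
  { intros l. eapply Rle_trans; [apply psum_Cmod_le with (b := fun _ => B * (kap / 4) ^ l)|].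
    - intros m Hm. rewrite Cmod_mult, Cmod_pow.
      eapply Rle_trans; [apply Rmult_le_compat_r; [now apply pow_le|apply Ha]|].
      replace (B * (2 / rho0) ^ m * (2 / r0) ^ (l - m) * Cmod w ^ m) with (B * ((2 / rho0 * Cmod w) ^ m * (2 / r0) ^ (l - m))) by (rewrite Rpow_mult_distr; ring).
      apply Rmult_le_compat_l; [exact HB|]. replace ((kap / 4) ^ l) with ((kap / 4) ^ m * (kap / 4) ^ (l - m)) by (rewrite <- pow_add; f_equal; lia).
      apply Rmult_le_compat; try (apply pow_le; unfold Rdiv; try apply Rmult_le_pos; lra); apply pow_incr; (split; [unfold Rdiv; try apply Rmult_le_pos; lra|assumption]).
    (* There are l + 1 <= 2^l terms, each at most B (kap / 4)^l. *)
    - rewrite rsum_const, S_INR. assert (P2 := pow_ge_succ l).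
      assert (0 <= kap ^ l) by now apply pow_le. assert (0 <= (kap / 4) ^ l) by (apply pow_le; lra).
      replace (kap ^ l) with (4 ^ l * (kap / 4) ^ l) by (rewrite <- Rpow_mult_distr; f_equal; field).
      assert (2 ^ l <= 4 ^ l) by (apply pow_incr; lra).
      replace (B * (4 ^ l * (kap / 4) ^ l)) with (4 ^ l * (B * (kap / 4) ^ l)) by ring.
      apply Rmult_le_compat_r; [now apply Rmult_le_pos|lra]. }
  split.
  - intros l. eapply Rle_trans; [apply Coef|]. apply Rmult_le_compat_r; [now apply pow_le|lra].
  - intros N. set (x := kap * Cmod e). assert (Px : 0 <= x) by (apply Rmult_le_pos; lra).
    destruct (Rlt_le_dec (Cmod (e * w)%C) rho0) as [h|h].
    + destruct (Hf h) as [-> Hf']. clear Hf HF. specialize (Hf' N).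
      rewrite (psum_ext _ (fun l => psum (fun i => (fun i n => (e * w) ^ i * (a i n * e ^ n)) i (l - i)%nat) (S l))%C).
      2: { intros l _. rewrite Cmult_comm, <- psum_scal. apply psum_ext. intros i Hi.
           replace (e ^ l)%C with (e ^ i * e ^ (l - i))%C by (rewrite <- Cpow_add_r; f_equal; lia). rewrite Cpow_mult_l. ring. }
      rewrite (tri_exchange (fun i n => (e * w) ^ i * (a i n * e ^ n))%C).
      rewrite (psum_ext (fun i => psum _ (N - i)) (fun i => v i e * (e * w) ^ i - (e * w) ^ i * (v i e - psum (fun n => a i n * e ^ n) (N - i)))%C).
      2: { intros i _. rewrite psum_scal. ring. }
      rewrite psum_minus.
      match goal with |- Cmod (f - (?a - ?b))%C <= _ => replace (f - (a - b))%C with ((f - a) + b)%C by ring end.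
      eapply Rle_trans; [apply Cmod_triangle|].
      assert (T1 : 3 * B * (4 * Cmod (e * w)%C / rho0) ^ N <= 3 * B * (x / 2) ^ N).
      { apply Rmult_le_compat_l; [lra|]. rewrite Cmod_mult. apply pow_incr. split.
        - unfold Rdiv. repeat apply Rmult_le_pos; lra.
        - unfold x. replace (4 * (Cmod e * Cmod w) / rho0) with (2 * (2 / rho0 * Cmod w) * Cmod e) by (field; lra).
          replace (kap * Cmod e / 2) with (2 * (kap / 4) * Cmod e) by field. apply Rmult_le_compat_r; lra. }
      assert (T2 : Cmod (psum (fun i => (e * w) ^ i * (v i e - psum (fun n => a i n * e ^ n) (N - i))) N)%C <= INR N * (3 * B * (x / 2) ^ N)).
      { rewrite <- rsum_const. apply psum_Cmod_le. intros i Hi. rewrite Cmod_mult, Cmod_pow, Cmod_mult.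
        eapply Rle_trans; [apply Rmult_le_compat_l; [apply pow_le, Rmult_le_pos; lra|apply Hv]|].
        replace ((Cmod e * Cmod w) ^ i * (3 * (B * (2 / rho0) ^ i) * (4 * Cmod e / r0) ^ (N - i))) with
          (3 * B * ((2 / rho0 * Cmod w * Cmod e) ^ i * (2 * (2 / r0) * Cmod e) ^ (N - i))).
        2: { replace (4 * Cmod e / r0) with (2 * (2 / r0) * Cmod e) by (field; lra). rewrite !Rpow_mult_distr. ring. }
        apply Rmult_le_compat_l; [lra|].
        replace ((x / 2) ^ N) with ((x / 2) ^ i * (x / 2) ^ (N - i)) by (rewrite <- pow_add; f_equal; lia).
        assert (Q1 : 0 <= 2 / rho0 * Cmod w) by (unfold Rdiv; repeat apply Rmult_le_pos; lra).
        assert (Q2 : 0 <= 2 / r0) by (unfold Rdiv; lra).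
        apply Rmult_le_compat; try (apply pow_le; repeat apply Rmult_le_pos; lra); apply pow_incr; split.
        - now apply Rmult_le_pos.
        - unfold x. replace (kap * Cmod e / 2) with ((kap / 2) * Cmod e) by field. apply Rmult_le_compat_r; lra.
        - repeat apply Rmult_le_pos; lra.
        - unfold x. replace (kap * Cmod e / 2) with ((kap / 2) * Cmod e) by field. apply Rmult_le_compat_r; lra. }
      assert (P2 := pow_ge_succ N). 
      assert (P3 : 3 * B * (x / 2) ^ N + INR N * (3 * B * (x / 2) ^ N) <= 3 * B * x ^ N).
      { replace (x ^ N) with (2 ^ N * (x / 2) ^ N) by (rewrite <- Rpow_mult_distr; f_equal; field).
        assert (Q : 0 <= 3 * B * (x / 2) ^ N) by (apply Rmult_le_pos; [lra|apply pow_le; lra]).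
        replace (3 * B * (2 ^ N * (x / 2) ^ N)) with (2 ^ N * (3 * B * (x / 2) ^ N)) by ring.
        replace (3 * B * (x / 2) ^ N + INR N * (3 * B * (x / 2) ^ N)) with ((INR N + 1) * (3 * B * (x / 2) ^ N)) by ring.
        now apply Rmult_le_compat_r. }
      assert (0 <= E * x ^ N) by (apply Rmult_le_pos; [exact HE|now apply pow_le]).
      rewrite Rmult_plus_distr_r. lra.
    + specialize (HF h). clear Hf.
      (* Here kap |e| >= 8 |e w| >= 8 rho0 > 2, so even the geometric sum of the powers below N is
         at most the N-th power. *)
      assert (X2 : 2 <= x).
      { unfold x, kap. rewrite Cmod_mult in h. assert (0 <= 8 / r0 * Cmod e) by (unfold Rdiv; repeat apply Rmult_le_pos; lra). nra. }
      eapply Rle_trans; [apply Cmod_sub_le|].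
      assert (T : Cmod (psum (fun l => psum (fun m => a m (l - m)%nat * w ^ m) (S l) * e ^ l) N)%C <= B * x ^ N).
      { eapply Rle_trans; [apply psum_Cmod_le with (b := fun l => B * x ^ l)|].
        - intros l _. rewrite Cmod_mult, Cmod_pow. unfold x. rewrite Rpow_mult_distr, <- Rmult_assoc.
          apply Rmult_le_compat_r; [now apply pow_le|apply Coef].
        - rewrite rsum_scal. apply Rmult_le_compat_l; [exact HB|now apply rsum_pow_le]. }
      assert (1 <= x ^ N) by (apply pow_R1_Rle; lra). nra.
Qed.

(** The formal equation uses the derivatives at 0, the estimates use Cauchy's coefficients;
    [taylor_coef] identifies them. The rate [kap / 2] is the one asked of a multiplier in
    [expands_mult]. *)
Lemma b_expands f r0 c kap (e : C) : 0 < r0 -> 8 / r0 <= kap -> Cpdisc r0 e -> hol (Cdisc r0) f ->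
  (forall z, Cdisc r0 z -> Cmod (f z) <= c) ->
  expands (kap / 2) e (f e) (fun l => C_derive_n f l 0 / Cfact l)%C (3 * c).
Proof.
  intros Hr Hk [He1 He2] Hf Hc.
  assert (HD : forall w, ball_at 0 r0 w -> Cdisc r0 w).
  { intros w Hw. unfold ball_at in Hw. replace (w - 0)%C with w in Hw by ring. exact Hw. }
  destruct (taylor_ball f 0 r0 c Hr) as [a [A0 [A1 A2]]].
  - intros w Hw. apply Hf; auto.
  - intros w Hw. apply Hc; auto.
  - assert (Hc0 : 0 <= c) by (eapply Rle_trans; [apply Cmod_ge_0|apply (Hc 0)]; unfold Cdisc; rewrite Cmod_0; lra).
    assert (P2 : 0 < 2 / r0) by (apply Rdiv_lt_0_compat; lra).
    assert (Co : forall l, C_derive_n f l 0 = (Cfact l * a l)%C).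
    { apply (taylor_coef f a c (2 / r0) (r0 / 8)); auto; [lra|]. intros z Hz.
      destruct (Ceq_dec z 0) as [->|Nz]; [rewrite psf_0; now symmetry|]. symmetry. apply Cser_eq.
      apply (tends_squeeze _ _ (fun N => 3 * c * (/ 2) ^ N)).
      - apply filter_forall. intros N. rewrite Cmod_sub_sym. replace z with (0 + z)%C at 1 by ring.
        eapply Rle_trans; [apply A2; auto; lra|]. apply Rmult_le_compat_l; [lra|]. apply pow_incr. split.
        + apply Rmult_le_pos; [|apply Rlt_le, Rinv_0_lt_compat; lra]. generalize (Cmod_ge_0 z). lra.
        + apply Rmult_le_reg_r with r0; [lra|]. unfold Rdiv. rewrite Rmult_assoc, Rinv_l by lra. lra.
      - intros eta Heta. assert (Q : 0 < eta / (3 * c + 1)) by (apply Rdiv_lt_0_compat; lra).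
        destruct (pow_lt_1_zero (/ 2) ltac:(rewrite Rabs_pos_eq; lra) _ Q) as [N0 HN0]. exists N0. intros n Hn.
        specialize (HN0 n ltac:(lia)). rewrite Rabs_pos_eq in HN0 by (apply pow_le; lra).
        assert (0 < (/ 2) ^ n) by (apply pow_lt; lra).
        apply Rmult_lt_compat_r with (r := 3 * c + 1) in HN0; [|lra]. unfold Rdiv in HN0. rewrite Rmult_assoc, Rinv_l in HN0 by lra. nra. }
    assert (Pe := proj1 (Cmod_gt_0 e) He1).
    assert (Ir : 0 < / r0) by now apply Rinv_0_lt_compat.
    assert (K1 : 2 / r0 <= kap / 2) by (unfold Rdiv in *; lra).
    assert (K2 : 4 * Cmod e / r0 <= kap / 2 * Cmod e).
    { replace (4 * Cmod e / r0) with (8 / r0 / 2 * Cmod e) by (field; lra). apply Rmult_le_compat_r; lra. }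
    assert (E : forall l, (C_derive_n f l 0 / Cfact l)%C = a l) by (intros l; rewrite Co; field; apply Cfact_neq_0).
    split.
    + intros l. rewrite E. eapply Rle_trans; [apply A1|].
      apply Rmult_le_compat; [exact Hc0|apply pow_le; lra|lra|]. apply pow_incr. lra.
    + intros N. rewrite (psum_ext _ (fun l => a l * e ^ l)%C) by (intros; now rewrite E).
      specialize (A2 N e He2 He1). replace (0 + e)%C with e in A2 by ring. eapply Rle_trans; [exact A2|].
      apply Rmult_le_compat_l; [lra|]. apply pow_incr. split; [|exact K2].
      apply Rmult_le_pos; [lra|apply Rlt_le, Rinv_0_lt_compat; lra].
Qed.

(** ** Weights absorbing the recursion *)

Lemma fact_quot x j : INR (fact (x + j)) <= INR (fact x) * INR (x + j) ^ j.
Proof.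
  induction j; [rewrite Nat.add_0_r; simpl; lra|]. replace (x + S j)%nat with (S (x + j)) by lia.
  change (fact (S (x + j))) with (S (x + j) * fact (x + j))%nat. rewrite mult_INR.
  assert (P := pos_INR (x + j)). assert (Q : INR (x + j) <= INR (S (x + j))) by (rewrite S_INR; lra).
  assert (INR (x + j) ^ j <= INR (S (x + j)) ^ j) by (apply pow_incr; lra).
  assert (Pf := INR_fact_lt_0 x). rewrite <- tech_pow_Rmult.
  apply Rle_trans with (INR (S (x + j)) * (INR (fact x) * INR (x + j) ^ j)); [apply Rmult_le_compat_l; [apply pos_INR|exact IHj]|].
  replace (INR (fact x) * (INR (S (x + j)) * INR (S (x + j)) ^ j)) with (INR (S (x + j)) * (INR (fact x) * INR (S (x + j)) ^ j)) by ring.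
  apply Rmult_le_compat_l; [apply pos_INR|]. apply Rmult_le_compat_l; lra.
Qed.

Lemma pow_le_exp y eta j : 0 <= y -> 0 < eta -> y ^ j <= INR (fact j) / eta ^ j * exp (eta * y).
Proof.
  intros Hy He. assert (P := INR_fact_lt_0 j). assert (Q : 0 < eta ^ j) by now apply pow_lt.
  assert (H := rsum_exp (eta * y) (S j) ltac:(nra)). rewrite rsum_S in H.
  assert (0 <= rsum (fun k => (eta * y) ^ k / INR (fact k)) j).
  { apply rsum_ge_0. intros k _. apply Rmult_le_pos; [apply pow_le; nra|]. apply Rlt_le, Rinv_0_lt_compat, INR_fact_lt_0. }
  assert (X : (eta * y) ^ j / INR (fact j) <= exp (eta * y)) by lra.
  rewrite Rpow_mult_distr in X.
  apply Rmult_le_compat_l with (r := INR (fact j) / eta ^ j) in X; [|apply Rmult_le_pos; [lra|]; apply Rlt_le, Rinv_0_lt_compat; lra].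
  replace (INR (fact j) / eta ^ j * (eta ^ j * y ^ j / INR (fact j))) with (y ^ j) in X by (field; lra). exact X.
Qed.

(** In the coefficient of z^n / n!, the product of z^j with the term of degree n - j of the series
    dilated by q^(-m1) produces this factor. *)
Definition cfac (q : C) (m1 : nat -> nat) (n k j : nat) : C :=
  (Cfact n / Cfact (n - j) * (/ q ^ m1 k) ^ (n - j))%C.

(** With x = n - j and h = Sz - k + j, the index rises from x + k to x + k + h. The weight loses al
    (2 (x + k) h + h^2), while the dilation brings q^(-m1 x), at most exp(-2 h A1 L x). The surplus
    2 h (A1 L - al) x also absorbs the factorial quotient, a polynomial in x, and what does not
    depend on x is left to the linear term g h. *)
Lemma weights (q : C) (hq : 1 < Cmod q) Sz jm (m1 : nat -> nat) (Ik : nat -> list nat) A1 al K : 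
  0 <= K -> 0 < al < A1 * ln (Cmod q) ->
  (forall k s, (k < Sz)%nat -> In s (Ik k) -> INR (m1 k) >= 2 * (INR Sz - INR k + INR s) * A1) ->
  exists g, 0 <= g /\ forall n k j, (k < Sz)%nat -> (j < jm)%nat -> In j (Ik k) -> (j <= n)%nat ->
    K * Cmod (cfac q m1 n k j) * exp (- al * INR (n - j + k) ^ 2 + g * INR (n - j + k)) <=
    exp (- al * INR (n + Sz) ^ 2 + g * INR (n + Sz)).
Proof.
  intros HK Hal Hm. set (L := ln (Cmod q)) in *. assert (HL := L_pos q hq). fold L in HL.
  set (eta := 2 * (A1 * L - al)). assert (He : 0 < eta) by (unfold eta; lra).
  set (Cj := fun j => INR (fact j) / eta ^ j * exp (eta * INR j)).
  assert (PCj : forall j, 0 <= Cj j).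
  { intros j. unfold Cj. apply Rmult_le_pos; [|apply Rlt_le, exp_pos]. apply Rmult_le_pos; [apply pos_INR|]. apply Rlt_le, Rinv_0_lt_compat, pow_lt; lra. }
  set (CC := rsum Cj jm).
  assert (HCC : forall j, (j < jm)%nat -> Cj j <= CC).
  { unfold CC. clear -PCj. induction jm as [|n IHn]; intros j Hj; [lia|]. rewrite rsum_S. assert (0 <= rsum Cj n) by (apply rsum_ge_0; auto).
    destruct (Nat.eq_dec j n) as [->|]; [lra|]. specialize (IHn j ltac:(lia)). specialize (PCj n). lra. }
  assert (PCC : 0 <= CC) by (apply rsum_ge_0; auto).
  set (H := INR Sz + INR jm).
  (* The three summands pay, after multiplication by h, for the constant K CC, the cross term 2 al k
     h and al h^2, in view of 1 <= h <= H. *)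
  set (g := ln (1 + K * CC) + 2 * al * INR Sz + al * H).
  assert (PKC : 0 <= K * CC) by now apply Rmult_le_pos.
  assert (PS := pos_INR Sz). assert (Pj := pos_INR jm).
  assert (Pln : 0 <= ln (1 + K * CC)).
  { rewrite <- ln_1. destruct PKC as [h|h]; [apply Rlt_le, ln_increasing; lra|rewrite <- h, Rplus_0_r; lra]. }
  assert (Pg : 0 <= g) by (unfold g, H; nra).
  exists g. split; [exact Pg|]. intros n k j Hk Hj HI Hn.
  set (x := (n - j)%nat). set (h := INR Sz - INR k + INR j).
  assert (Hn' : n = (x + j)%nat) by (unfold x; lia).
  assert (Hh1 : 1 <= h). { apply le_INR in Hk. rewrite S_INR in Hk. unfold h. generalize (pos_INR j). lra. }
  assert (HhH : h <= H). { apply lt_INR in Hj. unfold h, H. generalize (pos_INR k). lra. }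
  assert (Ek : INR k <= INR Sz) by (apply le_INR; lia). assert (Pk := pos_INR k). assert (Px := pos_INR x).
  assert (E1 : INR (n + Sz) = INR x + INR k + h).
  { rewrite Hn', !plus_INR. unfold h. ring. }
  assert (E2 : INR (x + k) = INR x + INR k) by apply plus_INR. rewrite E1, E2.
  assert (Cf : Cmod (cfac q m1 n k j) <= CC * exp (- 2 * h * al * INR x)).
  { unfold cfac. fold x. assert (Nq := Cpow_neq_0 q (m1 k) (q_neq_0 q hq)).
    rewrite Cmod_mult, Cmod_div, !Cmod_Cfact, Cmod_pow, Cmod_inv, Cmod_pow by (auto using Cfact_neq_0).
    rewrite (Cmod_q_exp q hq). fold L. rewrite (exp_nat L (m1 k)), <- exp_Ropp, (exp_nat _ x).
    assert (Pf := INR_fact_lt_0 x).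
    assert (Y1 : INR (fact n) / INR (fact x) <= INR (x + j) ^ j).
    { apply Rmult_le_reg_r with (INR (fact x)); [exact Pf|]. unfold Rdiv. rewrite Rmult_assoc, Rinv_l by lra.
      rewrite Hn'. generalize (fact_quot x j). lra. }
    assert (Y2 := pow_le_exp (INR (x + j)) eta j (pos_INR _) He). rewrite plus_INR, Rmult_plus_distr_l, exp_plus in Y2.
    assert (Y3 : INR (fact j) / eta ^ j * (exp (eta * INR x) * exp (eta * INR j)) = Cj j * exp (eta * INR x)) by (unfold Cj; ring).
    rewrite Y3 in Y2.
    assert (Y4 : exp (INR x * - (INR (m1 k) * L)) <= exp (INR x * - (2 * h * A1 * L))).
    { apply exp_le. apply Rmult_le_compat_l; [exact Px|]. apply Ropp_le_contravar. apply Rmult_le_compat_r; [lra|]. specialize (Hm k j Hk HI). unfold h. lra. }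
    apply Rle_trans with (CC * exp (eta * INR x) * exp (INR x * - (2 * h * A1 * L))).
    - apply Rmult_le_compat; [|apply Rlt_le, exp_pos| |exact Y4].
      + apply Rmult_le_pos; [apply pos_INR|apply Rlt_le, Rinv_0_lt_compat; lra].
      + eapply Rle_trans; [exact Y1|]. rewrite plus_INR. eapply Rle_trans; [exact Y2|]. apply Rmult_le_compat_r; [apply Rlt_le, exp_pos|]. now apply HCC.
    - rewrite Rmult_assoc. apply Rmult_le_compat_l; [exact PCC|]. rewrite <- exp_plus. apply exp_le.
      unfold eta. assert (0 <= (A1 * L - al) * INR x) by (apply Rmult_le_pos; lra). nra. }
  apply Rle_trans with (K * (CC * exp (- 2 * h * al * INR x)) * exp (- al * (INR x + INR k) ^ 2 + g * (INR x + INR k))).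
  { apply Rmult_le_compat_r; [apply Rlt_le, exp_pos|]. now apply Rmult_le_compat_l. }
  apply Rle_trans with (exp (ln (1 + K * CC)) * exp (- 2 * h * al * INR x) * exp (- al * (INR x + INR k) ^ 2 + g * (INR x + INR k))).
  { rewrite exp_ln by lra. apply Rmult_le_compat_r; [apply Rlt_le, exp_pos|]. rewrite <- Rmult_assoc. apply Rmult_le_compat_r; [apply Rlt_le, exp_pos|]. lra. }
  rewrite <- !exp_plus. apply exp_le.
  assert (G1 : ln (1 + K * CC) + 2 * al * INR k * h + al * h ^ 2 <= g * h).
  { assert (Z1 : ln (1 + K * CC) <= ln (1 + K * CC) * h) by nra.
    assert (Z2 : 2 * al * INR k * h <= 2 * al * INR Sz * h).
    { apply Rmult_le_compat_r; [lra|]. apply Rmult_le_compat_l; lra. }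
    assert (Z3 : al * h ^ 2 <= al * H * h).
    { replace (al * h ^ 2) with (al * h * h) by ring. apply Rmult_le_compat_r; [lra|]. apply Rmult_le_compat_l; lra. }
    unfold g. lra. }
  nra.
Qed.

Lemma choice_nat {A : Type} (P : nat -> A -> Prop) : (forall j, exists a, P j a) -> exists f, forall j, P j (f j).
Proof.
  intros H. exists (fun j => proj1_sig (constructive_indefinite_description _ (H j))).
  intros j. apply proj2_sig.
Qed.

Lemma fin_bound (P : nat -> R -> Prop) n : (forall j c c', c <= c' -> P j c -> P j c') ->
  (forall j, (j < n)%nat -> exists c, P j c) -> exists c, 0 <= c /\ forall j, (j < n)%nat -> P j c.
Proof.
  intros HM. induction n; intros H.
  - exists 0. split; [lra|]. intros; lia.
  - destruct IHn as [c [Hc Hc']]; [intros; apply H; lia|]. destruct (H n) as [d Hd]; [lia|].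
    exists (Rmax c d). split; [eapply Rle_trans; [exact Hc|apply Rmax_l]|]. intros j Hj.
    destruct (Nat.eq_dec j n) as [->|Hn]; [apply HM with d; [apply Rmax_r|exact Hd]|].
    apply HM with c; [apply Rmax_l|]. apply Hc'. lia.
Qed.

(** ** Sums over lists *)

Lemma Csum_app l l' f : Csum (l ++ l') f = (Csum l f + Csum l' f)%C.
Proof. induction l; simpl; [ring|]. unfold Csum in *. simpl. rewrite IHl. ring. Qed.

Lemma Csum_seq n f : Csum (seq 0 n) f = psum f n.
Proof. induction n; [easy|]. rewrite seq_S, Csum_app, IHn. simpl. ring. Qed.

Lemma psum_zero (f : nat -> C) n : (forall k, (k < n)%nat -> f k = 0) -> psum f n = 0.
Proof. induction n; intros H; simpl; [easy|]. rewrite IHn, H by auto. ring. Qed.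

Lemma psum_trunc (f : nat -> C) a b : (forall k, (a <= k)%nat -> f k = 0) -> (forall k, (b <= k)%nat -> f k = 0) ->
  psum f a = psum f b.
Proof.
  intros Ha Hb. destruct (le_ge_dec a b) as [h|h].
  - replace b with (a + (b - a))%nat by lia. rewrite psum_add, (psum_zero (fun k => f (a + k)%nat)); [ring|]. intros k _. apply Ha. lia.
  - replace a with (b + (a - b))%nat by lia. rewrite psum_add, (psum_zero (fun k => f (b + k)%nat)); [ring|]. intros k _. apply Hb. lia.
Qed.

Lemma psum_S (f : nat -> C) n : psum f (S n) = (psum f n + f n)%C.
Proof. reflexivity. Qed.

Lemma Csum_nodup (l : list nat) (f : nat -> C) N : NoDup l -> (forall s, In s l -> (s < N)%nat) ->
  Csum l f = psum (fun j => if in_dec Nat.eq_dec j l then f j else 0) N.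
Proof.
  induction l as [|x l IH]; intros Hnd HN.
  - simpl. symmetry. apply psum_zero. easy.
  - inversion Hnd as [|? ? Hx Hl]; subst. change (Csum (x :: l) f) with (f x + Csum l f)%C.
    rewrite IH by (auto; intros; apply HN; now right).
    assert (E : forall M, psum (fun j => if in_dec Nat.eq_dec j (x :: l) then f j else 0) M =
      ((if (x <? M)%nat then f x else 0) + psum (fun j => if in_dec Nat.eq_dec j l then f j else 0) M)%C).
    { induction M as [|M IHM]; [change (0 <? 0)%nat with false; cbn [psum Nat.ltb Nat.leb]; ring|]. rewrite !psum_S, IHM. clear IHM. cbv beta.
      destruct (in_dec Nat.eq_dec M (x :: l)) as [h|h]; destruct (in_dec Nat.eq_dec M l) as [h'|h'];
      destruct (Nat.ltb_spec x M); destruct (Nat.ltb_spec x (S M)); try lia; try ring.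
      all: try (exfalso; apply h; now right); try (exfalso; apply h; left; lia);
        try (destruct h as [h|h]; [lia|contradiction]); assert (x = M) by lia; subst; try contradiction; ring. }
    rewrite E. destruct (Nat.ltb_spec x N) as [h|h]; [easy|]. specialize (HN x (or_introl eq_refl)). lia.
Qed.

(** ** The recursion for the coefficients in [z] *)

Lemma Cfact_S n : Cfact (S n) = (RtoC (INR (S n)) * Cfact n)%C.
Proof. unfold Cfact. rewrite <- RtoC_mult, <- mult_INR. reflexivity. Qed.

Lemma zs_deriv_n_fact (w : nat -> C) k : forall n,
  zs_deriv_n k (fun b => w b / Cfact b)%C n = (w (n + k)%nat / Cfact n)%C.
Proof.
  induction k; intros n; [simpl; now rewrite Nat.add_0_r|].
  change (zs_deriv_n (S k) (fun b => w b / Cfact b)%C n) with (zs_deriv (zs_deriv_n k (fun b => w b / Cfact b)%C) n).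
  unfold zs_deriv. rewrite IHk. replace (n + 1)%nat with (S n) by lia. rewrite Cfact_S.
  replace (S n + k)%nat with (n + S k)%nat by lia. field. split; [apply Cfact_neq_0|].
  apply RtoC_neq_0, not_0_INR. lia.
Qed.

(** The negative powers of eps combine with tau^m0 into (tau / eps)^m0 = w^m0, so the recursion has
    no singularity at eps = 0 in the variable w. The sums over the sets [Ik] become sums over j < jm
    with vanishing terms outside. *)
Lemma W_rec q Sz m0 m1 Ik b w0 (eps tau : C) w jm : (forall k s, (k < Sz)%nat -> In s (Ik k) -> (s < jm)%nat) ->
  q <> RtoC 0 -> eps <> RtoC 0 -> (tau + 1)%C <> RtoC 0 -> W_formal_solution q Sz m0 m1 Ik b w0 eps tau w ->
  (forall j, (j < Sz)%nat -> w j = w0 j) /\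
  forall n, (w (n + Sz)%nat * (1 + tau))%C =
    SS Sz jm n (fun k j => cfac q m1 n k j * (zs_b Ik b k eps j * ((tau / eps) ^ m0 k * w (n - j + k)%nat)))%C.
Proof.
  intros Hjm Hq He Ht [H1 H2]. split.
  - intros j Hj. rewrite <- H2 by exact Hj. rewrite zs_deriv_n_fact. simpl. unfold Cfact. simpl. field.
  - intros n. specialize (H1 n). rewrite zs_deriv_n_fact, Csum_seq in H1.
    apply (f_equal (fun x => x * Cfact n * (1 + tau))%C) in H1.
    replace (w (n + Sz)%nat / Cfact n * Cfact n * (1 + tau))%C with (w (n + Sz)%nat * (1 + tau))%C in H1 by (field; apply Cfact_neq_0).
    rewrite H1. rewrite <- Cmult_assoc, Cmult_comm, <- psum_scal. unfold SS. apply psum_ext. intros k Hk.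
    unfold zs_mul. rewrite <- psum_sum_n, <- psum_scal.
    rewrite (psum_trunc (fun j => if (j <=? n)%nat then (cfac q m1 n k j * (zs_b Ik b k eps j * ((tau / eps) ^ m0 k * w (n - j + k)%nat)))%C else 0) jm (S n)).
    + apply psum_ext. intros j Hj. rewrite (proj2 (Nat.leb_le j n)) by lia.
      unfold zs_scal, zs_dil, cfac. rewrite zs_deriv_n_fact.
      replace ((tau / eps) ^ m0 k)%C with (tau ^ m0 k / eps ^ m0 k)%C by (unfold Cdiv; now rewrite Cpow_mult_l, Cpow_inv by exact He).
      assert (N1 := Cpow_neq_0 eps (m0 k) He). assert (N2 := Cfact_neq_0 (n - j)).
      set (Q := ((/ q ^ m1 k) ^ (n - j))%C).
      field. repeat split; auto.
    + intros j Hj. destruct (Nat.leb_spec j n); [|easy]. unfold zs_b. destruct (in_dec Nat.eq_dec j (Ik k)) as [h|h]; [|ring].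
      specialize (Hjm k j Hk h). lia.
    + intros j Hj. destruct (Nat.leb_spec j n); [lia|easy].
Qed.

(** ** Consequences of assumption (C) *)

(** (C.3) makes y = xi / (2L) - M positive, and y <= k0 = 1/(2L) - M as xi < 1. In (C.4) the factor
    of A1 is below 1 and the last term is positive, so A1 > Cc^2 / (4 xib L y) >= Cc^2 / (4 L k0).
    This leaves an interval for the decay rate in beta. *)
Lemma assumption_C_gap q M A1 Cc : 1 < Cmod q -> 0 < M -> 0 < A1 -> 0 < Cc -> assumption_C q M A1 Cc ->
  0 < 1 / (2 * ln (Cmod q)) - M /\ Cc ^ 2 / (4 * (1 / (2 * ln (Cmod q)) - M)) < A1 * ln (Cmod q).
Proof.
  intros hq HM HA HCc [a1 [a2 [b1 [b2 [d1 [d2 [xi [xib [P [Hxi [Hxib H]]]]]]]]]]].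
  set (L := ln (Cmod q)) in *. assert (HL := L_pos q hq). fold L in HL.
  cbv zeta in H. destruct H as [_ [_ [H3 H4]]]. destruct P as [P1 [P2 [_ [_ [P5 P6]]]]].
  set (y := xi / (2 * L) - M) in *. set (k0 := 1 / (2 * L) - M).
  assert (Hd : 0 < d2 / d1 * L) by (apply Rmult_lt_0_compat; [apply Rdiv_lt_0_compat; lra|lra]).
  assert (Hy : 0 < y) by (unfold y; lra).
  assert (Hyk : y <= k0).
  { unfold y, k0, Rdiv. assert (0 < / (2 * L)) by (apply Rinv_0_lt_compat; lra). nra. }
  split; [lra|].
  assert (T1 : 0 < d2 * L / (d1 * y)) by (apply Rdiv_lt_0_compat; nra).
  assert (T2 : 0 < Cc * a2 / a1) by (apply Rdiv_lt_0_compat; nra).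
  assert (T3 : Cc ^ 2 / (4 * L * k0) <= Cc ^ 2 / (4 * xib * L * y)).
  { assert (Q : 0 < L * y) by nra. unfold Rdiv. apply Rmult_le_compat_l; [apply pow2_ge_0|]. apply Rinv_le_contravar; [nra|].
    replace (4 * xib * L * y) with (xib * (4 * (L * y))) by ring. replace (4 * L * k0) with (4 * (L * k0)) by ring.
    assert (L * y <= L * k0) by nra. nra. }
  assert (T4 : Cc ^ 2 / (4 * L * k0) < A1) by nra.
  apply Rmult_lt_compat_r with (r := L) in T4; [|exact HL].
  replace (Cc ^ 2 / (4 * L * k0) * L) with (Cc ^ 2 / (4 * k0)) in T4 by (field; lra). lra.
Qed.

(** ** Expansions of the [W_beta] *)

Definition opw (f : C -> C) (w : C) : C := (w * f w)%C.
Definition opt (q : C) (f : C -> C) (t : C) : C := (t * f (q * t))%C.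

Lemma opw_iter m f w : Nat.iter m opw f w = (w ^ m * f w)%C.
Proof. induction m; simpl; [ring|]. unfold opw at 1. rewrite IHm. ring. Qed.

Section Main.
Variables (q lq : C) (hq : 1 < Cmod q) (hlq : Cexp lq = q).
Variables (Sz jm : nat) (hSz : (1 <= Sz)%nat) (hjm0 : (1 <= jm)%nat) (m0 m1 : nat -> nat) (r0 : R) (hr0 : 0 < r0 <= 1).
Variables (Ik : nat -> list nat) (b : nat -> nat -> C -> C).
Hypothesis Hjm : forall k s, (k < Sz)%nat -> In s (Ik k) -> (s < jm)%nat.
Variable Bb : R.
Hypothesis HBb : 0 <= Bb.
Hypothesis Hb : forall k s, (k < Sz)%nat -> In s (Ik k) -> hol (Cdisc r0) (b k s) /\
  forall e, Cdisc r0 e -> Cmod (b k s e) <= Bb.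
Variables (p : nat) (II : nat -> ipair).
Hypothesis hUr0 : forall i eps, (i < p)%nat -> UqN q lq (II i) eps -> Cdisc r0 eps.
Variables (delta rho0 : R) (V : nat -> C -> Prop) (T : C -> Prop).
Hypothesis hdelta : 0 < delta.
Hypothesis hass : associated_family lq p II delta rho0 V T.
Variables (M A1 Cc : R).
Hypothesis hM : 0 < M.
Hypothesis hCc : 0 < Cc.
Hypothesis hA : assumption_A Sz m0 m1 Ik A1 Cc.
Let L := ln (Cmod q).
Let HL : 0 < L := L_pos q hq.
Let k0 := 1 / (2 * L) - M.
Hypothesis Hk0 : 0 < k0.
Hypothesis Hgap : Cc ^ 2 / (4 * k0) < A1 * L.
Variables (WUV : nat -> nat -> C -> C -> C) (B0 : R).
Hypothesis HB0 : 0 <= B0.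
Variables (f0 : nat -> C -> C -> C) (Delta Mt : R).
Hypothesis HDelta : 0 < Delta.
Hypothesis HMt : 0 < Mt < M.
Hypothesis Hf0 : forall j e tau, (j < Sz)%nat -> Cpdisc r0 e -> Cpdisc rho0 tau -> Cmod (f0 j e tau) <= B0.
Hypothesis Hf0h : forall j, (j < Sz)%nat -> holomorphic2 (fun e tau => Cpdisc r0 e /\ Cpdisc rho0 tau) (f0 j).
Hypothesis HWUVh : forall i j, (i < p)%nat -> (j < Sz)%nat ->
  holomorphic2 (fun e tau => UqN q lq (II i) e /\ (mul_qRp lq (V i) tau \/ Cpdisc rho0 tau)) (WUV i j).
Hypothesis HWUV : forall i j e tau, (i < p)%nat -> (j < Sz)%nat -> UqN q lq (II i) e -> Cpdisc rho0 tau -> WUV i j e tau = f0 j e tau.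
Hypothesis HWUVb : forall i j e tau, (i < p)%nat -> (j < Sz)%nat -> UqN q lq (II i) e -> (mul_qRp lq (V i) tau \/ Cpdisc rho0 tau) ->
  Cmod (WUV i j e tau) <= Delta * exp (Mt * (ln (Cmod (tau / e)%C)) ^ 2).
Variable lam : nat -> C.
Hypothesis hlam : forall i, (i < p)%nat -> V i (lam i) /\ Cdisc rho0 (lam i) /\ r0 < 1 < Cmod (lam i).
Variable W : nat -> nat -> C -> C -> C.
Hypothesis hW : forall i eps tau, (i < p)%nat -> UqN q lq (II i) eps ->
  mul_qRp lq (V i) tau \/ Cpdisc rho0 tau -> tau <> RtoC (-1) ->
  W_formal_solution q Sz m0 m1 Ik b (fun j => WUV i j eps tau) eps tau (fun beta => W i beta eps tau).

Let qn0 := q_neq_0 q hq.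

Lemma UqN_neq_0 i e : UqN q lq (II i) e -> e <> RtoC 0.
Proof.
  intros [x [n [[u [v [_ [_ ->]]]] ->]]]. unfold Cdiv. apply Cmult_neq_0.
  - apply Cmult_neq_0; apply Cexp_neq_0.
  - intros E. apply (f_equal (fun z => z * q ^ n)%C) in E. rewrite Cinv_l in E by now apply Cpow_neq_0.
    apply C1_nz. rewrite E. ring.
Qed.

Lemma UqN_Cpdisc i e : (i < p)%nat -> UqN q lq (II i) e -> Cpdisc r0 e.
Proof. intros Hi He. split; [eapply UqN_neq_0, He|now apply (hUr0 i)]. Qed.

Lemma lam_neq_0 i : (i < p)%nat -> lam i <> RtoC 0.
Proof. intros Hi. destruct (hlam i Hi) as [_ [_ H]]. apply Cmod_gt_0. lra. Qed.

(** For s >= 0 the point belongs to V q^(R+); for s < 0 its modulus is below |lam i| < rho0. *)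
Lemma path_dom i s : (i < p)%nat -> mul_qRp lq (V i) (qpow lq s * lam i)%C \/ Cpdisc rho0 (qpow lq s * lam i)%C.
Proof.
  intros Hi. destruct (hlam i Hi) as [H1 [H2 H3]]. unfold Cdisc in H2. destruct (Rle_dec 0 s) as [h|h].
  - left. exists (lam i), s. split; [exact H1|]. split; [exact h|]. ring.
  - right. split; [apply Cmult_neq_0; [apply qpow_neq_0|now apply lam_neq_0]|].
    rewrite Cmod_mult, (Cmod_qpow q lq hlq). fold L.
    assert (exp (s * L) <= 1) by (rewrite <- exp_0; apply exp_le; nra). assert (0 < exp (s * L)) by apply exp_pos. nra.
Qed.

Lemma path_delta i s : (i < p)%nat -> delta <= Cmod (1 + qpow lq s * lam i)%C.
Proof.
  intros Hi. destruct hass as [_ [_ [_ [_ [H _]]]]]. apply Rlt_le. rewrite Cplus_comm. apply (H i); [exact Hi|].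
  exists (lam i), s. split; [apply hlam, Hi|ring].
Qed.

Lemma path_m1 i s : (i < p)%nat -> (qpow lq s * lam i)%C <> RtoC (-1).
Proof.
  intros Hi E. assert (H := path_delta i s Hi). rewrite E in H.
  replace (1 + RtoC (-1))%C with (RtoC 0) in H by (rewrite <- RtoC_plus; f_equal; ring). rewrite Cmod_0 in H. lra.
Qed.

(** Condition (3) of the associated family holds for all real powers of q, so the powers coming from
    e in U q^(-N) and from t in q^m T are absorbed in its exponent. *)
Lemma path_off_spiral i e m t : (i < p)%nat -> UqN q lq (II i) e -> dilate q m T t -> off_spiral lq delta (lam i / e / t)%C.
Proof.
  intros Hi He [t0 [Ht0 ->]]. split; [exact hdelta|].
  assert (Ne := UqN_neq_0 i e He). destruct hass as [_ [[_ [_ HT0]] [_ [_ [_ [H _]]]]]].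
  assert (Nt : t0 <> RtoC 0) by (intros ->; contradiction).
  assert (Nq := Cpow_neq_0 q m qn0). assert (Nl := lam_neq_0 i Hi).
  split.
  - intros E. apply Nl. replace (lam i) with (lam i / e / (q ^ m * t0) * e * (q ^ m * t0))%C by (field; auto). rewrite E. ring.
  - intros r. destruct He as [x [n [Hx ->]]]. apply Rlt_le.
    destruct (hlam i Hi) as [H1 [H2 _]].
    specialize (H i t0 x (lam i) (INR m - INR n - r) Hi Ht0 Hx H1 H2).
    assert (Nn := Cpow_neq_0 q n qn0). assert (Nr := qpow_neq_0 lq r).
    assert (Nx : x <> RtoC 0) by (intros ->; apply Ne; unfold Cdiv; ring).
    replace (qpow lq (INR m - INR n - r)) with (q ^ m / q ^ n / qpow lq r)%C in H.
    + replace (1 + lam i / (x / q ^ n) / (q ^ m * t0) * qpow lq r)%C with (1 + lam i / (x * t0 * (q ^ m / q ^ n / qpow lq r)))%C; [exact H|].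
      field. repeat split; auto.
    + unfold Rminus. rewrite !qpow_plus, !qpow_opp, !(qpow_nat q lq hlq). unfold Cdiv. ring.
Qed.

Definition bt (k j i : nat) : C := if in_dec Nat.eq_dec j (Ik k) then (C_derive_n (b k j) i 0 / Cfact i)%C else 0.

(** The midpoint of the interval left open by assumption (C): below A1 L for the induction on beta
    ([weights]), above Cc^2 / (4 k0) for a bound uniform in beta after the transform
    ([weight_sum]). *)
Definition al := (A1 * L + Cc ^ 2 / (4 * k0)) / 2.

Lemma al_bounds : Cc ^ 2 / (4 * k0) < al /\ 0 < al < A1 * L.
Proof.
  assert (0 < Cc ^ 2 / (4 * k0)) by (apply Rdiv_lt_0_compat; [apply pow_lt; lra|lra]). unfold al. lra.
Qed.

Definition psi (w : C) := ln (1 + Cmod w).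

Lemma psi_pos w : 0 <= psi w.
Proof.
  unfold psi. rewrite <- ln_1. assert (P := Cmod_ge_0 w). destruct P as [h|h]; [apply Rlt_le, ln_increasing; lra|rewrite <- h, Rplus_0_r; lra].
Qed.

Lemma exp_psi w : exp (psi w) = 1 + Cmod w.
Proof. unfold psi. apply exp_ln. generalize (Cmod_ge_0 w). lra. Qed.

(** The summand 8 / r0 covers the Taylor radius in eps of the data and of the [b k s]. The summand 8
    |w| covers the radius in tau, the domain |eps w| >= rho0, and the condition 2 |w| <= kap of
    [expands_div]. *)
Definition kap (w : C) := 8 / r0 + 8 * Cmod w.

Lemma kap_pos w : 0 <= kap w.
Proof. unfold kap. assert (0 < / r0) by (apply Rinv_0_lt_compat; lra). generalize (Cmod_ge_0 w). unfold Rdiv. lra. Qed.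

Lemma ini_ex : exists (ini : nat -> nat -> nat -> C) (v : nat -> nat -> C -> C), forall j, (j < Sz)%nat ->
    (forall m n, Cmod (ini j m n) <= B0 * (2 / rho0) ^ m * (2 / r0) ^ n) /\
    (forall m N e, Cpdisc r0 e -> Cmod (v j m e - psum (fun n => ini j m n * e ^ n) N)%C <= 3 * (B0 * (2 / rho0) ^ m) * (4 * Cmod e / r0) ^ N) /\
    (forall N e tau, Cpdisc r0 e -> Cpdisc rho0 tau -> Cmod (f0 j e tau - psum (fun m => v j m e * tau ^ m) N)%C <= 3 * B0 * (4 * Cmod tau / rho0) ^ N).
Proof.
  assert (Hrho : 1 < rho0) by apply hass.
  destruct (choice_nat (fun j (av : (nat -> nat -> C) * (nat -> C -> C)) => (j < Sz)%nat ->
    (forall m n, Cmod (fst av m n) <= B0 * (2 / rho0) ^ m * (2 / r0) ^ n) /\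
    (forall m N e, Cpdisc r0 e -> Cmod (snd av m e - psum (fun n => fst av m n * e ^ n) N)%C <= 3 * (B0 * (2 / rho0) ^ m) * (4 * Cmod e / r0) ^ N) /\
    (forall N e tau, Cpdisc r0 e -> Cpdisc rho0 tau -> Cmod (f0 j e tau - psum (fun m => snd av m e * tau ^ m) N)%C <= 3 * B0 * (4 * Cmod tau / rho0) ^ N))) as [F HF].
  - intros j. destruct (lt_dec j Sz) as [h|h]; [|exists (fun _ _ => RtoC 0, fun _ _ => RtoC 0); tauto].
    destruct (two_var (f0 j) r0 rho0 B0) as [a [v H]]; try lra.
    + intros e He tau Htau. apply (holomorphic2_snd _ (f0 j) e tau (Hf0h j h)). now split.
    + intros tau Htau e He. apply (holomorphic2_fst _ (f0 j) e tau (Hf0h j h)). now split.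
    + intros e tau He Htau. now apply Hf0.
    + exists (a, v). intros _. exact H.
  - exists (fun j => fst (F j)), (fun j => snd (F j)). exact HF.
Qed.

Section WithIni.
Variable ini : nat -> nat -> nat -> C.
Variable v : nat -> nat -> C -> C.
Hypothesis Hini : forall j, (j < Sz)%nat ->
    (forall m n, Cmod (ini j m n) <= B0 * (2 / rho0) ^ m * (2 / r0) ^ n) /\
    (forall m N e, Cpdisc r0 e -> Cmod (v j m e - psum (fun n => ini j m n * e ^ n) N)%C <= 3 * (B0 * (2 / rho0) ^ m) * (4 * Cmod e / r0) ^ N) /\
    (forall N e tau, Cpdisc r0 e -> Cpdisc rho0 tau -> Cmod (f0 j e tau - psum (fun m => v j m e * tau ^ m) N)%C <= 3 * B0 * (4 * Cmod tau / rho0) ^ N).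

Definition PW := PB Sz jm m0 (cfac q m1) bt ini opw (fun _ => RtoC 1).

Lemma initl_opw j l w : initl ini opw (fun _ => RtoC 1) j l w = psum (fun m => ini j m (l - m)%nat * w ^ m)%C (S l).
Proof. unfold initl. apply psum_ext. intros m _. rewrite opw_iter. ring. Qed.

(** The exponential offsets exp(- al j^2) for the initial indices j < Sz, so that the initial data
    satisfy the general bound. *)
Definition Q0 := (3 * B0 + Delta) * exp (al * INR Sz ^ 2).

Lemma Q0_pos : 0 < Q0.
Proof. apply Rmult_lt_0_compat; [lra|apply exp_pos]. Qed.

(** Each step multiplies by w^m0 with m0 <= Cc (Sz - k + j) by assumption (A), and Sz - k + j is the
    gain of index; this is the origin of the term Cc beta psi. *)
Definition Qb (g : R) (beta : nat) (w : C) : R :=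
  Q0 * exp (- al * INR beta ^ 2 + g * INR beta) * exp (Cc * INR beta * psi w + Mt * psi w ^ 2).

Lemma initial_expands g i j e s : 0 <= g -> (i < p)%nat -> (j < Sz)%nat -> UqN q lq (II i) e ->
  let w := (qpow lq s * (lam i / e))%C in
  expands (kap w) e (WUV i j e (qpow lq s * lam i)%C) (fun l => PW j l w) (Qb g j w).
Proof.
  intros Hg Hi Hj He w. assert (HDe := UqN_Cpdisc i e Hi He). destruct HDe as [Ne He2].
  assert (Hrho : 1 < rho0) by apply hass.
  destruct (Hini j Hj) as [I1 [I2 I3]].
  assert (Ew : (e * w)%C = (qpow lq s * lam i)%C) by (unfold w; field; exact Ne).
  set (tau := (qpow lq s * lam i)%C) in *.
  assert (Nt : tau <> RtoC 0) by (apply Cmult_neq_0; [apply qpow_neq_0|now apply lam_neq_0]).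
  assert (Pm := psi_pos w).
  assert (E2 : 1 <= exp (Mt * psi w ^ 2)) by (apply exp_ge_1; apply Rmult_le_pos; [lra|apply pow2_ge_0]).
  assert (X : expands (kap w) e (WUV i j e tau) (fun l => psum (fun m => ini j m (l - m)%nat * w ^ m) (S l))%C (3 * B0 + Delta * exp (Mt * psi w ^ 2))).
  { apply (init_expands (ini j) (v j) (f0 j e tau) r0 rho0 B0 e w); try lra.
    - apply Rmult_le_pos; lra.
    - exact I1.
    - intros m N. apply I2. now split.
    - rewrite Ew. intros h. split; [apply HWUV; auto; now split|]. intros N. apply I3; now split.
    - rewrite Ew. intros h. eapply Rle_trans; [apply HWUVb; auto; apply path_dom, Hi|].
      apply Rmult_le_compat_l; [lra|]. apply exp_le. apply Rmult_le_compat_l; [lra|].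
      assert (Mw : Cmod (tau / e)%C = Cmod w) by (f_equal; unfold w, tau, Cdiv; ring). rewrite Mw.
      (* Outside the disc, |tau| >= rho0 > 1 >= r0 > |e|, so |w| > 1 and ln^2 |w| is below psi(w)^2.
         Inside, where ln^2 |w| is unbounded near 0, the Taylor bound is used instead. *)
      assert (W1 : 1 <= Cmod w).
      { rewrite <- Mw, Cmod_div by exact Ne. unfold Cdisc in He2. assert (Pe := proj1 (Cmod_gt_0 e) Ne).
        apply Rmult_le_reg_r with (Cmod e); [exact Pe|]. unfold Rdiv. rewrite Rmult_assoc, Rinv_l by lra. lra. }
      apply pow_incr. split.
      + rewrite <- ln_1. destruct W1 as [h'|h']; [apply Rlt_le, ln_increasing; lra|rewrite <- h'; lra].
      + unfold psi. apply Rlt_le, ln_increasing; lra. }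
  apply (expands_mono _ e (kap_pos w) _ _ _ (Qb g j w)) in X.
  - revert X. apply expands_eq; [easy|]. intros l. unfold PW. rewrite PB_init by exact Hj. symmetry. apply initl_opw.
  - unfold Qb, Q0. apply Rle_trans with ((3 * B0 + Delta) * exp (Mt * psi w ^ 2)); [nra|].
    rewrite !Rmult_assoc. apply Rmult_le_compat_l; [lra|]. rewrite <- !exp_plus. apply exp_le.
    apply le_INR in Hj as Hj'. rewrite S_INR in Hj'. assert (Pj := pos_INR j).
    assert (INR j ^ 2 <= INR Sz ^ 2) by (apply pow_incr; lra). assert (A := al_bounds).
    assert (al * INR j ^ 2 <= al * INR Sz ^ 2) by (apply Rmult_le_compat_l; lra).
    assert (0 <= g * INR j) by (apply Rmult_le_pos; lra).
    assert (0 <= Cc * INR j * psi w) by (repeat apply Rmult_le_pos; lra). lra.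
Qed.

(** Strong induction on beta: multiply by w^m0, by the expansion of b_k and by [cfac], sum, divide
    by 1 + e w. Continuity along the path goes through the same induction, from the initial data and
    the recursion. *)
Lemma W_expands : exists g, 0 <= g /\ forall i e beta, (i < p)%nat -> UqN q lq (II i) e ->
  (forall s, rcont (fun s => W i beta e (qpow lq s * lam i)%C) s) /\
  forall s, let w := (qpow lq s * (lam i / e))%C in
    expands (kap w) e (W i beta e (qpow lq s * lam i)%C) (fun l => PW beta l w) (Qb g beta w).
Proof.
  (* The constant lost in one step: 2 (1 + 1/delta) for the division, Sz jm for the number of terms,
     2 (3 Bb) for the product with b_k. [weights] provides a [g] that absorbs it. *)
  set (KK := 2 * (1 + / delta) * (INR Sz * (INR jm * (2 * (3 * Bb))))).
  assert (Pd : 0 < / delta) by now apply Rinv_0_lt_compat.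
  assert (PKK : 0 <= KK).
  { unfold KK. assert (P1 := pos_INR Sz). assert (P2 := pos_INR jm). repeat apply Rmult_le_pos; lra. }
  destruct (weights q hq Sz jm m1 Ik A1 al KK PKK (proj2 al_bounds)) as [g [Hg HW]].
  { intros k s Hk Hs. apply (hA k s Hk Hs). }
  exists g. split; [exact Hg|]. intros i e beta Hi He.
  assert (Ne := UqN_neq_0 i e He). assert (HDe := UqN_Cpdisc i e Hi He).
  set (tau := fun s => (qpow lq s * lam i)%C).
  assert (Nt1 : forall s, (1 + tau s)%C <> RtoC 0).
  { intros s. apply Cmod_gt_0. generalize (path_delta i s Hi). fold (tau s). lra. }
  assert (Nt2 : forall s, (tau s + 1)%C <> RtoC 0) by (intros s; rewrite Cplus_comm; apply Nt1).
  assert (Rec := fun s => W_rec q Sz m0 m1 Ik b _ e (tau s) _ jm Hjm qn0 Ne (Nt2 s)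
     (hW i e (tau s) Hi He (path_dom i s Hi) (path_m1 i s Hi))).
  cbv beta in Rec.
  assert (Ctau : forall s, rcont tau s) by (intros s; apply rcont_mult; [eapply rder_cont, rder_Cexp|apply rcont_const]).
  induction beta as [beta IH] using (well_founded_induction lt_wf).
  destruct (lt_dec beta Sz) as [hb|hb].
  - split.
    + intros s. apply rcont_ext with (fun s => WUV i beta e (tau s)).
      * intros s'. symmetry. apply Rec. exact hb.
      * destruct (holomorphic2_snd _ (WUV i beta) e (tau s) (HWUVh i beta Hi hb) (conj He (path_dom i s Hi))) as [l Hl].
        exact (cder_rcont (WUV i beta e) l tau s Hl (Ctau s)).
    + intros s w. fold (tau s). rewrite (proj1 (Rec s) beta hb). apply initial_expands; auto.
  - set (n := (beta - Sz)%nat). assert (Eb : beta = (n + Sz)%nat) by (unfold n; lia).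
    split.
    + intros s. apply rcont_ext with (fun s => / (1 + tau s) * SS Sz jm n (fun k j => cfac q m1 n k j * (zs_b Ik b k e j * ((tau s / e) ^ m0 k * W i (n - j + k)%nat e (tau s)))))%C.
      * intros s'. rewrite <- (proj2 (Rec s') n), <- Eb. fold (tau s'). match goal with |- ?x = ?y => change (@eq C x y) end. field. apply Nt1.
      * apply rcont_mult; [apply rcont_inv; [apply Nt1|apply rcont_plus; [apply rcont_const|apply Ctau]]|].
        unfold SS.
        assert (RP : forall (F : nat -> R -> C) N, (forall k, (k < N)%nat -> rcont (F k) s) -> rcont (fun s => psum (fun k => F k s) N) s).
        { induction N; intros HF; simpl; [apply rcont_const|]. apply rcont_plus; [apply IHN; intros; apply HF; lia|apply HF; lia]. }
        apply (RP (fun k s => psum (fun j => if (j <=? n)%nat then (cfac q m1 n k j * (zs_b Ik b k e j * ((tau s / e) ^ m0 k * W i (n - j + k)%nat e (tau s))))%C else 0) jm)).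
        intros k Hk. apply (RP (fun j s => if (j <=? n)%nat then (cfac q m1 n k j * (zs_b Ik b k e j * ((tau s / e) ^ m0 k * W i (n - j + k)%nat e (tau s))))%C else 0)).
        intros j Hj. destruct (Nat.leb_spec j n) as [hj|hj]; [|apply rcont_const].
        apply rcont_mult; [apply rcont_const|]. apply rcont_mult; [apply rcont_const|]. apply rcont_mult.
        -- apply rcont_pow. apply rcont_mult; [apply Ctau|apply rcont_const].
        -- apply IH. lia.
    + intros s w. assert (Ew : (e * w)%C = tau s) by (unfold w, tau; field; exact Ne).
      assert (Ew' : (tau s / e)%C = w) by (rewrite <- Ew; field; exact Ne).
      assert (Pk := kap_pos w). assert (Pm := psi_pos w).
      (* [Qt] is the share granted to each of the Sz jm terms so that summation and division return
         exactly [Qb g beta w]. *)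
      set (D0 := 2 * (1 + / delta) * (INR Sz * INR jm)).
      assert (PSz : 1 <= INR Sz) by (apply (le_INR 1); exact hSz). assert (Pjm : 1 <= INR jm) by (apply (le_INR 1); exact hjm0).
      assert (PD0 : 0 < D0).
      { unfold D0. apply Rmult_lt_0_compat; [lra|]. apply Rmult_lt_0_compat; lra. }
      set (Qt := Qb g beta w / D0).
      assert (PQ : 0 < Qb g beta w).
      { unfold Qb. apply Rmult_lt_0_compat; [apply Rmult_lt_0_compat; [apply Q0_pos|apply exp_pos]|apply exp_pos]. }
      assert (PQt : 0 <= Qt) by (apply Rlt_le, Rdiv_lt_0_compat; assumption).
      assert (Src : expands (kap w) e (SS Sz jm n (fun k j => cfac q m1 n k j * (zs_b Ik b k e j * ((tau s / e) ^ m0 k * W i (n - j + k)%nat e (tau s))))%C)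
         (fun l => src Sz jm m0 (cfac q m1) bt opw PW n l w) (INR Sz * (INR jm * Qt))).
      { unfold src, SS.
        apply (expands_psum (kap w) e (fun k => psum (fun j => if (j <=? n)%nat then _ else 0) jm) (fun k l => psum (fun j => if (j <=? n)%nat then _ else 0) jm)).
        intros k Hk.
        apply (expands_psum (kap w) e (fun j => if (j <=? n)%nat then _ else 0) (fun j l => if (j <=? n)%nat then _ else 0)).
        intros j Hj. destruct (Nat.leb_spec j n) as [hj|hj]; [|apply (expands_mono _ e Pk _ _ 0); [exact PQt|apply expands_0]].
        destruct (in_dec Nat.eq_dec j (Ik k)) as [hI|hI].
        2: { apply (expands_mono _ e Pk _ _ 0); [exact PQt|]. refine (expands_eq _ e _ _ _ _ _ _ _ (expands_0 (kap w) e)).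
             - unfold zs_b. destruct (in_dec Nat.eq_dec j (Ik k)); [contradiction|]. ring.
             - intros l. rewrite (psum_zero _ (S l)); [ring|]. intros i' _. unfold bt. destruct (in_dec Nat.eq_dec j (Ik k)); [contradiction|]. ring. }
        assert (X1 := proj2 (IH (n - j + k)%nat ltac:(lia)) s). cbv zeta in X1. fold (tau s) in X1. fold w in X1.
        apply (expands_scal (kap w) e (w ^ m0 k)%C) in X1.
        assert (X2 : expands (kap w / 2) e (b k j e) (bt k j) (3 * Bb)).
        { destruct (Hb k j Hk hI) as [Hbh Hbb]. refine (expands_eq _ e _ _ _ _ _ _ _ (b_expands (b k j) r0 Bb (kap w) e _ _ HDe Hbh Hbb)).
          - easy.
          - intros l. unfold bt. now destruct (in_dec Nat.eq_dec j (Ik k)).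
          - lra.
          - unfold kap. generalize (Cmod_ge_0 w). lra. }
        assert (X3 := expands_mult (kap w) e Pk _ _ _ _ _ _ X1 X2).
        apply (expands_scal (kap w) e (cfac q m1 n k j)) in X3.
        refine (expands_mono _ e Pk _ _ _ _ _ (expands_eq _ e _ _ _ _ _ _ _ X3)).
        - specialize (HW n k j Hk Hj hI hj).
          set (h := INR Sz - INR k + INR j).
          assert (Hh : INR beta = INR (n - j + k) + h).
          { rewrite Eb. unfold h. rewrite !plus_INR, minus_INR by lia. ring. }
          assert (M0 : Cmod (w ^ m0 k)%C <= exp (Cc * h * psi w)).
          { rewrite Cmod_pow. apply Rle_trans with (exp (psi w) ^ m0 k).
            - apply pow_incr. rewrite exp_psi. generalize (Cmod_ge_0 w). lra.
            - rewrite (exp_nat (psi w) (m0 k)). apply exp_le. apply Rmult_le_compat_r; [exact Pm|]. apply (hA k j Hk hI). }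
          unfold Qt. apply Rmult_le_reg_r with D0; [exact PD0|].
          replace (Qb g beta w / D0 * D0) with (Qb g beta w) by (field; lra).
          unfold Qb at 2. rewrite Eb at 1 2.
          apply Rle_trans with (Q0 * (KK * Cmod (cfac q m1 n k j) * exp (- al * INR (n - j + k) ^ 2 + g * INR (n - j + k))) * exp (Cc * INR beta * psi w + Mt * psi w ^ 2)).
          2: { apply Rmult_le_compat_r; [apply Rlt_le, exp_pos|]. apply Rmult_le_compat_l; [apply Rlt_le, Q0_pos|]. exact HW. }
          unfold Qb. set (E1 := exp (- al * INR (n - j + k) ^ 2 + g * INR (n - j + k))).
          replace (exp (Cc * INR beta * psi w + Mt * psi w ^ 2)) with
            (exp (Cc * h * psi w) * exp (Cc * INR (n - j + k) * psi w + Mt * psi w ^ 2)) by (rewrite <- exp_plus, Hh; f_equal; ring).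
          set (E2 := exp (Cc * INR (n - j + k) * psi w + Mt * psi w ^ 2)).
          unfold KK, D0.
          assert (P1 := Cmod_ge_0 (cfac q m1 n k j)). assert (PE1 : 0 < E1) by apply exp_pos. assert (PE2 : 0 < E2) by apply exp_pos.
          assert (PQ0 := Q0_pos).
          match goal with |- ?A <= ?B => replace A with
            ((Q0 * (2 * (1 + / delta) * (INR Sz * (INR jm * (2 * (3 * Bb)))) * Cmod (cfac q m1 n k j) * E1) * E2) * Cmod (w ^ m0 k)%C) by ring;
            replace B with ((Q0 * (2 * (1 + / delta) * (INR Sz * (INR jm * (2 * (3 * Bb)))) * Cmod (cfac q m1 n k j) * E1) * E2) * exp (Cc * h * psi w)) by ring end.
          apply Rmult_le_compat_l; [|exact M0]. repeat apply Rmult_le_pos; try apply Rlt_le, exp_pos; lra.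
        - rewrite Ew'. unfold zs_b. destruct (in_dec Nat.eq_dec j (Ik k)); [|contradiction]. easy.
        - intros l. f_equal. apply psum_ext. intros i' _. now rewrite opw_iter. }
      assert (EQ : (2 * (1 + / delta) * (INR Sz * (INR jm * Qt))) = Qb g beta w).
      { unfold Qt, D0. field. lra. }
      rewrite <- EQ. fold (tau s). rewrite Eb.
      refine (expands_div (kap w) e Pk w _ _ _ _ _ delta Src _ hdelta _ _ _).
      * unfold kap. assert (0 < / r0) by (apply Rinv_0_lt_compat; lra). generalize (Cmod_ge_0 w). unfold Rdiv. lra.
      * rewrite Ew. now apply path_delta.
      * rewrite Ew. apply (proj2 (Rec s) n).
      * intros l. unfold PW. rewrite PB_rec. destruct l; reflexivity.
Qed.
End WithIni.
End Main.

(** ** The q-Laplace transform of the expansions *)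

(** Young's inequality (X + n)^2 <= (1 + z) X^2 + (1 + 1/z) n^2 with X = Cc beta, where z is chosen
    so that (1 + z) Cc^2 / (4 k0) is halfway between Cc^2 / (4 k0) and al. The Gaussian decay left
    in beta absorbs the linear terms; the part in N becomes the coefficient a2. *)
Lemma weight_sum al k0 Cc g c : 0 < k0 -> 0 < Cc -> 0 <= g -> 0 <= c -> Cc ^ 2 / (4 * k0) < al ->
  exists K1 a2, 0 < K1 /\ 0 <= a2 /\ forall beta N : nat,
    exp (- al * INR beta ^ 2 + g * INR beta) * exp ((Cc * INR beta + INR N) * c + (Cc * INR beta + INR N) ^ 2 / (4 * k0)) <=
    K1 * exp (c * INR N + a2 * INR N ^ 2).
Proof.
  intros Hk HC Hg Hc Hal. set (x := Cc ^ 2 / (4 * k0)) in *.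
  assert (Hx : 0 < x) by (apply Rdiv_lt_0_compat; [apply pow_lt; lra|lra]).
  set (z := (al - x) / (2 * x)). assert (Hz : 0 < z) by (apply Rdiv_lt_0_compat; lra).
  set (th := (al - x) / 2). assert (Hth : 0 < th) by (unfold th; lra).
  set (gg := g + Cc * c). 
  exists (exp (gg ^ 2 / (4 * th))), ((1 + / z) / (4 * k0)).
  assert (Pz : 0 < / z) by now apply Rinv_0_lt_compat.
  split; [apply exp_pos|]. split; [apply Rmult_le_pos; [lra|apply Rlt_le, Rinv_0_lt_compat; lra]|].
  intros beta N. rewrite <- !exp_plus. apply exp_le. set (B := INR beta). set (n := INR N).
  assert (Y1 : (Cc * B + n) ^ 2 <= (1 + z) * (Cc * B) ^ 2 + (1 + / z) * n ^ 2).
  { assert (Q : 0 <= (z * (Cc * B) - n) ^ 2 / z) by (apply Rmult_le_pos; [apply pow2_ge_0|lra]).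
    replace ((z * (Cc * B) - n) ^ 2 / z) with (z * (Cc * B) ^ 2 - 2 * (Cc * B) * n + / z * n ^ 2) in Q by (field; lra). nra. }
  assert (Y2 : (Cc * B + n) ^ 2 / (4 * k0) <= ((1 + z) * (Cc * B) ^ 2 + (1 + / z) * n ^ 2) / (4 * k0)).
  { apply Rmult_le_compat_r; [apply Rlt_le, Rinv_0_lt_compat; lra|exact Y1]. }
  assert (Y3 : ((1 + z) * (Cc * B) ^ 2 + (1 + / z) * n ^ 2) / (4 * k0) = (al - th) * B ^ 2 + (1 + / z) / (4 * k0) * n ^ 2).
  { replace (((1 + z) * (Cc * B) ^ 2 + (1 + / z) * n ^ 2) / (4 * k0)) with ((1 + z) * x * B ^ 2 + (1 + / z) / (4 * k0) * n ^ 2) by (unfold x; field; lra).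
    f_equal. f_equal. unfold th, z. field. lra. }
  assert (Y4 : gg * B - th * B ^ 2 <= gg ^ 2 / (4 * th)).
  { assert (Z : 0 <= (gg - 2 * th * B) ^ 2 / (4 * th)) by (apply Rmult_le_pos; [apply pow2_ge_0|apply Rlt_le, Rinv_0_lt_compat; lra]).
    replace ((gg - 2 * th * B) ^ 2 / (4 * th)) with (gg ^ 2 / (4 * th) - gg * B + th * B ^ 2) in Z by (field; lra). lra. }
  unfold gg in *. nra.
Qed.

Section Lap.
Variables (q lq : C) (hq : 1 < Cmod q) (hlq : Cexp lq = q).
Let L := ln (Cmod q).
Let HL : 0 < L := L_pos q hq.

(** The parameter enters only the domination, and 1 + (y + c)^2 <= (2 + 2 c^2)(1 + y^2). It lets
    [Lap_op] pass from t to q t. *)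
Lemma Gint_v v v' f l : Gint L v f l -> Gint L v' f l.
Proof.
  intros [[A [H1 H2]] Hl]. split; [|exact Hl]. assert (HA := Gdom_A L v A f (conj H1 H2)).
  exists (A * (2 + 2 * (v' - v) ^ 2)). split; [exact H1|]. intros s. eapply Rle_trans; [apply H2|].
  set (y := L * s + v). replace (L * s + v') with (y + (v' - v)) by (unfold y; ring). set (c := v' - v).
  assert (P1 : 0 < 1 + y ^ 2) by (generalize (pow2_ge_0 y); lra). assert (P2 : 0 < 1 + (y + c) ^ 2) by (generalize (pow2_ge_0 (y + c)); lra).
  unfold Rdiv. rewrite Rmult_assoc. apply Rmult_le_compat_l; [exact HA|].
  apply Rmult_le_reg_r with ((1 + y ^ 2) * (1 + (y + c) ^ 2)); [now apply Rmult_lt_0_compat|].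
  replace (/ (1 + y ^ 2) * ((1 + y ^ 2) * (1 + (y + c) ^ 2))) with (1 + (y + c) ^ 2) by (field; lra).
  replace ((2 + 2 * c ^ 2) * / (1 + (y + c) ^ 2) * ((1 + y ^ 2) * (1 + (y + c) ^ 2))) with ((2 + 2 * c ^ 2) * (1 + y ^ 2)) by (field; lra).
  assert (0 <= (y - c) ^ 2) by apply pow2_ge_0. assert (0 <= y ^ 2) by apply pow2_ge_0. assert (0 <= c ^ 2) by apply pow2_ge_0.
  nra.
Qed.

(* [P] is the q-Laplace transform of [p], in every direction avoiding the zeros of Theta. *)
Definition Lap (p P : C -> C) : Prop :=
  forall u t d, off_spiral lq d (u / t)%C -> t <> RtoC 0 ->
    Gint L (ln (Cmod (u / t)%C)) (fun s => p (qpow lq s * u)%C / Theta q (qpow lq s * u / t))%C (P t).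

Lemma Lap_op p P : Lap p P -> Lap (opw p) (opt q P).
Proof.
  intros H u t d Ho Ht. assert (qn0 := q_neq_0 q hq).
  assert (Nqt : (q * t)%C <> RtoC 0) by now apply Cmult_neq_0.
  assert (Ho' : off_spiral lq d (u / (q * t))%C).
  { replace (u / (q * t))%C with (qpow lq (- (1)) * (u / t))%C.
    - now apply off_spiral_mul.
    - rewrite qpow_opp, (qpow_1 q lq hlq). field. split; auto. }
  specialize (H u (q * t)%C d Ho' Nqt). apply (Gint_scal L _ t) in H.
  apply (Gint_v (ln (Cmod (u / (q * t))%C))). refine (Gint_ext L _ _ _ _ _ H). intros s. unfold opw.
  assert (Hs := off_spiral_mul lq d _ s Ho'). assert (NT := off_spiral_Theta q lq hq hlq d _ Hs).
  replace (qpow lq s * (u / (q * t)))%C with (qpow lq s * u / (q * t))%C in * by (unfold Cdiv; ring).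
  set (x := (qpow lq s * u / (q * t))%C) in *.
  assert (Ex : (qpow lq s * u / t)%C = (q * x)%C) by (unfold x; field; auto).
  (* For w = q t x this is w / Theta(w / t) = q t x / (q x Theta(x)) = t / Theta(w / (q t)). *)
  rewrite Ex. rewrite (Theta_q q hq x) by apply Hs.
  replace (qpow lq s * u)%C with (q * t * x)%C by (unfold x; field; auto).
  assert (Nx : x <> RtoC 0) by apply Hs.
  match goal with |- ?a = ?b => change (@eq C a b) end. field. auto.
Qed.

Lemma Lap_0 : Lap (fun _ => RtoC 0) (fun _ => RtoC 0).
Proof.
  intros u t d _ _. eapply Gint_ext; [|apply Gint_0]. intros s. cbv beta. unfold Cdiv. match goal with |- ?a = ?b => change (@eq C a b) end. ring.
Qed.

Lemma Lap_plus p P r R : Lap p P -> Lap r R -> Lap (fun w => p w + r w)%C (fun t => P t + R t)%C.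
Proof.
  intros H1 H2 u t d Ho Ht. eapply Gint_ext; [|apply (Gint_plus L); [exact (H1 u t d Ho Ht)|exact (H2 u t d Ho Ht)]].
  intros s. cbv beta. unfold Cdiv. match goal with |- ?a = ?b => change (@eq C a b) end. ring.
Qed.

Lemma Lap_scal c p P : Lap p P -> Lap (fun w => c * p w)%C (fun t => c * P t)%C.
Proof.
  intros H1 u t d Ho Ht. eapply Gint_ext; [|apply (Gint_scal L); exact (H1 u t d Ho Ht)].
  intros s. cbv beta. unfold Cdiv. match goal with |- ?a = ?b => change (@eq C a b) end. ring.
Qed.

Lemma rcont_kernel d u t (f : R -> C) s : off_spiral lq d (u / t)%C -> rcont f s ->
  rcont (fun s => f s / Theta q (qpow lq s * u / t))%C s.
Proof.
  intros Ho Hf.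
  assert (Hs := off_spiral_mul lq d _ s Ho).
  replace (qpow lq s * (u / t))%C with (qpow lq s * u / t)%C in Hs by (unfold Cdiv; ring).
  apply rcont_mult; [exact Hf|]. apply (rcont_inv (fun s => Theta q (qpow lq s * u / t)%C)).
  - exact (off_spiral_Theta q lq hq hlq d _ Hs).
  - apply (rcont_Theta q hq (fun s => qpow lq s * u / t)%C); [apply Hs|].
    unfold Cdiv. apply rcont_mult; [|apply rcont_const]. apply rcont_mult; [eapply rder_cont, rder_Cexp|apply rcont_const].
Qed.

(** Integrability is [laplace_bound] for the integrand 1, with D = 0, Mt = 0 and the rate 1/(4L),
    any positive rate below 1/(2L) being suitable. [kernel_const] then makes the value the same for
    all u and t. *)
Lemma Lap_one : exists kappa, Lap (fun _ => RtoC 1) (fun _ => kappa).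
Proof.
  assert (Ex : forall u t d, off_spiral lq d (u / t)%C -> t <> RtoC 0 ->
    exists l, Gint L (ln (Cmod (u / t)%C)) (fun s => 1 / Theta q (qpow lq s * u / t))%C l).
  { intros u t d Ho Ht.
    assert (Pm : 0 < 1 / (4 * L)) by (apply Rdiv_lt_0_compat; lra).
    destruct (laplace_bound q lq hq hlq d (Rabs (ln (Cmod t))) (1 / (4 * L)) 0) as [K [HK Hb]].
    - apply Ho.
    - apply Rabs_pos.
    - lra.
    - fold L. replace (1 / (2 * L)) with (1 / (4 * L) + 1 / (4 * L)) by (field; lra). lra.
    - assert (Pt := proj1 (Cmod_gt_0 t) Ht).
      eapply Gint_ex; [exact HL|]. split.
      + intros s. apply (rcont_kernel d u t (fun _ => RtoC 1)); [exact Ho|apply rcont_const].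
      + intros s. refine (Hb 0 1 u t (qpow lq s * u)%C (RtoC 1) (Rle_refl 0) Ho Ht _ s eq_refl _).
        * rewrite <- (exp_ln (Cmod t)) at 1 by exact Pt. apply exp_le, Rle_abs.
        * rewrite Cmod_1. replace (0 * ln (1 + Cmod (qpow lq s * u)) + 0 * ln (1 + Cmod (qpow lq s * u)) ^ 2) with 0 by ring. rewrite exp_0. lra. }
  (* [kappa] is the integral along one admissible curve; if there is none, the claim is vacuous. *)
  destruct (classic (exists d u, off_spiral lq d u)) as [[d0 [u0 H0]]|h].
  - assert (H0' : off_spiral lq d0 (u0 / 1)%C) by (replace (u0 / 1)%C with u0 by field; exact H0).
    destruct (Ex u0 (RtoC 1) d0 H0' C1_nz) as [kappa Hk]. exists kappa. intros u t d Ho Ht.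
    destruct (Ex u t d Ho Ht) as [l Hl].
    replace kappa with l; [exact Hl|].
    apply (kernel_const q lq hq hlq d d0 (u / t)%C u0 (ln (Cmod (u / t)%C)) (ln (Cmod (u0 / 1)%C)) l kappa Ho H0).
    + revert Hl. apply Gint_ext. intros s. unfold Cdiv. rewrite Cmult_1_l, Cmult_assoc. reflexivity.
    + revert Hk. apply Gint_ext. intros s. replace (qpow lq s * u0 / 1)%C with (qpow lq s * u0)%C by field. unfold Cdiv. apply Cmult_1_l.
  - exists 0. intros u t d Ho _. exfalso. apply h. now exists d, (u / t)%C.
Qed.

Section Estimates.
Variables (delta M Mt k0 Cc al g r0 Q0 tau : R).
Hypothesis hdelta : 0 < delta.
Hypothesis HMt : 0 < Mt < M.
Hypothesis Ek0 : k0 = 1 / (2 * L) - M.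
Hypothesis Hk0 : 0 < k0.
Hypothesis hCc : 0 < Cc.
Hypothesis Hal : Cc ^ 2 / (4 * k0) < al.
Hypothesis Hg : 0 <= g.
Hypothesis Hr0 : 0 < r0.
Hypothesis HQ0 : 0 <= Q0.
Hypothesis Htau : 0 <= tau.
Variables (p P : nat -> nat -> C -> C).
Hypothesis HLap : forall beta l, Lap (p beta l) (P beta l).

Let psi (w : C) := ln (1 + Cmod w).
Let QQ (beta : nat) (w : C) := Q0 * exp (- al * INR beta ^ 2 + g * INR beta) * exp (Cc * INR beta * psi w + Mt * psi w ^ 2).
Let ck := 8 / r0 + 8.

(** The factor exp(psi)^N raises the linear growth from Cc beta to Cc beta + N, and [weight_sum]
    makes the result uniform in beta. Taking Y = ck gives the coefficients, Y = ck |e| the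
    remainders. *)
Lemma kernel_estimate : exists K a1 a2, 0 <= K /\ 0 <= a1 /\ 0 <= a2 /\
  forall beta N Y u t x s, 0 <= Y -> off_spiral lq delta (u / t)%C -> t <> RtoC 0 -> Cmod t <= exp tau ->
    Cmod x <= QQ beta (qpow lq s * u)%C * (Y * exp (psi (qpow lq s * u)%C)) ^ N ->
    Cmod (x / Theta q (qpow lq s * u / t))%C <= K * exp (a1 * INR N + a2 * INR N ^ 2) * Y ^ N / (1 + (L * s + ln (Cmod (u / t)%C)) ^ 2).
Proof.
  destruct (laplace_bound q lq hq hlq delta tau M Mt hdelta Htau) as [K0 [HK0 Hlb]].
  { lra. } { fold L. rewrite <- Ek0. exact Hk0. }
  assert (Hc : 0 <= ln 2 + tau) by (generalize ln_lt_2; lra).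
  destruct (weight_sum al k0 Cc g (ln 2 + tau) Hk0 hCc Hg Hc Hal) as [K1 [a2 [HK1 [Ha2 Hw]]]].
  exists (Q0 * K0 * K1), (ln 2 + tau), a2.
  split; [repeat apply Rmult_le_pos; lra|]. split; [exact Hc|]. split; [exact Ha2|].
  intros beta N Y u t x s HY Ho Ht Htt Hx. set (w := (qpow lq s * u)%C) in *.
  set (D := Cc * INR beta + INR N).
  assert (PB := pos_INR beta). assert (PN := pos_INR N).
  assert (HD : 0 <= D) by (unfold D; assert (0 <= Cc * INR beta) by (apply Rmult_le_pos; lra); lra).
  assert (PY : 0 <= Y ^ N) by now apply pow_le.
  set (Ew := exp (- al * INR beta ^ 2 + g * INR beta)). assert (PE : 0 < Ew) by apply exp_pos.
  assert (X := Hlb D (Q0 * Ew * Y ^ N) u t w x HD Ho Ht Htt s eq_refl).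
  fold (psi w) L in X.
  assert (H1 : Cmod x <= Q0 * Ew * Y ^ N * exp (D * psi w + Mt * psi w ^ 2)).
  { eapply Rle_trans; [exact Hx|]. right. unfold QQ. fold Ew. rewrite Rpow_mult_distr, (exp_nat (psi w) N).
    replace (D * psi w + Mt * psi w ^ 2) with ((Cc * INR beta * psi w + Mt * psi w ^ 2) + INR N * psi w) by (unfold D; ring).
    rewrite (exp_plus (Cc * INR beta * psi w + Mt * psi w ^ 2)). ring. }
  specialize (X H1). eapply Rle_trans; [exact X|].
  assert (P1 : 0 < 1 + (L * s + ln (Cmod (u / t)%C)) ^ 2) by (generalize (pow2_ge_0 (L * s + ln (Cmod (u / t)%C))); lra).
  apply Rmult_le_compat_r; [apply Rlt_le, Rinv_0_lt_compat, P1|].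
  rewrite <- Ek0. specialize (Hw beta N). fold D Ew in Hw.
  replace (Q0 * Ew * Y ^ N * K0 * exp (D * (ln 2 + tau) + D ^ 2 / (4 * k0))) with
    (Q0 * K0 * Y ^ N * (Ew * exp (D * (ln 2 + tau) + D ^ 2 / (4 * k0)))) by ring.
  replace (Q0 * K0 * K1 * exp ((ln 2 + tau) * INR N + a2 * INR N ^ 2) * Y ^ N) with
    (Q0 * K0 * Y ^ N * (K1 * exp ((ln 2 + tau) * INR N + a2 * INR N ^ 2))) by ring.
  apply Rmult_le_compat_l; [|exact Hw]. repeat apply Rmult_le_pos; lra.
Qed.

Definition spiral_data (e u : C) (F : nat -> R -> C) : Prop :=
  forall beta, (forall s, rcont (F beta) s) /\
    forall s, expands (8 / r0 + 8 * Cmod (qpow lq s * u)%C) e (F beta s) (fun l => p beta l (qpow lq s * u)%C) (QQ beta (qpow lq s * u)%C).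

Lemma kapc_le w : 0 <= 8 / r0 + 8 * Cmod w <= ck * exp (psi w).
Proof.
  assert (I : 0 < / r0) by (apply Rinv_0_lt_compat; lra). assert (Pw := Cmod_ge_0 w). unfold Rdiv.
  split; [lra|]. unfold psi. rewrite exp_ln by lra. unfold ck, Rdiv.
  assert (0 <= 8 * / r0 * Cmod w) by (apply Rmult_le_pos; lra). nra.
Qed.

Lemma QQ_pos beta w : 0 <= QQ beta w.
Proof. unfold QQ. repeat apply Rmult_le_pos; try apply Rlt_le, exp_pos. exact HQ0. Qed.

(** The pointwise estimates are integrated, PI / L being the mass of the majorant. The constants
    precede the domain, e, u and F: uniformity over sectors and over eps is what an asymptotic
    expansion requires. *)
Lemma spiral_estimates : exists K a1 a2, 0 <= K /\ 0 <= a1 /\ 0 <= a2 /\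
  forall (D : C -> Prop) e u F, open D -> (forall t, D t -> t <> RtoC 0 /\ Cmod t <= exp tau /\ off_spiral lq delta (u / t)%C) ->
    spiral_data e u F ->
    (forall beta l t, D t -> Cmod (P beta l t) <= K * exp (a1 * INR l + a2 * INR l ^ 2) * ck ^ l) /\
    exists G : nat -> C -> C,
      (forall beta, hol D (G beta)) /\
      (forall beta t, D t -> Gint L (ln (Cmod (u / t)%C)) (fun s => F beta s / Theta q (qpow lq s * u / t))%C (G beta t)) /\
      (forall beta N t, D t -> Cmod (G beta t - psum (fun l => P beta l t * e ^ l) N)%C <= K * exp (a1 * INR N + a2 * INR N ^ 2) * (ck * Cmod e) ^ N).
Proof.
  destruct kernel_estimate as [K [a1 [a2 [HK [Ha1 [Ha2 HE]]]]]].
  exists (K * (PI / L)), a1, a2. 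
  assert (HPL : 0 < PI / L) by (apply Rdiv_lt_0_compat; [apply PI_RGT_0|exact HL]).
  split; [apply Rmult_le_pos; lra|]. split; [exact Ha1|]. split; [exact Ha2|].
  intros D e u F HD Ht HF. assert (Pck : 0 <= ck).
  { unfold ck, Rdiv. assert (0 < / r0) by (apply Rinv_0_lt_compat; lra). lra. }
  assert (GB : forall (A Y : R) f l t, D t -> Gint L (ln (Cmod (u / t)%C)) f l ->
    (forall s, Cmod (f s) <= A * Y / (1 + (L * s + ln (Cmod (u / t)%C)) ^ 2)) -> Cmod l <= A * Y * (PI / L)).
  { intros A Y f l t Dt HG Hf. eapply Gint_bound; eauto. }
  assert (PP : forall beta l s t, D t -> Cmod (p beta l (qpow lq s * u) / Theta q (qpow lq s * u / t))%C <=
     K * exp (a1 * INR l + a2 * INR l ^ 2) * ck ^ l / (1 + (L * s + ln (Cmod (u / t)%C)) ^ 2)).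
  { intros beta l s t Dt. destruct (Ht t Dt) as [T1 [T2 T3]]. apply (HE beta); auto.
    destruct (proj2 (HF beta) s) as [X _]. eapply Rle_trans; [apply X|]. apply Rmult_le_compat_l; [apply QQ_pos|].
    apply pow_incr. apply kapc_le. }
  assert (RR : forall beta N s t, D t -> Cmod ((F beta s - psum (fun l => p beta l (qpow lq s * u) * e ^ l) N) / Theta q (qpow lq s * u / t))%C <=
     K * exp (a1 * INR N + a2 * INR N ^ 2) * (ck * Cmod e) ^ N / (1 + (L * s + ln (Cmod (u / t)%C)) ^ 2)).
  { intros beta N s t Dt. destruct (Ht t Dt) as [T1 [T2 T3]]. apply (HE beta); auto.
    - apply Rmult_le_pos; [exact Pck|apply Cmod_ge_0].
    - destruct (proj2 (HF beta) s) as [_ X]. eapply Rle_trans; [apply X|]. apply Rmult_le_compat_l; [apply QQ_pos|].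
      assert (Kc := kapc_le (qpow lq s * u)%C). assert (Pe := Cmod_ge_0 e).
      apply pow_incr. split; [apply Rmult_le_pos; lra|].
      replace (ck * Cmod e * exp (psi (qpow lq s * u)%C)) with (ck * exp (psi (qpow lq s * u)%C) * Cmod e) by ring.
      apply Rmult_le_compat_r; lra. }
  split.
  - intros beta l t Dt. destruct (Ht t Dt) as [T1 [T2 T3]].
    eapply Rle_trans; [apply (GB (K * exp (a1 * INR l + a2 * INR l ^ 2)) (ck ^ l) _ _ t Dt (HLap beta l u t delta T3 T1)); intros s; apply PP, Dt|]. right. ring.
  - assert (FB : forall beta s t, D t -> Cmod (F beta s / Theta q (qpow lq s * u / t))%C <= K / (1 + (L * s + ln (Cmod (u / t)%C)) ^ 2)).
    { intros beta s t Dt. assert (X := RR beta 0%nat s t Dt). simpl psum in X. replace (F beta s - 0)%C with (F beta s) in X by ring.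
      eapply Rle_trans; [exact X|]. right. simpl. replace (a1 * 0 + a2 * (0 * (0 * 1))) with 0 by ring. rewrite exp_0. unfold Rdiv. ring. }
    assert (GX : forall beta t, exists l, D t -> Gint L (ln (Cmod (u / t)%C)) (fun s => F beta s / Theta q (qpow lq s * u / t))%C l).
    { intros beta t. destruct (classic (D t)) as [Dt|Dt]; [|exists 0; tauto].
      destruct (Ht t Dt) as [T1 [T2 T3]].
      destruct (Gint_ex L HL (ln (Cmod (u / t)%C)) K (fun s => F beta s / Theta q (qpow lq s * u / t))%C) as [l Hl].
      - split; [|intros s; now apply FB]. intros s. apply (rcont_kernel delta u t (F beta)); [exact T3|apply HF].
      - exists l. auto. }
    set (G := fun beta t => proj1_sig (constructive_indefinite_description _ (GX beta t))).
    assert (HG : forall beta t, D t -> Gint L (ln (Cmod (u / t)%C)) (fun s => F beta s / Theta q (qpow lq s * u / t))%C (G beta t)).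
    { intros beta t. unfold G. apply proj2_sig. }
    exists G. split; [|split; [exact HG|]].
    + intros beta. apply (Gint_hol L HL D (fun s t => F beta s / Theta q (qpow lq s * u / t))%C (G beta) (fun t => ln (Cmod (u / t)%C)) K HD).
      * intros s. apply hol_mult; [apply hol_const|]. apply hol_inv.
        -- apply (hol_comp D (fun x => x <> RtoC 0) (Theta q) (fun t => qpow lq s * u / t)%C).
           ++ apply hol_mult; [apply hol_const|]. apply hol_inv; [apply hol_id|]. intros t Dt. apply Ht, Dt.
           ++ intros t Dt. destruct (Ht t Dt) as [T1 [T2 T3]]. assert (Hs := off_spiral_mul lq delta _ s T3).
              replace (qpow lq s * (u / t))%C with (qpow lq s * u / t)%C in Hs by (unfold Cdiv; ring). apply Hs.
           ++ apply Theta_hol, hq.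
        -- intros t Dt. destruct (Ht t Dt) as [T1 [T2 T3]]. assert (Hs := off_spiral_mul lq delta _ s T3).
           replace (qpow lq s * (u / t))%C with (qpow lq s * u / t)%C in Hs by (unfold Cdiv; ring).
           exact (off_spiral_Theta q lq hq hlq delta _ Hs).
      * intros K' _. exists K. intros s t _ Dt. eapply Rle_trans; [now apply FB|].
        assert (P1 : 0 <= (L * s + ln (Cmod (u / t)%C)) ^ 2) by apply pow2_ge_0.
        unfold Rdiv. rewrite <- (Rmult_1_r K) at 2. apply Rmult_le_compat_l; [exact HK|]. rewrite <- Rinv_1. apply Rinv_le_contravar; lra.
      * intros t Dt. now apply HG.
      * intros t s Dt. now apply FB.
    + intros beta N t Dt. destruct (Ht t Dt) as [T1 [T2 T3]].
      assert (X : Gint L (ln (Cmod (u / t)%C)) (fun s => (F beta s - psum (fun l => p beta l (qpow lq s * u) * e ^ l) N) / Theta q (qpow lq s * u / t))%C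
        (G beta t - psum (fun l => P beta l t * e ^ l) N)%C).
      { assert (X1 := Gint_psum L (ln (Cmod (u / t)%C)) (fun l s => e ^ l * (p beta l (qpow lq s * u) / Theta q (qpow lq s * u / t)))%C (fun l => e ^ l * P beta l t)%C N
          (fun l => Gint_scal L _ (e ^ l)%C _ _ (HLap beta l u t delta T3 T1))).
        assert (X2 := Gint_minus L _ _ _ _ _ (HG beta t Dt) X1).
        rewrite (psum_ext (fun l => P beta l t * e ^ l)%C (fun l => e ^ l * P beta l t)%C) by (intros; ring).
        revert X2. apply Gint_ext. intros s.
        rewrite (psum_ext (fun l => e ^ l * (p beta l (qpow lq s * u) / Theta q (qpow lq s * u / t)))%C
          (fun l => / Theta q (qpow lq s * u / t) * (p beta l (qpow lq s * u) * e ^ l))%C) by (intros; unfold Cdiv; ring).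
        rewrite psum_scal. unfold Cdiv. match goal with |- ?a = ?b => change (@eq C a b) end. ring. }
      eapply Rle_trans; [apply (GB (K * exp (a1 * INR N + a2 * INR N ^ 2)) ((ck * Cmod e) ^ N) _ _ t Dt X); intros s; now apply RR|]. right. ring.
Qed.
End Estimates.
End Lap.

(** ** The formal solution *)

(** The factor t (q t) ... (q^(m-1) t) produced by the m-fold composition of t sigma_q. *)
Fixpoint tfac (q : C) (m : nat) (t : C) : C :=
  match m with O => 1 | S m' => (t * tfac q m' (q * t))%C end.

Lemma Cpow_S_shift (q t : C) m : (q ^ m * (q * t))%C = (q ^ S m * t)%C.
Proof. simpl. ring. Qed.

Lemma opt_iter q m : forall f t, Nat.iter m (opt q) f t = (tfac q m t * f (q ^ m * t))%C.
Proof.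
  induction m; intros f t.
  - simpl. replace (1 * t)%C with t by ring. ring.
  - change (Nat.iter (S m) (opt q) f t) with (t * Nat.iter m (opt q) f (q * t))%C. rewrite IHm, Cpow_S_shift. simpl. ring.
Qed.

Lemma es_tsigma_iter q m : forall X n t z, es_tsigma_n q m X n t z = (tfac q m t * X n (q ^ m * t)%C z)%C.
Proof.
  induction m; intros X n t z.
  - simpl. replace (1 * t)%C with t by ring. ring.
  - change (es_tsigma_n q (S m) X n t z) with (t * es_tsigma_n q m X n (q * t) z)%C. rewrite IHm, Cpow_S_shift. simpl. ring.
Qed.

Lemma psum_swap (f : nat -> nat -> C) n m : psum (fun i => psum (f i) m) n = psum (fun j => psum (fun i => f i j) n) m.
Proof.
  induction n.
  - simpl. symmetry. now apply psum_zero.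
  - rewrite psum_S, IHn, <- psum_plus. now apply psum_ext.
Qed.

Lemma Cser_psum (a : nat -> nat -> C) (l : nat -> C) n : (forall k, (k < n)%nat -> Cser (a k) (l k)) ->
  Cser (fun v => psum (fun k => a k v) n) (psum l n).
Proof.
  induction n; intros H; simpl; [apply Cser_0|]. apply (Cser_plus (fun v => psum (fun k => a k v) n) (a n)); auto.
Qed.

Lemma Cser_delay (a : nat -> C) l j : Cser a l -> Cser (fun v => if (j <=? v)%nat then a (v - j)%nat else 0) l.
Proof.
  intros H. induction j.
  - revert H. apply Cser_ext. intros n. simpl. now rewrite Nat.sub_0_r.
  - replace l with (0 + l)%C by ring.
    exact (Cser_shift (fun v => if (S j <=? v)%nat then a (v - S j)%nat else 0) l IHj).
Qed.

Section Formal.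
Variables (q : C) (Sz jm : nat) (m0 m1 : nat -> nat) (Ik : nat -> list nat) (b : nat -> nat -> C -> C).
Hypothesis hIk : forall k, (k < Sz)%nat -> NoDup (Ik k).
Hypothesis Hjm : forall k s, (k < Sz)%nat -> In s (Ik k) -> (s < jm)%nat.

Lemma b_taylor_psum k l z : (k < Sz)%nat -> b_taylor Ik b k l z = psum (fun j => bt Ik b k j l * z ^ j)%C jm.
Proof.
  intros Hk. unfold b_taylor. rewrite (Csum_nodup (Ik k) _ jm (hIk k Hk)).
  - apply psum_ext. intros j _. unfold bt. destruct (in_dec Nat.eq_dec j (Ik k)); [easy|]. ring.
  - intros s Hs. exact (Hjm k s Hk Hs).
Qed.

Variable P : nat -> nat -> C -> C.
Hypothesis HP : forall n l t, P (n + Sz)%nat l t =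
  (src Sz jm m0 (cfac q m1) (bt Ik b) (opt q) P n l t - match l with O => 0 | S l' => opt q (P (n + Sz)%nat l') t end)%C.

(** Both sides are sums of convergent series in z, so it is enough to compare the coefficients of
    z^v, where the identity is [HP]. The points q^m t occur because t sigma_q evaluates the
    coefficients there. *)
Lemma egf_formal_solution (D : C -> C -> Prop) c :
  (forall t z, D t z -> forall m l, exists K, forall beta, Cmod (P beta l (q ^ m * t)%C) <= K) ->
  formal_solution q Sz m0 m1 Ik b D (fun n t z => (Cfact n * egf (fun beta => c * P beta n t) z / Cfact n))%C.
Proof.
  intros HB n t z HD. specialize (HB t z HD).
  assert (HB' : forall m l, exists K, forall beta, Cmod (c * P beta l (q ^ m * t))%C <= K).
  { intros m l. destruct (HB m l) as [K HK]. exists (Cmod c * K). intros beta. rewrite Cmod_mult.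
    apply Rmult_le_compat_l; [apply Cmod_ge_0|apply HK]. }
  set (X := fun n t z => (Cfact n * egf (fun beta => c * P beta n t) z / Cfact n)%C).
  assert (DS : forall m l k y, Cser (fun v => c * P (v + k)%nat l (q ^ m * t) * (y ^ v / Cfact v))%C (C_derive_n (X l (q ^ m * t)%C) k y)).
  { intros m l k y. destruct (HB' m l) as [K HK].
    rewrite (egf_derive_n (X l (q ^ m * t)%C) (fun beta => c * P beta l (q ^ m * t))%C K k HK).
    - apply (egf_ser (fun v => c * P (v + k)%nat l (q ^ m * t))%C K). intros v. apply HK.
    - intros y'. unfold X. field. apply Cfact_neq_0. }
  set (R := fun v k j i => (if (j <=? v)%nat then bt Ik b k j i * (z ^ j * tfac q (m0 k) t *
      (c * P (v - j + k)%nat (n - i)%nat (q ^ m0 k * t) * ((z * / q ^ m1 k) ^ (v - j) / Cfact (v - j)))) else 0)%C).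
  assert (RHS : Cser (fun v => psum (fun k => psum (fun i => psum (fun j => R v k j i) jm) (S n)) Sz)
    (Csum (seq 0 Sz) (fun k => es_mul (b_taylor Ik b k) (es_zdil (/ q ^ m1 k) (es_tsigma_n q (m0 k) (es_dz k X))) n t z))).
  { rewrite Csum_seq. apply Cser_psum. intros k Hk. unfold es_mul. rewrite <- psum_sum_n. apply (Cser_psum (fun i v => psum (fun j => R v k j i) jm)).
    intros i _. rewrite b_taylor_psum by exact Hk. rewrite Cmult_comm, <- psum_scal.
    apply (Cser_psum (fun j v => R v k j i)). intros j _. unfold es_zdil. rewrite es_tsigma_iter. unfold es_dz.
    assert (H := Cser_scal (bt Ik b k j i * (z ^ j * tfac q (m0 k) t))%C _ _ (Cser_delay _ _ j (DS (m0 k) (n - i)%nat k (z * / q ^ m1 k)%C))).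
    match goal with |- Cser _ ?x => match type of H with Cser _ ?y => replace x with y by ring end end.
    revert H. apply Cser_ext. intros v. unfold R. destruct (j <=? v)%nat; ring. }
  assert (E0 : t = (q ^ 0 * t)%C) by (simpl; ring). assert (E1 : (q * t)%C = (q ^ 1 * t)%C) by (simpl; ring).
  assert (LHS : Cser (fun v => (match n with O => 0 | S n' => t * (c * P (v + Sz)%nat n' (q * t)%C) end + c * P (v + Sz)%nat n t) * (z ^ v / Cfact v))%C
    (es_eps_t (es_sigma q (es_dz Sz X)) n t z + es_dz Sz X n t z)%C).
  { unfold es_eps_t, es_sigma, es_dz. assert (H0 := DS 0%nat n Sz z). rewrite <- E0 in H0. destruct n as [|n'].
    - replace (0 + C_derive_n (X 0%nat t) Sz z)%C with (C_derive_n (X 0%nat t) Sz z) by ring.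
      revert H0. apply Cser_ext. intros v. ring.
    - assert (H1 := Cser_scal t _ _ (DS 1%nat n' Sz z)). rewrite <- E1 in H1.
      assert (H := Cser_plus _ _ _ _ H1 H0). revert H. apply Cser_ext. intros v. ring. }
  refine (Cser_unique _ _ _ LHS _). revert RHS. apply Cser_ext. intros v.
  assert (HPv := HP v n t). unfold opt in HPv at 2.
  replace (match n with O => 0 | S n' => t * (c * P (v + Sz)%nat n' (q * t)) end + c * P (v + Sz)%nat n t)%C
    with (c * src Sz jm m0 (cfac q m1) (bt Ik b) (opt q) P v n t)%C by (rewrite HPv; destruct n; ring).
  rewrite (Cmult_comm c), <- Cmult_assoc, Cmult_comm. unfold src, SS. rewrite <- psum_scal. apply psum_ext. intros k _.
  rewrite psum_swap, <- psum_scal. apply psum_ext. intros j _. unfold R.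
  destruct (Nat.leb_spec j v) as [h|h]; [|rewrite psum_zero; [ring|easy]].
  rewrite Cmult_assoc, <- psum_scal. apply psum_ext. intros i _. rewrite opt_iter. unfold cfac.
  rewrite Cpow_mult_l. replace (z ^ v)%C with (z ^ j * z ^ (v - j))%C.
  - field. split; apply Cfact_neq_0.
  - rewrite <- Cpow_add_r. f_equal. lia.
Qed.
End Formal.

(** ** Asymptotic expansions of the solutions *)

Lemma open_dilate q m T : q <> RtoC 0 -> open T -> open (dilate q m T).
Proof.
  intros Hq HT x [t [Ht ->]]. assert (Nm := Cpow_neq_0 q m Hq).
  destruct (proj1 (locally_Cmod t T) (HT t Ht)) as [d [Hd H]].
  assert (Pm : 0 < Cmod (q ^ m)%C) by now apply Cmod_gt_0.
  apply locally_Cmod. exists (d * Cmod (q ^ m)%C). split; [now apply Rmult_lt_0_compat|]. intros w Hw.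
  exists (w / q ^ m)%C. split; [|field; exact Nm]. apply H.
  replace (w / q ^ m - t)%C with ((w - q ^ m * t) / q ^ m)%C by (field; exact Nm).
  rewrite Cmod_div by exact Nm. apply Rmult_lt_reg_r with (Cmod (q ^ m)%C); [exact Pm|].
  unfold Rdiv. rewrite Rmult_assoc, Rinv_l, Rmult_1_r by lra. exact Hw.
Qed.

Lemma dilate_0 q T t : T t <-> dilate q 0 T t.
Proof.
  split; [intros H; exists t; split; [exact H|simpl; ring]|]. intros [t0 [H ->]]. simpl. now replace (1 * t0)%C with t0 by ring.
Qed.

(** Crude but sufficient: an exponential of a square only raises the type [B]. *)
Lemma fact_le_exp n : INR (fact n) <= exp (INR n ^ 2).
Proof.
  induction n; [simpl; rewrite Rmult_0_l, exp_0; lra|].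
  rewrite fact_simpl, mult_INR, S_INR. assert (P := pos_INR n).
  replace ((INR n + 1) ^ 2) with ((2 * INR n + 1) + INR n ^ 2) by ring. rewrite exp_plus.
  apply Rmult_le_compat; [lra|apply pos_INR| |exact IHn].
  generalize (exp_ineq1_le (2 * INR n + 1)). lra.
Qed.

Lemma indexed_bound Sz (Ik : nat -> list nat) (P : nat -> nat -> R -> Prop) :
  (forall k s c c', c <= c' -> P k s c -> P k s c') ->
  (forall k s, (k < Sz)%nat -> In s (Ik k) -> exists c, P k s c) ->
  exists c, 0 <= c /\ forall k s, (k < Sz)%nat -> In s (Ik k) -> P k s c.
Proof.
  intros Mono H.
  destruct (fin_bound (fun k c => forall s, In s (Ik k) -> P k s c) Sz) as [c [Hc Hc']].
  - intros j c c' h K s Hs. eapply Mono; eauto.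
  - intros k Hk. destruct (fin_bound (fun s c => In s (Ik k) -> P k s c) (S (list_max (Ik k)))) as [c [_ Hc]].
    + intros j c c' h K Hs. eapply Mono; eauto.
    + intros s _. destruct (in_dec Nat.eq_dec s (Ik k)) as [h|h]; [|now exists 0]. destruct (H k s Hk h) as [c Hc]. now exists c.
    + exists c. intros s Hs. apply Hc; [|exact Hs]. apply Nat.lt_succ_r.
      assert (F := proj1 (list_max_le (Ik k) _) (le_n _)). rewrite Forall_forall in F. now apply F.
  - exists c. split; [exact Hc|]. intros k s Hk Hs. now apply Hc'.
Qed.

Lemma index_bound Sz (Ik : nat -> list nat) : exists jm, (1 <= jm)%nat /\ forall k s, (k < Sz)%nat -> In s (Ik k) -> (s < jm)%nat.
Proof.
  exists (S (list_max (flat_map Ik (seq 0 Sz)))). split; [lia|]. intros k s Hk Hs. apply Nat.lt_succ_r.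
  assert (F := proj1 (list_max_le (flat_map Ik (seq 0 Sz)) _) (le_n _)). rewrite Forall_forall in F. apply F.
  apply in_flat_map. exists k. split; [apply in_seq; lia|exact Hs].
Qed.

(** The bounds on the coefficients are obtained by integrating along a path, so at least one sector
    with a point in it is required. *)
Lemma good_covering_inhabited q lq p II : good_covering q lq p II -> exists i e, (i < p)%nat /\ UqN q lq (II i) e.
Proof.
  intros [_ [[nu [Hnu H]] _]]. destruct (proj1 (locally_Cmod 0 nu) Hnu) as [d [Hd Hd']].
  destruct (proj2 (H (RtoC (d / 2)))) as [i [Hi Hu]]; [|now exists i, (RtoC (d / 2))].
  split; [|apply RtoC_neq_0; lra]. apply Hd'.
  replace (RtoC (d / 2) - 0)%C with (RtoC (d / 2)) by ring. rewrite Cmod_RtoC_pos; lra.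
Qed.

(** The coefficients [P] are chosen before the sector and before the dilation q^m T; only the
    constants depend on m. The functions [G] are the bare integrals, without the factor lq /
    pi_q. *)
Lemma coefficient_expansions
  (q lq : C) (hq : 1 < Cmod q) (hlq : Cexp lq = q)
  (Sz jm : nat) (hSz : (1 <= Sz)%nat) (hjm : (1 <= jm)%nat)
  (m0 m1 : nat -> nat)
  (r0 : R) (hr0 : 0 < r0 <= 1)
  (Ik : nat -> list nat) (Hjm : forall k s, (k < Sz)%nat -> In s (Ik k) -> (s < jm)%nat)
  (b : nat -> nat -> C -> C)
  (hb : forall k s, (k < Sz)%nat -> In s (Ik k) ->
     holomorphic (Cdisc r0) (b k s) /\
     exists c : R, forall eps, Cdisc r0 eps -> Cmod (b k s eps) <= c)
  (p : nat) (II : nat -> ipair)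
  (hcov : good_covering q lq p II)
  (hUr0 : forall i eps, (i < p)%nat -> UqN q lq (II i) eps -> Cdisc r0 eps)
  (delta rho0 : R) (hdelta : 0 < delta)
  (V : nat -> C -> Prop) (T : C -> Prop)
  (hass : associated_family lq p II delta rho0 V T)
  (M A1 Cc : R) (hM : 0 < M) (hA1 : 0 < A1) (hCc : 0 < Cc)
  (hA : assumption_A Sz m0 m1 Ik A1 Cc)
  (hC : assumption_C q M A1 Cc)
  (W0 : nat -> C -> C -> C) (WUV : nat -> nat -> C -> C -> C)
  (hW0 : initial_data q lq p II Sz r0 rho0 M V W0 WUV)
  (lam : nat -> C)
  (hlam : forall i, (i < p)%nat ->
     V i (lam i) /\ Cdisc rho0 (lam i) /\ r0 < 1 < Cmod (lam i))
  (W : nat -> nat -> C -> C -> C)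
  (hW : forall i eps tau, (i < p)%nat -> UqN q lq (II i) eps ->
     mul_qRp lq (V i) tau \/ Cpdisc rho0 tau -> tau <> RtoC (-1) ->
     W_formal_solution q Sz m0 m1 Ik b (fun j => WUV i j eps tau) eps tau
       (fun beta => W i beta eps tau)) :
  exists P : nat -> nat -> C -> C,
    (forall beta l, hol (fun _ => True) (P beta l)) /\
    (forall n l t, P (n + Sz)%nat l t =
      (src Sz jm m0 (cfac q m1) (bt Ik b) (opt q) P n l t - match l with O => 0 | S l' => opt q (P (n + Sz)%nat l') t end)%C) /\
    forall m, exists K a1 a2, 0 <= K /\ 0 <= a1 /\ 0 <= a2 /\
      (forall beta l t, dilate q m T t -> Cmod (P beta l t) <= K * exp (a1 * INR l + a2 * INR l ^ 2) * (8 / r0 + 8) ^ l) /\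
      forall i e, (i < p)%nat -> UqN q lq (II i) e -> exists G : nat -> C -> C,
        (forall beta, hol (dilate q m T) (G beta)) /\
        (forall beta t, dilate q m T t -> q_laplace q lq (lam i) (W i beta e) (e * t) = (lq / pi_q q lq * G beta t)%C) /\
        (forall beta N t, dilate q m T t -> Cmod (G beta t - psum (fun l => P beta l t * e ^ l) N)%C <=
          K * exp (a1 * INR N + a2 * INR N ^ 2) * ((8 / r0 + 8) * Cmod e) ^ N).
Proof.
  destruct hW0 as [D1 [D2 [Delta [Mt [HDelta [HMt [_ D4]]]]]]].
  destruct (assumption_C_gap q M A1 Cc hq hM hA1 hCc hC) as [Hk0 Hgap].
  assert (HL := L_pos q hq). assert (qn0 := q_neq_0 q hq).
  destruct (indexed_bound Sz Ik (fun k s c => forall e, Cdisc r0 e -> Cmod (b k s e) <= c)) as [Bb [HBb Hb]].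
  { intros k s c c' h H e He. specialize (H e He). lra. }
  { intros k s Hk Hs. apply (hb k s Hk Hs). }
  assert (Hb' : forall k s, (k < Sz)%nat -> In s (Ik k) -> hol (Cdisc r0) (b k s) /\ forall e, Cdisc r0 e -> Cmod (b k s e) <= Bb).
  { intros k s Hk Hs. split; [apply hol_holomorphic, (hb k s Hk Hs)|now apply Hb]. }
  destruct (fin_bound (fun j c => forall e tau, Cpdisc r0 e /\ Cpdisc rho0 tau -> Cmod (W0 j e tau) <= c) Sz) as [B0 [HB0 HW0]].
  { intros j c c' h H e tau Het. specialize (H e tau Het). lra. }
  { intros j Hj. exact (proj2 (D1 j Hj)). }
  destruct (ini_ex lq Sz r0 hr0 p II delta rho0 V T hass M B0 W0 Mt HMt) as [ini [v Hini]].
  { intros j e tau Hj He Ht. now apply HW0. }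
  { intros j Hj. apply D1, Hj. }
  destruct (W_expands q lq hq hlq Sz jm hSz hjm m0 m1 r0 hr0 Ik b Hjm Bb HBb Hb' p II hUr0 delta rho0 V T hdelta hass M A1 Cc hCc hA Hk0 Hgap
    WUV B0 HB0 W0 Delta Mt HDelta HMt) with (lam := lam) (W := W) (ini := ini) (v := v) as [g [Hg HW]]; auto.
  { intros i j Hi Hj. apply D2; auto. }
  { intros i j e tau Hi Hj. apply D2; auto. }
  destruct (al_bounds q M A1 Cc hCc Hk0 Hgap) as [Hal _].
  destruct (Lap_one q lq hq hlq) as [kappa Hkappa].
  set (P := PB Sz jm m0 (cfac q m1) (bt Ik b) ini (opt q) (fun _ => kappa)).
  exists P. split; [|split].
  - intros beta l.
    apply (PB_rel Sz jm m0 (cfac q m1) (bt Ik b) ini (opt q) (opt q) (fun _ => kappa) (fun _ => kappa) (fun _ f => hol (fun _ => True) f)).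
    + apply hol_const.
    + intros _ f Hf. apply hol_mult; [apply hol_id|]. apply (hol_comp _ (fun _ => True)); [|easy|exact Hf].
      apply hol_mult; [apply hol_const|apply hol_id].
    + apply hol_const.
    + intros _ f _ f'. apply hol_plus.
    + intros c _ f Hf. apply hol_mult; [apply hol_const|exact Hf].
  - intros n l t. apply PB_rec.
  - intros m.
    (* On T one has |t| <= 1, hence |t| <= exp(m L) on q^m T: this is the parameter [tau] of the
       estimates. *)
    assert (Htau : 0 <= INR m * ln (Cmod q)) by (apply Rmult_le_pos; [apply pos_INR|lra]).
    assert (HLap : forall beta l, Lap q lq (PW q Sz jm m0 m1 Ik b ini beta l) (P beta l)).
    { intros beta l. apply (PB_rel Sz jm m0 (cfac q m1) (bt Ik b) ini opw (opt q) (fun _ => 1) (fun _ => kappa) (Lap q lq)).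
      - exact Hkappa.
      - apply Lap_op; assumption.
      - apply Lap_0; assumption.
      - apply Lap_plus; assumption.
      - apply Lap_scal; assumption. }
    destruct (spiral_estimates q lq hq hlq delta M Mt (1 / (2 * ln (Cmod q)) - M) Cc (al q M A1 Cc) g r0 (Q0 q Sz M A1 Cc B0 Delta)
      (INR m * ln (Cmod q)) hdelta HMt eq_refl Hk0 hCc Hal Hg (proj1 hr0) (Rlt_le _ _ (Q0_pos q Sz M A1 Cc B0 HB0 Delta HDelta)) Htau
      (PW q Sz jm m0 m1 Ik b ini) P HLap) as [K [a1 [a2 [HK [Ha1 [Ha2 HE]]]]]].
    exists K, a1, a2. do 3 (split; [assumption|]).
    assert (OT : open (dilate q m T)) by (apply open_dilate; [exact qn0|apply hass]).
    assert (HD : forall i e, (i < p)%nat -> UqN q lq (II i) e -> forall t, dilate q m T t ->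
      t <> RtoC 0 /\ Cmod t <= exp (INR m * ln (Cmod q)) /\ off_spiral lq delta (lam i / e / t)%C).
    { intros i e Hi He t Ht. split; [|split].
      - destruct Ht as [t0 [Ht0 ->]]. apply Cmult_neq_0; [now apply Cpow_neq_0|]. intros ->. destruct hass as [_ [[_ [_ HT0]] _]]. contradiction.
      - destruct Ht as [t0 [Ht0 ->]]. rewrite Cmod_mult, Cmod_pow, <- (exp_nat (ln (Cmod q))), exp_ln by lra.
        assert (Cmod t0 <= 1) by (destruct hass as [_ [_ [_ [_ [_ [_ hT]]]]]]; now apply hT). assert (0 < Cmod q ^ m) by (apply pow_lt; lra). nra.
      - eapply path_off_spiral; eauto. }
    assert (HF : forall i e, (i < p)%nat -> UqN q lq (II i) e ->
      spiral_data lq Mt Cc (al q M A1 Cc) g r0 (Q0 q Sz M A1 Cc B0 Delta) (PW q Sz jm m0 m1 Ik b ini) e (lam i / e)%C (fun beta s => W i beta e (qpow lq s * lam i)%C)).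
    { intros i e Hi He beta. exact (HW i e beta Hi He). }
    split.
    + destruct (good_covering_inhabited q lq p II hcov) as [i [e [Hi He]]].
      exact (proj1 (HE (dilate q m T) e (lam i / e)%C _ OT (HD i e Hi He) (HF i e Hi He))).
    + intros i e Hi He. destruct (proj2 (HE (dilate q m T) e (lam i / e)%C _ OT (HD i e Hi He) (HF i e Hi He))) as [G [G1 [G2 G3]]].
      exists G. split; [exact G1|]. split; [|exact G3]. intros beta t Ht. unfold q_laplace. f_equal.
      (* The q-Laplace transform in tau, in the direction lam and at e t, is the one in w = tau / e,
         in the direction lam / e and at t. *)
      apply (Gint_RInt_gen _ HL (ln (Cmod (lam i / e / t)%C))).
      refine (Gint_ext _ _ _ _ _ _ (G2 beta t Ht)). intros s. cbv beta. do 2 f_equal.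
      assert (Ne := UqN_neq_0 q lq hq II i e He). assert (Nt := proj1 (HD i e Hi He t Ht)). field. auto.
Qed.

Lemma egf_scal a u K z : (forall n, Cmod (u n) <= K) -> egf (fun n => a * u n)%C z = (a * egf u z)%C.
Proof.
  intros H. apply Cser_eq. generalize (Cser_scal a _ _ (proj1 (egf_ser u K z H))). apply Cser_ext. intros n. ring.
Qed.

(** The remainder is again an exponential series in z, with the remainders of the [G beta] as
    coefficients. [remainder] of order N subtracts the terms n <= N, whence the order [S N] in the
    hypothesis. *)
Lemma egf_remainder (D : C -> Prop) rho c (P : nat -> nat -> C -> C) (KP : nat -> R) (G : nat -> C -> C) e N A A0 (X : C -> C -> C -> C) :
  open D -> (forall beta l, hol D (P beta l)) -> (forall beta, hol D (G beta)) ->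
  (forall beta l t, D t -> Cmod (P beta l t) <= KP l) -> (forall beta t, D t -> Cmod (G beta t) <= A0) ->
  (forall beta t, D t -> Cmod (G beta t - psum (fun l => P beta l t * e ^ l) (S N))%C <= A) ->
  (forall t z, D t -> X e t z = egf (fun beta => c * G beta t)%C z) ->
  H_norm_le D rho (remainder X (fun n t z => Cfact n * egf (fun beta => c * P beta n t) z)%C N e) (Cmod c * A * exp rho).
Proof.
  intros HD HP HG HPb HGb HA HX.
  assert (Bc : forall x K, Cmod x <= K -> Cmod (c * x)%C <= Cmod c * K).
  { intros x K H. rewrite Cmod_mult. apply Rmult_le_compat_l; [apply Cmod_ge_0|exact H]. }
  destruct (egf_in_H D rho (Cmod c * A) (fun beta t => c * (G beta t - psum (fun l => P beta l t * e ^ l) (S N)))%C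
    (remainder X (fun n t z => Cfact n * egf (fun beta => c * P beta n t) z)%C N e) HD) as [H1 H2].
  - intros n. apply hol_mult; [apply hol_const|]. apply hol_minus; [apply HG|].
    apply (hol_psum D (fun l t => P n l t * e ^ l)%C). intros l. apply hol_mult; [apply HP|apply hol_const].
  - intros n t Dt. apply Bc, HA, Dt.
  - intros t z [Dt _]. unfold remainder. rewrite HX, <- psum_sum_n by exact Dt. symmetry. apply Cser_eq.
    assert (SG := proj1 (egf_ser (fun beta => c * G beta t)%C (Cmod c * A0) z (fun n => Bc _ _ (HGb n t Dt)))).
    assert (SP : Cser (fun v => psum (fun n => e ^ n * (c * P v n t * (z ^ v / Cfact v))) (S N))%C
      (psum (fun n => Cfact n * egf (fun beta => c * P beta n t) z / Cfact n * e ^ n) (S N))%C).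
    { rewrite (psum_ext _ (fun n => e ^ n * egf (fun beta => c * P beta n t) z)%C) by (intros k _; field; apply Cfact_neq_0).
      apply (Cser_psum (fun n v => e ^ n * (c * P v n t * (z ^ v / Cfact v)))%C). intros n _. apply Cser_scal.
      apply (egf_ser (fun beta => c * P beta n t)%C (Cmod c * KP n) z). intros v. apply Bc, HPb, Dt. }
    assert (S := Cser_minus _ _ _ _ SG SP). revert S. apply Cser_ext. intros v. cbv beta.
    rewrite (psum_ext _ (fun n => (c * (z ^ v / Cfact v)) * (P v n t * e ^ n))%C) by (intros k _; ring). rewrite psum_scal. ring.
  - apply H_norm_le_intro; assumption.
Qed.

Lemma dilate_0_eq q T : dilate q 0 T = T.
Proof. apply functional_extensionality. intros t. apply propositional_extensionality. symmetry. apply dilate_0. Qed.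

(** The factorial stands on the left because the required bound divides by it. As (N + 1)^2 <= 2 N^2
    + 2, the exponent (a2 + 1)(N + 1)^2 is at most 2 (a2 + 1) N^2 plus a constant, and 2 (a2 + 1)
    N^2 is B (N^2 / 2) L for B = 4 (a2 + 1) / L. *)
Lemma gevrey_weight L a1 a2 ck N : 0 < L -> 0 <= a2 -> 0 < ck ->
  exp (a1 * INR (N + 1) + a2 * INR (N + 1) ^ 2) * ck ^ (N + 1) * INR (fact (N + 1)) <=
  exp (a1 + ln ck + 2 * (a2 + 1)) * exp (a1 + ln ck) ^ N * exp (4 * (a2 + 1) / L * (INR N ^ 2 / 2) * L).
Proof.
  intros HL Ha Hc. assert (F := fact_le_exp (N + 1)).
  replace (ck ^ (N + 1)) with (exp (INR (N + 1) * ln ck)) by (rewrite <- exp_nat, exp_ln by exact Hc; reflexivity).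
  rewrite (exp_nat (a1 + ln ck) N).
  eapply Rle_trans; [apply Rmult_le_compat_l; [|exact F]; apply Rmult_le_pos; apply Rlt_le, exp_pos|].
  rewrite <- !exp_plus. apply exp_le. rewrite plus_INR. simpl (INR 1).
  replace (4 * (a2 + 1) / L * (INR N ^ 2 / 2) * L) with (2 * (a2 + 1) * INR N ^ 2) by (field; lra).
  assert (0 <= (INR N - 1) ^ 2) by apply pow2_ge_0. nra.
Qed.

Theorem theorem7
  (q lq : C) (hq : 1 < Cmod q) (hlq : Cexp lq = q)
  (Sz : nat) (hSz : (1 <= Sz)%nat)
  (m0 m1 : nat -> nat)
  (hm0 : forall k, (k < Sz)%nat -> (1 <= m0 k)%nat)
  (hm1 : forall k, (k < Sz)%nat -> (1 <= m1 k)%nat)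
  (r0 : R) (hr0 : 0 < r0 <= 1)
  (Ik : nat -> list nat) (hIk : forall k, (k < Sz)%nat -> NoDup (Ik k))
  (b : nat -> nat -> C -> C)
  (hb : forall k s, (k < Sz)%nat -> In s (Ik k) ->
     holomorphic (Cdisc r0) (b k s) /\
     exists c : R, forall eps, Cdisc r0 eps -> Cmod (b k s eps) <= c)
  (p : nat) (II : nat -> ipair)
  (hcov : good_covering q lq p II)
  (hUr0 : forall i eps, (i < p)%nat -> UqN q lq (II i) eps -> Cdisc r0 eps)
  (delta rho0 : R) (hdelta : 0 < delta)
  (V : nat -> C -> Prop) (T : C -> Prop)
  (hass : associated_family lq p II delta rho0 V T)
  (M A1 Cc : R) (hM : 0 < M) (hA1 : 0 < A1) (hCc : 0 < Cc)
  (hA : assumption_A Sz m0 m1 Ik A1 Cc)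
  (hB : assumption_B q M)
  (hC : assumption_C q M A1 Cc)
  (W0 : nat -> C -> C -> C) (WUV : nat -> nat -> C -> C -> C)
  (hW0 : initial_data q lq p II Sz r0 rho0 M V W0 WUV)
  (lam : nat -> C)
  (hlam : forall i, (i < p)%nat ->
     V i (lam i) /\ Cdisc rho0 (lam i) /\ r0 < 1 < Cmod (lam i))
  (W : nat -> nat -> C -> C -> C)
  (hW : forall i eps tau, (i < p)%nat -> UqN q lq (II i) eps ->
     mul_qRp lq (V i) tau \/ Cpdisc rho0 tau -> tau <> RtoC (-1) ->
     W_formal_solution q Sz m0 m1 Ik b (fun j => WUV i j eps tau) eps tau
       (fun beta => W i beta eps tau))
  (rho : R) (hrho : 0 < rho)
  (K : nat -> C -> Prop)
  (hK : forall i, (i < p)%nat ->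
     Ccompact (K i) /\ (forall x, K i x -> Uset lq (II i) x) /\
     exists x, Cinterior (K i) x)
  (hKcov : exists U : C -> Prop, locally (RtoC 0) U /\
     forall x, (exists i, (i < p)%nat /\ mul_qN q (K i) x) <-> (U x /\ x <> RtoC 0)) :
  let X := fun i => X_solution q lq (lam i) (W i) in
  exists Xhat : nat -> C -> C -> C,
    (forall n, in_H T rho (Xhat n)) /\
    formal_solution q Sz m0 m1 Ik b (polyset T rho)
      (fun n t z => Cdiv (Xhat n t z) (Cfact n)) /\
    (* The equation evaluates the coefficients on the sets [q^m T], where they
       are the coefficients of the expansions of the [X_I]. *)
    (forall m n, in_H (dilate q m T) rho (Xhat n)) /\
    (forall m i Kt, (i < p)%nat -> Ccompact Kt ->
       (forall x, Kt x -> Cinterior (K i) x) ->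
       asymptotic_expansion (dilate q m T) rho (mul_qN q Kt) (X i) Xhat) /\
    (forall i Kt, (i < p)%nat -> Ccompact Kt ->
       (forall x, Kt x -> Cinterior (K i) x) ->
       exists B : R, 0 < B /\
         q_gevrey_expansion q T rho B (mul_qN q Kt) (X i) Xhat).

Proof.
  intros X. destruct (index_bound Sz Ik) as [jm [hjm Hjm]].
  destruct (coefficient_expansions q lq hq hlq Sz jm hSz hjm m0 m1 r0 hr0 Ik Hjm b hb p II hcov hUr0 delta rho0 hdelta V T hass
    M A1 Cc hM hA1 hCc hA hC W0 WUV hW0 lam hlam W hW) as [P [P1 [P2 P3]]].
  assert (HL := L_pos q hq). assert (qn0 := q_neq_0 q hq).
  assert (OT : forall m, open (dilate q m T)) by (intros m; apply open_dilate; [exact qn0|apply hass]).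
  (* The normalising factor of the transform is restored here, and the factorial makes the n-th
     function divided by n! the coefficient of eps^n. *)
  set (c := (lq / pi_q q lq)%C). set (Xhat := fun n t z => (Cfact n * egf (fun beta => c * P beta n t) z)%C).
  assert (P1' : forall m beta l, hol (dilate q m T) (P beta l)).
  { intros m beta l. apply (hol_subset _ (fun _ => True)); [easy|apply P1]. }
  assert (Pc : 0 < 8 / r0 + 8) by (assert (0 < / r0) by (apply Rinv_0_lt_compat; lra); unfold Rdiv; lra).
  assert (HH : forall m n, in_H (dilate q m T) rho (Xhat n)).
  { intros m n. destruct (P3 m) as [K0 [a1 [a2 [_ [_ [_ [HP _]]]]]]]. set (KP := K0 * exp (a1 * INR n + a2 * INR n ^ 2) * (8 / r0 + 8) ^ n) in *.
    assert (Bc : forall beta t, dilate q m T t -> Cmod (c * P beta n t)%C <= Cmod c * KP).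
    { intros beta t Dt. rewrite Cmod_mult. apply Rmult_le_compat_l; [apply Cmod_ge_0|apply HP, Dt]. }
    apply (egf_in_H (dilate q m T) rho (Cmod (Cfact n) * (Cmod c * KP)) (fun beta t => Cfact n * (c * P beta n t))%C).
    - apply OT.
    - intros beta. apply hol_mult; [apply hol_const|]. apply hol_mult; [apply hol_const|apply P1'].
    - intros beta t Dt. rewrite Cmod_mult. apply Rmult_le_compat_l; [apply Cmod_ge_0|apply Bc, Dt].
    - intros t z [Dt _]. unfold Xhat. symmetry. apply (egf_scal _ _ (Cmod c * KP)). intros beta. apply Bc, Dt. }
  assert (HR : forall m, exists K0 a1 a2, 0 <= K0 /\ 0 <= a2 /\ forall i Kt N e, (i < p)%nat ->
    (forall x, Kt x -> Cinterior (K i) x) -> mul_qN q Kt e ->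
    H_norm_le (dilate q m T) rho (remainder (X i) Xhat N e)
      (Cmod c * (K0 * exp (a1 * INR (N + 1) + a2 * INR (N + 1) ^ 2) * ((8 / r0 + 8) * Cmod e) ^ (N + 1)) * exp rho)).
  { intros m. destruct (P3 m) as [K0 [a1 [a2 [HK0 [_ [Ha2 [HP HG]]]]]]]. exists K0, a1, a2. split; [exact HK0|]. split; [exact Ha2|].
    intros i Kt N e Hi HKt [x [n [Hx He]]].
    assert (Ue : UqN q lq (II i) e).
    { exists x, n. split; [|exact He]. apply (hK i Hi). apply locally_singleton, HKt, Hx. }
    destruct (HG i e Hi Ue) as [G [G1 [G2 G3]]].
    apply (egf_remainder (dilate q m T) rho c P (fun l => K0 * exp (a1 * INR l + a2 * INR l ^ 2) * (8 / r0 + 8) ^ l) G e N _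
      (K0 * exp (a1 * INR 0 + a2 * INR 0 ^ 2) * ((8 / r0 + 8) * Cmod e) ^ 0) (X i)); auto.
    - intros beta t Dt. replace (G beta t) with (G beta t - psum (fun l => P beta l t * e ^ l) 0)%C by (simpl; ring). apply G3, Dt.
    - intros beta t Dt. replace (S N) with (N + 1)%nat by lia. apply G3, Dt.
    - intros t z Dt. unfold X, X_solution, egf. f_equal. apply functional_extensionality. intros beta. now rewrite G2. }
  exists Xhat. split; [|split; [|split; [|split]]].
  - intros n. rewrite <- (dilate_0_eq q T). apply HH.
  - apply (egf_formal_solution q Sz jm m0 m1 Ik b hIk Hjm P P2).
    intros t z [Dt _] m l. destruct (P3 m) as [K0 [a1 [a2 [_ [_ [_ [HP _]]]]]]]. eexists. intros beta. apply HP. now exists t.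
  - exact HH.
  - intros m i Kt Hi _ HKt N. destruct (HR m) as [K0 [a1 [a2 [_ [_ H]]]]].
    exists (Cmod c * (K0 * exp (a1 * INR (N + 1) + a2 * INR (N + 1) ^ 2) * (8 / r0 + 8) ^ (N + 1)) * exp rho).
    intros e He. specialize (H i Kt N e Hi HKt He). rewrite Rpow_mult_distr in H.
    match goal with |- H_norm_le _ _ _ ?y => match type of H with H_norm_le _ _ _ ?x => replace y with x by ring end end. exact H.
  - intros i Kt Hi _ HKt. destruct (HR 0%nat) as [K0 [a1 [a2 [HK0 [Ha2 H]]]]]. rewrite dilate_0_eq in H.
    set (L := ln (Cmod q)) in *. set (ck := 8 / r0 + 8) in *.
    assert (PC : 0 <= Cmod c * K0 * exp rho).
    { apply Rmult_le_pos; [apply Rmult_le_pos; [apply Cmod_ge_0|exact HK0]|apply Rlt_le, exp_pos]. }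
    exists (4 * (a2 + 1) / L). split; [apply Rdiv_lt_0_compat; lra|].
    (* The added 1 keeps the constant positive even if [Cmod c * K0] vanishes. *)
    exists ((Cmod c * K0 * exp rho + 1) * exp (a1 + ln ck + 2 * (a2 + 1))), (exp (a1 + ln ck)).
    split; [apply Rmult_lt_0_compat; [lra|apply exp_pos]|]. split; [apply exp_pos|].
    intros N e He. destruct (H i Kt N e Hi HKt He) as [HI HN]. split; [exact HI|].
    eapply Rbar_le_trans; [exact HN|]. cbv beta iota delta [Rbar_le]. rewrite Rpow_mult_distr. unfold Rpower. fold L.
    assert (Pf := INR_fact_lt_0 (N + 1)). assert (Pe : 0 <= Cmod e ^ (N + 1)) by apply pow_le, Cmod_ge_0.
    assert (Wt := gevrey_weight L a1 a2 ck N HL Ha2 Pc).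
    set (E1 := exp (a1 * INR (N + 1) + a2 * INR (N + 1) ^ 2) * ck ^ (N + 1)) in *.
    set (E2 := exp (a1 + ln ck + 2 * (a2 + 1)) * exp (a1 + ln ck) ^ N * exp (4 * (a2 + 1) / L * (INR N ^ 2 / 2) * L)) in *.
    assert (P2' : 0 < E2) by (unfold E2; repeat apply Rmult_lt_0_compat; try apply exp_pos; apply pow_lt, exp_pos).
    assert (Wt' : E1 <= E2 / INR (fact (N + 1))).
    { apply Rmult_le_reg_r with (INR (fact (N + 1))); [exact Pf|]. unfold Rdiv. rewrite Rmult_assoc, Rinv_l, Rmult_1_r by lra. exact Wt. }
    match goal with |- ?x <= ?y => replace x with (Cmod c * K0 * exp rho * (E1 * Cmod e ^ (N + 1))) by (unfold E1; ring);
      replace y with ((Cmod c * K0 * exp rho + 1) * (E2 / INR (fact (N + 1)) * Cmod e ^ (N + 1))) by (unfold E2; field; lra) end.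
    assert (PE2 : 0 <= E2 / INR (fact (N + 1))) by (apply Rlt_le, Rdiv_lt_0_compat; lra).
    assert (PE1 : 0 <= E1) by (unfold E1; apply Rmult_le_pos; [apply Rlt_le, exp_pos|apply pow_le; lra]).
    apply Rmult_le_compat; [exact PC|now apply Rmult_le_pos|lra|]. now apply Rmult_le_compat_r.
Qed.
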